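(* Let $N$ be a positive integer and $0<p<\infty$ with $Np>1$. Then the class $\mathfrak{R}_N(i,i,\dots,i)$ is dense in $H^p(T_\Gamma)$.
   Context: $\Gamma=\{y\in\mathbb{R}^n:y_j>0\ \forall j\}$, $T_\Gamma=\{x+iy:x\in\mathbb{R}^n,y\in\Gamma\}$, and $H^p(T_\Gamma)$ is the space of holomorphic $F$ on $T_\Gamma$ with $\|F\|_{H^p}=\sup_{y\in\Gamma}\left(\int_{\mathbb{R}^n}|F(x+iy)|^p\,dx\right)^{1/p}<\infty$. For $\alpha=(\alpha_1,\dots,\alpha_n)\in\mathbb{C}^n$, $\mathfrak{R}_N(\alpha)$ is the family of rational functions $f(z)=(z_1+\alpha_1)^{-N-1}\cdots(z_n+\alpha_n)^{-N-1}P\!\left(\frac{1}{z_1+\alpha_1},\dots,\frac{1}{z_n+\alpha_n}\right)$ with $P$ a polynomial in $n$ variables. *)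

(* Defs.v *)
From Stdlib Require Import Reals List ClassicalEpsilon.
From mathcomp Require Import ssreflect ssrfun ssrbool eqtype ssrnat seq fintype bigop.
Set Implicit Arguments.
Unset Strict Implicit.
Open Scope R_scope.

Definition cplx : Type := (R * R)%type.
Definition Cre (z : cplx) : R := fst z.
Definition Cim (z : cplx) : R := snd z.
Definition Cof (a b : R) : cplx := (a, b).
Definition C0 : cplx := (0, 0).
Definition C1 : cplx := (1, 0).
Definition Ci : cplx := (0, 1).
Definition Cadd (z w : cplx) : cplx := (Cre z + Cre w, Cim z + Cim w).
Definition Copp (z : cplx) : cplx := (- Cre z, - Cim z).
Definition Csub (z w : cplx) : cplx := Cadd z (Copp w).
Definition Cmul (z w : cplx) : cplx :=
  (Cre z * Cre w - Cim z * Cim w, Cre z * Cim w + Cim z * Cre w).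
Definition Cnorm2 (z : cplx) : R := Cre z * Cre z + Cim z * Cim z.
Definition Cnorm (z : cplx) : R := sqrt (Cnorm2 z).
(* multiplicative inverse (only used at nonzero points) *)
Definition Cinv (z : cplx) : cplx := (Cre z / Cnorm2 z, - Cim z / Cnorm2 z).
Fixpoint Cpow (z : cplx) (k : nat) : cplx :=
  match k with O => C1 | S k' => Cmul z (Cpow z k') end.

Definition RVec (n : nat) := 'I_n -> R.
Definition CVec (n : nat) := 'I_n -> cplx.

Definition cpoint (n : nat) (x y : RVec n) : CVec n := fun j => Cof (x j) (y j).

Definition in_Gamma (n : nat) (y : RVec n) : Prop := forall j, 0 < y j.
Definition in_tube (n : nat) (z : CVec n) : Prop := forall j, 0 < Cim (z j).

Definition cupdate (n : nat) (z : CVec n) (j : 'I_n) (w : cplx) : CVec n :=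
  fun k => if k == j then w else z k.

(* holomorphic on T_Gamma: continuous and complex differentiable in each
   variable separately (Osgood's definition). *)
Definition holomorphic_on_tube (n : nat) (F : CVec n -> cplx) : Prop :=
  forall z, in_tube z ->
    (forall eps, 0 < eps -> exists delta, 0 < delta /\
        forall w, (forall j, Cnorm (Csub (w j) (z j)) < delta) ->
          Cnorm (Csub (F w) (F z)) < eps) /\
    (forall j : 'I_n, exists L : cplx, forall eps, 0 < eps -> exists delta, 0 < delta /\
        forall h : cplx, h <> C0 -> Cnorm h < delta ->
          Cnorm (Csub (Csub (F (cupdate z j (Cadd (z j) h))) (F z)) (Cmul L h))
            <= eps * Cnorm h).

(* real power t^p for t >= 0 (with 0^p = 0, p > 0) *)
Definition rpow (t p : R) : R := if Rle_dec t 0 then 0 else Rpower t p.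

(* ---------- integral over R^n of a nonnegative function ----------
   A step function is a finite list of (c, a, b): c times the indicator of
   the half-open box [a, b) = prod_j [a_j, b_j).  The integral of g over R^n
   is at most M iff every step function below g has integral at most M
   (lower integral; equals the Lebesgue integral for the nonnegative lower
   semicontinuous integrands |F(x+iy)|^p considered here). *)
Definition in_box (n : nat) (a b x : RVec n) : Prop :=
  forall j, a j <= x j /\ x j < b j.
Definition box_vol (n : nat) (a b : RVec n) : R :=
  \big[Rmult/1]_(j < n) Rmax 0 (b j - a j).
Definition step (n : nat) := list (R * (RVec n * RVec n)).
Definition step_le (n : nat) (s : step n) (g : RVec n -> R) : Prop :=
  forall x, fold_right (fun t acc =>
      (if excluded_middle_informative (in_box (fst (snd t)) (snd (snd t)) x)
       then fst t else 0) + acc) 0 s <= g x.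
Definition step_int (n : nat) (s : step n) : R :=
  fold_right (fun t acc => fst t * box_vol (fst (snd t)) (snd (snd t)) + acc) 0 s.
Definition integral_le (n : nat) (g : RVec n -> R) (M : R) : Prop :=
  forall s : step n, step_le s g -> step_int s <= M.

Definition Hp_norm_le (n : nat) (p : R) (F : CVec n -> cplx) (M : R) : Prop :=
  forall y : RVec n, in_Gamma y ->
    integral_le (fun x => rpow (Cnorm (F (cpoint x y))) p) (rpow M p).

Definition in_Hp (n : nat) (p : R) (F : CVec n -> cplx) : Prop :=
  holomorphic_on_tube F /\ exists M, 0 <= M /\ Hp_norm_le p F M.

Definition cpoly (n : nat) := list (cplx * ('I_n -> nat)).
Definition monomial_eval (n : nat) (e : 'I_n -> nat) (w : CVec n) : cplx :=
  \big[Cmul/C1]_(j < n) Cpow (w j) (e j).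
Definition cpoly_eval (n : nat) (P : cpoly n) (w : CVec n) : cplx :=
  fold_right (fun m acc => Cadd (Cmul (fst m) (monomial_eval (snd m) w)) acc) C0 P.

Definition RN_fun (n N : nat) (alpha : CVec n) (P : cpoly n) : CVec n -> cplx :=
  fun z =>
    Cmul (\big[Cmul/C1]_(j < n) Cpow (Cinv (Cadd (z j) (alpha j))) N.+1)
         (cpoly_eval P (fun j => Cinv (Cadd (z j) (alpha j)))).

Definition alpha_i (n : nat) : CVec n := fun _ => Ci.

(* Main.v *)
(* Write [F_d(z) = F(z_1 + i d, ..., z_n + i d)]. The approximation of [F] in [H^p] has three steps.

   1. [F_d -> F] as [d -> 0]. For bounded holomorphic [f] on a half plane, [|f|^q] at a point is at most its
   Poisson mean on the boundary, for every [q > 0]; discretised at finitely many nodes this follows from the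
   maximum principle. Hence the p-means of [F] decrease with the height. A refined inequality bounds the
   Poisson mean of [|f - f(i h)|^p] by [eps] times p-means plus [C_eps] times the defect of subharmonicity of
   [|f|^p]. Near the boundary the p-means are nearly constant, so this defect is small, and both [F_y] and
   [F_{y+d}] are close to [F_{y+2d}] after a common horizontal translation.

   2. [F_d * prod_j (1 - i e z_j)^-m -> F_d] as [e -> 0]: by monotonicity it suffices to look at one height,
   where the tails of the integral of [|F_d|^p] are uniformly small.

   3. The product [G] in step 2 is holomorphic in a larger tube and decays like [prod_j |z_j + i|^-m]. In each
   variable apply Cauchy's formula on a line below the real axis, replace the integral by a Riemann sum, and
   expand each kernel [1 / (zeta - z)] in a geometric series in [1 - 2 i u], [u = 1 / (z + i)]; this gives
   rational functions [u_1^(N+1) ... u_n^(N+1) P(u)] with an error at most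
   [eta * prod_j |u_j|^(N+1)], whose p-th power is integrable because [(N + 1) p > 1].

   Boundedness of [F] on [Im z_j >= d], which makes all the integrands uniformly continuous, comes from
   averaging Cauchy's formula over grids of squares. *)
From Stdlib Require Import Reals Psatz List ClassicalEpsilon FunctionalExtensionality.
From HB Require Import structures.
From Coquelicot Require Import Rcomplements Rbar Hierarchy Continuity Derive RInt RInt_analysis AutoDerive Compactness Lim_seq.
From mathcomp Require Import ssreflect ssrfun ssrbool eqtype ssrnat seq fintype finfun bigop.
From mathcomp Require Import zify.
Require Import Defs.
Set Implicit Arguments.
Unset Strict Implicit.
Open Scope R_scope.

(** * Complex arithmetic and complex derivatives *)

Declare Scope cplx_scope.
Delimit Scope cplx_scope with C.
Bind Scope cplx_scope with cplx.
Notation "z + w" := (Cadd z w) : cplx_scope.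
Notation "- z" := (Copp z) : cplx_scope.
Notation "z - w" := (Csub z w) : cplx_scope.
Notation "z * w" := (Cmul z w) : cplx_scope.
Notation "/ z" := (Cinv z) : cplx_scope.
Notation "z / w" := (Cmul z (Cinv w)) : cplx_scope.
Notation "z ^ k" := (Cpow z k) : cplx_scope.

(** [integral_le] is a lower integral over finite step functions; such integrals are superadditive
    but in general not subadditive. Hence every analytic inequality is brought to a finite weighted
    sum over nodes that do not depend on the point [x], with weights of total mass at most one: such
    a sum integrates by translation invariance and by additivity for uniformly continuous
    integrands. Boundary values are never taken: all heights in the tube stay positive, and the
    poles of the discrete Poisson kernels lie at depth [kappa] below the real axis. Exponents p < 1
    exclude Minkowski's inequality and duality, so p-means are added with the constant 2^p, and each
    argument has to tolerate a bounded number of such losses. The cutoff exponent is 4 + (N + 1):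
    four powers make Cauchy's formula on an infinite line converge with a uniform error, and N + 1
    powers survive as the weight of the error and as the factor in front of P. *)

Definition RtoC (r : R) : cplx := (r, 0).

Lemma cplx_ext (z w : cplx) : Cre z = Cre w -> Cim z = Cim w -> z = w.
Proof. by case: z w => [a b] [c d] /= -> ->. Qed.

Ltac cunfold := rewrite /Csub /Cadd /Copp /Cmul /RtoC /C0 /C1 /Ci /Cof /Cre /Cim /=.
Ltac cring := apply: cplx_ext; cunfold; ring.

Lemma cplx_ring_theory :
  ring_theory C0 C1 Cadd Cmul Csub Copp (@eq cplx).
Proof. by split => *; try cring. Qed.

Lemma Cnorm2_ge0 z : 0 <= Cnorm2 z.
Proof. rewrite /Cnorm2; nra. Qed.

Lemma Cnorm2_gt0 z : z <> C0 -> 0 < Cnorm2 z.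
Proof.
case: z => a b; rewrite /Cnorm2 /C0 /= => h.
have [ha|ha] := Req_dec a 0; have [hb|hb] := Req_dec b 0; try nra.
by case: h; rewrite ha hb.
Qed.

Lemma cplx_field_theory :
  field_theory C0 C1 Cadd Cmul Csub Copp (fun z w => Cmul z (Cinv w)) Cinv (@eq cplx).
Proof.
split => //; first exact: cplx_ring_theory.
- by move=> [/R1_neq_R0].
- move=> z /Cnorm2_gt0 h; move: h; case: z => a b; rewrite /Cnorm2 /= => h.
  apply: cplx_ext; rewrite /Cinv /Cnorm2; cunfold; field; lra.
Qed.

Add Field cplx_field : cplx_field_theory.

Lemma Cnorm_ge0 z : 0 <= Cnorm z.
Proof. exact: sqrt_pos. Qed.

Lemma Cnorm_sqr z : Cnorm z * Cnorm z = Cnorm2 z.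
Proof. by rewrite /Cnorm sqrt_sqrt //; exact: Cnorm2_ge0. Qed.

Lemma Cnorm0 : Cnorm C0 = 0.
Proof. by rewrite /Cnorm /Cnorm2 /= Rmult_0_l Rplus_0_l sqrt_0. Qed.

Lemma Cnorm1 : Cnorm C1 = 1.
Proof. by rewrite /Cnorm /Cnorm2 /= Rmult_0_l Rplus_0_r Rmult_1_l sqrt_1. Qed.

Lemma Cnorm_gt0 z : z <> C0 -> 0 < Cnorm z.
Proof. by move=> h; apply: sqrt_lt_R0; exact: Cnorm2_gt0. Qed.

Lemma Cnorm_eq0 z : Cnorm z = 0 -> z = C0.
Proof.
move=> h; case: (excluded_middle_informative (z = C0)) => // /Cnorm_gt0; lra.
Qed.

Lemma Cnorm_mul z w : Cnorm (z * w)%C = Cnorm z * Cnorm w.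
Proof.
rewrite /Cnorm -sqrt_mult; try exact: Cnorm2_ge0.
congr sqrt; rewrite /Cnorm2; cunfold; ring.
Qed.

Lemma Cnorm_opp z : Cnorm (- z)%C = Cnorm z.
Proof. by rewrite /Cnorm; congr sqrt; rewrite /Cnorm2; cunfold; ring. Qed.

Lemma Cnorm_le_sqr z r : 0 <= r -> Cnorm2 z <= r * r -> Cnorm z <= r.
Proof.
move=> hr h; rewrite /Cnorm -(sqrt_square r) //; exact: sqrt_le_1_alt.
Qed.

Lemma Cre_le z : Rabs (Cre z) <= Cnorm z.
Proof.
have h := Cnorm_sqr z; have h0 := Cnorm_ge0 z; move: h; rewrite /Cnorm2 => h.
apply: Rabs_le; nra.
Qed.

Lemma Cim_le z : Rabs (Cim z) <= Cnorm z.
Proof.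
have h := Cnorm_sqr z; have h0 := Cnorm_ge0 z; move: h; rewrite /Cnorm2 => h.
apply: Rabs_le; nra.
Qed.

Lemma Cnorm_le_sum z : Cnorm z <= Rabs (Cre z) + Rabs (Cim z).
Proof.
have ha := Rabs_pos (Cre z); have hb := Rabs_pos (Cim z).
apply: Cnorm_le_sqr; first lra.
rewrite /Cnorm2 -/(Rsqr (Cre z)) -/(Rsqr (Cim z)) (Rsqr_abs (Cre z)) (Rsqr_abs (Cim z)) /Rsqr.
nra.
Qed.

Lemma Cnorm_tri z w : Cnorm (z + w)%C <= Cnorm z + Cnorm w.
Proof.
have h1 := Cnorm_ge0 z; have h2 := Cnorm_ge0 w.
apply: Cnorm_le_sqr; first lra.
have e1 := Cnorm_sqr z; have e2 := Cnorm_sqr w; have e3 := Cnorm_sqr (z * w)%C.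
move: e1 e2 e3; rewrite Cnorm_mul /Cnorm2; cunfold.
move: (Cnorm z) (Cnorm w) h1 h2 => p q h1 h2.
case: z w => [a b] [c d] /= e1 e2 e3.
have : a * c + b * d <= p * q.
  apply: Rsqr_incr_0_var; last nra.
  rewrite /Rsqr e3; have := Rle_0_sqr (a * d - b * c); rewrite /Rsqr; nra.
nra.
Qed.

Lemma Cnorm_sub_sym z w : Cnorm (z - w)%C = Cnorm (w - z)%C.
Proof. by rewrite -Cnorm_opp; congr Cnorm; ring. Qed.

Lemma Cnorm_tri_sub z w : Cnorm (z - w)%C <= Cnorm z + Cnorm w.
Proof. by have := Cnorm_tri z (- w)%C; rewrite Cnorm_opp. Qed.

Lemma Cnorm_tri_mid z v w : Cnorm (z - w)%C <= Cnorm (z - v)%C + Cnorm (v - w)%C.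
Proof.
have -> : (z - w = (z - v) + (v - w))%C by ring.
exact: Cnorm_tri.
Qed.

Lemma Cnorm_tri_rev z w : Cnorm z - Cnorm w <= Cnorm (z - w)%C.
Proof.
have := Cnorm_tri (z - w)%C w.
have -> : (z - w + w = z)%C by ring.
lra.
Qed.

Lemma Cnorm_RtoC r : Cnorm (RtoC r) = Rabs r.
Proof.
rewrite /Cnorm /Cnorm2 /= -sqrt_Rsqr_abs; congr sqrt; rewrite /Rsqr; ring.
Qed.

Lemma Cnorm_Ci : Cnorm Ci = 1.
Proof. by rewrite /Cnorm /Cnorm2 /= Rmult_0_l Rplus_0_l Rmult_1_l sqrt_1. Qed.

Lemma Cnorm_inv z : z <> C0 -> Cnorm (/ z)%C = / Cnorm z.
Proof.
move=> h; have hz := Cnorm_gt0 h.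
apply: (Rmult_eq_reg_l (Cnorm z)); last lra.
rewrite -Cnorm_mul Rinv_r; last lra.
have -> : (z / z = C1)%C by field.
exact: Cnorm1.
Qed.

Lemma Cnorm_pow z k : Cnorm (z ^ k)%C = Cnorm z ^ k.
Proof. by elim: k => [|k IH] /=; rewrite ?Cnorm1 // Cnorm_mul IH. Qed.

Lemma C0_neq_im z : Cim z <> 0 -> z <> C0.
Proof. by move=> h e; apply: h; rewrite e. Qed.

Definition ccont (f : cplx -> cplx) (z : cplx) : Prop :=
  forall eps, 0 < eps -> exists d, 0 < d /\
    forall w, Cnorm (w - z)%C < d -> Cnorm (f w - f z)%C < eps.

(** Stated without quotients and without excluding [w = z], where the inequality is trivial; the
    chain rule [cdiff_comp] then has no separate case in which the inner function repeats its
    value. *)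
Definition cderiv (f : cplx -> cplx) (z L : cplx) : Prop :=
  forall eps, 0 < eps -> exists d, 0 < d /\
    forall w, Cnorm (w - z)%C < d ->
      Cnorm (f w - f z - L * (w - z))%C <= eps * Cnorm (w - z)%C.

Definition cdiff f z := exists L, cderiv f z L.

Lemma cdiff_cont f z : cdiff f z -> ccont f z.
Proof.
move=> [L h] eps heps.
have [d [hd hh]] := h 1 Rlt_0_1.
have hL := Cnorm_ge0 L.
exists (Rmin d (eps / (Cnorm L + 1))); split.
  by apply: Rmin_glb_lt => //; apply: Rdiv_lt_0_compat; lra.
move=> w hw.
have hw1 : Cnorm (w - z)%C < d by apply: Rlt_le_trans hw _; exact: Rmin_l.
have hw2 : Cnorm (w - z)%C < eps / (Cnorm L + 1) by apply: Rlt_le_trans hw _; exact: Rmin_r.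
have := hh w hw1.
have := Cnorm_tri (f w - f z - L * (w - z))%C (L * (w - z))%C.
have -> : (f w - f z - L * (w - z) + L * (w - z) = f w - f z)%C by ring.
rewrite Cnorm_mul => h1 h2.
move/Rlt_div_r: hw2 => hw2; have := hw2 ltac:(lra).
lra.
Qed.

Lemma cdiff_ext f g z : (forall w, f w = g w) -> cdiff f z -> cdiff g z.
Proof. by move=> e h; have -> : g = f by apply: functional_extensionality. Qed.

Lemma cdiff_ext_loc f g z r : 0 < r ->
  (forall w, Cnorm (w - z)%C < r -> f w = g w) -> cdiff f z -> cdiff g z.
Proof.
move=> hr e [L h]; exists L => eps heps.
have [d [hd hh]] := h eps heps.
exists (Rmin d r); split; first exact: Rmin_glb_lt.
move=> w hw; rewrite -!e; first apply: hh.
- by apply: Rlt_le_trans hw _; exact: Rmin_l.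
- have -> : (z - z = C0)%C by ring.
  by rewrite Cnorm0.
- by apply: Rlt_le_trans hw _; exact: Rmin_r.
Qed.

Lemma cdiff_const c z : cdiff (fun _ => c) z.
Proof.
exists C0 => eps heps; exists 1; split; first lra.
move=> w _; have -> : (c - c - C0 * (w - z) = C0)%C by ring.
rewrite Cnorm0; have := Cnorm_ge0 (w - z)%C; nra.
Qed.

Lemma cdiff_id z : cdiff (fun w => w) z.
Proof.
exists C1 => eps heps; exists 1; split; first lra.
move=> w _; have -> : (w - z - C1 * (w - z) = C0)%C by ring.
rewrite Cnorm0; have := Cnorm_ge0 (w - z)%C; nra.
Qed.

Lemma cdiff_add f g z : cdiff f z -> cdiff g z -> cdiff (fun w => f w + g w)%C z.
Proof.
move=> [L hL] [M hM]; exists (L + M)%C => eps heps.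
have [d1 [hd1 h1]] := hL (eps / 2) ltac:(lra).
have [d2 [hd2 h2]] := hM (eps / 2) ltac:(lra).
exists (Rmin d1 d2); split; first exact: Rmin_glb_lt.
move=> w hw.
have {}h1 := h1 w (Rlt_le_trans _ _ _ hw (Rmin_l _ _)).
have {}h2 := h2 w (Rlt_le_trans _ _ _ hw (Rmin_r _ _)).
have -> : (f w + g w - (f z + g z) - (L + M) * (w - z) =
  (f w - f z - L * (w - z)) + (g w - g z - M * (w - z)))%C by ring.
apply: Rle_trans (Cnorm_tri _ _) _; lra.
Qed.

Lemma cdiff_mul f g z : cdiff f z -> cdiff g z -> cdiff (fun w => f w * g w)%C z.
Proof.
move=> hf hg; have hgc := cdiff_cont hg; move: hf hg => [L hL] [M hM].
exists (L * g z + f z * M)%C => eps heps.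
set A := Cnorm (g z) + 1; set B := Cnorm (f z) + 1; set Dd := Cnorm L + 1.
have hA : 0 < A by have := Cnorm_ge0 (g z); rewrite /A; lra.
have hB : 0 < B by have := Cnorm_ge0 (f z); rewrite /B; lra.
have hD : 0 < Dd by have := Cnorm_ge0 L; rewrite /Dd; lra.
have e1 : 0 < eps / (3 * A) by apply: Rdiv_lt_0_compat; lra.
have e2 : 0 < eps / (3 * B) by apply: Rdiv_lt_0_compat; lra.
have e3 : 0 < eps / (3 * Dd) by apply: Rdiv_lt_0_compat; lra.
have [d1 [hd1 h1]] := hL _ e1.
have [d2 [hd2 h2]] := hM _ e2.
have [d3 [hd3 h3]] := hgc _ e3.
have [d4 [hd4 h4]] := hgc 1 Rlt_0_1.
exists (Rmin (Rmin d1 d2) (Rmin d3 d4)); split; first by repeat apply: Rmin_glb_lt.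
move=> w hw.
have hw1 : Cnorm (w - z)%C < d1.
  by apply: Rlt_le_trans hw _; apply: Rle_trans (Rmin_l _ _) (Rmin_l _ _).
have hw2 : Cnorm (w - z)%C < d2.
  by apply: Rlt_le_trans hw _; apply: Rle_trans (Rmin_l _ _) (Rmin_r _ _).
have hw3 : Cnorm (w - z)%C < d3.
  by apply: Rlt_le_trans hw _; apply: Rle_trans (Rmin_r _ _) (Rmin_l _ _).
have hw4 : Cnorm (w - z)%C < d4.
  by apply: Rlt_le_trans hw _; apply: Rle_trans (Rmin_r _ _) (Rmin_r _ _).
have {}h1 := h1 w hw1; have {}h2 := h2 w hw2; have {}h3 := h3 w hw3; have {}h4 := h4 w hw4.
have -> : (f w * g w - f z * g z - (L * g z + f z * M) * (w - z) =
  (f w - f z - L * (w - z)) * g w + (f z * (g w - g z - M * (w - z))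
   + L * (w - z) * (g w - g z)))%C by ring.
apply: Rle_trans (Cnorm_tri _ _) _.
have := Cnorm_tri (f z * (g w - g z - M * (w - z)))%C (L * (w - z) * (g w - g z))%C.
rewrite !Cnorm_mul => h5.
have hgw : Cnorm (g w) <= A by have := Cnorm_tri_rev (g w) (g z); rewrite /A; lra.
have n0 := Cnorm_ge0 (w - z)%C.
have f1 : eps / (3 * A) * A = eps / 3 by field; lra.
have f2 : eps / (3 * B) * B = eps / 3 by field; lra.
have f3 : eps / (3 * Dd) * Dd = eps / 3 by field; lra.
have t1 : Cnorm (f w - f z - L * (w - z))%C * Cnorm (g w) <= eps / 3 * Cnorm (w - z)%C.
  apply: Rle_trans (_ : eps / (3 * A) * Cnorm (w - z)%C * A <= _); last nra.
  by apply: Rmult_le_compat => //; exact: Cnorm_ge0.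
have t2 : Cnorm (f z) * Cnorm (g w - g z - M * (w - z))%C <= eps / 3 * Cnorm (w - z)%C.
  apply: Rle_trans (_ : B * (eps / (3 * B) * Cnorm (w - z)%C) <= _); last nra.
  apply: Rmult_le_compat => //; try exact: Cnorm_ge0.
  by rewrite /B; lra.
have t3 : Cnorm L * Cnorm (w - z)%C * Cnorm (g w - g z)%C <= eps / 3 * Cnorm (w - z)%C.
  apply: Rle_trans (_ : Dd * Cnorm (w - z)%C * (eps / (3 * Dd)) <= _); last nra.
  apply: Rmult_le_compat => //; try exact: Cnorm_ge0; last lra.
  - by apply: Rmult_le_pos => //; exact: Cnorm_ge0.
  - by apply: Rmult_le_compat_r => //; rewrite /Dd; lra.
lra.
Qed.

Lemma cdiff_opp f z : cdiff f z -> cdiff (fun w => - f w)%C z.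
Proof.
move=> h; apply: (@cdiff_ext (fun w => Copp C1 * f w)%C); first by move=> w; ring.
by apply: cdiff_mul => //; exact: cdiff_const.
Qed.

Lemma cdiff_sub f g z : cdiff f z -> cdiff g z -> cdiff (fun w => f w - g w)%C z.
Proof. by move=> hf hg; apply: cdiff_add => //; exact: cdiff_opp. Qed.

Lemma cdiff_pow f z k : cdiff f z -> cdiff (fun w => f w ^ k)%C z.
Proof.
by move=> hf; elim: k => [|k IH] /=; [exact: cdiff_const | exact: cdiff_mul].
Qed.

Lemma cdiff_comp f g z : cdiff f z -> cdiff g (f z) -> cdiff (fun w => g (f w)) z.
Proof.
move=> hf hg; have hfc := cdiff_cont hf; move: hf hg => [L hL] [M hM].
exists (M * L)%C => eps heps.
set A := Cnorm L + 1; set B := Cnorm M + 1.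
have hA : 0 < A by have := Cnorm_ge0 L; rewrite /A; lra.
have hB : 0 < B by have := Cnorm_ge0 M; rewrite /B; lra.
have e1 : 0 < eps / (2 * A) by apply: Rdiv_lt_0_compat; lra.
have e2 : 0 < eps / (2 * B) by apply: Rdiv_lt_0_compat; lra.
have [d1 [hd1 h1]] := hM _ e1.
have [d2 [hd2 h2]] := hfc _ hd1.
have [d3 [hd3 h3]] := hL _ e2.
have [d4 [hd4 h4]] := hL 1 Rlt_0_1.
exists (Rmin d2 (Rmin d3 d4)); split; first by repeat apply: Rmin_glb_lt.
move=> w hw.
have hw2 : Cnorm (w - z)%C < d2 by apply: Rlt_le_trans hw (Rmin_l _ _).
have hw3 : Cnorm (w - z)%C < d3.
  by apply: Rlt_le_trans hw _; apply: Rle_trans (Rmin_r _ _) (Rmin_l _ _).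
have hw4 : Cnorm (w - z)%C < d4.
  by apply: Rlt_le_trans hw _; apply: Rle_trans (Rmin_r _ _) (Rmin_r _ _).
have {}h1 := h1 _ (h2 w hw2); have {}h3 := h3 w hw3; have {}h4 := h4 w hw4.
have -> : (g (f w) - g (f z) - M * L * (w - z) =
  (g (f w) - g (f z) - M * (f w - f z)) + M * (f w - f z - L * (w - z)))%C by ring.
apply: Rle_trans (Cnorm_tri _ _) _; rewrite Cnorm_mul.
have n0 := Cnorm_ge0 (w - z)%C.
have hfw : Cnorm (f w - f z)%C <= A * Cnorm (w - z)%C.
  have := Cnorm_tri (f w - f z - L * (w - z))%C (L * (w - z))%C.
  have -> : (f w - f z - L * (w - z) + L * (w - z) = f w - f z)%C by ring.
  rewrite Cnorm_mul /A; lra.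
have f1 : eps / (2 * A) * A = eps / 2 by field; lra.
have f2 : B * (eps / (2 * B)) = eps / 2 by field; lra.
have t1 : eps / (2 * A) * Cnorm (f w - f z)%C <= eps / 2 * Cnorm (w - z)%C by nra.
have t2 : Cnorm M * Cnorm (f w - f z - L * (w - z))%C <= eps / 2 * Cnorm (w - z)%C.
  apply: Rle_trans (_ : B * (eps / (2 * B) * Cnorm (w - z)%C) <= _); last nra.
  apply: Rmult_le_compat => //; try exact: Cnorm_ge0.
  by rewrite /B; lra.
lra.
Qed.

Lemma cdiff_inv z : z <> C0 -> cdiff Cinv z.
Proof.
move=> hz; have hn := Cnorm_gt0 hz.
exists (- (/ z * / z))%C => eps heps.
set r := Cnorm z in hn *.
exists (Rmin (r / 2) (eps * (r * r * r) / 2)); split.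
  apply: Rmin_glb_lt; first lra.
  have := Rmult_lt_0_compat _ _ hn hn => hh.
  have := Rmult_lt_0_compat _ _ hh hn => hh2.
  nra.
move=> w hw.
have hw1 : Cnorm (w - z)%C < r / 2 by apply: Rlt_le_trans hw (Rmin_l _ _).
have hw2 : Cnorm (w - z)%C < eps * (r * r * r) / 2 by apply: Rlt_le_trans hw (Rmin_r _ _).
have hwn : r / 2 < Cnorm w.
  by have := Cnorm_tri_rev z w; rewrite (Cnorm_sub_sym z w) -/r; lra.
have hw0 : w <> C0 by move=> e; move: hwn; rewrite e Cnorm0; lra.
have -> : (/ w - / z - - (/ z * / z) * (w - z) = (w - z) * (w - z) * (/ w * / z * / z))%C.
  by field.
rewrite !Cnorm_mul !Cnorm_inv // -/r.
have n0 := Cnorm_ge0 (w - z)%C.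
rewrite Rmult_assoc Rmult_comm.
apply: Rmult_le_compat_r => //.
have hi : / Cnorm w <= 2 / r.
  rewrite /Rdiv -[2]Rinv_inv -Rinv_mult; apply: Rinv_le_contravar; lra.
apply: Rle_trans (_ : (eps * (r * r * r) / 2) * (2 / r * / r * / r) <= _); last first.
  by apply: Req_le; field; lra.
have hr : 0 < / r by apply: Rinv_0_lt_compat.
apply: Rmult_le_compat => //.
- have : 0 < / Cnorm w by apply: Rinv_0_lt_compat; lra.
  by move=> h; apply: Rmult_le_pos; [apply: Rmult_le_pos|]; lra.
- lra.
- by apply: Rmult_le_compat_r; [lra|apply: Rmult_le_compat_r; lra].
Qed.

(** * Goursat's lemma and Cauchy's formula on rectangles *)

Lemma continuous_eps (g : R -> R) (x : R) :
  (forall eps, 0 < eps -> exists d, 0 < d /\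
     forall t, Rabs (t - x) < d -> Rabs (g t - g x) < eps) -> continuous g x.
Proof.
move=> h; apply/filterlim_locally => eps.
have [d [hd hh]] := h eps (cond_pos eps).
by exists (mkposreal d hd) => t ht; apply: hh; exact: ht.
Qed.

Definition lcont (f : R -> cplx) (t : R) :=
  continuous (fun t => Cre (f t)) t /\ continuous (fun t => Cim (f t)) t.

Lemma lcont_eps f t :
  (forall eps, 0 < eps -> exists d, 0 < d /\
     forall s, Rabs (s - t) < d -> Cnorm (f s - f t)%C < eps) -> lcont f t.
Proof.
move=> h; split; apply: continuous_eps => eps heps; have [d [hd hh]] := h eps heps;
  exists d; split => // s hs; apply: Rle_lt_trans (hh s hs).
- exact: (Cre_le (f s - f t)%C).
- exact: (Cim_le (f s - f t)%C).
Qed.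

Lemma lcont_hor f x c : ccont f (x, c) -> lcont (fun t => f (t, c)) x.
Proof.
move=> h; apply: lcont_eps => eps heps; have [d [hd hh]] := h eps heps.
exists d; split => // s hs; apply: hh.
have -> : ((s, c) - (x, c))%C = RtoC (s - x) by cring.
by rewrite Cnorm_RtoC.
Qed.

Lemma lcont_ver f a y : ccont f (a, y) -> lcont (fun t => f (a, t)) y.
Proof.
move=> h; apply: lcont_eps => eps heps; have [d [hd hh]] := h eps heps.
exists d; split => // s hs; apply: hh.
have -> : ((a, s) - (a, y))%C = (Ci * RtoC (s - y))%C by cring.
by rewrite Cnorm_mul Cnorm_Ci Rmult_1_l Cnorm_RtoC.
Qed.

Definition lcont_on f a b := forall t, a <= t <= b -> lcont f t.

Definition CInt (f : R -> cplx) (a b : R) : cplx :=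
  (RInt (fun t => Cre (f t)) a b, RInt (fun t => Cim (f t)) a b).

Lemma lcont_on_ex f a b : a <= b -> lcont_on f a b ->
  ex_RInt (fun t => Cre (f t)) a b /\ ex_RInt (fun t => Cim (f t)) a b.
Proof.
move=> hab h; split; apply: ex_RInt_continuous => t; rewrite Rmin_left // Rmax_right // => ht;
  by case: (h t ht).
Qed.

Lemma CInt_add f g a b : a <= b -> lcont_on f a b -> lcont_on g a b ->
  CInt (fun t => f t + g t)%C a b = (CInt f a b + CInt g a b)%C.
Proof.
move=> hab /(lcont_on_ex hab) [h1 h2] /(lcont_on_ex hab) [h3 h4].
by apply: cplx_ext; [exact: RInt_plus h1 h3|exact: RInt_plus h2 h4].
Qed.

Lemma CInt_scal f c a b : a <= b -> lcont_on f a b ->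
  CInt (fun t => c * f t)%C a b = (c * CInt f a b)%C.
Proof.
move=> hab /(lcont_on_ex hab) [h1 h2]; apply: cplx_ext.
- have e1 := RInt_scal _ a b (Cre c) h1; have e2 := RInt_scal _ a b (Cim c) h2.
  have e3 := RInt_minus _ _ a b (ex_RInt_scal _ a b (Cre c) h1) (ex_RInt_scal _ a b (Cim c) h2).
  by move: e3; rewrite e1 e2.
- have e1 := RInt_scal _ a b (Cre c) h2; have e2 := RInt_scal _ a b (Cim c) h1.
  have e3 := RInt_plus _ _ a b (ex_RInt_scal _ a b (Cre c) h2) (ex_RInt_scal _ a b (Cim c) h1).
  by move: e3; rewrite e1 e2.
Qed.

Lemma lcont_scal f c t : lcont f t -> lcont (fun t => c * f t)%C t.
Proof.
move=> [h1 h2]; split.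
- by apply: (@continuous_minus _ _ R_NormedModule); apply: (@continuous_scal_r _ _ R_NormedModule).
- by apply: (@continuous_plus _ _ R_NormedModule); apply: (@continuous_scal_r _ _ R_NormedModule).
Qed.

Lemma CInt_ext f g a b : a <= b -> (forall t, a <= t <= b -> f t = g t) -> CInt f a b = CInt g a b.
Proof.
move=> hab h; apply: cplx_ext; apply: RInt_ext => t; rewrite Rmin_left // Rmax_right // => ht;
  by rewrite h //; lra.
Qed.

Lemma CInt_sub f g a b : a <= b -> lcont_on f a b -> lcont_on g a b ->
  CInt (fun t => f t - g t)%C a b = (CInt f a b - CInt g a b)%C.
Proof.
move=> hab hf hg.
have -> : (fun t => f t - g t)%C = (fun t => f t + (- C1)%C * g t)%C.
  by apply: functional_extensionality => t; ring.
rewrite CInt_add // ?CInt_scal //; first ring.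
by move=> t ht; apply: lcont_scal; exact: hg.
Qed.

Lemma CInt_Chasles f a b c : a <= b -> b <= c -> lcont_on f a c ->
  CInt f a c = (CInt f a b + CInt f b c)%C.
Proof.
move=> hab hbc h.
have [h1 h2] : ex_RInt (fun t => Cre (f t)) a b /\ ex_RInt (fun t => Cim (f t)) a b.
  by apply: lcont_on_ex => // t ht; apply: h; lra.
have [h3 h4] : ex_RInt (fun t => Cre (f t)) b c /\ ex_RInt (fun t => Cim (f t)) b c.
  by apply: lcont_on_ex => // t ht; apply: h; lra.
by apply: cplx_ext; symmetry; [exact: RInt_Chasles h1 h3|exact: RInt_Chasles h2 h4].
Qed.

(** The integral is taken componentwise, so the two parts are bounded separately. The resulting
    factor 2 is absorbed later into constants, and in [max_modulus_rect] by taking large powers. *)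
Lemma CInt_bound f a b M : a <= b -> lcont_on f a b ->
  (forall t, a <= t <= b -> Cnorm (f t) <= M) -> Cnorm (CInt f a b) <= 2 * M * (b - a).
Proof.
move=> hab /(lcont_on_ex hab) [h1 h2] hM.
apply: Rle_trans (Cnorm_le_sum _) _.
have := @abs_RInt_le_const _ a b M hab h1 (fun t ht => Rle_trans _ _ _ (Cre_le _) (hM t ht)).
have := @abs_RInt_le_const _ a b M hab h2 (fun t ht => Rle_trans _ _ _ (Cim_le _) (hM t ht)).
rewrite /CInt /Cre /Cim /=; lra.
Qed.

(** The contour integral of [f] along the positively oriented boundary of [a, b] x [c, d], in the
    order bottom, right, top, left. *)
Definition bdry (f : cplx -> cplx) (a b c d : R) : cplx :=
  (CInt (fun t => f (t, c)) a b + Ci * CInt (fun t => f (b, t)) c d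
   - CInt (fun t => f (t, d)) a b - Ci * CInt (fun t => f (a, t)) c d)%C.

Definition inrect a b c d (z : cplx) := (a <= Cre z <= b) /\ (c <= Cim z <= d).

Definition onbdry a b c d (z : cplx) :=
  inrect a b c d z /\ (Cre z = a \/ Cre z = b \/ Cim z = c \/ Cim z = d).

Definition rcont f a b c d := forall z, inrect a b c d z -> ccont f z.
Definition bcont f a b c d := forall z, onbdry a b c d z -> ccont f z.

Lemma rcont_bcont f a b c d : rcont f a b c d -> bcont f a b c d.
Proof. by move=> h z [/h]. Qed.

Lemma bcont_bottom f a b c d : c <= d -> bcont f a b c d -> lcont_on (fun t => f (t, c)) a b.
Proof. by move=> h hf t ht; apply: lcont_hor; apply: hf; rewrite /onbdry /inrect /=; lra. Qed.
Lemma bcont_top f a b c d : c <= d -> bcont f a b c d -> lcont_on (fun t => f (t, d)) a b.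
Proof. by move=> h hf t ht; apply: lcont_hor; apply: hf; rewrite /onbdry /inrect /=; lra. Qed.
Lemma bcont_left f a b c d : a <= b -> bcont f a b c d -> lcont_on (fun t => f (a, t)) c d.
Proof. by move=> h hf t ht; apply: lcont_ver; apply: hf; rewrite /onbdry /inrect /=; lra. Qed.
Lemma bcont_right f a b c d : a <= b -> bcont f a b c d -> lcont_on (fun t => f (b, t)) c d.
Proof. by move=> h hf t ht; apply: lcont_ver; apply: hf; rewrite /onbdry /inrect /=; lra. Qed.

Lemma bdry_add f g a b c d : a <= b -> c <= d -> bcont f a b c d -> bcont g a b c d ->
  bdry (fun z => f z + g z)%C a b c d = (bdry f a b c d + bdry g a b c d)%C.
Proof.
move=> hab hcd hf hg; rewrite /bdry.
rewrite (CInt_add hab (bcont_bottom hcd hf) (bcont_bottom hcd hg)).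
rewrite (CInt_add hab (bcont_top hcd hf) (bcont_top hcd hg)).
rewrite (CInt_add hcd (bcont_left hab hf) (bcont_left hab hg)).
rewrite (CInt_add hcd (bcont_right hab hf) (bcont_right hab hg)).
ring.
Qed.

Lemma bdry_scal f k a b c d : a <= b -> c <= d -> bcont f a b c d ->
  bdry (fun z => k * f z)%C a b c d = (k * bdry f a b c d)%C.
Proof.
move=> hab hcd hf; rewrite /bdry.
rewrite (CInt_scal k hab (bcont_bottom hcd hf)) (CInt_scal k hab (bcont_top hcd hf)).
rewrite (CInt_scal k hcd (bcont_left hab hf)) (CInt_scal k hcd (bcont_right hab hf)).
ring.
Qed.

Lemma bdry_ext f g a b c d : a <= b -> c <= d ->
  (forall z, onbdry a b c d z -> f z = g z) ->
  bdry f a b c d = bdry g a b c d.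
Proof.
move=> hab hcd h; rewrite /bdry.
rewrite (CInt_ext (f := fun t => f (t, c)) (g := fun t => g (t, c))) //; last first.
  by move=> t ht; apply: h; rewrite /onbdry /inrect /=; lra.
rewrite (CInt_ext (f := fun t => f (b, t)) (g := fun t => g (b, t))) //; last first.
  by move=> t ht; apply: h; rewrite /onbdry /inrect /=; lra.
rewrite (CInt_ext (f := fun t => f (t, d)) (g := fun t => g (t, d))) //; last first.
  by move=> t ht; apply: h; rewrite /onbdry /inrect /=; lra.
rewrite (CInt_ext (f := fun t => f (a, t)) (g := fun t => g (a, t))) //.
by move=> t ht; apply: h; rewrite /onbdry /inrect /=; lra.
Qed.

Lemma bdry_bound f a b c d M : a <= b -> c <= d -> bcont f a b c d ->
  (forall z, onbdry a b c d z -> Cnorm (f z) <= M) ->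
  Cnorm (bdry f a b c d) <= 4 * M * ((b - a) + (d - c)).
Proof.
move=> hab hcd hf hM; rewrite /bdry.
have h1 := CInt_bound (M := M) hab (bcont_bottom hcd hf).
have h2 := CInt_bound (M := M) hab (bcont_top hcd hf).
have h3 := CInt_bound (M := M) hcd (bcont_left hab hf).
have h4 := CInt_bound (M := M) hcd (bcont_right hab hf).
have {}h1 := h1 ltac:(move=> t ht; apply: hM; rewrite /onbdry /inrect /=; lra).
have {}h2 := h2 ltac:(move=> t ht; apply: hM; rewrite /onbdry /inrect /=; lra).
have {}h3 := h3 ltac:(move=> t ht; apply: hM; rewrite /onbdry /inrect /=; lra).
have {}h4 := h4 ltac:(move=> t ht; apply: hM; rewrite /onbdry /inrect /=; lra).
apply: Rle_trans (Cnorm_tri_sub _ _) _; rewrite Cnorm_mul Cnorm_Ci.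
have := Cnorm_tri_sub (CInt (fun t => f (t, c)) a b + Ci * CInt (fun t => f (b, t)) c d)%C
  (CInt (fun t => f (t, d)) a b).
have := Cnorm_tri (CInt (fun t => f (t, c)) a b) (Ci * CInt (fun t => f (b, t)) c d)%C.
rewrite Cnorm_mul Cnorm_Ci; lra.
Qed.

Lemma rcont_sub f a b c d a' b' c' d' : a <= a' -> b' <= b -> c <= c' -> d' <= d ->
  rcont f a b c d -> rcont f a' b' c' d'.
Proof. by move=> ? ? ? ? h z hz; apply: h; move: hz; rewrite /inrect; lra. Qed.

Lemma bdry_split_ver f a m b c d : a <= m -> m <= b -> c <= d -> rcont f a b c d ->
  bdry f a b c d = (bdry f a m c d + bdry f m b c d)%C.
Proof.
move=> h1 h2 hcd hf; rewrite /bdry.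
rewrite (CInt_Chasles h1 h2 (bcont_bottom hcd (rcont_bcont hf))) (CInt_Chasles h1 h2 (bcont_top hcd (rcont_bcont hf))).
ring.
Qed.

Lemma bdry_split_hor f a b c m d : a <= b -> c <= m -> m <= d -> rcont f a b c d ->
  bdry f a b c d = (bdry f a b c m + bdry f a b m d)%C.
Proof.
move=> hab h1 h2 hf; rewrite /bdry.
rewrite (CInt_Chasles h1 h2 (bcont_left hab (rcont_bcont hf))) (CInt_Chasles h1 h2 (bcont_right hab (rcont_bcont hf))).
ring.
Qed.

Lemma CInt_affine u v a b :
  CInt (fun t => u + RtoC t * v)%C a b = (RtoC (b - a) * u + RtoC ((b * b - a * a) / 2) * v)%C.
Proof.
have key (k l : R) : RInt (fun t => k + t * l) a b = (b - a) * k + (b * b - a * a) / 2 * l.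
  apply: is_RInt_unique.
  have := @is_RInt_derive R_CompleteNormedModule (fun t => k * t + t * t / 2 * l)
    (fun t => k + t * l) a b.
  have -> : minus (k * b + b * b / 2 * l) (k * a + a * a / 2 * l)
    = (b - a) * k + (b * b - a * a) / 2 * l :> R.
    by rewrite /minus /plus /opp /=; field.
  apply.
  - by move=> t _; auto_derive => //; field.
  - move=> t _; apply: (@ex_derive_continuous _ R_NormedModule); by auto_derive.
rewrite /CInt.
have -> : (fun t => Cre (u + RtoC t * v)%C) = (fun t => Cre u + t * Cre v).
  by apply: functional_extensionality => t; cunfold; ring.
have -> : (fun t => Cim (u + RtoC t * v)%C) = (fun t => Cim u + t * Cim v).
  by apply: functional_extensionality => t; cunfold; ring.
by rewrite !key; apply: cplx_ext; cunfold; ring.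
Qed.

Lemma bdry_affine u v a b c d : bdry (fun z => u + v * z)%C a b c d = C0.
Proof.
rewrite /bdry.
have -> : (fun t => u + v * (t, c))%C = (fun t => (u + v * (0, c)) + RtoC t * v)%C.
  by apply: functional_extensionality => t; cring.
have -> : (fun t => u + v * (t, d))%C = (fun t => (u + v * (0, d)) + RtoC t * v)%C.
  by apply: functional_extensionality => t; cring.
have -> : (fun t => u + v * (a, t))%C = (fun t => (u + v * (a, 0)) + RtoC t * (Ci * v))%C.
  by apply: functional_extensionality => t; cring.
have -> : (fun t => u + v * (b, t))%C = (fun t => (u + v * (b, 0)) + RtoC t * (Ci * v))%C.
  by apply: functional_extensionality => t; cring.
rewrite !CInt_affine; apply: cplx_ext; cunfold; field.
Qed.

Lemma nested_point (a b : nat -> R) :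
  (forall k, a k <= a k.+1) -> (forall k, b k.+1 <= b k) -> (forall k, a k <= b k) ->
  exists x, forall k, a k <= x <= b k.
Proof.
move=> ha hb hab.
have ha' i j : a i <= a (i + j)%N.
  elim: j => [|j IH]; first by rewrite addn0; lra.
  by rewrite addnS; apply: Rle_trans IH (ha _).
have hb' i j : b (i + j)%N <= b i.
  elim: j => [|j IH]; first by rewrite addn0; lra.
  by rewrite addnS; apply: Rle_trans (hb _) IH.
have hcross i j : a i <= b j.
  apply: Rle_trans (ha' i j) _; apply: Rle_trans (hab _) _; rewrite addnC; exact: hb'.
have hbd : bound (fun r => exists k, r = a k) by exists (b 0%N) => r [k ->].
have hne : exists r, exists k, r = a k by exists (a 0%N); exists 0%N.
have [x [h1 h2]] := completeness _ hbd hne.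
exists x => k; split; first by apply: h1; exists k.
by apply: h2 => r [j ->].
Qed.

Section Goursat.
Variables (f : cplx -> cplx).

Record quad := Quad {qa : R; qb : R; qc : R; qd : R}.
Definition qok q := qa q <= qb q /\ qc q <= qd q.
Definition qsize q := (qb q - qa q) + (qd q - qc q).
Definition qbdry q := bdry f (qa q) (qb q) (qc q) (qd q).
Definition qin q z := inrect (qa q) (qb q) (qc q) (qd q) z.
Definition qhalf q q' := [/\ qa q <= qa q', qb q' <= qb q, qc q <= qc q', qd q' <= qd q
  & (qb q' - qa q' = (qb q - qa q) / 2 /\ qd q' - qc q' = (qd q - qc q) / 2)].

Lemma quad_bisect q eps : qok q -> (forall z, qin q z -> ccont f z) ->
  eps * (qsize q * qsize q) < Cnorm (qbdry q) ->
  exists q', qhalf q q' /\ eps * (qsize q' * qsize q') < Cnorm (qbdry q').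
Proof.
case: q => a b c d [/= hab hcd] hf; rewrite /qsize /qbdry /= => hbig.
set m := (a + b) / 2; set k := (c + d) / 2.
have hm : a <= m <= b by rewrite /m; lra.
have hk : c <= k <= d by rewrite /k; lra.
case: (excluded_middle_informative (exists q', qhalf (Quad a b c d) q' /\
   eps * (qsize q' * qsize q') < Cnorm (qbdry q'))) => // hno.
have hsmall q' : qhalf (Quad a b c d) q' ->
    Cnorm (qbdry q') <= eps * (((b - a) + (d - c)) * ((b - a) + (d - c))) / 4.
  move=> hq; case: (Rle_dec (Cnorm (qbdry q')) (eps * (qsize q' * qsize q'))) => h; last first.
    by case: hno; exists q'; split => //; lra.
  apply: Rle_trans h _; case: hq => /= _ _ _ _ [e1 e2]; rewrite /qsize e1 e2; lra.
have rc : rcont f a b c d by move=> z hz; apply: hf.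
have := hsmall (Quad a m c k) ltac:(by split => /=; rewrite /m /k; lra).
have := hsmall (Quad m b c k) ltac:(by split => /=; rewrite /m /k; lra).
have := hsmall (Quad a m k d) ltac:(by split => /=; rewrite /m /k; lra).
have := hsmall (Quad m b k d) ltac:(by split => /=; rewrite /m /k; lra).
rewrite /qbdry /= => h1 h2 h3 h4.
move: hbig.
rewrite (bdry_split_ver (m := m)) //; try lra.
rewrite (bdry_split_hor (m := k) (a := a)) //; try lra; last first.
  by apply: rcont_sub rc; lra.
rewrite (bdry_split_hor (m := k) (a := m)) //; try lra; last first.
  by apply: rcont_sub rc; lra.
have t1 := Cnorm_tri (bdry f a m c k + bdry f a m k d)%C (bdry f m b c k + bdry f m b k d)%C.
have t2 := Cnorm_tri (bdry f a m c k)%C (bdry f a m k d)%C.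
have t3 := Cnorm_tri (bdry f m b c k)%C (bdry f m b k d)%C.
lra.
Qed.

Theorem Goursat a b c d : a <= b -> c <= d ->
  (forall z, inrect a b c d z -> cdiff f z) -> bdry f a b c d = C0.
Proof.
move=> hab hcd hf; apply: Cnorm_eq0.
set q0 := Quad a b c d.
have hc z : qin q0 z -> ccont f z by move=> hz; apply: cdiff_cont; exact: hf.
suff hle eps : 0 < eps -> Cnorm (bdry f a b c d) <= eps * (qsize q0 * qsize q0).
  have h0 := Cnorm_ge0 (bdry f a b c d).
  have [h1|h1] := Rle_lt_dec (Cnorm (bdry f a b c d)) 0; first lra.
  have hs : 0 <= qsize q0 * qsize q0 by nra.
  have he : 0 < Cnorm (bdry f a b c d) / (2 * (qsize q0 * qsize q0 + 1)).
    by apply: Rdiv_lt_0_compat; lra.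
  have := hle _ he; move: (qsize q0 * qsize q0) hs => s hs h.
  have : Cnorm (bdry f a b c d) / (2 * (s + 1)) * s <= Cnorm (bdry f a b c d) / 2.
    have -> : Cnorm (bdry f a b c d) / (2 * (s + 1)) * s =
       Cnorm (bdry f a b c d) / 2 * (s / (s + 1)) by field; lra.
    have : s / (s + 1) <= 1 by apply/Rle_div_l; lra.
    by nra.
  lra.
move=> heps; apply: Rnot_lt_le => hbig.
pose good q := [/\ qok q, (forall z, qin q z -> qin q0 z) &
   eps * (qsize q * qsize q) < Cnorm (qbdry q)].
have hstep (s : {q | good q}) : {s' : {q | good q} | qhalf (sval s) (sval s')}.
  case: s => q hq; apply: constructive_indefinite_description.
  case: (hq) => h1 h2 h3.
  have [q' [h4 h5]] := quad_bisect h1 (fun z hz => hc z (h2 z hz)) h3.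
  have hq' : good q'.
    case: h4 h1 => e1 e2 e3 e4 [e5 e6] [e7 e8]; split => //; first by split; lra.
    by move=> z hz; apply: h2; move: hz; rewrite /qin /inrect; lra.
  by exists (exist _ q' hq').
have g0 : good q0 by split.
pose sq := fix sq k := match k with O => exist good q0 g0 | S k => sval (hstep (sq k)) end.
pose s k := sval (sq k).
have hs k : qhalf (s k) (s k.+1) by exact: svalP (hstep (sq k)).
have hg k : good (s k) by exact: svalP (sq k).
have [x hx] : exists x, forall k, qa (s k) <= x <= qb (s k).
  apply: nested_point => k; try by case: (hs k).
  by case: (hg k) => [[]].
have [y hy] : exists x, forall k, qc (s k) <= x <= qd (s k).
  apply: nested_point => k; try by case: (hs k).
  by case: (hg k) => [[]].
have hsz k : qsize (s k) = qsize q0 * (/ 2) ^ k.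
  elim: k => [|k IH]; first by rewrite Rmult_1_r.
  case: (hs k) => _ _ _ _ [e1 e2]; rewrite /qsize e1 e2 /=.
  move: IH; rewrite /qsize /q0 /=; lra.
have hz0 : qin (s 0%N) (x, y) by split; [exact: hx|exact: hy].
have [L hL] := hf (x, y) hz0.
have [dl [hdl hh]] := hL (eps / 4) ltac:(lra).
have hq0 : 0 <= qsize q0 by rewrite /qsize /=; lra.
have [k hk] : exists k, qsize (s k) < dl.
  have [k hk] := pow_lt_1_zero (/ 2) ltac:(rewrite Rabs_pos_eq; lra) (dl / (qsize q0 + 1))
    ltac:(apply: Rdiv_lt_0_compat; lra).
  exists k; rewrite hsz.
  have := hk k (le_n _); rewrite Rabs_pos_eq; last by apply: pow_le; lra.
  move/Rlt_div_r => h; have {}h := h ltac:(lra).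
  have : 0 <= (/ 2) ^ k by apply: pow_le; lra.
  nra.
case: (hg k) => [[h1 h2] h3 h4].
have hxk := hx k; have hyk := hy k.
move: h4; apply: Rle_not_lt; rewrite /qbdry.
set A := qa (s k) in hxk h1 *; set B := qb (s k) in hxk h1 *.
set C := qc (s k) in hyk h2 *; set D := qd (s k) in hyk h2 *.
(* The affine Taylor part has zero contour integral and is removed. What is left is at most eps / 4
   times [qsize] on the boundary, and the factor 4 of [bdry_bound] turns this into eps * qsize^2,
   against the choice of the nested rectangles. *)
pose g (z : cplx) := (f z - f (x, y) - L * (z - (x, y)))%C.
have hgf : f = (fun z => g z + ((f (x, y) - L * (x, y)) + L * z))%C.
  by apply: functional_extensionality => z; rewrite /g; ring.
have hgc : bcont g A B C D.
  move=> z [hz _]; apply: cdiff_cont; apply: cdiff_sub; first apply: cdiff_sub.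
  - by apply: hf; apply: h3.
  - exact: cdiff_const.
  - apply: cdiff_mul; first exact: cdiff_const.
    by apply: cdiff_sub; [exact: cdiff_id|exact: cdiff_const].
rewrite hgf bdry_add //; last first.
  move=> z _; apply: cdiff_cont; apply: cdiff_add; first exact: cdiff_const.
  by apply: cdiff_mul; [exact: cdiff_const|exact: cdiff_id].
rewrite bdry_affine.
have -> : (bdry g A B C D + C0 = bdry g A B C D)%C by ring.
have hszk : qsize (s k) = (B - A) + (D - C) by [].
apply: Rle_trans (bdry_bound (M := eps / 4 * qsize (s k)) h1 h2 hgc _) _.
  move=> z [hz _].
  have hd : Cnorm (z - (x, y))%C <= qsize (s k).
    apply: Rle_trans (Cnorm_le_sum _) _; rewrite hszk.
    case: hz; cunfold; case: z => u v /= h5 h6.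
    apply: Rplus_le_compat; apply: Rabs_le; lra.
  apply: Rle_trans (hh z _) _; first lra.
  by apply: Rmult_le_compat_l => //; lra.
rewrite -hszk; lra.
Qed.

End Goursat.

Lemma RInt_of_derive (F f : R -> R) a b :
  (forall t, is_derive F t (f t)) -> (forall t, ex_derive f t) -> RInt f a b = F b - F a.
Proof.
move=> h1 h2; apply: is_RInt_unique; apply: (@is_RInt_derive R_CompleteNormedModule F f).
- by move=> t _; exact: h1.
- by move=> t _; apply: (@ex_derive_continuous _ R_NormedModule).
Qed.

Lemma sqr_sum_gt0 s k : k <> 0 -> 0 < s * s + k * k.
Proof. move=> h; have : 0 < k * k by nra. nra. Qed.

Lemma RInt_inv_re x0 k a b : k <> 0 ->
  RInt (fun t => (t - x0) / ((t - x0) * (t - x0) + k * k)) a b =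
  ln ((b - x0) * (b - x0) + k * k) / 2 - ln ((a - x0) * (a - x0) + k * k) / 2.
Proof.
move=> hk.
apply: (RInt_of_derive (F := fun t => ln ((t - x0) * (t - x0) + k * k) / 2)).
- move=> t; have h := sqr_sum_gt0 (t - x0) hk.
  by auto_derive; [exact: h|field; lra].
- move=> t; have h := sqr_sum_gt0 (t - x0) hk.
  by auto_derive; lra.
Qed.

Lemma RInt_inv_im x0 k a b : k <> 0 ->
  RInt (fun t => k / ((t - x0) * (t - x0) + k * k)) a b =
  atan ((b - x0) / k) - atan ((a - x0) / k).
Proof.
move=> hk.
apply: (RInt_of_derive (F := fun t => atan ((t - x0) / k))).
- move=> t; have h := sqr_sum_gt0 (t - x0) hk.
  auto_derive => //; field; nra.
- move=> t; have h := sqr_sum_gt0 (t - x0) hk.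
  by auto_derive; lra.
Qed.

Lemma CInt_inv_hor (z0 : cplx) c a b : c <> Cim z0 ->
  CInt (fun t => / ((t, c) - z0))%C a b =
  (ln ((b - Cre z0) * (b - Cre z0) + (c - Cim z0) * (c - Cim z0)) / 2
   - ln ((a - Cre z0) * (a - Cre z0) + (c - Cim z0) * (c - Cim z0)) / 2,
   - (atan ((b - Cre z0) / (c - Cim z0)) - atan ((a - Cre z0) / (c - Cim z0)))).
Proof.
case: z0 => x0 y0 /= hc; have hk : c - y0 <> 0 by lra.
rewrite -RInt_inv_re // -RInt_inv_im //; apply: cplx_ext.
  by apply: RInt_ext => t _.
have hex : ex_RInt (fun t => (c - y0) / ((t - x0) * (t - x0) + (c - y0) * (c - y0))) a b.
  apply: (@ex_RInt_continuous R_CompleteNormedModule) => t _.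
  apply: (@ex_derive_continuous _ R_NormedModule).
  by have h := sqr_sum_gt0 (t - x0) hk; auto_derive; lra.
have := @RInt_opp R_CompleteNormedModule _ _ _ hex; rewrite /opp /= => <-.
apply: RInt_ext => t _; rewrite /Cinv /Cnorm2; cunfold.
by have h := sqr_sum_gt0 (t - x0) hk; field; apply: Rgt_not_eq; move: h; rewrite /Rminus.
Qed.

Lemma CInt_inv_ver (z0 : cplx) a c d : c <= d -> a <> Cre z0 ->
  CInt (fun t => / ((a, t) - z0))%C c d =
  (atan ((d - Cim z0) / (a - Cre z0)) - atan ((c - Cim z0) / (a - Cre z0)),
   - (ln ((a - Cre z0) * (a - Cre z0) + (d - Cim z0) * (d - Cim z0)) / 2
   - ln ((a - Cre z0) * (a - Cre z0) + (c - Cim z0) * (c - Cim z0)) / 2)).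
Proof.
(* Multiplication by - i turns the vertical segment into a horizontal one at height - a, so that
   [CInt_inv_hor] applies. *)
move=> hcd ha; have -> : (fun t => / ((a, t) - z0))%C =
  (fun t => - Ci * / ((t, - a)%R - (Cim z0, - Cre z0)%R))%C.
  apply: functional_extensionality => t; rewrite /Cinv.
  have -> : Cnorm2 ((t, - a)%R - (Cim z0, - Cre z0)%R)%C = Cnorm2 ((a, t) - z0)%C.
    by rewrite /Cnorm2; cunfold; ring.
  by apply: cplx_ext; cunfold; rewrite /Rdiv; ring.
have hk : - a <> - Cre z0 by lra.
have hc : forall t, ccont (fun z => / (z - (Cim z0, - Cre z0)%R))%C (t, - a).
  move=> t; apply: cdiff_cont; apply: (@cdiff_comp (fun z => z - _)%C Cinv).
    by apply: cdiff_sub; [exact: cdiff_id|exact: cdiff_const].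
  by apply: cdiff_inv; apply: C0_neq_im; move: hk; cunfold; lra.
rewrite CInt_scal //; last first.
  move=> t _; exact: (@lcont_hor (fun z => / (z - (Cim z0, - Cre z0)%R))%C).
rewrite CInt_inv_hor //; cunfold.
have e w : (w - z0.2) / (- a - - z0.1) = - ((w - z0.2) / (a - z0.1)).
  by field; move: ha; rewrite /Cre; lra.
have e2 w : (w - z0.2) * (w - z0.2) + (- a - - z0.1) * (- a - - z0.1) =
   (a - z0.1) * (a - z0.1) + (w - z0.2) * (w - z0.2) by ring.
by rewrite !e !e2 !atan_opp; apply: cplx_ext => /=; ring.
Qed.

Lemma atan_pair u v : 0 < u -> 0 < v -> atan (u / v) + atan (v / u) = PI / 2.
Proof.
move=> hu hv; have -> : v / u = / (u / v) by field; lra.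
rewrite atan_inv; first ring.
exact: Rdiv_lt_0_compat.
Qed.

(** An explicit winding number: the logarithms cancel around the contour, and the eight arctangents
    form four pairs, each summing to pi / 2 by [atan_pair]. *)
Lemma bdry_inv (z0 : cplx) a b c d : a < Cre z0 < b -> c < Cim z0 < d ->
  bdry (fun z => / (z - z0))%C a b c d = (RtoC (2 * PI) * Ci)%C.
Proof.
move=> hx hy; rewrite /bdry !CInt_inv_hor ?CInt_inv_ver; try lra.
case: z0 hx hy => x0 y0 /= hx hy.
have e1 : (b - x0) / (c - y0) = - ((b - x0) / (y0 - c)) by field; lra.
have e2 : (a - x0) / (c - y0) = (x0 - a) / (y0 - c) by field; lra.
have e3 : (a - x0) / (d - y0) = - ((x0 - a) / (d - y0)) by field; lra.
have e4 : (c - y0) / (b - x0) = - ((y0 - c) / (b - x0)) by field; lra.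
have e5 : (c - y0) / (a - x0) = (y0 - c) / (x0 - a) by field; lra.
have e6 : (d - y0) / (a - x0) = - ((d - y0) / (x0 - a)) by field; lra.
rewrite e1 e2 e3 e4 e5 e6 !atan_opp.
have p1 := @atan_pair (b - x0) (y0 - c) ltac:(lra) ltac:(lra).
have p2 := @atan_pair (x0 - a) (y0 - c) ltac:(lra) ltac:(lra).
have p3 := @atan_pair (b - x0) (d - y0) ltac:(lra) ltac:(lra).
have p4 := @atan_pair (x0 - a) (d - y0) ltac:(lra) ltac:(lra).
apply: cplx_ext; cunfold; lra.
Qed.

Lemma onbdry_neq (z0 : cplx) a b c d z : a < Cre z0 < b -> c < Cim z0 < d ->
  onbdry a b c d z -> (z - z0)%C <> C0.
Proof.
move=> hx hy [_ h] e.
have e1 : Cre z = Cre z0 by have : Cre (z - z0)%C = 0 by [rewrite e|]; cunfold; lra.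
have e2 : Cim z = Cim z0 by have : Cim (z - z0)%C = 0 by [rewrite e|]; cunfold; lra.
lra.
Qed.

Lemma cdiff_inv_sub z0 z : (z - z0)%C <> C0 -> cdiff (fun w => / (w - z0))%C z.
Proof.
move=> h; apply: (@cdiff_comp (fun w => w - z0)%C Cinv); last exact: cdiff_inv.
by apply: cdiff_sub; [exact: cdiff_id|exact: cdiff_const].
Qed.

Section Cauchy.
Variables (f : cplx -> cplx) (z0 : cplx) (a b c d : R).
Hypothesis hx : a < Cre z0 < b.
Hypothesis hy : c < Cim z0 < d.
Hypothesis hf : forall z, inrect a b c d z -> cdiff f z.

Let quot L (z : cplx) : cplx :=
  if excluded_middle_informative (z = z0) then L else ((f z - f z0) / (z - z0))%C.

Lemma quot_cdiff L z : z <> z0 -> inrect a b c d z -> cdiff (quot L) z.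
Proof.
move=> hz hr.
have hzz : (z - z0)%C <> C0.
  by move=> e; apply: hz; have -> : z = (z - z0 + z0)%C by [ring|]; rewrite e; ring.
apply: (@cdiff_ext_loc (fun w => (f w - f z0) / (w - z0))%C _ _ (Cnorm (z - z0)%C)).
- exact: Cnorm_gt0.
- move=> w hw; rewrite /quot; case: excluded_middle_informative => // e.
  by exfalso; move: hw; rewrite e Cnorm_sub_sym; lra.
- apply: cdiff_mul; last exact: cdiff_inv_sub.
  by apply: cdiff_sub; [exact: hf|exact: cdiff_const].
Qed.

Lemma quot_ccont L : cderiv f z0 L -> ccont (quot L) z0.
Proof.
move=> h eps heps; have [dl [hdl hh]] := h (eps / 2) ltac:(lra).
exists dl; split => // w hw; rewrite /quot.
case: (excluded_middle_informative (z0 = z0)) => [e0|//].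
case: excluded_middle_informative => [e1|hz].
  have -> : (L - L = C0)%C by ring.
  by rewrite Cnorm0.
have hzz : (w - z0)%C <> C0.
  by move=> e; apply: hz; have -> : w = (w - z0 + z0)%C by [ring|]; rewrite e; ring.
have -> : ((f w - f z0) / (w - z0) - L = (f w - f z0 - L * (w - z0)) / (w - z0))%C by field.
rewrite Cnorm_mul Cnorm_inv //.
have hn := Cnorm_gt0 hzz.
apply: Rle_lt_trans (_ : eps / 2 < eps); last lra.
by apply/Rle_div_l => //; apply: hh.
Qed.

(** [quot L] is holomorphic off [z0] and continuous at [z0]. Cutting the rectangle along the sides
    of a square of half-side [s] around [z0] leaves only the contribution of that square, which is
    O(s). *)
Lemma quot_bdry L : cderiv f z0 L -> bdry (quot L) a b c d = C0.
Proof.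
move=> hL; have hc := quot_ccont hL.
have hcont z : inrect a b c d z -> ccont (quot L) z.
  move=> hz; case: (excluded_middle_informative (z = z0)) => [->|hn] //.
  by apply: cdiff_cont; exact: quot_cdiff.
have [d1 [hd1 h1]] := hc 1 Rlt_0_1.
set M := Cnorm (quot L z0) + 1.
have hM : 0 < M by have := Cnorm_ge0 (quot L z0); rewrite /M; lra.
have hx' := hx; have hy' := hy.
set x0 := Cre z0 in hx' *; set y0 := Cim z0 in hy' *.
set s0 := Rmin (Rmin (x0 - a) (b - x0)) (Rmin (Rmin (y0 - c) (d - y0)) (d1 / 3)).
have hs0 : 0 < s0 by rewrite /s0; repeat apply: Rmin_glb_lt; lra.
have hs1 : s0 <= x0 - a by apply: Rle_trans (Rmin_l _ _) (Rmin_l _ _).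
have hs2 : s0 <= b - x0 by apply: Rle_trans (Rmin_l _ _) (Rmin_r _ _).
have hs3 : s0 <= y0 - c.
  by apply: Rle_trans (Rmin_r _ _) _; apply: Rle_trans (Rmin_l _ _) (Rmin_l _ _).
have hs4 : s0 <= d - y0.
  by apply: Rle_trans (Rmin_r _ _) _; apply: Rle_trans (Rmin_l _ _) (Rmin_r _ _).
have hs5 : s0 <= d1 / 3 by apply: Rle_trans (Rmin_r _ _) (Rmin_r _ _).
have off z : (Cre z <> x0 \/ Cim z <> y0) -> z <> z0.
  by move=> h e; move: h; rewrite e /x0 /y0; case.
have key s : 0 < s <= s0 -> Cnorm (bdry (quot L) a b c d) <= 4 * M * (4 * s).
  move=> hs.
  have hs6 : s <= s0 by lra.
  rewrite (bdry_split_ver (m := x0 - s)) //; try lra.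
  rewrite (Goursat (b := x0 - s)); try lra; last first.
    move=> z [h2 h3]; apply: quot_cdiff; first by apply: off; lra.
    by rewrite /inrect; lra.
  rewrite (bdry_split_ver (a := x0 - s) (m := x0 + s)); try lra; last first.
    by apply: rcont_sub hcont; lra.
  rewrite (Goursat (a := x0 + s)); try lra; last first.
    move=> z [h2 h3]; apply: quot_cdiff; first by apply: off; lra.
    by rewrite /inrect; lra.
  rewrite (bdry_split_hor (m := y0 - s)); try lra; last first.
    by apply: rcont_sub hcont; lra.
  rewrite (Goursat (d := y0 - s)); try lra; last first.
    move=> z [h2 h3]; apply: quot_cdiff; first by apply: off; lra.
    by rewrite /inrect; lra.
  rewrite (bdry_split_hor (m := y0 + s) (c := y0 - s)); try lra; last first.
    by apply: rcont_sub hcont; lra.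
  rewrite (Goursat (c := y0 + s)); try lra; last first.
    move=> z [h2 h3]; apply: quot_cdiff; first by apply: off; lra.
    by rewrite /inrect; lra.
  set B := bdry _ _ _ _ _.
  have -> : (C0 + (C0 + (B + C0) + C0) = B)%C by ring.
  have -> : 4 * M * (4 * s) = 4 * M * ((x0 + s - (x0 - s)) + (y0 + s - (y0 - s))) by ring.
  apply: bdry_bound; try lra.
    by apply: rcont_bcont; apply: rcont_sub hcont; lra.
  move=> z [[h2 h3] _].
  have hz : Cnorm (z - z0)%C < d1.
    apply: Rle_lt_trans (Cnorm_le_sum _) _.
    have : Rabs (Cre (z - z0)%C) <= s.
      by move: h2; rewrite /x0; cunfold => h2; apply: Rabs_le; lra.
    have : Rabs (Cim (z - z0)%C) <= s.
      by move: h3; rewrite /y0; cunfold => h3; apply: Rabs_le; lra.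
    lra.
  have := h1 z hz; have := Cnorm_tri_rev (quot L z) (quot L z0); rewrite /M; lra.
apply: Cnorm_eq0.
have hB := Cnorm_ge0 (bdry (quot L) a b c d).
have [hpos|//] := Rle_lt_or_eq_dec _ _ hB.
(* With this half-side the bound 4 * M * (4 * s) is at most half of the norm it is supposed to
   dominate. *)
have := key (Rmin s0 (Cnorm (bdry (quot L) a b c d) / (32 * M))).
move=> h; have h2 := Rmin_l s0 (Cnorm (bdry (quot L) a b c d) / (32 * M)).
have h3 := Rmin_r s0 (Cnorm (bdry (quot L) a b c d) / (32 * M)).
have h4 : 0 < Rmin s0 (Cnorm (bdry (quot L) a b c d) / (32 * M)).
  by apply: Rmin_glb_lt => //; apply: Rdiv_lt_0_compat; lra.
have {}h := h (conj h4 h2).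
have : 4 * M * (4 * (Cnorm (bdry (quot L) a b c d) / (32 * M))) = Cnorm (bdry (quot L) a b c d) / 2.
  by field; lra.
have : 4 * M * (4 * Rmin s0 (Cnorm (bdry (quot L) a b c d) / (32 * M))) <=
  4 * M * (4 * (Cnorm (bdry (quot L) a b c d) / (32 * M))) by apply: Rmult_le_compat_l; lra.
lra.
Qed.

Theorem Cauchy_formula :
  bdry (fun z => f z / (z - z0))%C a b c d = (RtoC (2 * PI) * Ci * f z0)%C.
Proof.
have [L hL] := hf (z := z0) ltac:(rewrite /inrect; lra).
have hab : a <= b by lra.
have hcd : c <= d by lra.
have hinv : bcont (fun z => / (z - z0))%C a b c d.
  by move=> z hz; apply: cdiff_cont; apply: cdiff_inv_sub; apply: onbdry_neq hz.
rewrite (bdry_ext (g := fun z => quot L z + f z0 * / (z - z0))%C) //; last first.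
  move=> z hz; have hn := onbdry_neq hx hy hz.
  rewrite /quot; case: excluded_middle_informative => [e|hne] /=; last by field.
  by case: hn; rewrite e; ring.
rewrite bdry_add // ?quot_bdry ?bdry_scal ?bdry_inv //; first ring.
- move=> z hz; apply: cdiff_cont; apply: quot_cdiff; last by case: hz.
  by move=> e; apply: (onbdry_neq hx hy hz); rewrite e; ring.
- move=> z hz; apply: cdiff_cont; apply: cdiff_mul; first exact: cdiff_const.
  by apply: cdiff_inv_sub; apply: onbdry_neq hz.
Qed.

End Cauchy.

Lemma Cnorm_2PI_Ci z : Cnorm (RtoC (2 * PI) * Ci * z)%C = 2 * PI * Cnorm z.
Proof.
rewrite !Cnorm_mul Cnorm_Ci Cnorm_RtoC Rabs_pos_eq; first ring.
by have := PI_RGT_0; lra.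
Qed.

Lemma onbdry_dist (z0 : cplx) a b c d z r : r <= Cre z0 - a -> r <= b - Cre z0 ->
  r <= Cim z0 - c -> r <= d - Cim z0 -> onbdry a b c d z -> r <= Cnorm (z - z0)%C.
Proof.
move=> h1 h2 h3 h4 [[h5 h6] h].
have hr := Cre_le (z - z0)%C; have hi := Cim_le (z - z0)%C.
move: hr hi; cunfold; move: h1 h2 h3 h4 h5 h6 h; rewrite /Cre /Cim.
move: (z.1) (z.2) (z0.1) (z0.2) => u v u0 v0 h1 h2 h3 h4 h5 h6 h hr hi.
have := Rle_abs (u + - u0); have := Rle_abs (v + - v0).
have := Rle_abs (- (u + - u0)); have := Rle_abs (- (v + - v0)); rewrite !Rabs_Ropp.
lra.
Qed.

(** Cauchy's formula for f^k gives |f(z0)|^k <= K * S^k with [K] independent of [k], so the crude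
    constant disappears as [k] grows. *)
Lemma max_modulus_rect f z0 a b c d S : a < Cre z0 < b -> c < Cim z0 < d -> 0 <= S ->
  (forall z, inrect a b c d z -> cdiff f z) ->
  (forall z, onbdry a b c d z -> Cnorm (f z) <= S) ->
  Cnorm (f z0) <= S.
Proof.
move=> hx hy hS hf hb; apply: Rnot_lt_le => hlt.
set r := Rmin (Rmin (Cre z0 - a) (b - Cre z0)) (Rmin (Cim z0 - c) (d - Cim z0)).
have hr : 0 < r by rewrite /r; repeat apply: Rmin_glb_lt; lra.
have hr1 : r <= Cre z0 - a by apply: Rle_trans (Rmin_l _ _) (Rmin_l _ _).
have hr2 : r <= b - Cre z0 by apply: Rle_trans (Rmin_l _ _) (Rmin_r _ _).
have hr3 : r <= Cim z0 - c by apply: Rle_trans (Rmin_r _ _) (Rmin_l _ _).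
have hr4 : r <= d - Cim z0 by apply: Rle_trans (Rmin_r _ _) (Rmin_r _ _).
set K := 4 * ((b - a) + (d - c)) / r.
have hK : 0 < K by rewrite /K; apply: Rdiv_lt_0_compat; lra.
have hPI := PI2_3_2.
have key k : Cnorm (f z0) ^ k <= K * S ^ k.
  have hfk z : inrect a b c d z -> cdiff (fun z => f z ^ k)%C z.
    by move=> hz; apply: cdiff_pow; exact: hf.
  have e := Cauchy_formula hx hy hfk.
  have : Cnorm (bdry (fun z => f z ^ k / (z - z0))%C a b c d) <=
      4 * (S ^ k / r) * ((b - a) + (d - c)).
    apply: bdry_bound; try lra.
      move=> z hz; apply: cdiff_cont; apply: cdiff_mul; first by apply: hfk; case: hz.
      by apply: cdiff_inv_sub; apply: onbdry_neq hz.
    move=> z hz; have hn := onbdry_neq hx hy hz.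
    rewrite Cnorm_mul Cnorm_inv // Cnorm_pow.
    apply: Rmult_le_compat.
    - by apply: pow_le; exact: Cnorm_ge0.
    - by apply: Rlt_le; apply: Rinv_0_lt_compat; exact: Cnorm_gt0.
    - by apply: pow_incr; split; [exact: Cnorm_ge0|exact: hb].
    - by apply: Rinv_le_contravar => //; apply: onbdry_dist hz.
  rewrite e Cnorm_2PI_Ci Cnorm_pow.
  have -> : 4 * (S ^ k / r) * (b - a + (d - c)) = K * S ^ k by rewrite /K; field; lra.
  have : 0 <= Cnorm (f z0) ^ k by apply: pow_le; exact: Cnorm_ge0.
  nra.
have hc0 : 0 < Cnorm (f z0) by lra.
have [k hk] := pow_lt_1_zero (S / Cnorm (f z0))
  ltac:(rewrite Rabs_pos_eq; [apply/Rlt_div_l; lra | apply: Rdiv_le_0_compat; lra])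
  (/ (2 * K)) ltac:(apply: Rinv_0_lt_compat; lra).
have := hk k (le_n _); rewrite Rabs_pos_eq; last first.
  by apply: pow_le; apply: Rdiv_le_0_compat; lra.
rewrite {1}/Rdiv Rpow_mult_distr pow_inv => h.
have hp : 0 < Cnorm (f z0) ^ k by apply: pow_lt.
move/Rlt_div_l: h => h; have {}h := h hp.
have h1 := key k.
have h2 : K * S ^ k < K * (/ (2 * K) * Cnorm (f z0) ^ k) by apply: Rmult_lt_compat_l.
have h3 : K * (/ (2 * K) * Cnorm (f z0) ^ k) = Cnorm (f z0) ^ k / 2 by field; lra.
lra.
Qed.

(** The Cauchy formulas at [w] and [z0] on the same square are subtracted: the kernels differ by (w
    - z0) / ((z - w) (z - z0)), whose two denominators are at least r / 2 and r in modulus on the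
    boundary. *)
Lemma Cauchy_lipschitz f z0 r A : 0 < r ->
  (forall z, inrect (Cre z0 - r) (Cre z0 + r) (Cim z0 - r) (Cim z0 + r) z ->
     cdiff f z /\ Cnorm (f z) <= A) ->
  forall w, Cnorm (w - z0)%C <= r / 2 ->
    Cnorm (f w - f z0)%C <= 16 * A / r * Cnorm (w - z0)%C.
Proof.
move=> hr hf w hw.
set x0 := Cre z0 in hf *; set y0 := Cim z0 in hf *.
have hwx : Rabs (Cre w - x0) <= r / 2.
  by apply: Rle_trans hw; exact: (Cre_le (w - z0)%C).
have hwy : Rabs (Cim w - y0) <= r / 2.
  by apply: Rle_trans hw; exact: (Cim_le (w - z0)%C).
move/Rabs_le_between: hwx => hwx; move/Rabs_le_between: hwy => hwy.
have hx0 : x0 - r < Cre z0 < x0 + r by rewrite /x0; lra.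
have hy0 : y0 - r < Cim z0 < y0 + r by rewrite /y0; lra.
have hx1 : x0 - r < Cre w < x0 + r by lra.
have hy1 : y0 - r < Cim w < y0 + r by lra.
have hd z : inrect (x0 - r) (x0 + r) (y0 - r) (y0 + r) z -> cdiff f z by move=> /hf [].
have e0 := Cauchy_formula hx0 hy0 hd; have e1 := Cauchy_formula hx1 hy1 hd.
have hxx : x0 - r <= x0 + r by lra.
have hyy : y0 - r <= y0 + r by lra.
have bc v : x0 - r < Cre v < x0 + r -> y0 - r < Cim v < y0 + r ->
    bcont (fun z => f z / (z - v))%C (x0 - r) (x0 + r) (y0 - r) (y0 + r).
  move=> hv1 hv2 z hz; apply: cdiff_cont; apply: cdiff_mul; first by apply: hd; case: hz.
  by apply: cdiff_inv_sub; apply: onbdry_neq hz.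
have hA : 0 <= A.
  have [|_] := hf z0; first by rewrite /inrect /x0 /y0; lra.
  by have := Cnorm_ge0 (f z0); lra.
have := @bdry_add (fun z => f z / (z - w))%C (fun z => Copp C1 * (f z / (z - z0)))%C _ _ _ _
  hxx hyy (bc w hx1 hy1).
rewrite bdry_scal //; last exact: bc.
rewrite e0 e1 => H.
have bc0 : bcont (fun z => - C1 * (f z / (z - z0)))%C (x0 - r) (x0 + r) (y0 - r) (y0 + r).
  move=> z hz; apply: cdiff_cont; apply: cdiff_mul; first exact: cdiff_const.
  apply: cdiff_mul; first by apply: hd; case: hz.
  by apply: cdiff_inv_sub; apply: onbdry_neq hz.
have {}H := H bc0.
have H2 : (RtoC (2 * PI) * Ci * f w + - C1 * (RtoC (2 * PI) * Ci * f z0) =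
   RtoC (2 * PI) * Ci * (f w - f z0))%C by ring.
rewrite H2 in H.
have : Cnorm (RtoC (2 * PI) * Ci * (f w - f z0))%C <=
  4 * (A * (Cnorm (w - z0)%C * (2 / (r * r)))) * ((x0 + r - (x0 - r)) + (y0 + r - (y0 - r))).
  rewrite -H; apply: bdry_bound => //.
    move=> z hz; apply: cdiff_cont; apply: cdiff_add.
      apply: cdiff_mul; first by apply: hd; case: hz.
      by apply: cdiff_inv_sub; apply: onbdry_neq hz.
    apply: cdiff_mul; first exact: cdiff_const.
    apply: cdiff_mul; first by apply: hd; case: hz.
    by apply: cdiff_inv_sub; apply: onbdry_neq hz.
  move=> z hz.
  have n0 := onbdry_neq hx0 hy0 hz; have n1 := onbdry_neq hx1 hy1 hz.
  have -> : (f z / (z - w) + - C1 * (f z / (z - z0)) = f z * ((w - z0) * (/ (z - w) * / (z - z0))))%C.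
    by field.
  rewrite !Cnorm_mul !Cnorm_inv //.
  have d0 : r <= Cnorm (z - z0)%C by apply: onbdry_dist hz; rewrite -/x0 -/y0; lra.
  have d1 : r / 2 <= Cnorm (z - w)%C by apply: onbdry_dist hz; lra.
  have [_ hA2] := hf z (proj1 hz).
  apply: Rmult_le_compat => //; first exact: Cnorm_ge0.
    apply: Rmult_le_pos; first exact: Cnorm_ge0.
    by apply: Rmult_le_pos; apply: Rlt_le; apply: Rinv_0_lt_compat; lra.
  apply: Rmult_le_compat_l; first exact: Cnorm_ge0.
  have -> : 2 / (r * r) = / (r / 2) * / r by field; lra.
  apply: Rmult_le_compat; try (apply: Rlt_le; apply: Rinv_0_lt_compat; lra).
    by apply: Rinv_le_contravar; lra.
  by apply: Rinv_le_contravar; lra.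
rewrite Cnorm_2PI_Ci.
have hPI := PI2_3_2.
have -> : 4 * (A * (Cnorm (w - z0)%C * (2 / (r * r)))) * (x0 + r - (x0 - r) + (y0 + r - (y0 - r)))
  = 2 * (16 * A / r * Cnorm (w - z0)%C) by field; lra.
have := Cnorm_ge0 (f w - f z0)%C; nra.
Qed.

(** * Finite sums, real powers and the exponential *)

HB.instance Definition _ := Monoid.isComLaw.Build R 0 Rplus
  (fun x y z => esym (Rplus_assoc x y z)) Rplus_comm Rplus_0_l.
HB.instance Definition _ := Monoid.isComLaw.Build R 1 Rmult
  (fun x y z => esym (Rmult_assoc x y z)) Rmult_comm Rmult_1_l.
HB.instance Definition _ := Monoid.isMulLaw.Build R 0 Rmult Rmult_0_l Rmult_0_r.
HB.instance Definition _ := Monoid.isAddLaw.Build R Rmult Rplus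
  Rmult_plus_distr_r Rmult_plus_distr_l.

Lemma CaddA : associative Cadd. Proof. by move=> x y z; ring. Qed.
Lemma CaddC : commutative Cadd. Proof. by move=> x y; ring. Qed.
Lemma Cadd0 : left_id C0 Cadd. Proof. by move=> x; ring. Qed.
Lemma CmulA : associative Cmul. Proof. by move=> x y z; ring. Qed.
Lemma CmulC : commutative Cmul. Proof. by move=> x y; ring. Qed.
Lemma Cmul1 : left_id C1 Cmul. Proof. by move=> x; ring. Qed.
Lemma Cmul0l : left_zero C0 Cmul. Proof. by move=> x; ring. Qed.
Lemma Cmul0r : right_zero C0 Cmul. Proof. by move=> x; ring. Qed.
Lemma CmulDl : left_distributive Cmul Cadd. Proof. by move=> x y z; ring. Qed.
Lemma CmulDr : right_distributive Cmul Cadd. Proof. by move=> x y z; ring. Qed.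
HB.instance Definition _ := Monoid.isComLaw.Build cplx C0 Cadd CaddA CaddC Cadd0.
HB.instance Definition _ := Monoid.isComLaw.Build cplx C1 Cmul CmulA CmulC Cmul1.
HB.instance Definition _ := Monoid.isMulLaw.Build cplx C0 Cmul Cmul0l Cmul0r.
HB.instance Definition _ := Monoid.isAddLaw.Build cplx Cmul Cadd CmulDl CmulDr.

Notation "\rsum_ ( i < n ) F" := (\big[Rplus/0]_(i < n) F)
  (at level 35, F at level 35, i, n at level 50).
Notation "\csum_ ( i < n ) F" := (\big[Cadd/C0]_(i < n) F%C)
  (at level 35, F at level 35, i, n at level 50).

Section RSum.
Variables (I : Type) (r : seq I) (P : pred I).
Implicit Types F G : I -> R.

Lemma rsum_le F G : (forall i, P i -> F i <= G i) ->
  \big[Rplus/0]_(i <- r | P i) F i <= \big[Rplus/0]_(i <- r | P i) G i.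
Proof. by move=> h; apply: (big_ind2 Rle) => // *; lra. Qed.

Lemma rsum_ge0 F : (forall i, P i -> 0 <= F i) -> 0 <= \big[Rplus/0]_(i <- r | P i) F i.
Proof. by move=> h; apply: (big_ind (Rle 0)) => // *; lra. Qed.

Lemma rsum_scal a F :
  \big[Rplus/0]_(i <- r | P i) (a * F i) = a * \big[Rplus/0]_(i <- r | P i) F i.
Proof. by rewrite big_distrr. Qed.

Lemma rsum_add F G : \big[Rplus/0]_(i <- r | P i) (F i + G i) =
  \big[Rplus/0]_(i <- r | P i) F i + \big[Rplus/0]_(i <- r | P i) G i.
Proof. exact: big_split. Qed.

Lemma Cnorm_csum (f : I -> cplx) :
  Cnorm (\big[Cadd/C0]_(i <- r | P i) f i) <= \big[Rplus/0]_(i <- r | P i) Cnorm (f i).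
Proof.
apply: (big_ind2 (fun z x => Cnorm z <= x)) => //; first by rewrite Cnorm0; lra.
  by move=> z x w y h1 h2; apply: Rle_trans (Cnorm_tri _ _) _; lra.
by move=> i _; exact: Rle_refl.
Qed.

Lemma Cnorm_cprod (f : I -> cplx) :
  Cnorm (\big[Cmul/C1]_(i <- r | P i) f i) = \big[Rmult/1]_(i <- r | P i) Cnorm (f i).
Proof. by apply: (big_morph Cnorm Cnorm_mul Cnorm1). Qed.

Lemma rprod_ge0 F : (forall i, P i -> 0 <= F i) -> 0 <= \big[Rmult/1]_(i <- r | P i) F i.
Proof.
move=> h; apply: (big_ind (Rle 0)) => //; first lra.
by move=> x y; exact: Rmult_le_pos.
Qed.

Lemma rprod_le F G : (forall i, P i -> 0 <= F i <= G i) ->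
  \big[Rmult/1]_(i <- r | P i) F i <= \big[Rmult/1]_(i <- r | P i) G i.
Proof.
move=> h.
suff : 0 <= \big[Rmult/1]_(i <- r | P i) F i <= \big[Rmult/1]_(i <- r | P i) G i by case.
apply: (big_ind2 (fun x y => 0 <= x <= y)) => //; first lra.
by move=> x y u v h1 h2; split; [apply: Rmult_le_pos; lra|apply: Rmult_le_compat; lra].
Qed.

End RSum.

Lemma rsum_const (T : finType) (a : R) : \big[Rplus/0]_(i : T) a = INR #|T| * a.
Proof.
rewrite big_const; elim: #|T| => [|k IH] /=; first by rewrite Rmult_0_l.
by rewrite IH -/(INR k.+1) S_INR; ring.
Qed.

Lemma rsum_ord_const n (a : R) : \rsum_(i < n) a = INR n * a.
Proof. by rewrite rsum_const card_ord. Qed.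

Lemma rsum_telescope (a : nat -> R) n : \rsum_(l < n) (a l.+1 - a l) = a n - a 0%N.
Proof.
elim: n => [|n IH]; first by rewrite big_ord0; lra.
by rewrite big_ord_recr /= IH; lra.
Qed.

Lemma exp_le_mono a b : a <= b -> exp a <= exp b.
Proof. by move=> [/exp_increasing|->]; lra. Qed.

Lemma rpow0 p : rpow 0 p = 0.
Proof. by rewrite /rpow; case: Rle_dec => //=; lra. Qed.

Lemma rpow_pos a p : 0 < a -> rpow a p = exp (p * ln a).
Proof. by move=> h; rewrite /rpow; case: Rle_dec => //=; lra. Qed.

Lemma rpow_gt0 a p : 0 < a -> 0 < rpow a p.
Proof. by move=> h; rewrite rpow_pos //; exact: exp_pos. Qed.

Lemma rpow_ge0 a p : 0 <= rpow a p.
Proof.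
rewrite /rpow; case: Rle_dec => /= _; first lra.
exact: Rlt_le (exp_pos _).
Qed.

Lemma rpow_one p : rpow 1 p = 1.
Proof. by rewrite rpow_pos ?ln_1 ?Rmult_0_r ?exp_0 //; lra. Qed.

Lemma rpow_exp u p : rpow (exp u) p = exp (p * u).
Proof. by rewrite rpow_pos ?ln_exp //; exact: exp_pos. Qed.

Lemma rpow_le a b p : 0 <= p -> a <= b -> rpow a p <= rpow b p.
Proof.
move=> hp hab; have [ha|ha] := Rle_lt_dec a 0.
  by rewrite {1}/rpow; case: Rle_dec => //= _; exact: rpow_ge0.
rewrite !rpow_pos; try lra.
have : ln a <= ln b by apply: ln_le.
move=> h; have : p * ln a <= p * ln b by nra.
case=> [/exp_increasing|->]; lra.
Qed.

Lemma rpow_mul a b p : 0 <= a -> 0 <= b -> rpow (a * b) p = rpow a p * rpow b p.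
Proof.
move=> [ha|<-] [hb|<-]; rewrite ?Rmult_0_l ?Rmult_0_r ?rpow0 ?Rmult_0_l ?Rmult_0_r //.
rewrite !rpow_pos //; last exact: Rmult_lt_0_compat.
by rewrite ln_mult // Rmult_plus_distr_l exp_plus.
Qed.

Lemma rpow_plus a p q : rpow a (p + q) = rpow a p * rpow a q.
Proof.
rewrite /rpow; case: Rle_dec => /= h; first ring.
by rewrite Rpower_plus.
Qed.

Lemma rpow_rpow a p q : rpow (rpow a p) q = rpow a (p * q).
Proof.
have [ha|ha] := Rle_lt_dec a 0.
  by rewrite {2 3}/rpow; case: Rle_dec => //= _; rewrite rpow0.
by rewrite (rpow_pos p ha) rpow_exp rpow_pos //; congr exp; ring.
Qed.

Lemma rpow1 a : 0 <= a -> rpow a 1 = a.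
Proof. by move=> [h|<-]; rewrite ?rpow0 // rpow_pos // Rmult_1_l exp_ln. Qed.

Lemma rpow_root a p : 0 <= a -> p <> 0 -> rpow (rpow a (/ p)) p = a.
Proof. by move=> h hp; rewrite rpow_rpow Rinv_l // rpow1. Qed.

Lemma rpow_natpow a q k : 0 <= a -> rpow (a ^ k) q = rpow a q ^ k.
Proof.
move=> ha; elim: k => [|k IH] /=; first exact: rpow_one.
by rewrite rpow_mul ?IH //; exact: pow_le.
Qed.

Lemma rpow_pow a q k : (0 < k)%N -> rpow a q ^ k = rpow a (INR k * q).
Proof.
case: k => // k _; elim: k => [|k IH]; first by rewrite /= Rmult_1_r Rmult_1_l.
rewrite -tech_pow_Rmult IH -rpow_plus; congr (rpow a _).
by rewrite (S_INR k.+1); ring.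
Qed.

(** From a + b <= 2 * max a b. This is the triangle inequality for p-means in a form valid both for
    p < 1 and for p >= 1, at the price of 2^p. *)
Lemma rpow_sum a b p : 0 < p -> 0 <= a -> 0 <= b ->
  rpow (a + b) p <= rpow 2 p * (rpow a p + rpow b p).
Proof.
move=> hp ha hb.
have h : rpow (a + b) p <= rpow (2 * Rmax a b) p.
  by apply: rpow_le; first lra; have := Rmax_l a b; have := Rmax_r a b; lra.
apply: Rle_trans h _; rewrite rpow_mul; last 2 first.
- lra.
- by apply: Rle_trans ha _; exact: Rmax_l.
apply: Rmult_le_compat_l; first exact: rpow_ge0.
have h1 := rpow_ge0 a p; have h2 := rpow_ge0 b p.
by rewrite /Rmax; case: Rle_dec => _; lra.
Qed.

Lemma rpow_Cnorm_add z w p : 0 < p ->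
  rpow (Cnorm (z + w)%C) p <= rpow 2 p * (rpow (Cnorm z) p + rpow (Cnorm w) p).
Proof.
move=> hp; apply: Rle_trans (rpow_sum hp (Cnorm_ge0 z) (Cnorm_ge0 w)).
by apply: rpow_le; [lra|exact: Cnorm_tri].
Qed.

Lemma rpow_small p eps : 0 < p -> 0 < eps -> exists d, 0 < d /\ rpow d p = eps.
Proof.
move=> hp he; exists (rpow eps (/ p)); split; first exact: rpow_gt0.
by rewrite rpow_root //; lra.
Qed.

Lemma derivable_pt_lim_eps (g : R -> R) l : derivable_pt_lim g 0 l ->
  forall eps, 0 < eps -> exists d, 0 < d /\
    forall h, Rabs h < d -> Rabs (g h - g 0 - l * h) <= eps * Rabs h.
Proof.
move=> H eps heps; have [[d hd] hh] := H eps heps.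
exists d; split => // h hlt.
have [->|hn] := Req_dec h 0.
  have -> : g 0 - g 0 - l * 0 = 0 by ring.
  rewrite Rabs_R0; lra.
have := hh h hn hlt; rewrite Rplus_0_l => h1.
have -> : g h - g 0 - l * h = ((g h - g 0) / h - l) * h by field.
rewrite Rabs_mult; apply: Rmult_le_compat_r; first exact: Rabs_pos.
exact: Rlt_le.
Qed.

(** * The complex exponential and the Poisson kernel *)

Definition cexp (z : cplx) : cplx := (exp (Cre z) * cos (Cim z), exp (Cre z) * sin (Cim z)).

Lemma cexp_add z w : cexp (z + w)%C = (cexp z * cexp w)%C.
Proof.
by apply: cplx_ext; rewrite /cexp; cunfold; rewrite exp_plus ?cos_plus ?sin_plus; ring.
Qed.

Lemma Cnorm_cexp z : Cnorm (cexp z) = exp (Cre z).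
Proof.
rewrite /Cnorm /Cnorm2 /cexp; cunfold.
have -> : exp z.1 * cos z.2 * (exp z.1 * cos z.2) + exp z.1 * sin z.2 * (exp z.1 * sin z.2)
  = exp z.1 * exp z.1 * (Rsqr (sin z.2) + Rsqr (cos z.2)) by rewrite /Rsqr; ring.
by rewrite sin2_cos2 Rmult_1_r sqrt_square //; exact: Rlt_le (exp_pos _).
Qed.

Lemma cexp_deriv0 : cderiv cexp C0 C1.
Proof.
(* The three terms of the decomposition below contribute 4, 1 and 2 times eps * |w|, whence the
   7. *)
move=> eps0 heps0; set eps := Rmin (eps0 / 7) (1 / 4).
have heps : 0 < eps by apply: Rmin_glb_lt; lra.
have he1 : eps <= eps0 / 7 by exact: Rmin_l.
have he2 : eps <= 1 / 4 by exact: Rmin_r.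
have [d1 [hd1 h1]] := derivable_pt_lim_eps (derivable_pt_lim_exp 0) heps.
have [d2 [hd2 h2]] := derivable_pt_lim_eps (derivable_pt_lim_sin 0) heps.
have [d3 [hd3 h3]] := derivable_pt_lim_eps (derivable_pt_lim_cos 0) heps.
exists (Rmin (Rmin d1 d2) (Rmin d3 eps)); split.
  by apply: Rmin_glb_lt; apply: Rmin_glb_lt.
move=> w; have -> : (w - C0 = w)%C by ring.
move=> hw.
have hwd1 : Cnorm w < d1 by apply: Rlt_le_trans hw (Rle_trans _ _ _ (Rmin_l _ _) (Rmin_l _ _)).
have hwd2 : Cnorm w < d2 by apply: Rlt_le_trans hw (Rle_trans _ _ _ (Rmin_l _ _) (Rmin_r _ _)).
have hwd3 : Cnorm w < d3 by apply: Rlt_le_trans hw (Rle_trans _ _ _ (Rmin_r _ _) (Rmin_l _ _)).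
have hwd4 : Cnorm w < eps by apply: Rlt_le_trans hw (Rle_trans _ _ _ (Rmin_r _ _) (Rmin_r _ _)).
set a := Cre w; set b := Cim w.
have ha := Cre_le w; have hb := Cim_le w; rewrite -/a -/b in ha hb.
have {}h1 := h1 a ltac:(lra); have {}h2 := h2 b ltac:(lra); have {}h3 := h3 b ltac:(lra).
move: h1 h2 h3; rewrite exp_0 sin_0 cos_0 => h1 h2 h3.
have -> : (cexp w - cexp C0 - C1 * w =
  RtoC (exp a) * (cos b - 1, sin b - b)%R + (RtoC (exp a - 1 - a) + RtoC (exp a - 1) * (Ci * RtoC b)))%C.
  by apply: cplx_ext; rewrite /cexp /a /b; cunfold; rewrite ?exp_0 ?cos_0 ?sin_0; ring.
have t1 := Cnorm_tri (RtoC (exp a - 1 - a)) (RtoC (exp a - 1) * (Ci * RtoC b))%C.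
apply: Rle_trans (Cnorm_tri _ _) _.
move: t1; rewrite !Cnorm_mul !Cnorm_RtoC Cnorm_Ci Rmult_1_l => t1.
have t2 := Cnorm_le_sum (cos b - 1, sin b - b); move: t2; rewrite /Cre /Cim /= => t2.
have hA := Rabs_pos a; have hB := Rabs_pos b; have hw0 := Cnorm_ge0 w.
have e1 : Rabs (exp a - 1) <= 2 * Rabs a.
  have -> : exp a - 1 = (exp a - 1 - 1 * a) + a by ring.
  apply: Rle_trans (Rabs_triang _ _) _; nra.
have e2 : Rabs (exp a) <= 2.
  have -> : exp a = (exp a - 1) + 1 by ring.
  apply: Rle_trans (Rabs_triang _ _) _; rewrite Rabs_R1; lra.
have e3 : Rabs (exp a - 1 - a) <= eps * Rabs a.
  by apply: Rle_trans h1; apply: Req_le; congr Rabs; ring.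
have e4 : Rabs (cos b - 1) <= eps * Rabs b.
  by apply: Rle_trans h3; apply: Req_le; congr Rabs; ring.
have e5 : Rabs (sin b - b) <= eps * Rabs b.
  by apply: Rle_trans h2; apply: Req_le; congr Rabs; ring.
have e6 : Rabs (exp a) * Cnorm (cos b - 1, sin b - b) <= 2 * (2 * (eps * Rabs b)).
  by apply: Rmult_le_compat; try exact: Rabs_pos; try exact: Cnorm_ge0; lra.
have e7 : Rabs (exp a - 1) * Rabs b <= 2 * eps * Rabs b.
  by apply: Rmult_le_compat_r => //; lra.
nra.
Qed.

Lemma cdiff_cexp z : cdiff cexp z.
Proof.
apply: (@cdiff_ext (fun w => cexp z * cexp (w - z))%C).
  by move=> w; rewrite -cexp_add; congr cexp; ring.
apply: cdiff_mul; first exact: cdiff_const.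
apply: (@cdiff_comp (fun w => w - z)%C cexp).
  by apply: cdiff_sub; [exact: cdiff_id|exact: cdiff_const].
by exists C1; have -> : (z - z = C0)%C by [ring|]; exact: cexp_deriv0.
Qed.

Lemma cdiff_csum (I : Type) (r : seq I) (F : I -> cplx -> cplx) z :
  (forall i, cdiff (F i) z) -> cdiff (fun w => \big[Cadd/C0]_(i <- r) F i w) z.
Proof.
move=> h; elim: r => [|i r IH].
  by apply: (@cdiff_ext (fun _ => C0)) => [w|]; [rewrite big_nil|exact: cdiff_const].
apply: (@cdiff_ext (fun w => F i w + \big[Cadd/C0]_(j <- r) F j w)%C).
  by move=> w; rewrite big_cons.
exact: cdiff_add.
Qed.

(** The Poisson kernel of the upper half plane at height [h]. *)
Definition pk (h s : R) : R := h / (PI * (s * s + h * h)).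

Lemma pk_ge0 h s : 0 < h -> 0 <= pk h s.
Proof.
move=> hh; rewrite /pk; apply: Rlt_le; apply: Rdiv_lt_0_compat => //.
by apply: Rmult_lt_0_compat; [exact: PI_RGT_0|nra].
Qed.

(** * Subharmonicity of |f|^q on a half plane, at finitely many nodes *)

(* If [|f| <= exp (eps + h)] on a large piece of the real line, with [h] the real part of the rational
   function [cmaj], then the maximum principle for [f * exp (- cmaj) / (1 - i eta z)] propagates this
   bound to the upper half plane; the factor [1 / (1 - i eta z)] handles infinity. *)
Section Majorant.
Variables (f : cplx -> cplx) (A eta X eps kappa : R) (L : nat) (c t : nat -> R).

Definition hmaj (z : cplx) : R := \rsum_(l < L) (c l * pk (kappa + Cim z) (Cre z - t l)).

(** Each term has its only pole at depth [kappa] below the real axis, and its real part is a Poisson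
    kernel whose height is raised by [kappa]; the majorant is therefore holomorphic on the closed
    upper half plane. *)
Definition cmaj (z : cplx) : cplx :=
  \csum_(l < L) (RtoC (c l / PI) * Ci * / (z - (t l, - kappa)%R)).

Lemma Cre_cmaj z : Cre (cmaj z) = hmaj z.
Proof.
rewrite /cmaj /hmaj (@big_morph _ _ Cre 0 Rplus) //; apply: eq_bigr => l _.
have hPI := PI_RGT_0.
by rewrite /pk /Cinv /Cnorm2; cunfold; rewrite /Rdiv Rinv_mult /Rminus Ropp_involutive
  (Rplus_comm z.2); ring.
Qed.

Lemma cdiff_cmaj z : 0 < kappa -> 0 <= Cim z -> cdiff cmaj z.
Proof.
move=> hk hz; apply: cdiff_csum => l; apply: cdiff_mul; first exact: cdiff_const.
by apply: cdiff_inv_sub; apply: C0_neq_im; move: hz; cunfold; lra.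
Qed.

Hypotheses (hA : 0 <= A) (heta : 0 < eta) (hX : 0 < X) (hAX : A <= eta * X) (hk : 0 < kappa).
Hypothesis heps : 0 <= eps.
Hypothesis hc : forall l, (l < L)%N -> 0 <= c l.
Hypothesis hf : forall z, 0 <= Cim z -> cdiff f z.
Hypothesis hb : forall z, 0 <= Cim z -> Cnorm (f z) <= A.
Hypothesis hbd : forall x, Rabs x <= X -> Cnorm (f (x, 0)) <= exp (eps + hmaj (x, 0)).

Lemma half_plane_majorant delta : 0 < delta ->
  Cnorm (f (0, delta)) <= (1 + eta * delta) * exp (eps + hmaj (0, delta)).
Proof.
move=> hd.
pose D (z : cplx) := (C1 - RtoC eta * Ci * z)%C.
pose G (z : cplx) := (f z / D z * cexp (- cmaj z))%C.
have hDre z : 0 <= Cim z -> 1 <= Cre (D z).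
  by move=> hz; rewrite /D; move: hz; cunfold => hz; nra.
have hD0 z : 0 <= Cim z -> D z <> C0.
  by move=> hz e; have := hDre z hz; rewrite e /=; lra.
have hD1 z : 0 <= Cim z -> 1 <= Cnorm (D z).
  by move=> hz; apply: Rle_trans (Cre_le _); apply: Rle_trans (Rle_abs _); exact: hDre.
have hD2 z : 0 <= Cim z -> eta * Cnorm z <= Cnorm (D z).
  move=> hz; rewrite -(Rabs_pos_eq (eta * Cnorm z)); last first.
    by apply: Rmult_le_pos; [lra|exact: Cnorm_ge0].
  rewrite /Cnorm -sqrt_Rsqr_abs; apply: sqrt_le_1_alt.
  rewrite /Rsqr; have e := Cnorm_sqr z; rewrite /Cnorm in e.
  have -> : eta * sqrt (Cnorm2 z) * (eta * sqrt (Cnorm2 z)) =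
     eta * eta * (sqrt (Cnorm2 z) * sqrt (Cnorm2 z)) by ring.
  rewrite e /Cnorm2 /D; move: hz; cunfold; nra.
have hh0 z : 0 <= Cim z -> 0 <= hmaj z.
  move=> hz; apply: rsum_ge0 => l _; apply: Rmult_le_pos; first exact: hc.
  by apply: pk_ge0; lra.
have hG z : 0 <= Cim z -> cdiff G z.
  move=> hz; apply: cdiff_mul; first apply: cdiff_mul; first exact: hf.
    apply: (@cdiff_comp D Cinv); last by apply: cdiff_inv; exact: hD0.
    apply: cdiff_sub; first exact: cdiff_const.
    by apply: cdiff_mul; [exact: cdiff_const|exact: cdiff_id].
  apply: (@cdiff_comp (fun z => - cmaj z)%C cexp); last exact: cdiff_cexp.
  by apply: cdiff_opp; exact: cdiff_cmaj.
have hGn z : 0 <= Cim z -> Cnorm (G z) = Cnorm (f z) / Cnorm (D z) * exp (- hmaj z).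
  move=> hz; rewrite /G !Cnorm_mul Cnorm_inv ?Cnorm_cexp; last exact: hD0.
  by rewrite -Cre_cmaj.
(* The rectangle [-Y, Y] x [0, Y] contains the point (0, delta), and its three sides off the real
   axis lie outside the disc of radius [X], where A <= eta * X gives |f / D| <= 1. *)
set Y := X + delta + 1.
have hfar z : 0 <= Cim z -> X <= Cnorm z -> Cnorm (G z) <= exp eps.
  move=> hz hz2; rewrite hGn //.
  have h1 : Cnorm (f z) / Cnorm (D z) <= 1.
    have h2 := hD1 z hz; have h3 := hD2 z hz; have h4 := hb hz.
    apply/Rle_div_l; first lra.
    by rewrite Rmult_1_l; nra.
  have h5 : 0 <= Cnorm (f z) / Cnorm (D z).
    by apply: Rdiv_le_0_compat; [exact: Cnorm_ge0|have := hD1 z hz; lra].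
  have h6 : exp (- hmaj z) <= 1.
    by rewrite -exp_0; apply: exp_le_mono; have := hh0 z hz; lra.
  have h7 : 1 <= exp eps by rewrite -exp_0; exact: exp_le_mono.
  have := exp_pos (- hmaj z); nra.
have hmax : Cnorm (G (0, delta)) <= exp eps.
  apply: (@max_modulus_rect G (0, delta) (- Y) Y 0 Y); rewrite /Y /=; try lra.
  - exact: Rlt_le (exp_pos _).
  - by move=> z [_ hz]; apply: hG; lra.
  - move=> z [[h1 h2] h3].
    have hz : 0 <= Cim z by lra.
    have [h4|h4] := Rle_lt_dec X (Cnorm z); first exact: hfar.
    have h5 := Cre_le z; have h6 := Cim_le z.
    have h7 := Rle_abs (Cre z); have h8 := Rle_abs (- Cre z); rewrite Rabs_Ropp in h8.
    have h9 := Rle_abs (Cim z).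
    have e0 : Cim z = 0 by case: h3 => [|[|[]]]; lra.
    rewrite hGn //.
    have ez : z = (Cre z, 0) by rewrite -e0; case: (z).
    have h10 : Cnorm (f z) <= exp (eps + hmaj z) by rewrite ez; apply: hbd; lra.
    have h11 : Cnorm (f z) / Cnorm (D z) <= exp (eps + hmaj z).
      have h12 := hD1 z hz; apply/Rle_div_l; first lra.
      have := exp_pos (eps + hmaj z); nra.
    have -> : exp eps = exp (eps + hmaj z) * exp (- hmaj z) by rewrite -exp_plus; congr exp; ring.
    by apply: Rmult_le_compat_r => //; exact: Rlt_le (exp_pos _).
have hd0 : 0 <= Cim (0, delta) by rewrite /=; lra.
move: hmax; rewrite hGn //.
have -> : Cnorm (D (0, delta)) = 1 + eta * delta.
  have -> : D (0, delta) = RtoC (1 + eta * delta) by rewrite /D; cring.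
  by rewrite Cnorm_RtoC Rabs_pos_eq //; nra.
have hp : 0 < 1 + eta * delta by nra.
move=> h.
have he := exp_pos (- hmaj (0, delta)).
have e1 : exp eps * exp (hmaj (0, delta)) = exp (eps + hmaj (0, delta)) by rewrite exp_plus.
have e2 : exp (- hmaj (0, delta)) * exp (hmaj (0, delta)) = 1.
  by rewrite -exp_plus Rplus_opp_l exp_0.
have he2 := exp_pos (hmaj (0, delta)).
rewrite -e1.
have : Cnorm (f (0, delta)) / (1 + eta * delta) * exp (- hmaj (0, delta)) * exp (hmaj (0, delta))
  <= exp eps * exp (hmaj (0, delta)) by apply: Rmult_le_compat_r; lra.
rewrite Rmult_assoc e2 Rmult_1_r => /Rle_div_l h3.
have := h3 hp; lra.
Qed.

End Majorant.

Lemma ex_derive_continuity_pt (g : R -> R) x : ex_derive g x -> continuity_pt g x.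
Proof.
move=> h; apply/continuity_pt_filterlim.
exact: (@ex_derive_continuous R_AbsRing R_NormedModule g x h).
Qed.

(** * Poisson weights at equally spaced nodes *)

Section Nodes.
Variables (X kappa : R) (L : nat).
Hypotheses (hX : 0 < X) (hk : 0 < kappa) (hL : (0 < L)%N).

Definition mesh := 2 * (X + 1) / INR L.
(** The nodes overshoot [- X, X] by one unit, so that every [x] in this interval keeps distance at
    least 1 from both ends and loses little Poisson mass there. *)
Definition node (l : nat) := - (X + 1) + INR l * mesh.
(* Replacing the node [t] by a point at distance at most [mesh] changes a Poisson kernel of height at least
   [kappa] by at most this factor. *)
Definition dist_const := 1 + mesh / kappa + (mesh / kappa) * (mesh / kappa).
(** The Riemann weight of the Poisson kernel, divided by [dist_const] so that the total mass never
    exceeds one. Jensen's inequality and the integration of weighted sums of translates both rely on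
    this. *)
Definition pwt (x h : R) (l : nat) := mesh / dist_const * pk h (x - node l).

Lemma mesh_gt0 : 0 < mesh.
Proof. by apply: Rdiv_lt_0_compat; [lra|apply: lt_0_INR; apply/ltP]. Qed.

Lemma mesh_ratio_gt0 : 0 < mesh / kappa.
Proof. exact: Rdiv_lt_0_compat mesh_gt0 hk. Qed.

Lemma dist_const_ge1 : 1 <= dist_const.
Proof. by rewrite /dist_const; have := mesh_ratio_gt0; nra. Qed.

Lemma node_last : node L = X + 1.
Proof.
rewrite /node /mesh; have h : 0 < INR L by apply: lt_0_INR; apply/ltP.
by field; lra.
Qed.

Lemma node_bound l : (l <= L)%N -> Rabs (node l) <= X + 1.
Proof.
move=> hl; have hm := mesh_gt0.
have h1 : INR l <= INR L by apply: le_INR; apply/leP.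
have h0 := pos_INR l; have e := node_last.
apply: Rabs_le; move: e; rewrite /node; nra.
Qed.

Lemma pwt_ge0 x h l : 0 < h -> 0 <= pwt x h l.
Proof.
move=> hh; apply: Rmult_le_pos; last exact: pk_ge0.
by apply: Rlt_le; apply: Rdiv_lt_0_compat; [exact: mesh_gt0|have := dist_const_ge1; lra].
Qed.

Lemma dist_ratio h s s' : kappa <= h -> Rabs (s - s') <= mesh ->
  s * s + h * h <= dist_const * (s' * s' + h * h).
Proof.
move=> hh /Rabs_le_between hs; have hm := mesh_gt0.
have hr := mesh_ratio_gt0; set r := mesh / kappa in hr *.
have em : mesh = r * kappa by rewrite /r; field; lra.
rewrite /dist_const -/r em in hs *.
have h1 : s * s <= s' * s' + 2 * Rabs s' * (r * kappa) + (r * kappa) * (r * kappa).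
  have h2 := Rabs_pos s'.
  have h3 : Rabs s' * Rabs s' = s' * s' by rewrite -Rabs_mult Rabs_pos_eq //; nra.
  have h4 := Rle_abs s'; have h5 := Rle_abs (- s'); rewrite Rabs_Ropp in h5.
  nra.
have h2 : 2 * Rabs s' * kappa <= s' * s' + kappa * kappa.
  have h3 : Rabs s' * Rabs s' = s' * s' by rewrite -Rabs_mult Rabs_pos_eq //; nra.
  have := Rle_0_sqr (Rabs s' - kappa); rewrite /Rsqr; nra.
have h3 : 2 * Rabs s' * (r * kappa) <= r * (s' * s' + kappa * kappa) by nra.
have h4 : kappa * kappa <= h * h by nra.
have h5 : r * (kappa * kappa) <= r * (h * h) by nra.
have h6 : r * r * (kappa * kappa) <= r * r * (h * h) by apply: Rmult_le_compat_l => //; nra.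
have h7 : 0 <= r * r * (s' * s') by nra.
nra.
Qed.

(** The exact Poisson mass of a cell is an increment of arctan, hence by the mean value theorem the
    mesh times the kernel at some point of the cell; these increments telescope, which gives the
    total mass without any integral. *)
Lemma cell_mass x h l : kappa <= h ->
  exists xi, Rabs (xi - (x - node l)) <= mesh /\
  atan ((node l.+1 - x) / h) - atan ((node l - x) / h) = mesh * PI * pk h xi.
Proof.
move=> hh; have hm := mesh_gt0; have hPI := PI_RGT_0.
have e : node l.+1 = node l + mesh by rewrite /node S_INR; ring.
have [xi h1] : exists xi, node l - x <= xi <= node l + mesh - x /\
  atan ((node l + mesh - x) / h) - atan ((node l - x) / h) = h / (xi * xi + h * h) * mesh.
  have [xi [hxi he]] := MVT_gen (fun s => atan (s / h)) (node l - x) (node l + mesh - x)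
    (fun s => h / (s * s + h * h))
    ltac:(move=> s _; auto_derive => //; field; nra)
    ltac:(move=> s _; apply: ex_derive_continuity_pt; by auto_derive).
  have hle : node l - x <= node l + mesh - x by lra.
  exists xi; move: hxi; rewrite Rmin_left // Rmax_right // => hxi; split; first lra.
  by rewrite he; ring.
case: h1 => h1 h2; exists (- xi); split; first by apply: Rabs_le; lra.
by rewrite e h2 /pk; field; split; nra.
Qed.

Lemma pk_ratio h s s' : kappa <= h -> Rabs (s - s') <= mesh -> pk h s' <= dist_const * pk h s.
Proof.
move=> hh hs; have h1 := dist_ratio hh hs; have hPI := PI_RGT_0.
have q1 := dist_const_ge1.
have p1 : 0 < s * s + h * h by nra.
have p2 : 0 < s' * s' + h * h by nra.
rewrite /pk /Rdiv !(Rinv_mult PI).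
have : / (s' * s' + h * h) <= dist_const * / (s * s + h * h).
  apply: (Rmult_le_reg_r ((s * s + h * h) * (s' * s' + h * h))); first nra.
  by field_simplify; lra.
have hp : 0 < h * / PI by apply: Rmult_lt_0_compat; [lra|exact: Rinv_0_lt_compat].
move/(Rmult_le_compat_l _ _ _ (Rlt_le _ _ hp)); lra.
Qed.

Definition Wtot x h := \rsum_(l < L) pwt x h l.

Lemma atan_sum x h : \rsum_(l < L) (atan ((node l.+1 - x) / h) - atan ((node l - x) / h)) =
  atan ((X + 1 - x) / h) + atan ((X + 1 + x) / h).
Proof.
rewrite (rsum_telescope (fun l => atan ((node l - x) / h))) node_last.
have -> : node 0 = - (X + 1) by rewrite /node /=; ring.
have -> : (- (X + 1) - x) / h = - ((X + 1 + x) / h) by rewrite /Rdiv; ring.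
by rewrite atan_opp; ring.
Qed.

Lemma Wtot_le1 x h : kappa <= h -> Wtot x h <= 1.
Proof.
move=> hh; have hPI := PI_RGT_0; have hm := mesh_gt0; have q1 := dist_const_ge1.
have h1 : Wtot x h <= / PI * (atan ((X + 1 - x) / h) + atan ((X + 1 + x) / h)).
  rewrite -atan_sum -rsum_scal; apply: rsum_le => l _.
  have [xi [h1 h2]] := cell_mass x l hh; rewrite h2 /pwt.
  have h3 := pk_ratio hh h1.
  have -> : / PI * (mesh * PI * pk h xi) = mesh / dist_const * (dist_const * pk h xi).
    by field; lra.
  apply: Rmult_le_compat_l => //; apply: Rlt_le; apply: Rdiv_lt_0_compat; lra.
have h2 := atan_bound ((X + 1 - x) / h); have h3 := atan_bound ((X + 1 + x) / h).
apply: Rle_trans h1 _; apply: (Rmult_le_reg_l PI) => //.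
rewrite -Rmult_assoc Rinv_r; lra.
Qed.

Lemma atan_ge V v h : 0 < h -> 0 < V <= v -> PI / 2 - h / V <= atan (v / h).
Proof.
move=> hh hv.
have -> : v / h = / (h / v) by field; lra.
rewrite atan_inv; last by apply: Rdiv_lt_0_compat; lra.
have h1 : atan (h / v) <= h / v.
  have hpos : 0 < h / v by apply: Rdiv_lt_0_compat; lra.
  have [xi [_ he]] := MVT_gen atan 0 (h / v) (fun s => / (1 + s * s))
    ltac:(move=> s _; auto_derive => //; field; nra)
    ltac:(move=> s _; apply: ex_derive_continuity_pt; by auto_derive).
  move: he; rewrite atan_0 !Rminus_0_r => ->.
  have : / (1 + xi * xi) <= / 1 by apply: Rinv_le_contravar; nra.
  rewrite Rinv_1; nra.
have : h / v <= h / V by apply: Rmult_le_compat_l; [lra|apply: Rinv_le_contravar; lra].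
lra.
Qed.

(** Two losses occur: the tails beyond the last nodes on both sides, together at most h / V since 2
    / pi < 1, and the factor dist_const^2, which costs at most 4 * mesh / kappa. *)
Lemma Wtot_ge x h V : kappa <= h -> 0 < V -> V <= X + 1 - x -> V <= X + 1 + x ->
  mesh / kappa <= 1 -> 1 - h / V - 4 * (mesh / kappa) <= Wtot x h.
Proof.
move=> hh hV hx1 hx2 hr1.
have hPI := PI_RGT_0; have hm := mesh_gt0; have q1 := dist_const_ge1.
have hr := mesh_ratio_gt0.
have h1 : / (PI * (dist_const * dist_const)) *
    (atan ((X + 1 - x) / h) + atan ((X + 1 + x) / h)) <= Wtot x h.
  rewrite -atan_sum -rsum_scal; apply: rsum_le => l _.
  have [xi [h1 h2]] := cell_mass x l hh; rewrite h2 /pwt.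
  have h1' : Rabs ((x - node l) - xi) <= mesh by rewrite Rabs_minus_sym.
  have h3 := pk_ratio hh h1'.
  have -> : / (PI * (dist_const * dist_const)) * (mesh * PI * pk h xi) =
    mesh / dist_const * (pk h xi / dist_const) by field; lra.
  apply: Rmult_le_compat_l; first by apply: Rlt_le; apply: Rdiv_lt_0_compat; lra.
  by apply/Rle_div_l; [lra|rewrite Rmult_comm].
apply: Rle_trans h1.
have h2 := @atan_ge V _ h ltac:(lra) (conj hV hx1).
have h3 := @atan_ge V _ h ltac:(lra) (conj hV hx2).
have hq : (1 - 4 * (mesh / kappa)) * (dist_const * dist_const) <= 1.
  rewrite /dist_const; move: (mesh / kappa) hr hr1 => r hr hr1.
  have : 1 + r + r * r <= 1 + 2 * r by nra.
  have : 1 <= 1 + r + r * r by nra.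
  move: (1 + r + r * r) => q h4 h5.
  have : q * q <= (1 + 2 * r) * (1 + 2 * r) by nra.
  have [h6|h6] := Rle_lt_dec (1 - 4 * r) 0; first by nra.
  move=> h7; apply: Rle_trans (_ : (1 - 4 * r) * ((1 + 2 * r) * (1 + 2 * r)) <= _).
    by apply: Rmult_le_compat_l; lra.
  nra.
have hhV : 0 < h / V by apply: Rdiv_lt_0_compat; lra.
have hPI2 := PI2_3_2.
have [h0|h0] := Rle_lt_dec (1 - h / V - 4 * (mesh / kappa)) 0.
  apply: Rle_trans h0 _; apply: Rmult_le_pos.
    by apply: Rlt_le; apply: Rinv_0_lt_compat; nra.
  have pos v : V <= v -> 0 < atan (v / h).
    by move=> hv; rewrite -atan_0; apply: atan_increasing; apply: Rdiv_lt_0_compat; lra.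
  have := pos _ hx1; have := pos _ hx2; lra.
apply: (Rmult_le_reg_l (PI * (dist_const * dist_const))); first nra.
rewrite -[X in _ <= X]Rmult_assoc Rinv_r; last nra.
rewrite Rmult_1_l.
apply: Rle_trans (_ : PI - 2 * (h / V) <= _); last lra.
set q2 := dist_const * dist_const in hq *.
have hq2 : 1 <= q2 by rewrite /q2; nra.
move: (mesh / kappa) (h / V) hr hr1 hq hhV h0 => r v hr hr1 hq hhV h0.
have : q2 * (1 - v - 4 * r) <= 1 - v by nra.
nra.
Qed.

(** Beyond distance [T] the kernel of height [h] is at most 2 * h / T times the kernel of height
    [T], whose weights again have total mass at most one. *)
Lemma pwt_tail h T : kappa <= h -> h < T ->
  \rsum_(l < L) (if Rle_dec (Rabs (node l)) T then 0 else pwt 0 h l) <= 2 * h / T.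
Proof.
move=> hh hT; have hPI := PI_RGT_0.
have h1 : \rsum_(l < L) (if Rle_dec (Rabs (node l)) T then 0 else pwt 0 h l) <=
  2 * \rsum_(l < L) (h / T * pwt 0 T l).
  rewrite -rsum_scal; apply: rsum_le => l _.
  case: Rle_dec => h1 /=.
    apply: Rmult_le_pos; first lra.
    apply: Rmult_le_pos; last by apply: pwt_ge0; lra.
    by apply: Rlt_le; apply: Rdiv_lt_0_compat; lra.
  have -> : 2 * (h / T * pwt 0 T l) = mesh / dist_const * (2 * (h / T * pk T (0 - node l))).
    by rewrite /pwt; ring.
  apply: Rmult_le_compat_l.
    by apply: Rlt_le; apply: Rdiv_lt_0_compat; [exact: mesh_gt0|have := dist_const_ge1; lra].
  have h2 : T * T < (0 - node l) * (0 - node l).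
    have h3 : T < Rabs (node l) by lra.
    have h4 : Rabs (node l) * Rabs (node l) = (0 - node l) * (0 - node l).
      by rewrite -Rabs_mult Rabs_pos_eq; [ring|nra].
    nra.
  move: ((0 - node l)) h2 => s h2; rewrite /pk.
  have p1 : 0 < s * s + h * h by nra.
  have p2 : 0 < s * s + T * T by nra.
  have -> : 2 * (h / T * (T / (PI * (s * s + T * T)))) = h / (PI * ((s * s + T * T) / 2)).
    by field; split; lra.
  apply: Rmult_le_compat_l; first lra.
  apply: Rinv_le_contravar; first by apply: Rmult_lt_0_compat; lra.
  by apply: Rmult_le_compat_l; [lra|nra].
apply: Rle_trans h1 _; rewrite rsum_scal.
have := @Wtot_le1 0 T ltac:(lra); rewrite /Wtot => h2.
have hp : 0 < h / T by apply: Rdiv_lt_0_compat; lra.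
have -> : 2 * h / T = 2 * (h / T * 1) by field; lra.
by apply: Rmult_le_compat_l; [lra|apply: Rmult_le_compat_l; [lra|exact: h2]].
Qed.

End Nodes.

(** The tangent line of exp at the mean [m] lies below exp. The missing mass is treated as sitting
    at the value 0, where exp is 1. *)
Lemma jensen_exp L (w v : nat -> R) : (forall l, (l < L)%N -> 0 <= w l) ->
  \rsum_(l < L) w l <= 1 ->
  exp (\rsum_(l < L) (w l * v l)) <= \rsum_(l < L) (w l * exp (v l)) + (1 - \rsum_(l < L) w l).
Proof.
move=> hw hW; set m := \rsum_(l < L) (w l * v l); set W := \rsum_(l < L) w l in hW *.
have tang x : exp m * (1 + x - m) <= exp x.
  have -> : exp x = exp m * exp (x - m) by rewrite -exp_plus; congr exp; ring.
  apply: Rmult_le_compat_l; first exact: Rlt_le (exp_pos _).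
  by have := exp_ineq1_le (x - m); lra.
have h1 : exp m * (W + m - m * W) <= \rsum_(l < L) (w l * exp (v l)).
  have -> : exp m * (W + m - m * W) =
     \rsum_(l < L) (exp m * (1 - m) * w l + exp m * (w l * v l)).
    by rewrite rsum_add !rsum_scal -/W -/m; ring.
  apply: rsum_le => l _; have := tang (v l); have := hw l (ltn_ord l) => h2 h3.
  have := Rmult_le_compat_l _ _ _ h2 h3; lra.
have h2 := tang 0; rewrite exp_0 in h2.
have : (1 - W) * (exp m * (1 + 0 - m)) <= (1 - W) * 1 by apply: Rmult_le_compat_l; lra.
lra.
Qed.

Lemma ln_Rmax1_lip a b : Rabs (ln (Rmax a 1) - ln (Rmax b 1)) <= Rabs (a - b).
Proof.
have key u v : 1 <= u -> u <= v -> ln v - ln u <= v - u.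
  move=> hu huv; have h : ln (v / u) = ln v - ln u by rewrite ln_div; lra.
  rewrite -h; have hvu : 0 < v / u by apply: Rdiv_lt_0_compat; lra.
  have h1 : ln (v / u) <= v / u - 1.
    have := exp_ineq1_le (ln (v / u)); rewrite exp_ln //; lra.
  apply: Rle_trans h1 _; have -> : v / u - 1 = (v - u) / u by field; lra.
  by apply/Rle_div_l; [lra|nra].
have mono u v : 1 <= u -> u <= v -> ln u <= ln v by move=> *; apply: ln_le; lra.
wlog h : a b / b <= a.
  move=> H; have [h|h] := Rle_lt_dec b a; first exact: H.
  by rewrite Rabs_minus_sym (Rabs_minus_sym a); apply: H; lra.
have h1 : Rmax b 1 <= Rmax a 1 by apply: Rle_max_compat_r.
have h2 := Rmax_r b 1; have h3 := key _ _ h2 h1; have h4 := mono _ _ h2 h1.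
rewrite !Rabs_pos_eq; try lra.
apply: Rle_trans h3 _; rewrite /Rmax; do 2 case: Rle_dec; lra.
Qed.

(** The sub-mean value property of |f|^q, with a discrete Poisson mean and an additive error [e].
    The order of quantifiers matters: [X] and [tau] depend only on the bounds, the modulus [rho] may
    depend on [tau], and [kappa] and [L] are chosen before [f], so one family of nodes serves all
    slices of a function of several variables. [sigma] lets the caller ask for a small [kappa] and a
    fine mesh. *)
Lemma jensen_nodes A q e D X0 : 0 < A -> 0 < q -> 0 < e -> 0 < D ->
  exists X tau, [/\ 0 < X, X0 <= X, 0 < tau & forall rho sigma, 0 < rho -> 0 < sigma ->
  exists kappa L, [/\ 0 < kappa, kappa <= sigma, (0 < L)%N, mesh X L / kappa <= sigma &
  forall f, (forall z, 0 <= Cim z -> cdiff f z) -> (forall z, 0 <= Cim z -> Cnorm (f z) <= A) ->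
  (forall x t, Rabs x <= X + 1 -> Rabs t <= X + 1 -> Rabs (x - t) <= rho ->
     Cnorm (f (x, 0) - f (t, 0))%C <= tau) ->
  forall delta, 0 < delta <= D ->
  rpow (Cnorm (f (0, delta))) q <=
    \rsum_(l < L) (pwt X kappa L 0 (kappa + delta) l * rpow (Cnorm (f (node X L l, 0))) q) + e]].
Proof.
move=> hA hq he hD.
set Aq := rpow A q; have hAq : 0 <= Aq by exact: rpow_ge0.
(* The parameters below are set so that exp (q * (eta * D + eps)) = 1 + zeta. This relative error
   costs at most e / 2, since the weighted mean is at most A^q. *)
set zeta := Rmin 1 (e / (2 * (Aq + 1))).
have hz : 0 < zeta by apply: Rmin_glb_lt; [lra|apply: Rdiv_lt_0_compat; lra].
have hz1 : zeta <= 1 by exact: Rmin_l.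
have hz2 : zeta * Aq <= e / 2.
  have h1 : zeta <= e / (2 * (Aq + 1)) by exact: Rmin_r.
  apply: Rle_trans (_ : e / (2 * (Aq + 1)) * Aq <= _); first exact: Rmult_le_compat_r.
  have -> : e / (2 * (Aq + 1)) * Aq = e / 2 * (Aq / (Aq + 1)) by field; lra.
  have : Aq / (Aq + 1) <= 1 by apply/Rle_div_l; lra.
  nra.
set g := ln (1 + zeta).
have hg : 0 < g by rewrite /g -ln_1; apply: ln_increasing; lra.
set eps := g / (2 * q); have heps : 0 < eps by apply: Rdiv_lt_0_compat; lra.
set eta := g / (2 * q * D); have heta : 0 < eta by apply: Rdiv_lt_0_compat; nra.
(* Zeros of [f] are avoided by working with the logarithm of max (|f| / lam, 1); the floor [lam]
   costs lam^q = e / 4 in the q-th power. *)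
have [lam [hlam elam]] := @rpow_small q (e / 4) hq ltac:(lra).
set U := A / lam + 1.
have hU : 1 < U by have : 0 < A / lam by [exact: Rdiv_lt_0_compat|]; rewrite /U; lra.
set X := Rmax (Rmax X0 1) (A / lam / eta).
have hX1 : 1 <= X by apply: Rle_trans (Rmax_r X0 1) (Rmax_l _ _).
have hX0 : X0 <= X by apply: Rle_trans (Rmax_l X0 1) (Rmax_l _ _).
have hX2 : A / lam <= eta * X.
  have h : A / lam / eta <= X by exact: Rmax_r.
  move/Rle_div_l: h => h; have := h heta; lra.
set tau := lam * (eps / 4).
have htau : 0 < tau by rewrite /tau; nra.
exists X, tau; split => //; first lra.
move=> rho sigma hrho hsigma.
(* Losses per unit of [kappa]: [U] for the Poisson mass lost at the ends, and the second term for
   the nodes farther than [rho], where the kernel is at most kappa / rho^2 while [u] is at most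
   [U]. *)
set B := U + U * (2 * (X + 1)) / (rho * rho).
have hB0 : 0 < U * (2 * (X + 1)) / (rho * rho) by apply: Rdiv_lt_0_compat; nra.
have hB : 0 < B by rewrite /B; lra.
set kappa := Rmin sigma (eps / (4 * B)).
have hk : 0 < kappa by apply: Rmin_glb_lt => //; apply: Rdiv_lt_0_compat; lra.
have hks : kappa <= sigma by exact: Rmin_l.
have hkB : B * kappa <= eps / 4.
  have h : kappa <= eps / (4 * B) by exact: Rmin_r.
  have -> : eps / 4 = B * (eps / (4 * B)) by field; lra.
  by apply: Rmult_le_compat_l; lra.
set r0 := Rmin (Rmin sigma 1) (eps / (16 * U)).
have hr0 : 0 < r0.
  by apply: Rmin_glb_lt; [apply: Rmin_glb_lt; lra|apply: Rdiv_lt_0_compat; lra].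
have hr1 : r0 <= sigma by apply: Rle_trans (Rmin_l _ _) (Rmin_l _ _).
have hr2 : r0 <= 1 by apply: Rle_trans (Rmin_l _ _) (Rmin_r _ _).
have hr3 : 4 * U * r0 <= eps / 4.
  have h : r0 <= eps / (16 * U) by exact: Rmin_r.
  have -> : eps / 4 = 4 * U * (eps / (16 * U)) by field; lra.
  by apply: Rmult_le_compat_l; lra.
have [L hL] := INR_unbounded (2 * (X + 1) / (kappa * r0)).
have hkr : 0 < kappa * r0 by nra.
have hL0 : 0 < INR L by apply: Rlt_trans hL; apply: Rdiv_lt_0_compat; lra.
have hLn : (0 < L)%N by apply/ltP; apply: INR_lt.
have hmesh : mesh X L / kappa <= r0.
  rewrite /mesh; apply/Rle_div_l => //; apply/Rle_div_l => //.
  move/Rgt_lt: hL => /Rlt_div_l h; have := h hkr; lra.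
have hX : 0 < X by lra.
have hm0 := mesh_gt0 hX hLn.
have q1 := dist_const_ge1 hX hk hLn.
exists kappa, L; split => //; first lra.
move=> f hf hb hmod delta hdelta.
pose u x := ln (Rmax (Cnorm (f (x, 0)) / lam) 1).
have hu0 x : 0 <= u x by rewrite /u -ln_1; apply: ln_le; [lra|exact: Rmax_r].
have huU x : u x <= U.
  have h1 : Rmax (Cnorm (f (x, 0)) / lam) 1 <= U.
    apply: Rmax_lub; last lra.
    have h2 := hb (x, 0) ltac:(rewrite /=; lra).
    have : Cnorm (f (x, 0)) / lam <= A / lam.
      by apply: Rmult_le_compat_r => //; apply: Rlt_le; exact: Rinv_0_lt_compat.
    rewrite /U; lra.
  have h3 := Rmax_r (Cnorm (f (x, 0)) / lam) 1.
  have := exp_ineq1_le (u x); rewrite /u exp_ln; lra.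
have humod x t : Rabs x <= X + 1 -> Rabs t <= X + 1 -> Rabs (x - t) <= rho -> u x <= u t + eps / 4.
  move=> h1 h2 h3; have h4 := hmod x t h1 h2 h3.
  have h5 := ln_Rmax1_lip (Cnorm (f (x, 0)) / lam) (Cnorm (f (t, 0)) / lam).
  have h6 := Rle_abs (u x - u t).
  have h7 : Rabs (Cnorm (f (x, 0)) / lam - Cnorm (f (t, 0)) / lam) <= eps / 4.
    have -> : Cnorm (f (x, 0)) / lam - Cnorm (f (t, 0)) / lam =
       (Cnorm (f (x, 0)) - Cnorm (f (t, 0))) / lam by field; lra.
    rewrite Rabs_div; last lra.
    rewrite (Rabs_pos_eq lam); last lra.
    apply/Rle_div_l => //; rewrite Rmult_comm -/tau; apply: Rabs_le; split.
    - by have := Cnorm_tri_rev (f (t, 0)) (f (x, 0)); rewrite Cnorm_sub_sym; lra.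
    - by have := Cnorm_tri_rev (f (x, 0)) (f (t, 0)); lra.
  by move: h5 h6; rewrite -/(u x) -/(u t); lra.
pose f' z := (RtoC (/ lam) * f z)%C.
have hil : 0 < / lam by exact: Rinv_0_lt_compat.
have hf'n z : Cnorm (f' z) = Cnorm (f z) / lam.
  by rewrite /f' Cnorm_mul Cnorm_RtoC Rabs_pos_eq; [rewrite Rmult_comm|lra].
pose c l := mesh X L / dist_const X kappa L * u (node X L l).
have hmajE z : hmaj kappa L c (node X L) z =
  \rsum_(l < L) (pwt X kappa L (Cre z) (kappa + Cim z) l * u (node X L l)).
  by apply: eq_bigr => l _; rewrite /c /pwt; ring.
have hnb l : (l < L)%N -> Rabs (node X L l) <= X + 1.
  by move=> hl; apply: node_bound => //; exact: ltnW.
have hbnd x : Rabs x <= X -> u x <= eps + hmaj kappa L c (node X L) (x, 0).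
  move=> hx; rewrite hmajE /Cre /Cim /= Rplus_0_r.
  set W := Wtot X kappa L x kappa.
  have hW1 : W <= 1 by apply: Wtot_le1 => //; lra.
  have hxx := Rle_abs x; have hxx2 := Rle_abs (- x); rewrite Rabs_Ropp in hxx2.
  have hW2 : 1 - kappa - 4 * r0 <= W.
    have := @Wtot_ge X kappa L hX hk hLn x kappa 1 ltac:(lra) ltac:(lra) ltac:(lra) ltac:(lra) ltac:(lra).
    rewrite -/W /Rdiv Rinv_1 -/(Rdiv _ _); lra.
  have hsum : (u x - eps / 4) * W - U * (2 * (X + 1)) / (rho * rho) * kappa <=
      \rsum_(l < L) (pwt X kappa L x kappa l * u (node X L l)).
    have -> : (u x - eps / 4) * W - U * (2 * (X + 1)) / (rho * rho) * kappa =
      \rsum_(l < L) ((u x - eps / 4) * pwt X kappa L x kappa l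
         + - (U * mesh X L * (kappa / (rho * rho)))).
      rewrite rsum_add rsum_scal rsum_ord_const -/(Wtot X kappa L x kappa) -/W /mesh.
      by field; split; lra.
    apply: rsum_le => l _.
    have hp : 0 <= pwt X kappa L x kappa l by exact: pwt_ge0.
    have hC : 0 <= U * mesh X L * (kappa / (rho * rho)).
      apply: Rmult_le_pos; first by apply: Rmult_le_pos; lra.
      by apply: Rlt_le; apply: Rdiv_lt_0_compat => //; nra.
    have [hc|hc] := Rle_lt_dec (Rabs (x - node X L l)) rho.
      have := humod x (node X L l) ltac:(lra) (hnb l (ltn_ord l)) hc => h.
      have : (u x - eps / 4) * pwt X kappa L x kappa l <= u (node X L l) * pwt X kappa L x kappa l.
        by apply: Rmult_le_compat_r; lra.
      lra.
    have hpk : pwt X kappa L x kappa l <= mesh X L * (kappa / (rho * rho)).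
      rewrite /pwt; apply: Rmult_le_compat.
      - by apply: Rlt_le; apply: Rdiv_lt_0_compat; lra.
      - exact: pk_ge0.
      - by apply/Rle_div_l; [lra|nra].
      - rewrite /pk; apply: Rmult_le_compat_l; first lra.
        apply: Rinv_le_contravar; first nra.
        have hs : rho * rho <= (x - node X L l) * (x - node X L l).
          have -> : (x - node X L l) * (x - node X L l) =
             Rabs (x - node X L l) * Rabs (x - node X L l).
            rewrite -Rabs_mult Rabs_pos_eq //. exact: Rle_0_sqr.
          nra.
        have hPI := PI2_3_2; nra.
    have h1 : (u x - eps / 4) * pwt X kappa L x kappa l <= U * (mesh X L * (kappa / (rho * rho))).
      apply: Rle_trans (_ : U * pwt X kappa L x kappa l <= _).
        by apply: Rmult_le_compat_r => //; have := huU x; lra.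
      by apply: Rmult_le_compat_l; lra.
    have h2 := Rmult_le_pos _ _ hp (hu0 (node X L l)).
    lra.
  have hux := hu0 x; have huxU := huU x.
  have h1 : u x - eps / 4 - U * (kappa + 4 * r0) <= (u x - eps / 4) * W.
    have [h|h] := Rle_lt_dec (u x - eps / 4) 0.
      have : u x - eps / 4 <= (u x - eps / 4) * W by nra.
      have : 0 <= U * (kappa + 4 * r0) by nra.
      lra.
    have : (u x - eps / 4) * (1 - W) <= U * (kappa + 4 * r0) by apply: Rmult_le_compat; lra.
    lra.
  have h2 : B * kappa = U * kappa + U * (2 * (X + 1)) / (rho * rho) * kappa by rewrite /B; ring.
  move: hsum h1 h2; move: (U * (2 * (X + 1)) / (rho * rho) * kappa) ((u x - eps / 4) * W) => Q1 Q2.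
  move: (\big[Rplus/0]_(l < L) _) => Q3 hsum h1 h2; lra.
have hmajor : Cnorm (f' (0, delta)) <=
    (1 + eta * delta) * exp (eps + hmaj kappa L c (node X L) (0, delta)).
  have hAl : 0 <= A / lam by apply: Rlt_le; exact: Rdiv_lt_0_compat.
  apply: (@half_plane_majorant f' (A / lam) eta X) => //; try lra.
  - move=> l hl; rewrite /c; apply: Rmult_le_pos; last exact: hu0.
    by apply: Rlt_le; apply: Rdiv_lt_0_compat; lra.
  - by move=> z hz'; apply: cdiff_mul; [exact: cdiff_const|exact: hf].
  - by move=> z hz'; rewrite hf'n; apply: Rmult_le_compat_r; [lra|exact: hb].
  - move=> x hx; rewrite hf'n.
    have h3 := Rmax_r (Cnorm (f (x, 0)) / lam) 1.
    apply: Rle_trans (_ : exp (u x) <= _); last by apply: exp_le_mono; exact: hbnd.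
    by rewrite /u exp_ln; [exact: Rmax_l|lra].
set h := hmaj kappa L c (node X L) (0, delta) in hmajor.
pose w l := pwt X kappa L 0 (kappa + delta) l.
have hw l : (l < L)%N -> 0 <= w l by move=> _; apply: pwt_ge0 => //; lra.
have hW : \rsum_(l < L) w l <= 1.
  by apply: (@Wtot_le1 X kappa L hX hk hLn 0 (kappa + delta)); lra.
have hh : h = \rsum_(l < L) (w l * u (node X L l)) by rewrite /h hmajE.
set S := \rsum_(l < L) (pwt X kappa L 0 (kappa + delta) l * rpow (Cnorm (f (node X L l, 0))) q).
have hS0 : 0 <= S.
  by apply: rsum_ge0 => l _; apply: Rmult_le_pos; [exact: hw|exact: rpow_ge0].
have hSA : S <= Aq.
  apply: Rle_trans (_ : \rsum_(l < L) (Aq * w l) <= _).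
    apply: rsum_le => l _; rewrite Rmult_comm; apply: Rmult_le_compat_r; first exact: hw.
    by apply: rpow_le; [lra|apply: hb; rewrite /=; lra].
  by rewrite rsum_scal -[X in _ <= X]Rmult_1_r; exact: Rmult_le_compat_l.
(* Jensen with the values q * u, together with (e / 4) * exp (q * u) = max (|f|, lam)^q <= |f|^q + e
   / 4 at each node. *)
have hexp : (e / 4) * exp (q * h) <= S + e / 4.
  have -> : q * h = \rsum_(l < L) (w l * (q * u (node X L l))).
    by rewrite hh -rsum_scal; apply: eq_bigr => l _; ring.
  have h1 := @jensen_exp L w (fun l => q * u (node X L l)) hw hW.
  have h2 : (e / 4) * (\rsum_(l < L) (w l * exp (q * u (node X L l)))) <=
      S + (e / 4) * (\rsum_(l < L) w l).
    rewrite -!rsum_scal /S -rsum_add; apply: rsum_le => l _.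
    have hl := hw l (ltn_ord l).
    suff h3 : e / 4 * exp (q * u (node X L l)) <= rpow (Cnorm (f (node X L l, 0))) q + e / 4.
      by have := Rmult_le_compat_l _ _ _ hl h3; rewrite -/(w l); lra.
    set a := Cnorm (f (node X L l, 0)); have ha : 0 <= a by exact: Cnorm_ge0.
    have hmx := Rmax_r (a / lam) 1.
    rewrite /u -/a -rpow_pos; last lra.
    have h4 : rpow (Rmax (a / lam) 1) q <= rpow (a / lam) q + 1.
      have h5 := rpow_ge0 (a / lam) q.
      by rewrite /Rmax; case: Rle_dec => _; rewrite ?rpow_one; lra.
    have h5 : e / 4 * rpow (a / lam) q = rpow a q.
      rewrite -elam -rpow_mul; try lra.
        by congr rpow; field; lra.
      by apply: Rmult_le_pos; lra.
    have he4 : 0 < e / 4 by lra.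
    have := Rmult_le_compat_l _ _ _ (Rlt_le _ _ he4) h4; lra.
  have he4 : 0 <= e / 4 by lra.
  have := Rmult_le_compat_l _ _ _ he4 h1; lra.
have hfin : rpow (Cnorm (f (0, delta))) q <= (1 + zeta) * (e / 4 * exp (q * h)).
  have -> : Cnorm (f (0, delta)) = lam * Cnorm (f' (0, delta)) by rewrite hf'n; field; lra.
  rewrite rpow_mul ?elam; [|lra|exact: Cnorm_ge0].
  suff : rpow (Cnorm (f' (0, delta))) q <= (1 + zeta) * exp (q * h) by nra.
  have hle : Cnorm (f' (0, delta)) <= exp (eta * D + eps + h).
    apply: Rle_trans hmajor _; rewrite (Rplus_assoc (eta * D)) (exp_plus (eta * D)).
    apply: Rmult_le_compat_r; first exact: Rlt_le (exp_pos _).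
    by have := exp_ineq1_le (eta * D); nra.
  apply: Rle_trans (rpow_le (Rlt_le _ _ hq) hle) _.
  rewrite rpow_exp; apply: Req_le.
  have -> : q * (eta * D + eps + h) = g + q * h by rewrite /eta /eps; field; lra.
  by rewrite exp_plus /g exp_ln //; lra.
nra.
Qed.

(** * Quantitative subharmonicity of |f|^p *)

(* Weighted means of [plK |a| |f| |(a + f) / 2|] over the nodes are controlled by the defect
   [sum w |f|^p - |a|^p] through Jensen's inequality with exponent [q] for [f^m (a + f) / 2], while [plK]
   controls [|f - a|^p]. This replaces uniform convexity and works for every [p > 0]. *)
Section PLConvexity.
Variables (p q c : R) (m : nat).
Hypothesis hp : 0 < p.
Hypothesis hm : (0 < m)%N.
Hypothesis hmp : / (2 * INR m) <= p / 4.
Hypothesis hq : q = p / (4 * (INR m + 1)).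
Hypothesis hc : 1 + c = 4 * (INR m + 1) / (INR m + 1 / 2).

Let hM : 1 <= INR m. Proof. by apply: (le_INR 1); apply/leP. Qed.

Lemma pl_q_gt0 : 0 < q.
Proof. by rewrite hq; apply: Rdiv_lt_0_compat; have := hM; lra. Qed.

Lemma pl_c_gt0 : 0 < c.
Proof.
have h : 1 < 1 + c; last lra.
by rewrite hc; apply/Rlt_div_r; have := hM; lra.
Qed.

(** Homogeneous of degree [p] in (a, f, s), because (m + 1) * q = p / 4; the last two factors are
    the q-th power of |f^m (a + f) / 2|. The value of [c] makes the derivative in [f] vanish at f =
    a when s = (a + f) / 2, a point where [plK] itself is 0. *)
Definition plK (a f s : R) : R :=
  rpow f p + c * rpow a p - (1 + c) * (rpow a (3 * p / 4) * (rpow f (INR m * q) * rpow s q)).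

(* [plk r] is [plK 1 r s] at the largest possible value [s = (1 + r) / 2]. *)
Definition plk (r : R) : R :=
  exp (p * ln r) + c - (1 + c) * exp (INR m * q * ln r + q * ln ((1 + r) / 2)).

Definition plk' (r : R) : R :=
  p / r * exp (p * ln r)
  - (1 + c) * ((INR m * q / r + q / (1 + r)) * exp (INR m * q * ln r + q * ln ((1 + r) / 2))).

Lemma plk_derive r : 0 < r -> derivable_pt_lim plk r (plk' r).
Proof.
move=> hr; apply/is_derive_Reals; rewrite /plk /plk'.
auto_derive; first by repeat split; lra.
by rewrite /Rdiv; field; lra.
Qed.

Lemma plk1 : plk 1 = 0.
Proof.
rewrite /plk ln_1; have -> : (1 + 1) / 2 = 1 by field.
by rewrite ln_1 !Rmult_0_r Rplus_0_r exp_0; ring.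
Qed.

Lemma plk'_factor r : 0 < r -> plk' r = p / r * (exp (p * ln r) -
  (INR m + r / (1 + r)) / (INR m + 1 / 2) * exp (INR m * q * ln r + q * ln ((1 + r) / 2))).
Proof.
move=> hr; have h1 := hM; rewrite /plk' hc hq.
move: (exp (p * ln r)) (exp _) => E1 E2.
by field; repeat split; lra.
Qed.

(** In the factored form both factors of the subtracted product are at most r^(p / 4), the rational
    one by 1 + x <= exp x and the smallness of 1 / m; so the product is at most r^(p / 2), which is
    below r^p. For r < 1, [plk'_lt0] reverses each comparison. *)
Lemma plk'_gt0 r : 1 < r -> 0 < plk' r.
Proof.
move=> hr; have h1 := hM; have hq0 := pl_q_gt0.
have hl : 0 < ln r by rewrite -ln_1; apply: ln_increasing; lra.
rewrite plk'_factor; last lra.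
apply: Rmult_lt_0_compat; first by apply: Rdiv_lt_0_compat; lra.
have e2 : exp (INR m * q * ln r + q * ln ((1 + r) / 2)) <= exp (p / 4 * ln r).
  apply: exp_le_mono; have h2 : ln ((1 + r) / 2) <= ln r by apply: ln_le; lra.
  have -> : p / 4 * ln r = INR m * q * ln r + q * ln r by rewrite hq; field; lra.
  by nra.
have e3 : (INR m + r / (1 + r)) / (INR m + 1 / 2) <= exp (p / 4 * ln r).
  apply: Rle_trans (_ : 1 + p / 4 * ln r <= _); last exact: exp_ineq1_le.
  have h2 : 1 - / r <= ln r.
    have := exp_ineq1_le (ln (/ r)); rewrite ln_Rinv ?exp_Ropp ?exp_ln; lra.
  have h3 : r / (1 + r) - 1 / 2 <= (1 - / r) / 2.
    have -> : r / (1 + r) - 1 / 2 = (r - 1) / (2 * (1 + r)) by field; lra.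
    have -> : (1 - / r) / 2 = (r - 1) / (2 * r) by field; lra.
    by apply: Rmult_le_compat_l; [lra|apply: Rinv_le_contravar; lra].
  have h4 : (INR m + r / (1 + r)) / (INR m + 1 / 2) = 1 + (r / (1 + r) - 1 / 2) * / (INR m + 1 / 2).
    by field; lra.
  have h5 : / (INR m + 1 / 2) <= / INR m by apply: Rinv_le_contravar; lra.
  have h6 : 0 < / (INR m + 1 / 2) by apply: Rinv_0_lt_compat; lra.
  have h7 : / INR m <= p / 2 by move: hmp; rewrite Rinv_mult; lra.
  rewrite h4.
  have h8 : (r / (1 + r) - 1 / 2) * / (INR m + 1 / 2) <= (ln r / 2) * (p / 2).
    apply: Rle_trans (_ : ln r / 2 * / (INR m + 1 / 2) <= _).
      by apply: Rmult_le_compat_r; lra.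
    by apply: Rmult_le_compat_l; lra.
  lra.
have e4 : (INR m + r / (1 + r)) / (INR m + 1 / 2) * exp (INR m * q * ln r + q * ln ((1 + r) / 2))
  <= exp (p / 4 * ln r) * exp (p / 4 * ln r).
  apply: Rmult_le_compat => //; last exact: Rlt_le (exp_pos _).
  have : 0 < r / (1 + r) by apply: Rdiv_lt_0_compat; lra.
  by move=> h; apply: Rlt_le; apply: Rdiv_lt_0_compat; lra.
have e5 : exp (p / 4 * ln r) * exp (p / 4 * ln r) < exp (p * ln r).
  by rewrite -exp_plus; apply: exp_increasing; nra.
lra.
Qed.

Lemma plk'_lt0 r : 0 < r < 1 -> plk' r < 0.
Proof.
move=> hr; have h1 := hM; have hq0 := pl_q_gt0.
have hl : ln r < 0 by rewrite -ln_1; apply: ln_increasing; lra.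
rewrite plk'_factor; last lra.
suff : 0 < p / r * ((INR m + r / (1 + r)) / (INR m + 1 / 2) *
   exp (INR m * q * ln r + q * ln ((1 + r) / 2)) - exp (p * ln r)) by lra.
apply: Rmult_lt_0_compat; first by apply: Rdiv_lt_0_compat; lra.
have e2 : exp (p / 4 * ln r) <= exp (INR m * q * ln r + q * ln ((1 + r) / 2)).
  apply: exp_le_mono; have h2 : ln r <= ln ((1 + r) / 2) by apply: ln_le; lra.
  have -> : p / 4 * ln r = INR m * q * ln r + q * ln r by rewrite hq; field; lra.
  by nra.
have e3 : exp (p / 4 * ln r) <= (INR m + r / (1 + r)) / (INR m + 1 / 2).
  have h2 : 1 - r <= - ln r.
    have := exp_ineq1_le (ln r); rewrite exp_ln; lra.
  have hpos : 0 < r / (1 + r) by apply: Rdiv_lt_0_compat; lra.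
  have h0 : 0 < (INR m + r / (1 + r)) / (INR m + 1 / 2) by apply: Rdiv_lt_0_compat; lra.
  have h3 : / ((INR m + r / (1 + r)) / (INR m + 1 / 2)) <= exp (- (p / 4 * ln r)).
    apply: Rle_trans (_ : 1 + - (p / 4 * ln r) <= _); last exact: exp_ineq1_le.
    have -> : / ((INR m + r / (1 + r)) / (INR m + 1 / 2)) =
       1 + (1 / 2 - r / (1 + r)) * / (INR m + r / (1 + r)) by field; repeat split; nra.
    have h4 : 1 / 2 - r / (1 + r) <= (1 - r) / 2.
      have -> : 1 / 2 - r / (1 + r) = (1 - r) / (2 * (1 + r)) by field; lra.
      by apply: Rmult_le_compat_l; [lra|apply: Rinv_le_contravar; lra].
    have h5 : / (INR m + r / (1 + r)) <= / INR m by apply: Rinv_le_contravar; lra.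
    have h6 : 0 < / (INR m + r / (1 + r)) by apply: Rinv_0_lt_compat; lra.
    have h7 : / INR m <= p / 2 by move: hmp; rewrite Rinv_mult; lra.
    have h8 : (1 / 2 - r / (1 + r)) * / (INR m + r / (1 + r)) <= (- ln r / 2) * (p / 2).
      apply: Rle_trans (_ : - ln r / 2 * / (INR m + r / (1 + r)) <= _).
        by apply: Rmult_le_compat_r; lra.
      by apply: Rmult_le_compat_l; lra.
    lra.
  rewrite exp_Ropp in h3.
  have h4 := exp_pos (p / 4 * ln r).
  by rewrite -(Rinv_inv (exp _)) -(Rinv_inv ((INR m + _) / _)); apply: Rinv_le_contravar => //;
    exact: Rinv_0_lt_compat.
have e4 : exp (p / 4 * ln r) * exp (p / 4 * ln r) <=
  (INR m + r / (1 + r)) / (INR m + 1 / 2) * exp (INR m * q * ln r + q * ln ((1 + r) / 2)).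
  by apply: Rmult_le_compat => //; exact: Rlt_le (exp_pos _).
have e5 : exp (p * ln r) < exp (p / 4 * ln r) * exp (p / 4 * ln r).
  by rewrite -exp_plus; apply: exp_increasing; nra.
lra.
Qed.

Lemma plk_incr r s : 1 <= r -> r < s -> plk r < plk s.
Proof.
move=> hr hrs.
have [xi [h1 h2]] := MVT_cor2 plk plk' r s hrs (fun x hx => plk_derive (r := x) ltac:(lra)).
by have := @plk'_gt0 xi ltac:(lra); nra.
Qed.

Lemma plk_decr r s : 0 < r -> r < s -> s <= 1 -> plk s < plk r.
Proof.
move=> hr hrs hs.
have [xi [h1 h2]] := MVT_cor2 plk plk' r s hrs (fun x hx => plk_derive (r := x) ltac:(lra)).
by have := @plk'_lt0 xi ltac:(lra); nra.
Qed.

Lemma plk_ge0 r : 0 < r -> 0 <= plk r.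
Proof.
move=> hr; have [h|[->|h]] : r < 1 \/ r = 1 \/ 1 < r by lra.
- by have := plk_decr hr h (Rle_refl 1); rewrite plk1; lra.
- by rewrite plk1; lra.
- by have := plk_incr (Rle_refl 1) h; rewrite plk1; lra.
Qed.

Lemma plK_ge_plk r s : 0 < r -> 0 <= s <= (1 + r) / 2 -> plk r <= plK 1 r s.
Proof.
move=> hr hs; rewrite /plK /plk !rpow_one Rmult_1_l Rmult_1_r (rpow_pos p hr).
have hc0 := pl_c_gt0; have hq0 := pl_q_gt0.
have h1 : rpow r (INR m * q) * rpow s q <= exp (INR m * q * ln r + q * ln ((1 + r) / 2)).
  rewrite exp_plus -!rpow_pos //; last lra.
  apply: Rmult_le_compat_l; first exact: rpow_ge0.
  by apply: rpow_le; lra.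
have : (1 + c) * (rpow r (INR m * q) * rpow s q) <=
  (1 + c) * exp (INR m * q * ln r + q * ln ((1 + r) / 2)) by apply: Rmult_le_compat_l; lra.
lra.
Qed.

Lemma plK_zero s : plK 1 0 s = c.
Proof. by rewrite /plK !rpow0 !rpow_one; ring. Qed.

Lemma plK_ge0 r s : 0 <= r -> 0 <= s <= (1 + r) / 2 -> 0 <= plK 1 r s.
Proof.
move=> [hr|<-] hs; last by rewrite plK_zero; have := pl_c_gt0; lra.
by apply: Rle_trans (plk_ge0 hr) (plK_ge_plk hr hs).
Qed.

(** If [r] is away from 1, monotonicity of [plk] on either side of 1 suffices. If [r] is near 1
    while the distance [d] is at least [s], the parallelogram identity in the last premise pushes
    the midpoint norm [sg] strictly below (1 + r) / 2, and the gain comes from the factor rpow sg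
    q. *)
Lemma plK_lower s : 0 < s <= 1 -> exists k, 0 < k /\ forall r d sg,
  0 <= r -> 0 <= sg <= (1 + r) / 2 -> s <= d -> sg * sg = (1 + r * r) / 2 - d * d / 4 ->
  k <= plK 1 r sg.
Proof.
move=> hs; have hc0 := pl_c_gt0; have hq0 := pl_q_gt0.
set k1 := plk (1 + s / 2); set k2 := plk (1 - s / 2).
have hk1 : 0 < k1 by have := @plk_incr 1 (1 + s / 2) ltac:(lra) ltac:(lra); rewrite plk1.
have hk2 : 0 < k2.
  by have := @plk_decr (1 - s / 2) 1 ltac:(lra) ltac:(lra) ltac:(lra); rewrite plk1.
(* With x = (1 + r) / 2, from d >= s and |r - 1| < s / 2 one gets x^2 - sg^2 >= s^2 / 4 - s^2 / 16 =
   3 * s^2 / 16, while x + sg <= 5 / 2. *)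
set eta := 3 * (s * s) / 40.
have heta : 0 < eta < 1 / 2 by rewrite /eta; nra.
set th := rpow (1 - 4 * eta / 5) q.
have hth : th < 1.
  rewrite /th rpow_pos; last lra.
  rewrite -[X in _ < X]exp_0; apply: exp_increasing.
  have h : ln (1 - 4 * eta / 5) < 0.
    by rewrite -[X in _ < X]ln_1; apply: ln_increasing; lra.
  by rewrite -[X in _ < X](Rmult_0_r q); exact: Rmult_lt_compat_l.
have hth0 : 0 <= th by exact: rpow_ge0.
set k3 := (1 + c) * (rpow (1 / 2) (INR m * q) * (rpow (3 / 4) q * (1 - th))).
have hk3 : 0 < k3.
  rewrite /k3; apply: Rmult_lt_0_compat; first lra.
  apply: Rmult_lt_0_compat; first by apply: rpow_gt0; lra.
  by apply: Rmult_lt_0_compat; [apply: rpow_gt0|]; lra.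
exists (Rmin (Rmin c k1) (Rmin k2 k3)); split; first by repeat apply: Rmin_glb_lt.
move=> r d sg hr hsg hd hsq.
have b1 := Rmin_l (Rmin c k1) (Rmin k2 k3); have b2 := Rmin_r (Rmin c k1) (Rmin k2 k3).
have b3 := Rmin_l c k1; have b4 := Rmin_r c k1; have b5 := Rmin_l k2 k3; have b6 := Rmin_r k2 k3.
case: hr => [hr|hr]; last by rewrite -hr plK_zero; lra.
have hK := plK_ge_plk hr hsg.
have [h1|h1] := Rle_lt_dec (1 + s / 2) r.
  have : k1 <= plk r by case: h1 => [h1|<-]; [have := @plk_incr (1 + s / 2) r ltac:(lra) h1; rewrite /k1|rewrite /k1]; lra.
  lra.
have [h2|h2] := Rle_lt_dec r (1 - s / 2).
  have : k2 <= plk r by case: h2 => [h2|->]; [have := @plk_decr r (1 - s / 2) hr h2 ltac:(lra); rewrite /k2|rewrite /k2]; lra.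
  lra.
suff : k3 <= plK 1 r sg by lra.
set x := (1 + r) / 2 in hsg *.
have hx : 3 / 4 <= x <= 5 / 4 by rewrite /x; lra.
have hsx : sg <= x * (1 - 4 * eta / 5).
  have h3 : sg * sg <= x * x - 3 * (s * s) / 16 by rewrite hsq /x; nra.
  have h4 : (x - sg) * (x + sg) >= 3 * (s * s) / 16 by lra.
  have h5 : eta <= x - sg.
    apply: Rnot_lt_le => h5; have : (x - sg) * (x + sg) < eta * (5 / 2) by nra.
    by rewrite /eta; lra.
  nra.
have h6 : rpow sg q <= rpow x q * th.
  by rewrite /th -rpow_mul; [apply: rpow_le|..]; lra.
have h7 := plk_ge0 hr.
have h8 : plK 1 r sg = plk r + (1 + c) * (rpow r (INR m * q) * (rpow x q - rpow sg q)).
  rewrite /plK /plk !rpow_one (rpow_pos p hr) exp_plus -/x -!rpow_pos //; last lra.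
  ring.
have h9 : k3 <= (1 + c) * (rpow r (INR m * q) * (rpow x q - rpow sg q)).
  rewrite /k3; apply: Rmult_le_compat_l; first lra.
  have h34 : rpow (3 / 4) q <= rpow x q by apply: rpow_le; lra.
  have h34' := rpow_ge0 (3 / 4) q.
  apply: Rmult_le_compat; try exact: rpow_ge0.
  - by apply: Rmult_le_pos; lra.
  - apply: rpow_le; last lra.
    by apply: Rmult_le_pos; lra.
  - apply: Rle_trans (_ : rpow x q * (1 - th) <= _); last lra.
    by apply: Rmult_le_compat_r; lra.
lra.
Qed.

(** The case |a| = 1. A small [d] is paid by [eps]; for large [r] the term r^p dominates and [plK]
    is at least r^p / 2; in between [plK_lower] gives a positive floor against the bounded quantity
    d^p. *)
Lemma plK_bound1 eps : 0 < eps -> exists C, 0 < C /\ forall r d sg,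
  0 <= r -> 0 <= sg <= (1 + r) / 2 -> 0 <= d <= 1 + r ->
  sg * sg = (1 + r * r) / 2 - d * d / 4 ->
  rpow d p <= eps * (1 + rpow r p) + C * plK 1 r sg.
Proof.
move=> heps; have hc0 := pl_c_gt0; have hq0 := pl_q_gt0.
have [s0 [hs0 es0]] := rpow_small hp heps.
set s := Rmin 1 s0.
have hs : 0 < s <= 1 by split; [apply: Rmin_glb_lt; lra|exact: Rmin_l].
have [k [hk hlow]] := plK_lower hs.
(* At this threshold r1^(3 p / 4) = 2 * (1 + c), so beyond it the negative term of [plK] is at most
   half of r^p. *)
set r1 := rpow (2 * (1 + c)) (4 / (3 * p)).
have er1 : rpow r1 (3 * p / 4) = 2 * (1 + c).
  rewrite /r1 rpow_rpow; have -> : 4 / (3 * p) * (3 * p / 4) = 1 by field; lra.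
  by rewrite rpow1 //; lra.
have hr1 : 1 <= r1.
  rewrite -(rpow_one (4 / (3 * p))); apply: rpow_le; last lra.
  by apply: Rlt_le; apply: Rdiv_lt_0_compat; lra.
set C := 2 * rpow 2 p + rpow (1 + r1) p / k.
have hC1 : 0 < rpow 2 p by apply: rpow_gt0; lra.
have hC2 : 0 < rpow (1 + r1) p / k by apply: Rdiv_lt_0_compat => //; apply: rpow_gt0; lra.
exists C; split; first by rewrite /C; lra.
move=> r d sg hr hsg hd hsq.
have hK := plK_ge0 hr hsg.
have hrp := rpow_ge0 r p.
have [h|h] := Rle_lt_dec d s.
  have : rpow d p <= eps.
    by rewrite -es0; apply: rpow_le; [lra|apply: Rle_trans h (Rmin_r _ _)].
  have : 0 <= C * plK 1 r sg by apply: Rmult_le_pos => //; rewrite /C; lra.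
  nra.
have he : 0 <= eps * (1 + rpow r p) by nra.
have [h2|h2] := Rle_lt_dec r1 r.
  have h3 : rpow r p / 2 <= plK 1 r sg.
    rewrite /plK !rpow_one Rmult_1_l.
    have h4 : rpow r (INR m * q) * rpow sg q <= rpow r (p / 4).
      have -> : p / 4 = INR m * q + q by rewrite hq; field; have := hM; lra.
      rewrite rpow_plus; apply: Rmult_le_compat_l; first exact: rpow_ge0.
      by apply: rpow_le; lra.
    have h5 : 2 * (1 + c) * rpow r (p / 4) <= rpow r p.
      have -> : rpow r p = rpow r (3 * p / 4) * rpow r (p / 4).
        by rewrite -rpow_plus; congr rpow; field.
      apply: Rmult_le_compat_r; first exact: rpow_ge0.
      by rewrite -er1; apply: rpow_le; lra.
    have : (1 + c) * (rpow r (INR m * q) * rpow sg q) <= (1 + c) * rpow r (p / 4).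
      by apply: Rmult_le_compat_l; lra.
    lra.
  have h4 : rpow d p <= rpow 2 p * rpow r p.
    by rewrite -rpow_mul; [apply: rpow_le|..]; lra.
  have : 2 * rpow 2 p * (rpow r p / 2) <= 2 * rpow 2 p * plK 1 r sg.
    by apply: Rmult_le_compat_l; lra.
  have : 0 <= rpow (1 + r1) p / k * plK 1 r sg by apply: Rmult_le_pos; lra.
  rewrite /C; lra.
have h3 := hlow r d sg hr hsg ltac:(lra) hsq.
have h4 : rpow d p <= rpow (1 + r1) p by apply: rpow_le; lra.
have h5 : rpow (1 + r1) p <= rpow (1 + r1) p / k * plK 1 r sg.
  have {1}-> : rpow (1 + r1) p = rpow (1 + r1) p / k * k by field; lra.
  by apply: Rmult_le_compat_l; lra.
have : 0 <= 2 * rpow 2 p * plK 1 r sg by apply: Rmult_le_pos; lra.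
rewrite /C; lra.
Qed.

Lemma plK_bound eps : 0 < eps -> exists C, 0 < C /\ forall a f : cplx,
  rpow (Cnorm (f - a)%C) p <= eps * (rpow (Cnorm a) p + rpow (Cnorm f) p)
   + C * plK (Cnorm a) (Cnorm f) (Cnorm (RtoC (/ 2) * (a + f))%C).
Proof.
move=> heps; have [C [hC hh]] := plK_bound1 heps.
(* For a = 0 one cannot normalise, but then [plK] is |f|^p and the constant 1 suffices; otherwise
   homogeneity reduces to |a| = 1. *)
exists (Rmax C 1); split; first by apply: Rlt_le_trans (Rmax_r C 1); lra.
move=> a f; have hq0 := pl_q_gt0.
have [->|ha] := excluded_middle_informative (a = C0).
  have -> : (f - C0 = f)%C by ring.
  rewrite /plK Cnorm0 !rpow0.
  have := rpow_ge0 (Cnorm f) p; have := Rmax_r C 1; nra.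
have hal := Cnorm_gt0 ha; set al := Cnorm a in hal *.
set r := Cnorm f / al; set d := Cnorm (f - a)%C / al.
set sg := Cnorm (RtoC (/ 2) * (a + f))%C / al.
have hia : 0 < / al by exact: Rinv_0_lt_compat.
have hr : 0 <= r by apply: Rmult_le_pos; [exact: Cnorm_ge0|lra].
have ef : Cnorm f = al * r by rewrite /r; field; lra.
have ed : Cnorm (f - a)%C = al * d by rewrite /d; field; lra.
have es : Cnorm (RtoC (/ 2) * (a + f))%C = al * sg by rewrite /sg; field; lra.
have hsg0 : 0 <= sg by apply: Rmult_le_pos; [exact: Cnorm_ge0|lra].
have hd0 : 0 <= d by apply: Rmult_le_pos; [exact: Cnorm_ge0|lra].
have hsg : 0 <= sg <= (1 + r) / 2.
  split => //.
  have : Cnorm (RtoC (/ 2) * (a + f))%C <= (al + Cnorm f) / 2.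
    rewrite Cnorm_mul Cnorm_RtoC Rabs_pos_eq; last lra.
    by have := Cnorm_tri a f; rewrite -/al; lra.
  rewrite es ef; nra.
have hd : 0 <= d <= 1 + r.
  split => //; have := Cnorm_tri_sub f a; rewrite -/al ed ef; nra.
have hsq : sg * sg = (1 + r * r) / 2 - d * d / 4.
  have : Cnorm (RtoC (/ 2) * (a + f))%C * Cnorm (RtoC (/ 2) * (a + f))%C =
    (al * al + Cnorm f * Cnorm f) / 2 - Cnorm (f - a)%C * Cnorm (f - a)%C / 4.
    by rewrite /al !Cnorm_sqr /Cnorm2; cunfold; field.
  rewrite es ef ed => h.
  apply: (Rmult_eq_reg_l (al * al)); last by apply: Rgt_not_eq; nra.
  lra.
clearbody r d sg.
have := hh r d sg hr hsg hd hsq.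
have hK := plK_ge0 hr hsg.
have eK : plK al (Cnorm f) (Cnorm (RtoC (/ 2) * (a + f))%C) = rpow al p * plK 1 r sg.
  rewrite /plK ef es !rpow_mul ?rpow_one; try lra.
  have -> : rpow al p = rpow al (3 * p / 4) * (rpow al (INR m * q) * rpow al q).
    rewrite -!rpow_plus; congr rpow; rewrite hq; field; have := hM; lra.
  ring.
rewrite eK ed ef !rpow_mul; try lra.
have hap : 0 < rpow al p by exact: rpow_gt0.
move=> h.
have h2 : rpow al p * rpow d p <= rpow al p * (eps * (1 + rpow r p) + C * plK 1 r sg).
  by apply: Rmult_le_compat_l; lra.
have h3 : rpow al p * (C * plK 1 r sg) <= rpow al p * (Rmax C 1 * plK 1 r sg).
  apply: Rmult_le_compat_l; first lra.
  by apply: Rmult_le_compat_r => //; exact: Rmax_l.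
lra.
Qed.

End PLConvexity.

Lemma pow_lip (z w : cplx) A k : 0 <= A -> Cnorm z <= A -> Cnorm w <= A ->
  Cnorm (z ^ k - w ^ k)%C <= INR k * (1 + A) ^ k * Cnorm (z - w)%C.
Proof.
move=> hA hz hw; elim: k => [|k IH].
  have -> : (z ^ 0 - w ^ 0 = C0)%C by rewrite /=; ring.
  by rewrite Cnorm0 /=; lra.
have -> : (z ^ k.+1 - w ^ k.+1 = z * (z ^ k - w ^ k) + (z - w) * w ^ k)%C by rewrite /=; ring.
apply: Rle_trans (Cnorm_tri _ _) _; rewrite !Cnorm_mul Cnorm_pow S_INR -tech_pow_Rmult.
have n0 := Cnorm_ge0 (z - w)%C; have nz := Cnorm_ge0 z; have nw := Cnorm_ge0 w.
have hp : Cnorm w ^ k <= (1 + A) ^ k by apply: pow_incr; lra.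
have hp0 : 0 <= (1 + A) ^ k by apply: pow_le; lra.
have hk := pos_INR k.
have hk0 := Cnorm_ge0 (z ^ k - w ^ k)%C.
have t1 : Cnorm z * Cnorm (z ^ k - w ^ k)%C <= (1 + A) * (INR k * (1 + A) ^ k * Cnorm (z - w)%C).
  by apply: Rmult_le_compat; lra.
have t2 : Cnorm (z - w)%C * Cnorm w ^ k <= Cnorm (z - w)%C * ((1 + A) * (1 + A) ^ k).
  by apply: Rmult_le_compat_l => //; nra.
lra.
Qed.

(** [jensen_nodes] is applied to g = f^m (a + f) / 2 with a = f (0, delta), so that |g|^q at (0,
    delta) is |a|^(p / 4). Multiplying by |a|^(3 p / 4) bounds the weighted mean of [plK] by the
    defect S - |a|^p up to a small error, and [plK_bound] concludes. [C] depends only on [p] and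
    [eps], so that the admissible defect can be chosen after it. *)
Lemma pl_nodes p eps : 0 < p -> 0 < eps -> exists C, 0 < C /\
  forall A e D X0, 0 < A -> 0 < e -> 0 < D ->
  exists X tau, [/\ 0 < X, X0 <= X, 0 < tau & forall rho sigma, 0 < rho -> 0 < sigma ->
  exists kappa L, [/\ 0 < kappa, kappa <= sigma, (0 < L)%N, mesh X L / kappa <= sigma &
  forall f, (forall z, 0 <= Cim z -> cdiff f z) -> (forall z, 0 <= Cim z -> Cnorm (f z) <= A) ->
  (forall x t, Rabs x <= X + 1 -> Rabs t <= X + 1 -> Rabs (x - t) <= rho ->
     Cnorm (f (x, 0) - f (t, 0))%C <= tau) ->
  forall delta, 0 < delta <= D ->
  let w l := pwt X kappa L 0 (kappa + delta) l in
  let S := \rsum_(l < L) (w l * rpow (Cnorm (f (node X L l, 0))) p) in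
  let a := f (0, delta) in
  \rsum_(l < L) (w l * rpow (Cnorm (f (node X L l, 0) - a)%C) p) <=
    eps * (rpow (Cnorm a) p + S) + C * (S - rpow (Cnorm a) p) + e]].
Proof.
move=> hp heps.
have [m hm2] := INR_unbounded (2 / p + 1).
have hM : 1 < INR m by have : 0 < 2 / p by [apply: Rdiv_lt_0_compat; lra|]; lra.
have hm : (0 < m)%N by apply/ltP; apply: INR_lt; rewrite /=; lra.
have hmp : / (2 * INR m) <= p / 4.
  have h : 2 / p < INR m by lra.
  move/Rlt_div_l: h => h; have {}h := h hp.
  apply: (Rmult_le_reg_l (4 * INR m)); first lra.
  have -> : 4 * INR m * / (2 * INR m) = 2 by field; lra.
  nra.
set q := p / (4 * (INR m + 1)).
have hq : 0 < q by apply: Rdiv_lt_0_compat; lra.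
set c := 4 * (INR m + 1) / (INR m + 1 / 2) - 1.
have hc : 1 + c = 4 * (INR m + 1) / (INR m + 1 / 2) by rewrite /c; ring.
have hc0 := pl_c_gt0 hm hc.
have [C [hC hK]] := plK_bound hp hm hmp (erefl q) hc heps.
exists C; split => // A e D X0 hA he hD.
set A3 := rpow A (3 * p / 4); have hA3 : 0 <= A3 by exact: rpow_ge0.
set e' := e / (C * ((1 + c) * (A3 + 1))).
have hCc : 0 < C * ((1 + c) * (A3 + 1)) by repeat apply: Rmult_lt_0_compat; lra.
have he' : 0 < e' by apply: Rdiv_lt_0_compat.
have hAm : 0 < A ^ m * A by apply: Rmult_lt_0_compat => //; exact: pow_lt.
have [X [tau [hX hX0 htau hrest]]] := @jensen_nodes (A ^ m * A) q e' D X0 hAm hq he' hD.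
(* A Lipschitz constant of v -> v^m (a + v) / 2 on the disc |v| <= A; it transfers the modulus of
   continuity of [f] to [g]. *)
set Lip := INR m * (1 + A) ^ m * A + A ^ m.
have hLip : 0 < Lip.
  have h1 : 0 < (1 + A) ^ m by apply: pow_lt; lra.
  have h2 : 0 < A ^ m by exact: pow_lt.
  have : 0 < INR m * (1 + A) ^ m * A by repeat apply: Rmult_lt_0_compat; lra.
  rewrite /Lip; lra.
exists X, (tau / Lip); split => //; first exact: Rdiv_lt_0_compat.
move=> rho sigma hrho hsigma.
have [kappa [L [hk hks hL hmesh hJ]]] := hrest rho sigma hrho hsigma.
exists kappa, L; split => // f hf hb hmod delta hdelta w S a.
pose g z := (f z ^ m * (RtoC (/ 2) * (a + f z)))%C.
have ha : Cnorm a <= A by apply: hb; rewrite /=; lra.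
have hhalf z : 0 <= Cim z -> Cnorm (RtoC (/ 2) * (a + f z))%C <= A.
  move=> hz; rewrite Cnorm_mul Cnorm_RtoC Rabs_pos_eq; last lra.
  by have := Cnorm_tri a (f z); have := hb z hz; lra.
have hg z : 0 <= Cim z -> cdiff g z.
  move=> hz; apply: cdiff_mul; first by apply: cdiff_pow; exact: hf.
  apply: cdiff_mul; first exact: cdiff_const.
  by apply: cdiff_add; [exact: cdiff_const|exact: hf].
have hgb z : 0 <= Cim z -> Cnorm (g z) <= A ^ m * A.
  move=> hz; rewrite /g Cnorm_mul Cnorm_pow; apply: Rmult_le_compat.
  - by apply: pow_le; exact: Cnorm_ge0.
  - exact: Cnorm_ge0.
  - by apply: pow_incr; split; [exact: Cnorm_ge0|exact: hb].
  - exact: hhalf.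
have hgm x t : Rabs x <= X + 1 -> Rabs t <= X + 1 -> Rabs (x - t) <= rho ->
    Cnorm (g (x, 0) - g (t, 0))%C <= tau.
  move=> h1 h2 h3; have h4 := hmod x t h1 h2 h3.
  have hx0 : 0 <= Cim (x, 0) by rewrite /=; lra.
  have ht0 : 0 <= Cim (t, 0) by rewrite /=; lra.
  have -> : (g (x, 0) - g (t, 0) = (f (x, 0) ^ m - f (t, 0) ^ m) * (RtoC (/ 2) * (a + f (x, 0)))
     + f (t, 0) ^ m * (RtoC (/ 2) * (f (x, 0) - f (t, 0))))%C by rewrite /g; ring.
  apply: Rle_trans (Cnorm_tri _ _) _; rewrite !(Cnorm_mul (_ - _)%C) !(Cnorm_mul (_ ^ _)%C).
  have e1 : Cnorm (RtoC (/ 2) * (f (x, 0) - f (t, 0)))%C <= Cnorm (f (x, 0) - f (t, 0))%C.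
    rewrite Cnorm_mul Cnorm_RtoC Rabs_pos_eq; last lra.
    by have := Cnorm_ge0 (f (x, 0) - f (t, 0))%C; lra.
  have e2 := @pow_lip _ _ A m (Rlt_le _ _ hA) (hb _ hx0) (hb _ ht0).
  have e3 := hhalf _ hx0.
  have e4 : Cnorm (f (t, 0) ^ m)%C <= A ^ m.
    by rewrite Cnorm_pow; apply: pow_incr; split; [exact: Cnorm_ge0|exact: hb].
  have t1 : Cnorm (f (x, 0) ^ m - f (t, 0) ^ m)%C * Cnorm (RtoC (/ 2) * (a + f (x, 0)))%C <=
    INR m * (1 + A) ^ m * Cnorm (f (x, 0) - f (t, 0))%C * A.
    by apply: Rmult_le_compat => //; exact: Cnorm_ge0.
  have t2 : Cnorm (f (t, 0) ^ m)%C * Cnorm (RtoC (/ 2) * (f (x, 0) - f (t, 0)))%C <=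
    A ^ m * Cnorm (f (x, 0) - f (t, 0))%C.
    by apply: Rmult_le_compat => //; exact: Cnorm_ge0.
  have t3 : Lip * Cnorm (f (x, 0) - f (t, 0))%C <= tau.
    have -> : tau = Lip * (tau / Lip) by field; lra.
    by apply: Rmult_le_compat_l; lra.
  rewrite /Lip in t3; lra.
have hJg := hJ g hg hgb hgm delta hdelta.
set al := Cnorm a in ha *; have hal : 0 <= al by exact: Cnorm_ge0.
have hw l : 0 <= w l by apply: pwt_ge0 => //; lra.
have hW : \rsum_(l < L) w l <= 1.
  by apply: (@Wtot_le1 X kappa L hX hk hL 0 (kappa + delta)); lra.
have eg0 : rpow (Cnorm (g (0, delta))) q = rpow al (p / 4).
  rewrite /g -/a; have -> : (RtoC (/ 2) * (a + a) = a)%C by apply: cplx_ext; cunfold; field.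
  rewrite Cnorm_mul Cnorm_pow -/al rpow_mul //; last exact: pow_le.
  rewrite rpow_natpow // rpow_pow // -rpow_plus; congr rpow; rewrite /q; field; lra.
pose T l := rpow (Cnorm (f (node X L l, 0))) (INR m * q)
   * rpow (Cnorm (RtoC (/ 2) * (a + f (node X L l, 0)))%C) q.
have egl l : rpow (Cnorm (g (node X L l, 0))) q = T l.
  rewrite /g Cnorm_mul Cnorm_pow rpow_mul; try exact: Cnorm_ge0; last first.
    by apply: pow_le; exact: Cnorm_ge0.
  by rewrite rpow_natpow ?rpow_pow //; exact: Cnorm_ge0.
have hT : rpow al (p / 4) <= \rsum_(l < L) (w l * T l) + e'.
  rewrite -eg0; apply: Rle_trans hJg _; apply: Req_le; congr (_ + _).
  by apply: eq_bigr => l _; rewrite egl.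
have hKs : \rsum_(l < L) (w l * plK p q c m al (Cnorm (f (node X L l, 0)))
   (Cnorm (RtoC (/ 2) * (a + f (node X L l, 0)))%C)) <= S - rpow al p + (1 + c) * (A3 * e').
  have -> : \rsum_(l < L) (w l * plK p q c m al (Cnorm (f (node X L l, 0)))
   (Cnorm (RtoC (/ 2) * (a + f (node X L l, 0)))%C)) =
    S + (c * rpow al p) * \rsum_(l < L) w l
      + (- ((1 + c) * rpow al (3 * p / 4))) * \rsum_(l < L) (w l * T l).
    rewrite /S -!rsum_scal -!rsum_add; apply: eq_bigr => l _; rewrite /plK /T; ring.
  have e1 : c * rpow al p * \rsum_(l < L) w l <= c * rpow al p.
    have : 0 <= c * rpow al p by apply: Rmult_le_pos; [lra|exact: rpow_ge0].
    by move=> h; rewrite -[X in _ <= X]Rmult_1_r; exact: Rmult_le_compat_l.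
  have e2 : rpow al p = rpow al (3 * p / 4) * rpow al (p / 4).
    by rewrite -rpow_plus; congr rpow; field.
  have e3 : rpow al (3 * p / 4) <= A3 by apply: rpow_le; lra.
  have e4 := rpow_ge0 al (3 * p / 4).
  have e5 : rpow al (3 * p / 4) * rpow al (p / 4) <=
     rpow al (3 * p / 4) * (\rsum_(l < L) (w l * T l) + e') by apply: Rmult_le_compat_l.
  have e6 : rpow al (3 * p / 4) * e' <= A3 * e' by apply: Rmult_le_compat_r; lra.
  move: (\big[Rplus/0]_(l < L) (w l * T l)) (\big[Rplus/0]_(l < L) w l) e1 e5 => S1 S2 e1 e5.
  have e7 : rpow al p <= rpow al (3 * p / 4) * S1 + A3 * e' by lra.
  have := Rmult_le_compat_l _ _ _ (Rlt_le _ _ (_ : 0 < 1 + c)) e7; lra.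
clear hJg; clearbody w.
apply: Rle_trans (_ : \rsum_(l < L) (eps * (rpow al p * w l)
   + (eps * (w l * rpow (Cnorm (f (node X L l, 0))) p)
   + C * (w l * plK p q c m al (Cnorm (f (node X L l, 0)))
     (Cnorm (RtoC (/ 2) * (a + f (node X L l, 0)))%C)))) <= _).
  apply: rsum_le => l _; have := hK a (f (node X L l, 0)); rewrite -/al => h.
  have := Rmult_le_compat_l _ _ _ (hw l) h; lra.
rewrite !rsum_add !rsum_scal -/S.
have f1 : rpow al p * \rsum_(l < L) w l <= rpow al p.
  by rewrite -[X in _ <= X]Rmult_1_r; apply: Rmult_le_compat_l => //; exact: rpow_ge0.
have f2 := Rmult_le_compat_l _ _ _ (Rlt_le _ _ hC) hKs.
have f3 : C * ((1 + c) * (A3 * e')) <= e.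
  have -> : C * ((1 + c) * (A3 * e')) = e * (A3 / (A3 + 1)) by rewrite /e'; field; lra.
  have : A3 / (A3 + 1) <= 1 by apply/Rle_div_l; lra.
  nra.
have f4 : eps * (rpow al p * \rsum_(l < L) w l) <= eps * rpow al p by apply: Rmult_le_compat_l; lra.
move: f1 f2 f3 f4; move: (\big[Rplus/0]_(l < L) (w l * plK _ _ _ _ _ _ _)) => S1; move: (\big[Rplus/0]_(l < L) w l) => S2 f1 f2 f3 f4.
lra.
Qed.

Lemma rsum_ge_term (T : finType) (F : T -> R) j : (forall i, 0 <= F i) ->
  F j <= \big[Rplus/0]_i F i.
Proof.
move=> h; rewrite (bigD1 j) //=; apply: Rle_trans (_ : F j + 0 <= _); first lra.
by apply: Rplus_le_compat_l; apply: rsum_ge0.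
Qed.

(** The truncation of [t] to [a, b + h] is monotone and grows by the full [h] over a step that
    starts in [a, b), so the number of grid points in [a, b) is bounded by a telescoping sum.
    [clamp_lower] is the matching lower bound. *)
Lemma clamp_upper a b h t : 0 < h -> a <= b ->
  h * (if Rle_dec a t then if Rlt_dec t b then 1 else 0 else 0) <=
  Rmin (Rmax (t + h) a) (b + h) - Rmin (Rmax t a) (b + h).
Proof.
move=> hh hab; case: Rle_dec => h1; [case: Rlt_dec => h2|] => /=;
  rewrite /Rmax; repeat (case: Rle_dec => ? /=); rewrite /Rmin; repeat (case: Rle_dec => ? /=); lra.
Qed.

Lemma clamp_lower a b h t : 0 < h -> a + h <= b ->
  Rmin (Rmax (t + h) (a + h)) b - Rmin (Rmax t (a + h)) b <=
  h * (if Rle_dec a t then if Rlt_dec t b then 1 else 0 else 0).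
Proof.
move=> hh hab; case: Rle_dec => h1; [case: Rlt_dec => h2|] => /=;
  rewrite /Rmax; repeat (case: Rle_dec => ? /=); rewrite /Rmin; repeat (case: Rle_dec => ? /=); lra.
Qed.

(** * Lower integrals of step functions *)

Section StepFunctions.
Variable n : nat.
Implicit Types (s t : step n) (g f : RVec n -> R) (x : RVec n).

Definition ind (b : RVec n * RVec n) x : R :=
  if excluded_middle_informative (in_box b.1 b.2 x) then 1 else 0.

(** Convertible to the fold inside [step_le], so that [step_le s g] can be read as a pointwise bound
    on [seval s]. *)
Definition seval s x : R := fold_right (fun u acc =>
  (if excluded_middle_informative (in_box (fst (snd u)) (snd (snd u)) x) then fst u else 0) + acc) 0 s.

Local Arguments seval : simpl never.
Local Arguments step_int : simpl never.

Lemma seval_cons c b s x : seval ((c, b) :: s) x = c * ind b x + seval s x.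
Proof.
rewrite /seval /= /ind; case: b => a b /=.
by case: excluded_middle_informative => _ /=; ring.
Qed.

Lemma sint_cons c b s : step_int ((c, b) :: s) = c * box_vol b.1 b.2 + step_int s.
Proof. by []. Qed.

Lemma seval_cat s t x : seval (s ++ t) x = seval s x + seval t x.
Proof.
elim: s => [|[c b] s IH]; first by rewrite Rplus_0_l.
by rewrite cat_cons !seval_cons IH; ring.
Qed.

Lemma sint_cat s t : step_int (s ++ t) = step_int s + step_int t.
Proof.
elim: s => [|[c b] s IH]; first by rewrite Rplus_0_l.
by rewrite cat_cons !sint_cons IH; ring.
Qed.

Definition sscal (a : R) s : step n := map (fun u => (a * u.1, u.2)) s.

Lemma seval_scal a s x : seval (sscal a s) x = a * seval s x.
Proof.
elim: s => [|[c b] s IH]; first by rewrite Rmult_0_r.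
by rewrite /sscal /= -/(sscal a s) !seval_cons IH; ring.
Qed.

Lemma sint_scal a s : step_int (sscal a s) = a * step_int s.
Proof.
elim: s => [|[c b] s IH]; first by rewrite Rmult_0_r.
by rewrite /sscal /= -/(sscal a s) !sint_cons IH; ring.
Qed.

Definition vadd x (v : RVec n) : RVec n := fun j => x j + v j.
Definition sshift (v : RVec n) s : step n := map (fun u => (u.1, (vadd u.2.1 v, vadd u.2.2 v))) s.

Lemma seval_shift v s x : seval (sshift v s) (vadd x v) = seval s x.
Proof.
elim: s => [//|[c [a b]] s IH]; rewrite /sshift /= -/(sshift v s) !seval_cons IH /ind /=.
congr (_ * _ + _); case: excluded_middle_informative => h; case: excluded_middle_informative => h' //.
- by case: h' => j; have := h j; rewrite /vadd; lra.
- by case: h => j; have := h' j; rewrite /vadd; lra.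
Qed.

Lemma sint_shift v s : step_int (sshift v s) = step_int s.
Proof.
elim: s => [//|[c [a b]] s IH]; rewrite /sshift /= -/(sshift v s) !sint_cons IH; congr (_ * _ + _).
by apply: eq_bigr => j _ /=; rewrite /vadd; congr Rmax; ring.
Qed.

Definition incube (r : R) x := forall j, Rabs (x j) <= r.

Lemma step_support s : exists r, 0 < r /\ forall x, ~ (forall j, - r <= x j /\ x j < r) -> seval s x = 0.
Proof.
elim: s => [|[c [a b]] s [r [hr IH]]]; first by exists 1; split; [lra|].
set m := \big[Rplus/0]_(j < n) (Rabs (a j) + Rabs (b j)).
have hm j : Rabs (a j) + Rabs (b j) <= m.
  apply: (rsum_ge_term (F := fun j => Rabs (a j) + Rabs (b j))) => i.
  by have := Rabs_pos (a i); have := Rabs_pos (b i); lra.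
have hm0 : 0 <= m.
  by apply: rsum_ge0 => i _; have := Rabs_pos (a i); have := Rabs_pos (b i); lra.
exists (r + m + 1); split; first lra.
move=> x hx; rewrite seval_cons IH; last first.
  by move=> h; apply: hx => j; have := h j; lra.
rewrite /ind; case: excluded_middle_informative => /= h; last by ring.
case: hx => j; have := h j; have := hm j.
have := Rle_abs (a j); have := Rle_abs (- a j); have := Rle_abs (b j); have := Rle_abs (- b j).
have := Rabs_pos (a j); have := Rabs_pos (b j).
by rewrite !Rabs_Ropp /=; lra.
Qed.

Definition cube (r : R) : RVec n * RVec n := ((fun _ => - r), (fun _ => r)).

Lemma cube_vol r : 0 <= r -> box_vol (cube r).1 (cube r).2 = (2 * r) ^ n.
Proof.
move=> hr; rewrite /box_vol /=; have -> : Rmax 0 (r - - r) = 2 * r by rewrite Rmax_right; lra.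
elim: n => [|k IH]; first by rewrite big_ord0.
by rewrite big_ord_recl IH.
Qed.

Lemma integral_le_mono f g A B : (forall x, f x <= g x) -> A <= B ->
  integral_le g A -> integral_le f B.
Proof.
move=> h hAB hg s hs; apply: Rle_trans hAB; apply: hg => x; exact: Rle_trans (hs x) (h x).
Qed.

Lemma integral_le_shift v g M : integral_le g M -> integral_le (fun x => g (vadd x v)) M.
Proof.
move=> h s hs; rewrite -(sint_shift v); apply: h => x.
have -> : x = vadd (vadd x (fun j => - v j)) v.
  by apply: functional_extensionality => j; rewrite /vadd; ring.
rewrite -/(seval (sshift v s) _) seval_shift; exact: hs.
Qed.

Lemma le_eps_scal (a b K : R) : 0 <= K -> (forall eps, 0 < eps -> a <= b + eps * K) -> a <= b.
Proof.
move=> hK h; apply: le_epsilon => eps heps.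
apply: Rle_trans (h (eps / (K + 1)) _) _; first by apply: Rdiv_lt_0_compat; lra.
have -> : eps / (K + 1) * K = eps * (K / (K + 1)) by field; lra.
have : K / (K + 1) <= 1 by apply/Rle_div_l; lra.
nra.
Qed.

(* A form of Fatou's lemma: only approximate majorants on bounded sets are needed. *)
Lemma integral_le_local g M : (forall r eps, 0 < r -> 0 < eps -> exists g',
    [/\ forall x, 0 <= g' x, integral_le g' (M + eps)
      & forall x, incube r x -> g x <= g' x + eps]) ->
  integral_le g M.
Proof.
move=> h s hs; have [r [hr hsup]] := step_support s.
apply: (@le_eps_scal _ _ ((2 * r) ^ n + 1)).
  by have : 0 <= (2 * r) ^ n by [apply: pow_le; lra|]; lra.
move=> eps heps; have [g' [h1 h2 h3]] := h r eps hr heps.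
(* Lowering [s] by [eps] on a cube containing its support gives a step function below g'. *)
have := h2 ((- eps, cube r) :: s); rewrite sint_cons cube_vol; last lra.
move=> h4; have : - eps * (2 * r) ^ n + step_int s <= M + eps; last lra.
apply: h4 => x; rewrite -/(seval _ x) seval_cons /ind.
case: excluded_middle_informative => /= hx.
  have := hs x; rewrite -/(seval s x) => h5.
  have := h3 x (fun j => _); have h6 j : Rabs (x j) <= r.
    by have := hx j; rewrite /= => h6; apply: Rabs_le; lra.
  move=> h7; have := h7 h6; lra.
have := hsup x hx; have := h1 x; lra.
Qed.

Lemma integral_sup g M : (forall x, 0 <= g x) -> integral_le g M ->
  exists V, [/\ integral_le g V, V <= M, 0 <= V
    & forall eta, 0 < eta -> exists s, step_le s g /\ V - eta < step_int s].
Proof.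
move=> hg hM.
pose E v := exists s, step_le s g /\ v = step_int s.
have hb : bound E by exists M => v [s [hs ->]]; exact: hM.
have he : exists v, E v by exists 0; exists [::]; split => // x; exact: hg.
have [V [h1 h2]] := completeness E hb he.
exists V; split.
- by move=> s hs; apply: h1; exists s.
- by apply: h2 => v [s [hs ->]]; exact: hM.
- by apply: h1; exists [::]; split => // x; exact: hg.
move=> eta heta.
case: (excluded_middle_informative (exists s, step_le s g /\ V - eta < step_int s)) => // hno.
have : V <= V - eta; last lra.
apply: h2 => v [s [hs ->]]; apply: Rnot_lt_le => hlt; apply: hno; by exists s.
Qed.

Lemma not_integral_le g M : ~ integral_le g M -> exists s, step_le s g /\ M < step_int s.
Proof.
move=> h; case: (excluded_middle_informative (exists s, step_le s g /\ M < step_int s)) => // hno.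
case: h => s hs; apply: Rnot_lt_le => hlt; apply: hno; by exists s.
Qed.

(** Take [s] below [g] with integral within [eta] of the supremum. Outside the support cube of [s],
    a step function below phi / C can be added to [s] without exceeding [g], so it contributes at
    most [eta]; inside the cube [tau] bounds [phi]. This plays the part of dominated convergence. *)
Lemma integral_le_tail g M : (forall x, 0 <= g x) -> integral_le g M ->
  forall eta, 0 < eta -> exists r, 0 < r /\ forall C tau (phi : RVec n -> R), 0 < C -> 0 <= tau ->
    (forall x, phi x <= C * g x) -> (forall x, incube r x -> phi x <= tau) ->
    integral_le phi (C * eta + tau * (2 * r) ^ n).
Proof.
move=> hg hM eta heta.
have [V [hV _ _ hnear]] := integral_sup hg hM.
have [s [hs hsV]] := hnear eta heta.
have [r [hr hsup]] := step_support s.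
exists r; split => // C tau phi hC htau h1 h2 t ht.
have := hV (s ++ sscal (/ C) ((- tau, cube r) :: t)).
rewrite sint_cat sint_scal sint_cons cube_vol; last lra.
move=> h; have {}h : step_int s + / C * (- tau * (2 * r) ^ n + step_int t) <= V.
  apply: h => x; rewrite -/(seval _ x) seval_cat seval_scal seval_cons.
  have hiC : 0 < / C by exact: Rinv_0_lt_compat.
  have hsx := hs x; rewrite -/(seval s x) in hsx.
  have htx := ht x; rewrite -/(seval t x) in htx.
  rewrite /ind; case: excluded_middle_informative => /= hx.
    have h3 : phi x <= tau.
      by apply: h2 => j; have := hx j; rewrite /= => h6; apply: Rabs_le; lra.
    have : / C * (- tau * 1 + seval t x) <= 0 by nra.
    lra.
  rewrite (hsup x hx) in hsx *.
  have h3 := h1 x.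
  have : / C * (- tau * 0 + seval t x) <= / C * (C * g x) by apply: Rmult_le_compat_l; lra.
  rewrite -Rmult_assoc Rinv_l; lra.
have h3 : / C * (- tau * (2 * r) ^ n + step_int t) < eta by lra.
have : C * (/ C * (- tau * (2 * r) ^ n + step_int t)) <= C * eta by apply: Rmult_le_compat_l; lra.
rewrite -Rmult_assoc Rinv_r; lra.
Qed.

Lemma INRS_gt0 k : 0 < INR k.+1. Proof. by apply: lt_0_INR; lia. Qed.

(** * Step functions constant on the cells of a grid *)

Section Cells.
Variables (o : RVec n) (h : R) (K : nat).
Hypothesis hh : 0 < h.

Definition gpt (k : {ffun 'I_n -> 'I_K}) : RVec n := fun j => o j + INR (k j) * h.
Definition gcell (k : {ffun 'I_n -> 'I_K}) : RVec n * RVec n :=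
  (gpt k, fun j => gpt k j + h).
Definition ingrid x := forall j, o j <= x j /\ x j < o j + INR K * h.

Lemma gcell_exists x : ingrid x -> exists k, in_box (gcell k).1 (gcell k).2 x.
Proof.
move=> hx.
have hex j : exists i : 'I_K, o j + INR i * h <= x j /\ x j < o j + INR i * h + h.
  have h0 : 0 <= (x j - o j) / h by apply: Rdiv_le_0_compat; [have := hx j; lra|].
  have [i [h1 h2]] := nfloor_ex _ h0.
  have e : (x j - o j) / h * h = x j - o j by field; lra.
  have hi1 : INR i * h <= x j - o j by rewrite -e; apply: Rmult_le_compat_r; lra.
  have hi2 : x j - o j < (INR i + 1) * h by rewrite -e; apply: Rmult_lt_compat_r; lra.
  have hi : (i < K)%N.
    apply/ltP; apply: INR_lt; apply: (Rmult_lt_reg_r h) => //.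
    by have := hx j; lra.
  exists (Ordinal hi); rewrite /=; lra.
pose k := [ffun j => sval (constructive_indefinite_description _ (hex j))].
exists k => j; rewrite /= /gpt /k ffunE.
exact: svalP (constructive_indefinite_description _ (hex j)).
Qed.

Lemma gcell_unique x k k' : in_box (gcell k).1 (gcell k).2 x -> in_box (gcell k').1 (gcell k').2 x ->
  k = k'.
Proof.
move=> h1 h2; apply/ffunP => j; apply: val_inj; have := h1 j; have := h2 j; rewrite /= /gpt.
move=> {}h1 {}h2.
have key (a b : nat) : INR a * h < INR b * h + h -> (a <= b)%N.
  move=> hab; have {}hab : INR a < INR b.+1 by rewrite S_INR; nra.
  by move/INR_lt: hab => /ltP; rewrite ltnS.
by apply/eqP; rewrite eqn_leq; apply/andP; split; apply: key; lra.
Qed.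

Lemma gcell_ingrid x k : in_box (gcell k).1 (gcell k).2 x -> ingrid x.
Proof.
move=> h0 j; have := h0 j; rewrite /= /gpt.
have h1 : INR (k j).+1 <= INR K by apply: le_INR; apply/leP; exact: ltn_ord.
move=> h2; have := pos_INR (k j); move: h1 h2; rewrite S_INR => h1 h2 h3.
split; nra.
Qed.

Definition cellstep (v : {ffun 'I_n -> 'I_K} -> R) : step n :=
  map (fun k => (v k, gcell k)) (enum {ffun 'I_n -> 'I_K}).

Lemma seval_cellstep v x : seval (cellstep v) x = \big[Rplus/0]_k (v k * ind (gcell k) x).
Proof.
rewrite /cellstep -big_enum /=; elim: (enum _) => [|k r IH] /=; first by rewrite big_nil.
by rewrite seval_cons IH big_cons.
Qed.

Lemma seval_cellstep_in v x k : in_box (gcell k).1 (gcell k).2 x -> seval (cellstep v) x = v k.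
Proof.
move=> hx; rewrite seval_cellstep (bigD1 k) //= big1 => [|k' hk'].
  by rewrite /ind; case: excluded_middle_informative => //= _; ring.
rewrite /ind; case: excluded_middle_informative => /= h0; last by ring.
by move: hk'; rewrite (gcell_unique h0 hx) eqxx.
Qed.

Lemma seval_cellstep_out v x : ~ ingrid x -> seval (cellstep v) x = 0.
Proof.
move=> hx; rewrite seval_cellstep big1 // => k _.
rewrite /ind; case: excluded_middle_informative => /= h0; last by ring.
by case: hx => j; exact: (gcell_ingrid h0).
Qed.

Lemma gcell_vol k : box_vol (gcell k).1 (gcell k).2 = h ^ n.
Proof.
rewrite /box_vol /= (eq_bigr (fun _ => h)); last first.
  by move=> j _; rewrite Rmax_right; [ring|lra].
elim: (n) => [|m IH]; first by rewrite big_ord0.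
by rewrite big_ord_recl IH.
Qed.

Lemma sint_cellstep v : step_int (cellstep v) = h ^ n * \big[Rplus/0]_k v k.
Proof.
rewrite /cellstep -big_enum /=; elim: (enum _) => [|k r IH] /=; first by rewrite big_nil Rmult_0_r.
by rewrite sint_cons IH big_cons (gcell_vol k) Rmult_plus_distr_l; congr (_ + _); ring.
Qed.

Lemma cells_lower g M v : (forall x, 0 <= g x) -> integral_le g M ->
  (forall k x, in_box (gcell k).1 (gcell k).2 x -> v k <= g x) ->
  h ^ n * \big[Rplus/0]_k v k <= M.
Proof.
move=> hg hM hv; rewrite -sint_cellstep; apply: hM => x; rewrite -/(seval _ x).
case: (excluded_middle_informative (ingrid x)) => hx.
  by have [k hk] := gcell_exists hx; rewrite (seval_cellstep_in _ hk); exact: hv.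
by rewrite seval_cellstep_out.
Qed.

End Cells.

(** * Riemann sums on uniform grids and monotonicity of the step integral *)

Section Grid.
Variables (R0 N : nat).

Definition gh : R := / INR N.+1.
Definition gK : nat := (2 * R0 * N.+1)%N.
Definition gpt1 (i : nat) : R := - INR R0 + INR i * gh.
Definition cpt (k : {ffun 'I_n -> 'I_gK}) : RVec n := gpt (fun _ => - INR R0) gh k.
Definition ccell (k : {ffun 'I_n -> 'I_gK}) : RVec n * RVec n := gcell (fun _ => - INR R0) gh k.

Lemma gh_gt0 : 0 < gh. Proof. exact: Rinv_0_lt_compat (INRS_gt0 N). Qed.

Lemma gKh : INR gK * gh = 2 * INR R0.
Proof.
rewrite /gK /gh !mulnE !mult_INR; have := INRS_gt0 N => h.
by rewrite [INR 2]/=; field; lra.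
Qed.

Lemma gpt1_last : gpt1 gK = INR R0.
Proof. by rewrite /gpt1 gKh; ring. Qed.

Lemma gpt1S i : gpt1 i.+1 = gpt1 i + gh.
Proof. by rewrite /gpt1 S_INR; ring. Qed.

Lemma ingrid_cube x : ingrid (fun _ => - INR R0) gh gK x <-> forall j, - INR R0 <= x j /\ x j < INR R0.
Proof. by rewrite /ingrid gKh; split => h j; have := h j; lra. Qed.

Lemma count_interval a b : - INR R0 <= a -> b <= INR R0 -> a <= b ->
  Rabs (gh * \rsum_(i < gK) (if Rle_dec a (gpt1 i) then if Rlt_dec (gpt1 i) b then 1 else 0 else 0)
    - (b - a)) <= gh.
Proof.
move=> ha hb hab; have hh := gh_gt0.
pose cl c d (t : R) := Rmin (Rmax t c) d.
have hcl c d (t : R) : c <= d -> c <= cl c d t <= d.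
  move=> hcd; rewrite /cl; have := Rmax_r t c; have := Rmin_r (Rmax t c) d => h1 h2.
  by split => //; apply: Rmin_glb.
set S := \big[Rplus/0]_(i < gK) _.
have hup : gh * S <= b + gh - a.
  rewrite /S -rsum_scal.
  apply: Rle_trans (_ : \rsum_(i < gK) (cl a (b + gh) (gpt1 i.+1) - cl a (b + gh) (gpt1 i)) <= _).
    by apply: rsum_le => i _; rewrite gpt1S; exact: clamp_upper.
  rewrite (rsum_telescope (fun i => cl a (b + gh) (gpt1 i))).
  have := @hcl a (b + gh) (gpt1 gK) ltac:(lra); have := @hcl a (b + gh) (gpt1 0) ltac:(lra); lra.
have hlow : b - a - gh <= gh * S.
  rewrite /S -rsum_scal.
  have [hs|hs] := Rle_lt_dec (a + gh) b; last first.
    apply: Rle_trans (_ : 0 <= _); first lra.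
    apply: rsum_ge0 => i _; case: Rle_dec => _ /=; last lra.
    by case: Rlt_dec => _ /=; lra.
  apply: Rle_trans (_ : \rsum_(i < gK) (cl (a + gh) b (gpt1 i.+1) - cl (a + gh) b (gpt1 i)) <= _).
    rewrite (rsum_telescope (fun i => cl (a + gh) b (gpt1 i))) gpt1_last.
    have -> : gpt1 0 = - INR R0 by rewrite /gpt1 /=; ring.
    have -> : cl (a + gh) b (INR R0) = b by rewrite /cl Rmax_left ?Rmin_right; lra.
    have -> : cl (a + gh) b (- INR R0) = a + gh by rewrite /cl Rmax_right ?Rmin_left; lra.
    lra.
  by apply: rsum_le => i _; rewrite gpt1S; exact: clamp_lower.
apply: Rabs_le; lra.
Qed.

Definition RSum (g : RVec n -> R) : R := gh ^ n * \big[Rplus/0]_k g (cpt k).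

(** Grid points are functions from coordinates to indices, so the sum of a product of one-variable
    indicators distributes into a product of one-variable counts. *)
Lemma RSum_ind (a b : RVec n) : RSum (ind (a, b)) = \big[Rmult/1]_(j < n)
  (gh * \rsum_(i < gK) (if Rle_dec (a j) (gpt1 i) then if Rlt_dec (gpt1 i) (b j) then 1 else 0 else 0)).
Proof.
rewrite big_split /=.
have -> : \big[Rmult/1]_(j < n) gh = gh ^ n.
  by elim: (n) => [|m IH]; [rewrite big_ord0|rewrite big_ord_recl IH].
rewrite /RSum; congr (_ * _).
rewrite bigA_distr_bigA /=; apply: eq_bigr => k _.
rewrite /ind /=; case: excluded_middle_informative => /= h.
  rewrite big1 // => j _; have := h j; rewrite /cpt /gpt -/(gpt1 _) => -[h1 h2].
  by case: Rle_dec => //= _; case: Rlt_dec.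
have [j hj] : exists j, ~ (a j <= gpt1 (k j) /\ gpt1 (k j) < b j).
  case: (excluded_middle_informative (exists j, ~ (a j <= gpt1 (k j) /\ gpt1 (k j) < b j))) => // hn.
  case: h => j; case: (excluded_middle_informative (a j <= gpt1 (k j) /\ gpt1 (k j) < b j)) => // h.
  by case: hn; exists j.
rewrite (bigD1 j) //=.
have -> : (if Rle_dec (a j) (gpt1 (k j)) then if Rlt_dec (gpt1 (k j)) (b j) then 1 else 0 else 0) = 0.
  by case: Rle_dec => //= h1; case: Rlt_dec => //= h2; case: hj.
by rewrite Rmult_0_l.
Qed.

Lemma RSum_seval_cons c b s : RSum (seval ((c, b) :: s)) = c * RSum (ind b) + RSum (seval s).
Proof.
rewrite /RSum.
have -> : \big[Rplus/0]_k seval ((c, b) :: s) (cpt k) =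
  c * \big[Rplus/0]_k ind b (cpt k) + \big[Rplus/0]_k seval s (cpt k).
  by rewrite -rsum_scal -rsum_add; apply: eq_bigr => k _; rewrite seval_cons.
ring.
Qed.

End Grid.

Lemma is_lim_seq_gh : is_lim_seq (fun N => gh N) 0.
Proof.
apply/(is_lim_seq_incr_1 (fun N => / INR N)).
exact: (is_lim_seq_inv _ p_infty is_lim_seq_INR).
Qed.

Lemma is_lim_seq_rprod (I : Type) (r : seq I) (u : I -> nat -> R) (l : I -> R) :
  (forall i, is_lim_seq (u i) (l i)) ->
  is_lim_seq (fun N => \big[Rmult/1]_(i <- r) u i N) (\big[Rmult/1]_(i <- r) l i).
Proof.
move=> h; elim: r => [|i r IH].
  by apply: (is_lim_seq_ext (fun _ => 1)) => [N|]; rewrite big_nil //; exact: is_lim_seq_const.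
rewrite big_cons; apply: (is_lim_seq_ext (fun N => u i N * \big[Rmult/1]_(i <- r) u i N)).
  by move=> N; rewrite big_cons.
by apply: is_lim_seq_mult'.
Qed.

Lemma RSum_lim_ind (R0 : nat) (a b : RVec n) : (0 < R0)%N ->
  (forall j, - INR R0 <= a j /\ b j <= INR R0) ->
  is_lim_seq (fun N => RSum R0 N (ind (a, b))) (box_vol a b).
Proof.
move=> hR h.
apply: (is_lim_seq_ext (fun N => \big[Rmult/1]_(j < n) (gh N * \rsum_(i < gK R0 N)
  (if Rle_dec (a j) (gpt1 R0 N i) then if Rlt_dec (gpt1 R0 N i) (b j) then 1 else 0 else 0)))).
  by move=> N; rewrite RSum_ind.
apply: is_lim_seq_rprod => j.
have [hab|hab] := Rle_lt_dec (a j) (b j).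
  rewrite Rmax_right; last lra.
  apply: (is_lim_seq_le_le (fun N => (b j - a j) - gh N) _ (fun N => (b j - a j) + gh N)).
  - move=> N; have [h1 h2] := h j.
    by have /Rabs_le_between := @count_interval R0 N (a j) (b j) h1 h2 hab; lra.
  - have -> : Rbar.Finite (b j - a j) = Rbar.Finite ((b j - a j) - 0) by f_equal; ring.
    by apply: is_lim_seq_minus'; [exact: is_lim_seq_const|exact: is_lim_seq_gh].
  - have -> : Rbar.Finite (b j - a j) = Rbar.Finite ((b j - a j) + 0) by f_equal; ring.
    by apply: is_lim_seq_plus'; [exact: is_lim_seq_const|exact: is_lim_seq_gh].
rewrite Rmax_left; last lra.
apply: (is_lim_seq_ext (fun _ => 0)); last exact: is_lim_seq_const.
move=> N; rewrite big1 ?Rmult_0_r // => i _.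
by case: Rle_dec => //= h1; case: Rlt_dec => //= h2; lra.
Qed.

Lemma step_cover s : exists R0, (0 < R0)%N /\
  forall u, List.In u s -> forall j, - INR R0 <= u.2.1 j /\ u.2.2 j <= INR R0.
Proof.
elim: s => [|[c [a b]] s [R1 [hR1 IH]]]; first by exists 1%N.
set m := \big[Rplus/0]_(j < n) (Rabs (a j) + Rabs (b j)).
have hm j : Rabs (a j) + Rabs (b j) <= m.
  apply: (rsum_ge_term (F := fun j => Rabs (a j) + Rabs (b j))) => i.
  by have := Rabs_pos (a i); have := Rabs_pos (b i); lra.
have [R2 hR2] := INR_unbounded m.
exists (R1 + R2)%N; split; first by rewrite addn_gt0 hR1.
have e : INR (R1 + R2)%N = INR R1 + INR R2 by rewrite plus_INR.
have p1 := pos_INR R1; have p2 := pos_INR R2.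
move=> u [<-|hu] j /=; last by have := IH u hu j; lra.
have := hm j; have := Rle_abs (- a j); have := Rle_abs (b j).
have := Rabs_pos (a j); have := Rabs_pos (b j).
rewrite Rabs_Ropp; lra.
Qed.

Lemma RSum_lim s (R0 : nat) : (0 < R0)%N ->
  (forall u, List.In u s -> forall j, - INR R0 <= u.2.1 j /\ u.2.2 j <= INR R0) ->
  is_lim_seq (fun N => RSum R0 N (seval s)) (step_int s).
Proof.
move=> hR; elim: s => [|[c [a b]] s IH] h.
  apply: (is_lim_seq_ext (fun _ => 0)); last exact: is_lim_seq_const.
  by move=> N; rewrite /RSum big1 ?Rmult_0_r.
apply: (is_lim_seq_ext (fun N => c * RSum R0 N (ind (a, b)) + RSum R0 N (seval s))).
  by move=> N; rewrite RSum_seval_cons.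
rewrite sint_cons; apply: is_lim_seq_plus'; last by apply: IH => u hu; apply: h; right.
apply: is_lim_seq_mult'; first exact: is_lim_seq_const.
by apply: RSum_lim_ind => // j; apply: (h (c, (a, b))); left.
Qed.

(** The boxes of a step function may overlap and carry opposite signs, so nothing is visible
    termwise. The Riemann sums over finer and finer grids are nonpositive and converge to the step
    integral; this spares a decomposition into disjoint boxes and yields the monotonicity of
    [step_int]. *)
Lemma step_int_le0 s : (forall x, seval s x <= 0) -> step_int s <= 0.
Proof.
move=> hs; have [R0 [hR h]] := step_cover s.
have h1 := RSum_lim hR h.
have := @is_lim_seq_le _ (fun _ => 0) (step_int s) 0 _ h1 (is_lim_seq_const 0).
apply=> N; rewrite /RSum -[X in _ <= X](Rmult_0_r (gh N ^ n)); apply: Rmult_le_compat_l.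
  by apply: pow_le; apply: Rlt_le; exact: gh_gt0.
apply: (Rle_trans _ (\big[Rplus/0]_(k : {ffun 'I_n -> 'I_(gK R0 N)}) 0)).
  by apply: rsum_le => k _; exact: hs.
by rewrite big1 //; lra.
Qed.

Lemma cells_upper t (R0 N : nat) v : (0 < R0)%N ->
  (forall x, ~ (forall j, - INR R0 <= x j /\ x j < INR R0) -> seval t x <= 0) ->
  (forall k x, in_box (@ccell R0 N k).1 (@ccell R0 N k).2 x -> seval t x <= v k) ->
  step_int t <= gh N ^ n * \big[Rplus/0]_k v k.
Proof.
move=> hR hout hin.
have : step_int (t ++ sscal (-1) (@cellstep (fun _ => - INR R0) (gh N) (gK R0 N) v)) <= 0.
  apply: step_int_le0 => x; rewrite seval_cat seval_scal.
  case: (excluded_middle_informative (forall j, - INR R0 <= x j /\ x j < INR R0)) => hx.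
    have [k hk] := gcell_exists (gh_gt0 N) ((ingrid_cube R0 N x).2 hx).
    by rewrite (seval_cellstep_in _ hk); have := hin k x hk; lra.
  rewrite seval_cellstep_out; last by move/ingrid_cube.
  by have := hout x hx; lra.
rewrite sint_cat sint_scal sint_cellstep; [lra|exact: gh_gt0].
Qed.

Definition ucont g := forall eps, 0 < eps -> exists d, 0 < d /\
  forall x x', (forall j, Rabs (x j - x' j) <= d) -> Rabs (g x - g x') <= eps.

Lemma exists_mesh d : 0 < d -> exists N, gh N <= d.
Proof.
move=> hd; have [N hN] := INR_unbounded (/ d).
exists N; rewrite /gh -(Rinv_inv d); apply: Rinv_le_contravar; first exact: Rinv_0_lt_compat.
by rewrite S_INR; lra.
Qed.

(** On a fine grid [f] and [g] are bounded below by step functions [v1] and [v2], and f + g exceeds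
    v1 + v2 by at most 4 * eps on each cell, namely two oscillations of size [eps] for each summand.
    Uniform continuity thus supplies the subadditivity of the lower integral. *)
Lemma integral_le_add f g A B : (forall x, 0 <= f x) -> (forall x, 0 <= g x) ->
  ucont f -> ucont g -> integral_le f A -> integral_le g B ->
  integral_le (fun x => f x + g x) (A + B).
Proof.
move=> hf hg uf ug hA hB t ht.
have [r [hr hsup]] := step_support t.
have [R0 hR0] := INR_unbounded r.
have hR : (0 < R0)%N by apply/ltP; apply: INR_lt; rewrite /=; lra.
apply: (@le_eps_scal _ _ (4 * (2 * INR R0) ^ n)).
  by apply: Rmult_le_pos; [lra|apply: pow_le; have := pos_INR R0; lra].
move=> eps heps.
have [d1 [hd1 h1]] := uf eps heps; have [d2 [hd2 h2]] := ug eps heps.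
have [N hN] := @exists_mesh (Rmin d1 d2) (Rmin_glb_lt _ _ _ hd1 hd2).
have hN1 := Rle_trans _ _ _ hN (Rmin_l d1 d2); have hN2 := Rle_trans _ _ _ hN (Rmin_r d1 d2).
have hgh := gh_gt0 N.
have hcl k x : in_box (@ccell R0 N k).1 (@ccell R0 N k).2 x ->
    forall j, Rabs (x j - cpt k j) <= gh N.
  move=> hx j; have := hx j; rewrite /= /cpt => h; apply: Rabs_le; lra.
pose v1 (k : {ffun 'I_n -> 'I_(gK R0 N)}) := f (cpt k) - eps.
pose v2 (k : {ffun 'I_n -> 'I_(gK R0 N)}) := g (cpt k) - eps.
have l1 : gh N ^ n * \big[Rplus/0]_k v1 k <= A.
  apply: (cells_lower (gh_gt0 N) hf hA) => k x hx; rewrite /v1.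
  have /Rabs_le_between := h1 x (cpt k) (fun j => Rle_trans _ _ _ (hcl k x hx j) hN1); lra.
have l2 : gh N ^ n * \big[Rplus/0]_k v2 k <= B.
  apply: (cells_lower (gh_gt0 N) hg hB) => k x hx; rewrite /v2.
  have /Rabs_le_between := h2 x (cpt k) (fun j => Rle_trans _ _ _ (hcl k x hx j) hN2); lra.
have eS : gh N ^ n * \big[Rplus/0]_(k : {ffun 'I_n -> 'I_(gK R0 N)}) (v1 k + (v2 k + 4 * eps)) =
  gh N ^ n * \big[Rplus/0]_k v1 k + gh N ^ n * \big[Rplus/0]_k v2 k + eps * (4 * (2 * INR R0) ^ n).
  rewrite !rsum_add !rsum_const card_ffun !card_ord.
  have -> : (2 * INR R0) ^ n = gh N ^ n * INR (gK R0 N ^ n)%N.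
    rewrite -(gKh R0 N) Rpow_mult_distr Rmult_comm; congr (_ * _).
    elim: (n) => [//|m IH]; by rewrite expnS (mult_INR (gK R0 N)) -IH.
  ring.
have h := @cells_upper t R0 N (fun k => v1 k + (v2 k + 4 * eps)).
rewrite eS in h; apply: Rle_trans (h _ _ _) _; last lra.
- exact: hR.
- move=> x hx; rewrite hsup; first lra.
  by move=> hx'; apply: hx => j; have := hx' j; lra.
- move=> k x hx; have := ht x; rewrite -/(seval t x) /v1 /v2.
  have /Rabs_le_between := h1 x (cpt k) (fun j => Rle_trans _ _ _ (hcl k x hx j) hN1).
  have /Rabs_le_between := h2 x (cpt k) (fun j => Rle_trans _ _ _ (hcl k x hx j) hN2).
  lra.
Qed.

Lemma integral_le_zero : integral_le (fun _ : RVec n => 0) 0.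
Proof. by move=> s hs; apply: step_int_le0. Qed.

Lemma integral_le_scal c f A : 0 <= c -> integral_le f A -> integral_le (fun x => c * f x) (c * A).
Proof.
move=> [hc|<-] h; last first.
  rewrite Rmult_0_l; apply: integral_le_mono integral_le_zero; last lra.
  by move=> x; lra.
move=> s hs; have := h (sscal (/ c) s); rewrite sint_scal => h1.
have : / c * step_int s <= A.
  apply: h1 => x; rewrite -/(seval _ x) seval_scal.
  have := hs x; rewrite -/(seval s x) => h2.
  apply: (Rmult_le_reg_l c) => //; rewrite -Rmult_assoc Rinv_r; lra.
move/(Rmult_le_compat_l _ _ _ (Rlt_le _ _ hc)); rewrite -Rmult_assoc Rinv_r; lra.
Qed.

Lemma ucont_add f g : ucont f -> ucont g -> ucont (fun x => f x + g x).
Proof.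
move=> hf hg eps heps; have [d1 [hd1 h1]] := hf (eps / 2) ltac:(lra).
have [d2 [hd2 h2]] := hg (eps / 2) ltac:(lra).
exists (Rmin d1 d2); split; first exact: Rmin_glb_lt.
move=> x x' hx.
have := h1 x x' (fun j => Rle_trans _ _ _ (hx j) (Rmin_l _ _)).
have := h2 x x' (fun j => Rle_trans _ _ _ (hx j) (Rmin_r _ _)).
have -> : f x + g x - (f x' + g x') = (f x - f x') + (g x - g x') by ring.
have := Rabs_triang (f x - f x') (g x - g x'); lra.
Qed.

Lemma ucont_const c : ucont (fun _ => c).
Proof.
by move=> eps heps; exists 1; split; [lra|move=> x x' _; rewrite Rminus_diag Rabs_R0; lra].
Qed.

Lemma ucont_scal c f : ucont f -> ucont (fun x => c * f x).
Proof.
move=> hf eps heps; have hc := Rabs_pos c.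
have [d [hd h]] := hf (eps / (Rabs c + 1)) ltac:(apply: Rdiv_lt_0_compat; lra).
exists d; split => // x x' hx; have := h x x' hx.
rewrite -Rmult_minus_distr_l Rabs_mult => /Rle_div_r h1.
have := h1 ltac:(lra); have := Rabs_pos (f x - f x'); nra.
Qed.

Lemma integral_le_sum L (w A : nat -> R) (f : nat -> RVec n -> R) :
  (forall l, (l < L)%N -> 0 <= w l) -> (forall l x, 0 <= f l x) -> (forall l, ucont (f l)) ->
  (forall l, (l < L)%N -> integral_le (f l) (A l)) ->
  integral_le (fun x => \rsum_(l < L) (w l * f l x)) (\rsum_(l < L) (w l * A l)).
Proof.
elim: L => [|L IH] hw hf uf hA.
  rewrite big_ord0; apply: integral_le_mono integral_le_zero; last lra.
  by move=> x; rewrite big_ord0; lra.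
rewrite big_ord_recr /=.
apply: (@integral_le_mono _ (fun x => \rsum_(l < L) (w l * f l x) + w L * f L x)); last first.
- apply: integral_le_add.
  + by move=> x; apply: rsum_ge0 => l _; apply: Rmult_le_pos => //; apply: hw; apply: ltnW; rewrite ltnS.
  + by move=> x; apply: Rmult_le_pos => //; exact: hw.
  + clear IH hA hw; elim: L => [|L IH].
      move=> eps heps; exists 1; split; first lra.
      by move=> x x' _; rewrite !big_ord0 Rminus_diag Rabs_R0; lra.
    have -> : (fun x => \rsum_(l < L.+1) (w l * f l x)) = (fun x => \rsum_(l < L) (w l * f l x) + w L * f L x).
      by apply: functional_extensionality => x; rewrite big_ord_recr.
    by apply: ucont_add => //; exact: ucont_scal.
  + exact: ucont_scal.
  + by apply: IH => // l hl; [apply: hw|apply: hA]; exact: ltnW.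
  + by apply: integral_le_scal; [exact: hw|exact: hA].
- exact: Rle_refl.
- by move=> x; rewrite big_ord_recr /=; lra.
Qed.

(** A substitute for Fubini: on unit cells the integrand is bounded by a product of one-variable
    cell bounds, and the sum of these products over all cells is a product of sums. *)
Lemma integral_le_prod (phi : R -> R) (psi : nat -> nat -> R) C :
  (forall t : R, 0 <= phi t) -> 0 <= C ->
  (forall R0 i (t : R), - INR R0 + INR i <= t -> t < - INR R0 + INR i + 1 -> phi t <= psi R0 i) ->
  (forall R0, (0 < R0)%N -> \rsum_(i < 2 * R0) (psi R0 i) <= C) ->
  integral_le (fun x => \big[Rmult/1]_(j < n) phi (x j)) (C ^ n).
Proof.
move=> hphi hC hpsi hsum t ht.
have [r [hr hsup]] := step_support t.
have [R0 hR0] := INR_unbounded r.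
have hR : (0 < R0)%N by apply/ltP; apply: INR_lt; rewrite /=; lra.
have eK : gK R0 0 = (2 * R0)%N by rewrite /gK muln1.
have e1 : gh 0 = 1 by rewrite /gh /= Rinv_1.
have := @cells_upper t R0 0 (fun k => \big[Rmult/1]_(j < n) psi R0 (k j)) hR.
rewrite e1 pow1 Rmult_1_l => h; apply: Rle_trans (h _ _) _.
- move=> x hx; rewrite hsup; first lra.
  by move=> hx'; apply: hx => j; have := hx' j; lra.
- move=> k x hx; apply: Rle_trans (ht x) _; apply: rprod_le => j _; split => //.
  by apply: hpsi; have := hx j; rewrite /= /gpt e1; lra.
rewrite -(bigA_distr_bigA (fun (j : 'I_n) (i : 'I_(gK R0 0)) => psi R0 i)) /=.
have -> : C ^ n = \big[Rmult/1]_(j < n) C.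
  by elim: (n) => [|m IH]; [rewrite big_ord0|rewrite big_ord_recl -IH].
apply: rprod_le => j _; rewrite eK; split; last exact: hsum.
apply: rsum_ge0 => i _; apply: Rle_trans (hphi (- INR R0 + INR i)) _.
by apply: hpsi; lra.
Qed.

End StepFunctions.

(** * Functions of H^p are bounded on proper subtubes *)

Section Compact.

(** Translation between the first [m] terms of a sequence and the nested pairs on which
    [compactness_list] is stated; [untn] is its inverse, padded with 0. *)
Fixpoint tn (m : nat) (g : nat -> R) : Tn m R :=
  match m with O => tt | S k => (g 0%N, tn k (fun i => g i.+1)) end.

Fixpoint untn (m : nat) : Tn m R -> nat -> R :=
  match m with
  | O => fun _ _ => 0
  | S k => fun t i => match i with O => t.1 | S i' => untn t.2 i' end
  end.

Lemma bounded_tn m a b (t : Tn m R) : bounded_n m (tn m a) (tn m b) t ->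
  forall i, (i < m)%N -> a i <= untn t i <= b i.
Proof.
elim: m a b t => // m IH a b [t1 t2] /= [h1 h2] [|i] hi //.
exact: (IH (fun i => a i.+1) (fun i => b i.+1)).
Qed.

Lemma tn_bounded m a b x : (forall i, (i < m)%N -> a i <= x i <= b i) ->
  bounded_n m (tn m a) (tn m b) (tn m x).
Proof.
elim: m a b x => //= m IH a b x h; split; first exact: (h 0%N).
by apply: IH => i hi; apply: (h i.+1).
Qed.

Lemma close_tn m d x (t : Tn m R) : close_n m d (tn m x) t ->
  forall i, (i < m)%N -> Rabs (x i - untn t i) < d.
Proof.
elim: m x t => // m IH x [t1 t2] /= [h1 h2] [|i] hi //.
exact: (IH (fun i => x i.+1)).
Qed.

Lemma compact_bounded m (a b : nat -> R) (G : (nat -> R) -> R) :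
  (forall x, (forall i, (i < m)%N -> a i <= x i <= b i) -> exists d, 0 < d /\ exists B,
     forall x', (forall i, (i < m)%N -> Rabs (x' i - x i) < d) -> G x' <= B) ->
  exists B, forall x, (forall i, (i < m)%N -> a i <= x i <= b i) -> G x <= B.
Proof.
move=> h.
pose ok (t : Tn m R) := bounded_n m (tn m a) (tn m b) t.
have hd (t : Tn m R) : {d : R | 0 < d /\ (ok t -> exists B,
     forall x', (forall i, (i < m)%N -> Rabs (x' i - untn t i) < d) -> G x' <= B)}.
  apply: constructive_indefinite_description.
  case: (excluded_middle_informative (ok t)) => ht; last by exists 1; split; [lra|].
  have [d [hd [B hB]]] := h (untn t) (bounded_tn ht).
  by exists d; split => // _; exists B.
pose delta t := mkposreal (sval (hd t)) (proj1 (svalP (hd t))).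
(* [compactness_list] provides the finite subcover only up to a double negation. *)
have := @compactness_list m (tn m a) (tn m b) delta => /NNPP [l hl].
have [B hB] : exists B, forall t, List.In t l -> ok t -> forall x,
    (forall i, (i < m)%N -> Rabs (x i - untn t i) < delta t) -> G x <= B.
  clear hl; elim: l => [|t l [B IH]]; first by exists 0.
  case: (excluded_middle_informative (ok t)) => ht; last first.
    by exists B => t' [<- //|]; exact: IH.
  have [B' hB'] := proj2 (svalP (hd t)) ht.
  exists (Rmax B B') => t' [<-|hin] ht' x hx.
    by apply: Rle_trans (Rmax_r _ _); apply: hB'.
  by apply: Rle_trans (Rmax_l _ _); apply: (IH t').
exists B => x hx; have [t [ht [hbt hct]]] := hl (tn m x) (tn_bounded hx).
by apply: (hB t) => // i hi; exact: close_tn hct i hi.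
Qed.

End Compact.

(** * Slices of holomorphic functions and local Lipschitz bounds *)

Section Tube.
Variable n : nat.
Implicit Types (F : CVec n -> cplx) (z w : CVec n).

Lemma cupdate_same z j u : cupdate z j u j = u.
Proof. by rewrite /cupdate eqxx. Qed.

Lemma cupdate_id z j : cupdate z j (z j) = z.
Proof. by apply: functional_extensionality => k; rewrite /cupdate; case: eqP => // ->. Qed.

Lemma cupdate_twice z j u v : cupdate (cupdate z j u) j v = cupdate z j v.
Proof. by apply: functional_extensionality => k; rewrite /cupdate; case: eqP. Qed.

Lemma hol_slice F z j u : holomorphic_on_tube F ->
  (forall k, k != j -> 0 < Cim (z k)) -> 0 < Cim u -> cdiff (fun v => F (cupdate z j v)) u.
Proof.
move=> hF hz hu.
have ht : in_tube (cupdate z j u).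
  by move=> k; rewrite /cupdate; case: eqP => // /eqP; exact: hz.
have [_ /(_ j) [L hL]] := hF _ ht; exists L => eps heps.
have [d [hd h]] := hL eps heps; exists d; split => // v hv.
case: (excluded_middle_informative (v = u)) => [->|hne].
  have -> : (F (cupdate z j u) - F (cupdate z j u) - L * (u - u) = C0)%C by ring.
  by rewrite Cnorm0; have := Cnorm_ge0 (u - u)%C; nra.
have hn : (v - u)%C <> C0.
  by move=> e; apply: hne; have -> : v = (v - u + u)%C by [ring|]; rewrite e; ring.
have := h (v - u)%C hn hv; rewrite cupdate_same cupdate_twice.
by have -> : (u + (v - u) = v)%C by ring.
Qed.

Definition hyb (z w : CVec n) (k : nat) : CVec n := fun j => if (j < k)%N then w j else z j.

Lemma hyb0 z w : hyb z w 0 = z.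
Proof. by apply: functional_extensionality => j; rewrite /hyb. Qed.

Lemma hyb_last z w : hyb z w n = w.
Proof. by apply: functional_extensionality => j; rewrite /hyb ltn_ord. Qed.

Lemma hybS z w (k : 'I_n) : hyb z w k.+1 = cupdate (hyb z w k) k (w k).
Proof.
apply: functional_extensionality => j; rewrite /hyb /cupdate ltnS leq_eqVlt.
by case: (eqVneq j k) => [->|hjk]; rewrite ?eqxx //= (_ : (j == k :> nat) = false) //; apply/negbTE.
Qed.

Lemma hybrid_telescope F z w e :
  (forall k : 'I_n, Cnorm (F (hyb z w k.+1) - F (hyb z w k))%C <= e) ->
  Cnorm (F w - F z)%C <= INR n * e.
Proof.
move=> h.
suff key m : (m <= n)%N -> Cnorm (F (hyb z w m) - F z)%C <= INR m * e.
  by have := key n (leqnn n); rewrite hyb_last.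
elim: m => [|m IH] hm.
  by rewrite hyb0; have -> : (F z - F z = C0)%C by [ring|]; rewrite Cnorm0 /=; lra.
have := h (Ordinal hm); have := IH (ltnW hm); rewrite S_INR /= => h1 h2.
have := Cnorm_tri_mid (F (hyb z w m.+1)) (F (hyb z w m)) (F z); lra.
Qed.

Definition polysq z r w := forall j,
  Rabs (Cre (w j) - Cre (z j)) <= r /\ Rabs (Cim (w j) - Cim (z j)) <= r.

Lemma polysq_refl z r : 0 <= r -> polysq z r z.
Proof. by move=> hr j; rewrite !Rminus_diag Rabs_R0. Qed.

Lemma polysq_trans z r s w v : polysq z r w -> polysq w s v -> polysq z (r + s) v.
Proof.
move=> h1 h2 j; have [a1 a2] := h1 j; have [b1 b2] := h2 j; split.
- have -> : Cre (v j) - Cre (z j) = (Cre (v j) - Cre (w j)) + (Cre (w j) - Cre (z j)) by ring.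
  by apply: Rle_trans (Rabs_triang _ _) _; lra.
- have -> : Cim (v j) - Cim (z j) = (Cim (v j) - Cim (w j)) + (Cim (w j) - Cim (z j)) by ring.
  by apply: Rle_trans (Rabs_triang _ _) _; lra.
Qed.

(** [hyb] moves from [z] to [w] one coordinate at a time. At each move the one-variable estimate
    applies on a square of half-side r / 2, which stays inside the polysquare because |w j - z j| <=
    r / 4. *)
Lemma Cnorm_lip_poly F z r B : 0 < r -> holomorphic_on_tube F ->
  (forall w, polysq z r w -> in_tube w /\ Cnorm (F w) <= B) ->
  forall w d, d <= r / 4 -> (forall j, Cnorm (w j - z j)%C <= d) ->
  Cnorm (F w - F z)%C <= INR n * (32 * B / r * d).
Proof.
move=> hr hF hb w d hd hw; apply: hybrid_telescope => k.
have hB : 0 <= B.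
  by have [_] := hb z (polysq_refl z (Rlt_le _ _ hr)); have := Cnorm_ge0 (F z); lra.
have hre j : Rabs (Cre (w j) - Cre (z j)) <= r / 2.
  by apply: Rle_trans (Cre_le (w j - z j)%C) _; have := hw j; lra.
have him j : Rabs (Cim (w j) - Cim (z j)) <= r / 2.
  by apply: Rle_trans (Cim_le (w j - z j)%C) _; have := hw j; lra.
rewrite hybS.
set v := hyb z w k.
have hv u : inrect (Cre (z k) - r / 2) (Cre (z k) + r / 2) (Cim (z k) - r / 2) (Cim (z k) + r / 2) u ->
    polysq z r (cupdate v k u).
  move=> [h1 h2] j; rewrite /cupdate; case: eqP => [->|_]; first by split; apply: Rabs_le; lra.
  rewrite /v /hyb; case: ifP => _; last by rewrite !Rminus_diag Rabs_R0; lra.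
  by have := hre j; have := him j; lra.
have hvk : v k = z k by rewrite /v /hyb ltnn.
have e0 : F (cupdate v k (z k)) = F v by rewrite -hvk cupdate_id.
have h := @Cauchy_lipschitz (fun u => F (cupdate v k u)) (z k) (r / 2) B ltac:(lra).
rewrite -e0; apply: Rle_trans (h _ (w k) _) _.
- move=> u hu; have [ht hbu] := hb _ (hv u hu); split => //.
  apply: hol_slice => //.
  + by move=> j hj; have := ht j; rewrite /cupdate (negbTE hj).
  + by have := ht k; rewrite cupdate_same.
- by have := hw k; lra.
have -> : 16 * B / (r / 2) = 32 * B / r by field; lra.
apply: Rmult_le_compat_l; last exact: hw.
by apply: Rdiv_le_0_compat; lra.
Qed.

Lemma hol_bounded_polysq F z r : holomorphic_on_tube F -> (forall w, polysq z r w -> in_tube w) ->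
  exists B, forall w, polysq z r w -> Cnorm (F w) <= B.
Proof.
move=> hF ht.
pose dec (x : nat -> R) : CVec n := fun j => (x j, x (n + j)%N).
(* A point of C^n is coded by 2 * n reals, real parts before imaginary parts; the default 0 is never
   met at an index below 2 * n. *)
pose a i := if (i < n)%N then (if insub i is Some j then Cre (z j) - r else 0)
  else (if insub (i - n)%N is Some j then Cim (z j) - r else 0).
pose b i := if (i < n)%N then (if insub i is Some j then Cre (z j) + r else 0)
  else (if insub (i - n)%N is Some j then Cim (z j) + r else 0).
have ea (j : 'I_n) : a j = Cre (z j) - r by rewrite /a ltn_ord valK.
have eb (j : 'I_n) : b j = Cre (z j) + r by rewrite /b ltn_ord valK.
have ea' (j : 'I_n) : a (n + j)%N = Cim (z j) - r by rewrite /a ltnNge leq_addr /= addKn valK.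
have eb' (j : 'I_n) : b (n + j)%N = Cim (z j) + r by rewrite /b ltnNge leq_addr /= addKn valK.
have hdec x : (forall i, (i < n + n)%N -> a i <= x i <= b i) -> polysq z r (dec x).
  move=> hx j; have h1 := hx j (ltn_addr n (ltn_ord j)).
  have h2 := hx (n + j)%N ltac:(by rewrite ltn_add2l).
  move: h1 h2; rewrite ea eb ea' eb' /dec /= => h1 h2; split; apply: Rabs_le; lra.
have [x hx|B hB] := @compact_bounded (n + n) a b (fun x => Cnorm (F (dec x))).
  have [hc _] := hF _ (ht _ (hdec x hx)).
  have [d [hd h]] := hc 1 Rlt_0_1.
  exists (d / 2); split; first lra.
  exists (Cnorm (F (dec x)) + 1) => x' hx'.
  have := h (dec x') _; have hclose j : Cnorm (dec x' j - dec x j)%C < d.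
    apply: Rle_lt_trans (Cnorm_le_sum _) _.
    have h1 := hx' j (ltn_addr n (ltn_ord j)).
    have h2 := hx' (n + j)%N ltac:(by rewrite ltn_add2l).
    by move: h1 h2; rewrite /dec; cunfold; rewrite /Rminus; lra.
  move=> h3; have := h3 hclose; have := Cnorm_tri_rev (F (dec x')) (F (dec x)); lra.
exists B => w hw.
pose x i := if (i < n)%N then (if insub i is Some j then Cre (w j) else 0)
  else (if insub (i - n)%N is Some j then Cim (w j) else 0).
have ex (j : 'I_n) : x j = Cre (w j) by rewrite /x ltn_ord valK.
have ex' (j : 'I_n) : x (n + j)%N = Cim (w j) by rewrite /x ltnNge leq_addr /= addKn valK.
have -> : w = dec x.
  by apply: functional_extensionality => j; rewrite /dec ex ex'; case: (w j).
apply: hB => i hi; case: (ltnP i n) => hin.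
  have -> : i = Ordinal hin by [].
  rewrite ex ea eb; have [/Rabs_le_between h _] := hw (Ordinal hin); lra.
have hin' : (i - n < n)%N by rewrite ltn_subLR.
have -> : i = (n + Ordinal hin')%N by rewrite /= subnKC.
rewrite ex' ea' eb'; have [_ /Rabs_le_between h] := hw (Ordinal hin'); lra.
Qed.

End Tube.

Lemma rsum_recr (U : nat -> R) m : \rsum_(i < m.+1) U i = \rsum_(i < m) U i + U m.
Proof. by rewrite big_ord_recr. Qed.

Lemma CInt_riemann (g : R -> cplx) (v : nat -> R) a h K : 0 < h ->
  lcont_on g a (a + INR K * h) ->
  (forall i t, (i < K)%N -> a + INR i * h <= t <= a + INR i.+1 * h -> Cnorm (g t) <= v i) ->
  Cnorm (CInt g a (a + INR K * h)) <= 2 * h * \rsum_(i < K) v i.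
Proof.
move=> hh; elim: K => [|K IH] hc hv.
  rewrite big_ord0; have -> : a + INR 0 * h = a by rewrite /=; ring.
  have -> : CInt g a a = C0 by rewrite /CInt !RInt_point.
  by rewrite Cnorm0; lra.
have hK := pos_INR K.
have e : a + INR K.+1 * h = a + INR K * h + h by rewrite S_INR; ring.
rewrite (@CInt_Chasles g a (a + INR K * h)) //; try (rewrite ?e; nra).
have h1 : Cnorm (CInt g a (a + INR K * h)) <= 2 * h * \rsum_(i < K) v i.
  apply: IH; last by move=> i t hi; apply: hv; exact: ltnW.
  by move=> t ht; apply: hc; rewrite e; lra.
have h2 : Cnorm (CInt g (a + INR K * h) (a + INR K.+1 * h)) <=
    2 * v K * (a + INR K.+1 * h - (a + INR K * h)).
  apply: CInt_bound; first by rewrite e; lra.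
    by move=> t ht; apply: hc; nra.
  by move=> t ht; apply: hv.
have e2 : 2 * v K * (a + INR K.+1 * h - (a + INR K * h)) = 2 * h * v K by rewrite e; ring.
rewrite e2 in h2; move: h2; move: (a + INR K.+1 * h) => E h2.
rewrite rsum_recr; apply: Rle_trans (Cnorm_tri _ _) _; lra.
Qed.

Lemma rsum_shift_le (U : nat -> R) o m K : (forall i, 0 <= U i) -> (o + m <= K)%N ->
  \rsum_(i < m) U (o + i)%N <= \rsum_(i < K) U i.
Proof.
move=> hU hK.
have e : \rsum_(i < m) U (o + i)%N = \rsum_(i < o + m) U i - \rsum_(i < o) U i.
  clear hK; elim: m => [|m IH]; first by rewrite big_ord0 addn0; ring.
  by rewrite (rsum_recr (fun i => U (o + i)%N)) IH addnS rsum_recr; ring.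
have mono k : \rsum_(i < o + m) U i <= \rsum_(i < o + m + k) U i.
  elim: k => [|k IH]; first by rewrite addn0; lra.
  by rewrite addnS rsum_recr; have := hU (o + m + k)%N; lra.
have h0 : 0 <= \rsum_(i < o) U i by apply: rsum_ge0.
by have := mono (K - (o + m))%N; rewrite subnKC // e; lra.
Qed.

(** * A sub-mean value inequality on square grids *)

Section GridOne.
Variables (f : cplx -> cplx) (z0 : cplx) (r eps : R) (M : nat).
Hypotheses (hr : 0 < r) (hM : (0 < M)%N).
Let K := (4 * M)%N.
Let h := r / (2 * INR M).
Let x0 := Cre z0.
Let y0 := Cim z0.
Let sq := inrect (x0 - r) (x0 + r) (y0 - r) (y0 + r).
Hypothesis hf : forall z, sq z -> cdiff f z.
Hypothesis hmod : forall z w, sq z -> sq w ->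
  Rabs (Cre z - Cre w) <= h -> Rabs (Cim z - Cim w) <= h -> Cnorm (f z - f w)%C <= eps.

Definition gtau (i : nat) := - r + INR i * h.

Let hMR : 1 <= INR M. Proof. by apply: (le_INR 1); apply/leP. Qed.
Let hh : 0 < h. Proof. by rewrite /h; apply: Rdiv_lt_0_compat; have := hMR; lra. Qed.
Let hMh : INR M * h = r / 2. Proof. by rewrite /h; field; have := hMR; lra. Qed.
Let hK : INR K * h = 2 * r.
Proof. by rewrite /K mult_INR [INR 4]/= Rmult_assoc hMh; lra. Qed.

Let gtau_rng i : (i <= K)%N -> - r <= gtau i <= r.
Proof.
move=> hi; have h1 : INR i <= INR K by apply: le_INR; apply/leP.
by have := pos_INR i; rewrite /gtau; have := hK; have := hh; nra.
Qed.

Let u (a b : nat) := Cnorm (f (x0 + gtau a, y0 + gtau b)).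
Let u0 a b : 0 <= u a b. Proof. exact: Cnorm_ge0. Qed.

(** All contours that will be used have half-side at least r / 2, so the Cauchy kernel is at most 2
    / r on them, and each edge integral is dominated by a sum over one row or column of the grid. *)
Lemma edge_bound (c s : R) (o m : nat) (pos : R -> cplx) (uu : nat -> R) :
  (o + m <= K)%N -> r / 2 <= s -> (forall i, 0 <= uu i) -> 0 <= eps ->
  (forall t, c + gtau o <= t <= c + gtau (o + m)%N -> s <= Cnorm (pos t - z0)%C) ->
  (forall i t, (i < m)%N -> c + gtau (o + i)%N <= t <= c + gtau (o + i)%N + h ->
     Cnorm (f (pos t)) <= uu (o + i)%N + eps) ->
  lcont_on (fun t => f (pos t) / (pos t - z0))%C (c + gtau o) (c + gtau (o + m)%N) ->
  Cnorm (CInt (fun t => f (pos t) / (pos t - z0))%C (c + gtau o) (c + gtau (o + m)%N)) <=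
    4 * h / r * (\rsum_(i < K) uu i + INR K * eps).
Proof.
move=> hom hs huu heps hpos hval hcont.
have egt i : c + gtau (o + i)%N = c + gtau o + INR i * h by rewrite /gtau plus_INR; ring.
rewrite egt in hcont hpos *.
have hs0 : 0 < s by lra.
apply: Rle_trans (@CInt_riemann _ (fun i => 2 / r * (uu (o + i)%N + eps)) _ h m hh hcont _) _.
- move=> i t hi; rewrite S_INR => ht.
  have ht2 : c + gtau o <= t <= c + gtau o + INR m * h.
    have hm : INR i.+1 <= INR m by apply: le_INR; apply/leP.
    have := pos_INR i; have := hh; move: ht hm; rewrite S_INR; nra.
  have h2 := hpos t ht2.
  have hn : (pos t - z0)%C <> C0 by move=> e; move: h2; rewrite e Cnorm0; lra.
  rewrite Cnorm_mul Cnorm_inv // Rmult_comm; apply: Rmult_le_compat.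
  + by apply: Rlt_le; apply: Rinv_0_lt_compat; lra.
  + exact: Cnorm_ge0.
  + have -> : 2 / r = / (r / 2) by field; lra.
    by apply: Rinv_le_contravar; lra.
  + by apply: hval => //; rewrite egt; lra.
rewrite rsum_scal.
have h3 : \rsum_(i < m) (uu (o + i)%N + eps) <= \rsum_(i < K) uu i + INR K * eps.
  rewrite rsum_add rsum_ord_const; apply: Rplus_le_compat; first exact: rsum_shift_le.
  apply: Rmult_le_compat_r => //; apply: le_INR; apply/leP.
  by apply: leq_trans hom; exact: leq_addl.
have -> : 4 * h / r * (\rsum_(i < K) uu i + INR K * eps) =
  2 * h * (2 / r * (\rsum_(i < K) uu i + INR K * eps)) by field; lra.
apply: Rmult_le_compat_l; first by have := hh; lra.
by apply: Rmult_le_compat_l => //; apply: Rdiv_le_0_compat; lra.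
Qed.

(* Average of Cauchy's formula over the [M] concentric squares through the points of the grid. *)
Lemma grid_one : 0 <= eps ->
  Cnorm (f z0) <= 64 / (INR K * INR K) * \rsum_(a < K) \rsum_(b < K) u a b + 16 * eps.
Proof.
move=> heps; set T := \rsum_(a < K) _.
have key (b : 'I_M) : 2 * PI * Cnorm (f z0) <=
   2 / INR M * (\rsum_(a < K) u a (M - b)%N + \rsum_(a < K) u a (3 * M + b)%N
     + \rsum_(a < K) u (M - b)%N a + \rsum_(a < K) u (3 * M + b)%N a + 4 * (INR K * eps)).
  (* The grid lines with indices M - b and 3 * M + b are those at - (r / 2 + b * h) and r / 2 + b *
     h; between them lie 2 * (M + b) cells. *)
  set o := (M - b)%N; set m := (2 * (M + b))%N.
  have hbM := ltn_ord b.
  have hom : (3 * M + b = o + m)%N by rewrite /o /m; lia.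
  have homK : (o + m <= K)%N by rewrite -hom /K; lia.
  rewrite hom.
  set s := r / 2 + INR b * h.
  have hb0 : 0 <= INR b * h by apply: Rmult_le_pos; [exact: pos_INR|have := hh; lra].
  have eo : gtau o = - s.
    rewrite /gtau /o minus_INR; last by apply/leP; exact: ltnW.
    by rewrite Rmult_minus_distr_r hMh /s; lra.
  have eom : gtau (o + m)%N = s.
    rewrite -hom /gtau plus_INR mult_INR Rmult_plus_distr_r Rmult_assoc hMh [INR 3]/= /s; lra.
  have hsr : r / 2 <= s <= r.
    have := @gtau_rng (o + m) homK; rewrite eom /s; lra.
  have exm : x0 - s = x0 + gtau o by rewrite eo; ring.
  have exp' : x0 + s = x0 + gtau (o + m)%N by rewrite eom.
  have eym : y0 - s = y0 + gtau o by rewrite eo; ring.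
  have eyp : y0 + s = y0 + gtau (o + m)%N by rewrite eom.
  have hx : x0 - s < Cre z0 < x0 + s by rewrite /x0; lra.
  have hy : y0 - s < Cim z0 < y0 + s by rewrite /y0; lra.
  have hsub z : inrect (x0 - s) (x0 + s) (y0 - s) (y0 + s) z -> sq z.
    by rewrite /sq /inrect; lra.
  have hCF := @Cauchy_formula f z0 _ _ _ _ hx hy (fun z hz => hf (hsub z hz)).
  have hbc : bcont (fun z => f z / (z - z0))%C (x0 - s) (x0 + s) (y0 - s) (y0 + s).
    move=> z hz; apply: cdiff_cont; apply: cdiff_mul; first by apply: hf; apply: hsub; case: hz.
    by apply: cdiff_inv_sub; apply: onbdry_neq hz.
  have hdist z : onbdry (x0 - s) (x0 + s) (y0 - s) (y0 + s) z -> s <= Cnorm (z - z0)%C.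
    by apply: onbdry_dist; rewrite -/x0 -/y0; lra.
  have hin i : (i < m)%N -> - s <= gtau (o + i)%N /\ gtau (o + i)%N + h <= s.
    move=> hi; have hm : INR i.+1 <= INR m by apply: le_INR; apply/leP.
    have e1 : gtau (o + i)%N = - s + INR i * h by move: eo; rewrite /gtau plus_INR; lra.
    have e2 : - s + INR m * h = s by move: eo eom; rewrite /gtau plus_INR; lra.
    have := pos_INR i; have := hh; move: hm; rewrite e1 S_INR; nra.
  have near z w : sq z -> sq w -> Rabs (Cre z - Cre w) <= h -> Rabs (Cim z - Cim w) <= h ->
      Cnorm (f z) <= Cnorm (f w) + eps.
    by move=> h1 h2 h3 h4; have := hmod h1 h2 h3 h4; have := Cnorm_tri_rev (f z) (f w); lra.
  have hss : - s <= s by lra.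
  have Hrow (c : nat) : (gtau c = - s \/ gtau c = s) ->
    Cnorm (CInt (fun t => f (t, y0 + gtau c)%R / ((t, y0 + gtau c)%R - z0))%C (x0 + gtau o) (x0 + gtau (o + m)%N))
      <= 4 * h / r * (\rsum_(a < K) u a c + INR K * eps).
    move=> hc; apply: (@edge_bound x0 s o m (fun t => (t, y0 + gtau c)) (fun a => u a c)) => //; try lra.
    - by move=> t; rewrite eo eom => ht; apply: hdist; rewrite /onbdry /inrect /=; lra.
    - move=> i t hi ht; have [h1 h2] := hin i hi.
      apply: near; rewrite /sq /inrect /=; try (apply: Rabs_le); lra.
    - move=> t; rewrite eo eom => ht.
      apply: (@lcont_hor (fun z => f z / (z - z0))%C); apply: hbc; rewrite /onbdry /inrect /=; lra.
  have Hcol (c : nat) : (gtau c = - s \/ gtau c = s) ->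
    Cnorm (CInt (fun t => f (x0 + gtau c, t)%R / ((x0 + gtau c, t)%R - z0))%C (y0 + gtau o) (y0 + gtau (o + m)%N))
      <= 4 * h / r * (\rsum_(a < K) u c a + INR K * eps).
    move=> hc; apply: (@edge_bound y0 s o m (fun t => (x0 + gtau c, t)) (fun a => u c a)) => //; try lra.
    - by move=> t; rewrite eo eom => ht; apply: hdist; rewrite /onbdry /inrect /=; lra.
    - move=> i t hi ht; have [h1 h2] := hin i hi.
      apply: near; rewrite /sq /inrect /=; try (apply: Rabs_le); lra.
    - move=> t; rewrite eo eom => ht.
      apply: (@lcont_ver (fun z => f z / (z - z0))%C); apply: hbc; rewrite /onbdry /inrect /=; lra.
  have r1 := Hrow o (or_introl eo); have r2 := Hrow (o + m)%N (or_intror eom).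
  have c1 := Hcol o (or_introl eo); have c2 := Hcol (o + m)%N (or_intror eom).
  rewrite -Cnorm_2PI_Ci -hCF exm exp' eym eyp /bdry.
  have -> : 2 / INR M = 4 * h / r by rewrite /h; field; have := hMR; lra.
  apply: Rle_trans (Cnorm_tri_sub _ _) _.
  apply: Rle_trans (Rplus_le_compat_r _ _ _ (Cnorm_tri_sub _ _)) _.
  apply: Rle_trans (Rplus_le_compat_r _ _ _ (Rplus_le_compat_r _ _ _ (Cnorm_tri _ _))) _.
  rewrite !(Cnorm_mul Ci) Cnorm_Ci !Rmult_1_l.
  lra.
(* Summed over [b], each of the four edge terms runs over distinct rows or columns, hence is at most
   the full double sum [T]. *)
have hsum : INR M * (2 * PI * Cnorm (f z0)) <= 2 / INR M * (4 * T + INR M * (4 * (INR K * eps))).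
  rewrite -rsum_ord_const.
  apply: Rle_trans; first by apply: rsum_le => b _; exact: key.
  rewrite rsum_scal; apply: Rmult_le_compat_l.
    by apply: Rdiv_le_0_compat; have := hMR; lra.
  rewrite !rsum_add rsum_ord_const; apply: Rplus_le_compat_r.
  have eT : \rsum_(b < K) \rsum_(a < K) u a b = T by rewrite exchange_big.
  have hi (U : nat -> R) : (forall i, 0 <= U i) -> \rsum_(b < M) U (3 * M + b)%N <= \rsum_(b < K) U b.
    by move=> hU; apply: rsum_shift_le => //; rewrite /K; lia.
  have lo (U : nat -> R) : (forall i, 0 <= U i) -> \rsum_(b < M) U (M - b)%N <= \rsum_(b < K) U b.
    move=> hU; rewrite (reindex_inj rev_ord_inj) /=.
    rewrite (eq_bigr (fun b : 'I_M => U (1 + b)%N)); last first.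
      by move=> b _; congr U; rewrite subKn.
    by apply: rsum_shift_le => //; rewrite /K; lia.
  have g0 (G : nat -> 'I_K -> R) : (forall i j, 0 <= G i j) -> forall i, 0 <= \rsum_(a < K) G i a.
    by move=> hG i; apply: rsum_ge0 => a _.
  have q1 := lo (fun b => \rsum_(a < K) u a b) (g0 (fun b a => u a b) (fun _ _ => u0 _ _)).
  have q2 := hi (fun b => \rsum_(a < K) u a b) (g0 (fun b a => u a b) (fun _ _ => u0 _ _)).
  have q3 := lo (fun b => \rsum_(a < K) u b a) (g0 (fun b a => u b a) (fun _ _ => u0 _ _)).
  have q4 := hi (fun b => \rsum_(a < K) u b a) (g0 (fun b a => u b a) (fun _ _ => u0 _ _)).
  rewrite eT in q1 q2; rewrite -/T in q3 q4.
  by move: q1 q2 q3 q4; rewrite /=; lra.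
have hPI := PI2_3_2.
have hMR0 := hMR.
have hT0 : 0 <= T by apply: rsum_ge0 => a _; apply: rsum_ge0 => b _; exact: u0.
have n0 := Cnorm_ge0 (f z0).
have eK : INR K = 4 * INR M by rewrite /K mult_INR [INR 4]/=; ring.
rewrite eK in hsum *.
have -> : 64 / (4 * INR M * (4 * INR M)) * T + 16 * eps =
  / (INR M * 2) * (2 / INR M * (4 * T + INR M * (4 * (4 * INR M * eps)))).
  by field; lra.
apply: Rle_trans (_ : / (INR M * 2) * (INR M * (2 * PI * Cnorm (f z0))) <= _); last first.
  by apply: Rmult_le_compat_l => //; apply: Rlt_le; apply: Rinv_0_lt_compat; lra.
have -> : / (INR M * 2) * (INR M * (2 * PI * Cnorm (f z0))) = PI * Cnorm (f z0) by field; lra.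
nra.
Qed.

End GridOne.

Section GridMulti.
Variables (n K : nat).

Definition fupd (al : {ffun 'I_n -> 'I_K}) (j : 'I_n) (a : 'I_K) : {ffun 'I_n -> 'I_K} :=
  [ffun i => if i == j then a else al i].

(** The involution exchanging coordinate [j] of [al] with the extra index [a] turns the summand into
    Psi al, which leaves a free sum of [K] equal terms. *)
Lemma sum_fupd j (Psi : {ffun 'I_n -> 'I_K} -> R) :
  \big[Rplus/0]_al \big[Rplus/0]_a Psi (fupd al j a) = INR K * \big[Rplus/0]_al Psi al.
Proof.
rewrite pair_big /=.
pose phi (x : {ffun 'I_n -> 'I_K} * 'I_K) := (fupd x.1 j x.2, x.1 j).
have phiK : involutive phi.
  move=> [al a]; rewrite /phi /=; congr (_, _); last by rewrite ffunE eqxx.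
  by apply/ffunP => i; rewrite !ffunE; case: eqP => // ->.
rewrite (reindex_inj (inv_inj phiK)) /=.
rewrite (eq_bigr (fun x : {ffun 'I_n -> 'I_K} * 'I_K => Psi x.1)); last first.
  move=> [al a] _ /=; congr Psi.
  by apply/ffunP => i; rewrite !ffunE; case: eqP => // ->.
rewrite -(pair_big xpredT xpredT (fun al (a : 'I_K) => Psi al)) /= -rsum_scal.
by apply: eq_bigr => al _; rewrite rsum_ord_const.
Qed.

End GridMulti.

Section Bounded.
Variable n : nat.
Implicit Types (F : CVec n -> cplx) (z w : CVec n).

Definition gridpt z r M (al be : {ffun 'I_n -> 'I_(4 * M)}) (k : nat) : CVec n :=
  fun j => if (j < k)%N then (Cre (z j) + gtau r M (al j), Cim (z j) + gtau r M (be j)) else z j.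

Lemma gtau_bound r M i : 0 < r -> (0 < M)%N -> (i <= 4 * M)%N -> Rabs (gtau r M i) <= r.
Proof.
move=> hr hM hi; have hMR : 1 <= INR M by apply: (le_INR 1); apply/leP.
have h1 : INR i <= 4 * INR M.
  by have := le_INR i (4 * M)%coq_nat; rewrite mult_INR [INR 4]/= => h; have := h ltac:(lia); lra.
have hh : 0 < r / (2 * INR M) by apply: Rdiv_lt_0_compat; lra.
have e : 4 * INR M * (r / (2 * INR M)) = 2 * r by field; lra.
have hi0 := pos_INR i; apply: Rabs_le; rewrite /gtau; nra.
Qed.

Lemma gridpt_polysq z r M (al be : {ffun 'I_n -> 'I_(4 * M)}) k : 0 < r -> (0 < M)%N -> polysq z r (gridpt z r al be k).
Proof.
move=> hr hM j; rewrite /gridpt; case: ifP => _; last by rewrite !Rminus_diag Rabs_R0; lra.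
rewrite /Cre /Cim /=; split.
- have -> : (z j).1 + gtau r M (al j) - (z j).1 = gtau r M (al j) by ring.
  by apply: gtau_bound => //; exact: ltnW.
- have -> : (z j).2 + gtau r M (be j) - (z j).2 = gtau r M (be j) by ring.
  by apply: gtau_bound => //; exact: ltnW.
Qed.

(** Induction on the number [k] of averaged coordinates, each application of [grid_one] costing a
    factor 64. The sums run over all [n] indices from the start, so that [k] affects only the
    points, and [sum_fupd] absorbs the newly created average. *)
Lemma grid_multi F z r M eps : holomorphic_on_tube F -> 0 < r -> (0 < M)%N -> 0 <= eps ->
  (forall w, polysq z r w -> in_tube w) ->
  (forall v w, polysq z r v -> polysq z r w ->
     polysq v (r / (2 * INR M)) w -> Cnorm (F v - F w)%C <= eps) ->
  forall k, (k <= n)%N ->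
  Cnorm (F z) <= 64 ^ k * / (INR (4 * M) ^ n * INR (4 * M) ^ n) *
     \big[Rplus/0]_al \big[Rplus/0]_be Cnorm (F (@gridpt z r M al be k)) + 16 * eps * (INR k * 64 ^ k).
Proof.
move=> hF hr hM heps htube hmod.
have hMR : 1 <= INR M by apply: (le_INR 1); apply/leP.
set K := (4 * M)%N.
have hK : 0 < INR K by apply: lt_0_INR; rewrite /K; lia.
have hKn : 0 < INR K ^ n by exact: pow_lt.
have cardK : INR #|{: {ffun 'I_n -> 'I_K}}| = INR K ^ n.
  rewrite card_ffun !card_ord; elim: (n) => [//|m IH].
  by rewrite expnS mult_INR IH.
elim=> [|k IH] hk.
  have e (al be : {ffun 'I_n -> 'I_K}) : gridpt z r al be 0 = z.
    by apply: functional_extensionality.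
  under eq_bigr => al _ do under eq_bigr => be _ do rewrite e.
  under eq_bigr => al _ do rewrite rsum_const cardK.
  rewrite rsum_const cardK /=; apply: Req_le; field; lra.
apply: Rle_trans (IH (ltnW hk)) _.
pose j := Ordinal hk.
pose Psi al be := Cnorm (F (@gridpt z r M al be k.+1)).
have hstep al be : Cnorm (F (@gridpt z r M al be k)) <=
   64 / (INR K * INR K) * \big[Rplus/0]_(a < K) \big[Rplus/0]_(b < K) Psi (fupd al j a) (fupd be j b)
   + 16 * eps.
  set v := gridpt z r al be k.
  have hv : polysq z r v by exact: gridpt_polysq.
  have hvj : v j = z j by rewrite /v /gridpt /= ltnn.
  have hup u : inrect (Cre (v j) - r) (Cre (v j) + r) (Cim (v j) - r) (Cim (v j) + r) u ->
      polysq z r (cupdate v j u).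
    rewrite hvj => -[h1 h2] i; rewrite /cupdate; case: eqP => [->|_]; last exact: hv.
    by split; apply: Rabs_le; lra.
  have := @grid_one (fun u => F (cupdate v j u)) (v j) r eps M hr hM.
  rewrite cupdate_id => h.
  apply: Rle_trans (h _ _ heps) _.
  - move=> u hu; have ht := htube _ (hup u hu).
    apply: hol_slice => //; last by have := ht j; rewrite cupdate_same.
    by move=> i hi; have := ht i; rewrite /cupdate (negbTE hi).
  - move=> u u' hu hu' h1 h2; apply: hmod; try exact: hup.
    move=> i; rewrite /cupdate; case: eqP => _; last first.
      rewrite !Rminus_diag Rabs_R0; have : 0 < r / (2 * INR M) by apply: Rdiv_lt_0_compat; lra.
      lra.
    by rewrite Rabs_minus_sym (Rabs_minus_sym (Cim u')).
  apply: Req_le; congr (_ * _ + _); apply: eq_bigr => a _; apply: eq_bigr => b _.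
  rewrite /Psi; congr (Cnorm (F _)); apply: functional_extensionality => i.
  rewrite hvj /cupdate /gridpt /v /gridpt !ffunE ltnS.
  case: (eqVneq i j) => [->|hij]; first by rewrite /= leqnn.
  by rewrite (leq_eqVlt i k); have -> : (i == k :> nat) = false by apply/negbTE.
have hsum : \big[Rplus/0]_al \big[Rplus/0]_be Cnorm (F (@gridpt z r M al be k)) <=
   64 * (\big[Rplus/0]_al \big[Rplus/0]_be Psi al be) + INR K ^ n * INR K ^ n * (16 * eps).
  apply: Rle_trans; first by apply: rsum_le => al _; apply: rsum_le => be _; exact: hstep.
  apply: Req_le.
  have -> : \big[Rplus/0]_al \big[Rplus/0]_be (64 / (INR K * INR K) *
      \big[Rplus/0]_(a < K) \big[Rplus/0]_(b < K) Psi (fupd al j a) (fupd be j b) + 16 * eps)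
    = 64 / (INR K * INR K) * (\big[Rplus/0]_al \big[Rplus/0]_be
      \big[Rplus/0]_(a < K) \big[Rplus/0]_(b < K) Psi (fupd al j a) (fupd be j b))
      + INR K ^ n * INR K ^ n * (16 * eps).
    rewrite -rsum_scal -[X in _ = _ + X](_ : \big[Rplus/0]_(al : {ffun 'I_n -> 'I_K})
       (INR K ^ n * (16 * eps)) = _); last by rewrite rsum_const cardK; ring.
    rewrite -rsum_add; apply: eq_bigr => al _; rewrite rsum_add rsum_scal rsum_const cardK //.
  congr (_ + _).
  have -> : \big[Rplus/0]_al \big[Rplus/0]_be
      \big[Rplus/0]_(a < K) \big[Rplus/0]_(b < K) Psi (fupd al j a) (fupd be j b) =
    INR K * INR K * \big[Rplus/0]_al \big[Rplus/0]_be Psi al be.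
    rewrite Rmult_assoc -rsum_scal -(sum_fupd j); apply: eq_bigr => al _.
    rewrite exchange_big /=; apply: eq_bigr => a _.
    by rewrite sum_fupd.
  by field; lra.
have h64 : 0 < 64 ^ k by apply: pow_lt; lra.
have hpos : 0 < 64 ^ k * / (INR K ^ n * INR K ^ n).
  by apply: Rmult_lt_0_compat => //; apply: Rinv_0_lt_compat; nra.
have h1 := Rmult_le_compat_l _ _ _ (Rlt_le _ _ hpos) hsum.
have e1 : 64 ^ k * / (INR K ^ n * INR K ^ n) * (64 * (\big[Rplus/0]_al \big[Rplus/0]_be Psi al be)
   + INR K ^ n * INR K ^ n * (16 * eps)) =
  64 ^ k.+1 * / (INR K ^ n * INR K ^ n) * (\big[Rplus/0]_al \big[Rplus/0]_be Psi al be)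
   + 64 ^ k * (16 * eps).
  by rewrite /=; field; lra.
rewrite e1 in h1.
have e2 : 64 ^ k * (16 * eps) + 16 * eps * (INR k * 64 ^ k) <= 16 * eps * (INR k.+1 * 64 ^ k.+1).
  rewrite S_INR -tech_pow_Rmult; have := pos_INR k => hk0.
  have : 0 <= 16 * eps * 64 ^ k * (INR k + 1) by apply: Rmult_le_pos; [nra|lra].
  nra.
apply: Rle_trans (Rplus_le_compat_r _ _ _ h1) _.
by rewrite Rplus_assoc; apply: Rplus_le_compat_l.
Qed.

(** [grid_multi] averages |F|, while only p-means are controlled and [p] may be below 1. Let [Phi]
    be the supremum of |F(z)| * s^gam over points [z] at distance at least [s] from the edge of a
    polysquare; it is finite by compactness. Near an almost extremal point |F| <= M1, hence |F| <=
    M1^(1 - p0) * |F|^p0, and averaging gives Phi <= const * Phi^(1 - p0) with a constant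
    independent of the centre. This bounds [Phi]. *)
Lemma Hp_bounded p F : 0 < p -> in_Hp p F ->
  forall delta, 0 < delta -> exists A, 0 < A /\
    forall z, (forall j, delta <= Cim (z j)) -> Cnorm (F z) <= A.
Proof.
move=> hp [hF [M [hM hN]]] delta0 hdelta0.
set delta := Rmin delta0 1.
have hdelta : 0 < delta by apply: Rmin_glb_lt; lra.
have hdelta1 : delta <= 1 by exact: Rmin_r.
set Mp := rpow M p; have hMp : 0 <= Mp by exact: rpow_ge0.
(* p0 < 1 keeps the exponent 1 - p0 positive, and p0 <= p gives t^p0 <= 1 + t^p. *)
set p0 := Rmin p (1 / 2).
have hp0 : 0 < p0 by apply: Rmin_glb_lt; lra.
have hp01 : p0 <= 1 / 2 by exact: Rmin_r.
have hp02 : p0 <= p by exact: Rmin_l.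
(* With this exponent s^(gam * p0) = s^n, which compensates the factor s^(-n) of an average over a
   cube of side proportional to [s]. *)
set gam := INR n / p0.
have hgam : 0 <= gam by apply: Rdiv_le_0_compat => //; exact: pos_INR.
set C := 64 ^ n; have hC : 1 <= C by rewrite /C; apply: pow_R1_Rle; lra.
set r0 := delta / 2; have hr0 : 0 < r0 by rewrite /r0; lra.
set D := 1 + 2 ^ n * Mp.
have hD : 1 <= D by have : 0 <= 2 ^ n by [apply: pow_le; lra|]; rewrite /D; nra.
have h2g : 1 <= rpow 2 gam by rewrite -(rpow_one gam); apply: rpow_le; lra.
set Bd := 2 * C * rpow 2 gam * D.
have hBd : 0 < Bd by rewrite /Bd; repeat apply: Rmult_lt_0_compat; lra.
set Phi0 := rpow Bd (/ p0).
have hPhi0 : 0 < Phi0 by exact: rpow_gt0.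
exists (Phi0 / rpow r0 gam); split; first by apply: Rdiv_lt_0_compat => //; exact: rpow_gt0.
move=> z0 hz0.
have hz0' j : delta <= Cim (z0 j) by apply: Rle_trans (Rmin_l _ _) (hz0 j).
have htube w : polysq z0 r0 w -> in_tube w.
  by move=> hw j; have [_ /Rabs_le_between h] := hw j; have := hz0' j; rewrite /r0 in h; lra.
have [B hB] := hol_bounded_polysq hF htube.
pose E v := exists z s, [/\ 0 < s, s <= r0, polysq z0 (r0 - s) z & v = Cnorm (F z) * rpow s gam].
have hin z s : 0 < s -> polysq z0 (r0 - s) z -> polysq z0 r0 z.
  by move=> hs h j; have := h j; lra.
have hEb : bound E.
  exists (B * rpow r0 gam) => v [z [s [h1 h2 h3 ->]]].
  apply: Rmult_le_compat; try exact: Cnorm_ge0; try exact: rpow_ge0.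
  - by apply: hB; exact: hin h3.
  - exact: rpow_le.
have hEz : E (Cnorm (F z0) * rpow r0 gam).
  by exists z0, r0; split => //; [lra|apply: polysq_refl; lra].
have [Phi [hP1 hP2]] := completeness E hEb (ex_intro _ _ hEz).
have hz := hP1 _ hEz.
suff hPhi : Phi <= Phi0.
  by apply/Rle_div_r; [exact: rpow_gt0|lra].
have [hneg|hpos] := Rle_lt_dec Phi 0; first lra.
have [v [[z [s [hs hsr hzs ->]]] hv]] : exists v, E v /\ Phi / 2 < v.
  case: (excluded_middle_informative (exists v, E v /\ Phi / 2 < v)) => // hno.
  have : Phi <= Phi / 2; last lra.
  by apply: hP2 => v hEv; apply: Rnot_lt_le => hlt; apply: hno; exists v.
have hs1 : s <= 1 by rewrite /r0 in hsr; lra.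
(* Points within s / 2 of [z] enter the supremum with margin s / 2, so |F| <= M1 at all of them. *)
set M1 := Phi / rpow (s / 2) gam.
have hsg : 0 < rpow (s / 2) gam by apply: rpow_gt0; lra.
have hM1 : 0 < M1 by exact: Rdiv_lt_0_compat.
have hsq w : polysq z (s / 2) w -> in_tube w /\ Cnorm (F w) <= M1.
  move=> hw; have hzw : polysq z0 (r0 - s / 2) w.
    by have := polysq_trans hzs hw; have -> : r0 - s + s / 2 = r0 - s / 2 by field.
  split; first by apply: htube; apply: (hin _ (s / 2)) => //; lra.
  apply/Rle_div_r => //; apply: hP1; exists w, (s / 2); split => //; lra.
set rr := s / 4.
have hrr : 0 < rr by rewrite /rr; lra.
have hkey : Cnorm (F z) <= C * (rpow M1 (1 - p0) * (1 + / (2 * rr) ^ n * Mp)).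
  apply: (@le_eps_scal _ _ (C + 16 * (INR n * 64 ^ n))).
    have : 0 <= INR n * 64 ^ n by apply: Rmult_le_pos; [exact: pos_INR|apply: pow_le; lra].
    lra.
  move=> eps heps.
  set Lc := INR n * (32 * M1 / rr) + 1.
  have hLc : 0 < Lc.
    have : 0 <= INR n * (32 * M1 / rr).
      by apply: Rmult_le_pos; [exact: pos_INR|apply: Rdiv_le_0_compat; lra].
    rewrite /Lc; lra.
  have [M0 hM0] := INR_unbounded (rr / Rmin (rr / 8) (eps / (2 * Lc)) + 1).
  have hmn : 0 < Rmin (rr / 8) (eps / (2 * Lc)).
    by apply: Rmin_glb_lt; [lra|apply: Rdiv_lt_0_compat; lra].
  have hM0p : 0 < rr / Rmin (rr / 8) (eps / (2 * Lc)) by exact: Rdiv_lt_0_compat.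
  have hM00 : (0 < M0)%N by apply/ltP; apply: INR_lt; rewrite /=; lra.
  set h := rr / (2 * INR M0).
  have hM0R : 1 < INR M0 by lra.
  have hh : 0 < h by apply: Rdiv_lt_0_compat; lra.
  have hhs : 2 * h <= Rmin (rr / 8) (eps / (2 * Lc)).
    have -> : 2 * h = rr / INR M0 by rewrite /h; field; lra.
    apply/Rle_div_l; first lra.
    have h1 : rr / Rmin (rr / 8) (eps / (2 * Lc)) < INR M0 by lra.
    move/Rlt_div_l: h1 => h1; have := h1 hmn; lra.
  have hh1 : 2 * h <= rr / 8 by apply: Rle_trans hhs (Rmin_l _ _).
  have hh2 : 2 * h <= eps / (2 * Lc) by apply: Rle_trans hhs (Rmin_r _ _).
  have hmod v1 w : polysq z rr v1 -> polysq v1 h w -> Cnorm (F v1 - F w)%C <= eps.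
    move=> hv1 hw1; rewrite Cnorm_sub_sym.
    have hsq2 w' : polysq v1 rr w' -> in_tube w' /\ Cnorm (F w') <= M1.
      move=> hw'; apply: hsq; have := polysq_trans hv1 hw'.
      by have -> : rr + rr = s / 2 by rewrite /rr; field.
    apply: Rle_trans (@Cnorm_lip_poly n F v1 rr M1 hrr hF hsq2 w (2 * h) ltac:(lra) _) _.
      move=> j; have [a1 a2] := hw1 j; apply: Rle_trans (Cnorm_le_sum _) _.
      by move: a1 a2; cunfold; rewrite /Rminus; lra.
    have -> : INR n * (32 * M1 / rr * (2 * h)) = INR n * (32 * M1 / rr) * (2 * h) by ring.
    apply: Rle_trans (_ : Lc * (eps / (2 * Lc)) <= _); last first.
      by have -> : Lc * (eps / (2 * Lc)) = eps / 2 by [field; lra|]; lra.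
    apply: Rmult_le_compat => //; try lra; last by rewrite /Lc; lra.
    by apply: Rmult_le_pos; [exact: pos_INR|apply: Rdiv_le_0_compat; lra].
  have htz w : polysq z rr w -> in_tube w.
    by move=> hw; apply: (hsq _ _).1 => j; have := hw j; rewrite /rr; lra.
  have hgm := @grid_multi F z rr M0 eps hF hrr hM00 (Rlt_le _ _ heps) htz
     (fun v w hv _ hvw => hmod v w hv hvw) n (leqnn n).
  set K := (4 * M0)%N in hgm.
  have hK : 0 < INR K by apply: lt_0_INR; rewrite /K; lia.
  have hKn : 0 < INR K ^ n by exact: pow_lt.
  have eKh : INR K * h = 2 * rr by rewrite /K mult_INR [INR 4]/= /h; field; lra.
  have cardK : INR #|{: {ffun 'I_n -> 'I_K}}| = INR K ^ n.
    rewrite card_ffun !card_ord; elim: (n) => [//|m IH].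
    by rewrite expnS mult_INR IH.
  pose G be al := Cnorm (F (@gridpt z rr M0 al be n)).
  (* For fixed imaginary parts, the p-th powers of the grid values lowered by [eps] form a step
     function below |F|^p at the height [y], so the given bound on the p-means applies. *)
  have hrow be : h ^ n * \big[Rplus/0]_al rpow (G be al - eps) p <= Mp.
    pose y : RVec n := fun j => Cim (z j) + gtau rr M0 (be j).
    pose o : RVec n := fun j => Cre (z j) - rr.
    have hyG : in_Gamma y.
      move=> j; have := htz _ (@gridpt_polysq z rr M0 be be n hrr hM00) j.
      by rewrite /gridpt ltn_ord.
    apply: (@cells_lower n o h K hh _ _ (fun al => rpow (G be al - eps) p) _ (hN y hyG)).
      by move=> x; exact: rpow_ge0.
    move=> al x hx; apply: rpow_le; first lra.
    have hnear : Cnorm (F (@gridpt z rr M0 al be n) - F (cpoint x y))%C <= eps.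
      apply: hmod; first exact: gridpt_polysq.
      move=> j; rewrite /cpoint /gridpt ltn_ord /Cof /Cre /Cim /= Rminus_diag Rabs_R0.
      split; last lra.
      have := hx j; rewrite /= /gpt /o /gtau /Cre -/h => hxj; apply: Rabs_le.
      pose a := INR (al j).
      have {}hxj : (z j).1 - rr + a * h <= x j < (z j).1 - rr + a * h + h := hxj.
      change (- h <= x j - ((z j).1 + (- rr + a * h)) <= h); lra.
    by have := Cnorm_tri_rev (F (@gridpt z rr M0 al be n)) (F (cpoint x y)); rewrite /G; lra.
  have hptw be al : G be al <= eps + rpow M1 (1 - p0) * (1 + rpow (G be al - eps) p).
    have hq0 := rpow_ge0 M1 (1 - p0); have hq1 := rpow_ge0 (G be al - eps) p.
    have [hle|hgt] := Rle_lt_dec (G be al) eps; first nra.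
    set t := G be al - eps; have ht : 0 < t by rewrite /t; lra.
    have htM : t <= M1.
      have [_] := hsq (@gridpt z rr M0 al be n) ltac:(move=> j;
        have := @gridpt_polysq z rr M0 al be n hrr hM00 j; rewrite /rr; lra).
      by rewrite /t /G; lra.
    have e1 : t = rpow t (1 - p0) * rpow t p0.
      by rewrite -rpow_plus -[LHS](rpow1 (Rlt_le _ _ ht)); congr rpow; ring.
    have h1 : rpow t (1 - p0) <= rpow M1 (1 - p0) by apply: rpow_le; lra.
    have h2 : rpow t p0 <= 1 + rpow t p.
      have [ht1|ht1] := Rle_lt_dec t 1.
        have : rpow t p0 <= rpow 1 p0 by apply: rpow_le; lra.
        by rewrite rpow_one; have := rpow_ge0 t p; lra.
      suff : rpow t p0 <= rpow t p by lra.
      rewrite !rpow_pos //; apply: exp_le_mono.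
      have : 0 < ln t by rewrite -ln_1; apply: ln_increasing; lra.
      nra.
    have h3 : t <= rpow M1 (1 - p0) * (1 + rpow t p).
      by rewrite {1}e1; apply: Rmult_le_compat => //; exact: rpow_ge0.
    by rewrite -/t in h3 *; rewrite /t in h3 *; lra.
  have hsum : / (INR K ^ n * INR K ^ n) * \big[Rplus/0]_al \big[Rplus/0]_be G be al <=
     eps + rpow M1 (1 - p0) * (1 + / (2 * rr) ^ n * Mp).
    rewrite exchange_big /=.
    have hb be : \big[Rplus/0]_al G be al <=
       INR K ^ n * (eps + rpow M1 (1 - p0) * (1 + / (2 * rr) ^ n * Mp)).
      apply: Rle_trans; first by apply: rsum_le => al _; exact: hptw.
      rewrite rsum_add rsum_scal rsum_add !rsum_const cardK.
      have hro := hrow be.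
      have hhn : 0 < h ^ n by exact: pow_lt.
      have e1 : (2 * rr) ^ n = INR K ^ n * h ^ n by rewrite -Rpow_mult_distr eKh.
      have h1 : \big[Rplus/0]_al rpow (G be al - eps) p <= INR K ^ n * (/ (2 * rr) ^ n * Mp).
        have -> : INR K ^ n * (/ (2 * rr) ^ n * Mp) = / h ^ n * Mp by rewrite e1; field; lra.
        apply: (Rmult_le_reg_l (h ^ n)) => //; rewrite -[X in _ <= X]Rmult_assoc Rinv_r; lra.
      have hq0 := rpow_ge0 M1 (1 - p0).
      have := Rmult_le_compat_l _ _ _ hq0 h1; lra.
    apply: (Rmult_le_reg_l (INR K ^ n * INR K ^ n)); first nra.
    rewrite -Rmult_assoc Rinv_r; last nra.
    rewrite Rmult_1_l.
    apply: Rle_trans; first by apply: rsum_le => be _; exact: hb.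
    by rewrite rsum_const cardK; lra.
  have hC0 : 0 <= C by lra.
  have h3 := Rmult_le_compat_l _ _ _ hC0 hsum.
  move: hgm; rewrite -/C Rmult_assoc /=.
  move: (/ (INR K ^ n * INR K ^ n) * _) h3 => Q h3 hgm; lra.
have hs0 := rpow_gt0 gam hs.
have eM1 : M1 = Phi * rpow 2 gam * / rpow s gam.
  rewrite /M1 /Rdiv rpow_mul; [|lra|lra].
  have -> : rpow (/ 2) gam = / rpow 2 gam.
    have h1 : rpow (/ 2) gam * rpow 2 gam = 1.
      by rewrite -rpow_mul; [rewrite Rinv_l ?rpow_one; lra|lra|lra].
    by apply: (Rmult_eq_reg_r (rpow 2 gam)); [rewrite Rinv_l|]; lra.
  by field; lra.
have hsn : rpow s (gam * p0) = s ^ n.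
  have -> : gam * p0 = INR n by rewrite /gam; field; lra.
  elim: (n) => [|m IH]; first by rewrite /= rpow_pos // Rmult_0_l exp_0.
  by rewrite S_INR rpow_plus IH rpow1 /=; lra.
have hpow1 : rpow M1 (1 - p0) * rpow s gam <= rpow 2 gam * rpow Phi (1 - p0) * s ^ n.
  rewrite eM1 !rpow_mul; try lra; last first.
  - by apply: Rlt_le; apply: Rinv_0_lt_compat.
  - by apply: Rmult_le_pos; lra.
  have e1 : rpow (/ rpow s gam) (1 - p0) * rpow s gam = s ^ n.
    rewrite -hsn -rpow_rpow; set a := rpow s gam in hs0 *.
    have {2}-> : a = rpow a (1 - p0) * rpow a p0.
      by rewrite -rpow_plus -[LHS](rpow1 (Rlt_le _ _ hs0)); congr rpow; ring.
    rewrite -Rmult_assoc -rpow_mul; [|by apply: Rlt_le; exact: Rinv_0_lt_compat|lra].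
    by rewrite Rinv_l ?rpow_one; lra.
  have e2 : rpow (rpow 2 gam) (1 - p0) <= rpow 2 gam.
    rewrite rpow_rpow !rpow_pos; try lra.
    have hl2 : 0 < ln 2 by rewrite -ln_1; apply: ln_increasing; lra.
    apply: exp_le_mono; apply: Rmult_le_compat_r; first lra.
    by have := Rmult_le_pos _ _ hgam (Rlt_le _ _ hp0); lra.
  rewrite Rmult_assoc e1.
  have hsnp : 0 <= s ^ n by apply: pow_le; lra.
  apply: Rmult_le_compat_r => //.
  rewrite Rmult_comm; apply: Rmult_le_compat_r => //; exact: rpow_ge0.
have hsn1 : s ^ n * (1 + / (2 * rr) ^ n * Mp) <= D.
  have hsnp : 0 < s ^ n by exact: pow_lt.
  have -> : (2 * rr) ^ n = s ^ n * (/ 2) ^ n.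
    by rewrite -Rpow_mult_distr; congr (_ ^ _); rewrite /rr; field.
  have h2n : (/ 2) ^ n = / 2 ^ n by rewrite pow_inv.
  have h2p : 0 < 2 ^ n by apply: pow_lt; lra.
  rewrite h2n; have -> : s ^ n * (1 + / (s ^ n * / 2 ^ n) * Mp) = s ^ n + 2 ^ n * Mp by field; lra.
  have : s ^ n <= 1 by rewrite -(pow1 n); apply: pow_incr; lra.
  rewrite /D; lra.
have hfin : Phi / 2 <= C * (rpow 2 gam * rpow Phi (1 - p0) * D).
  have h1 := Rmult_le_compat_r _ _ _ (Rlt_le _ _ hs0) hkey.
  apply: Rle_trans (Rlt_le _ _ hv) _; apply: Rle_trans h1 _.
  rewrite !Rmult_assoc; apply: Rmult_le_compat_l; first lra.
  have hq : 0 <= 1 + / (2 * rr) ^ n * Mp.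
    have : 0 <= / (2 * rr) ^ n by apply: Rlt_le; apply: Rinv_0_lt_compat; apply: pow_lt; lra.
    nra.
  have h2 := Rmult_le_compat_r _ _ _ hq hpow1.
  have hq2 : 0 <= rpow 2 gam * rpow Phi (1 - p0).
    by apply: Rmult_le_pos; exact: rpow_ge0.
  have h3 := Rmult_le_compat_l _ _ _ hq2 hsn1.
  lra.
have hPp : rpow Phi p0 <= Bd.
  have hr1 : 0 < rpow Phi (1 - p0) by exact: rpow_gt0.
  have e1 : Phi = rpow Phi (1 - p0) * rpow Phi p0.
    by rewrite -rpow_plus -[LHS](rpow1 (Rlt_le _ _ hpos)); congr rpow; ring.
  apply: (Rmult_le_reg_l (rpow Phi (1 - p0))) => //.
  by rewrite -e1 /Bd; lra.
rewrite -(rpow1 (Rlt_le _ _ hpos)) -(Rinv_r p0); last lra.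
rewrite -rpow_rpow; apply: rpow_le => //.
by apply: Rlt_le; exact: Rinv_0_lt_compat.
Qed.

End Bounded.

(** * Monotonicity of the p-means in the height *)

Section Hol.
Variable n : nat.
Implicit Types (F G : CVec n -> cplx) (z w : CVec n).

Definition mcont F z := forall eps, 0 < eps -> exists delta, 0 < delta /\
  forall w, (forall j, Cnorm (w j - z j)%C < delta) -> Cnorm (F w - F z)%C < eps.

(** Trades the differential quotients of the definition for [cdiff], so that closure properties of
    holomorphic functions reduce to one variable and to joint continuity. *)
Lemma holP F : holomorphic_on_tube F <->
  forall z, in_tube z -> mcont F z /\ forall j, cdiff (fun u => F (cupdate z j u)) (z j).
Proof.
split=> h z hz.
  have [h1 _] := h z hz; split => // j.
  by apply: hol_slice => // k _; exact: hz.
have [h1 h2] := h z hz; split => // j; have [L hL] := h2 j; exists L => eps heps.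
have [d [hd hh]] := hL eps heps; exists d; split => // u _ hu.
have := hh (z j + u)%C; have -> : (z j + u - z j = u)%C by ring.
by rewrite cupdate_id; apply.
Qed.

Lemma mcont_const c z : mcont (fun _ => c) z.
Proof.
move=> eps heps; exists 1; split; first lra.
by move=> w _; have -> : (c - c = C0)%C by [ring|]; rewrite Cnorm0.
Qed.

Lemma mcont_add F G z : mcont F z -> mcont G z -> mcont (fun w => F w + G w)%C z.
Proof.
move=> hF hG eps heps; have [d1 [hd1 h1]] := hF (eps / 2) ltac:(lra).
have [d2 [hd2 h2]] := hG (eps / 2) ltac:(lra).
exists (Rmin d1 d2); split; first exact: Rmin_glb_lt.
move=> w hw.
have := h1 w (fun j => Rlt_le_trans _ _ _ (hw j) (Rmin_l _ _)).
have := h2 w (fun j => Rlt_le_trans _ _ _ (hw j) (Rmin_r _ _)).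
have -> : (F w + G w - (F z + G z) = (F w - F z) + (G w - G z))%C by ring.
have := Cnorm_tri (F w - F z)%C (G w - G z)%C; lra.
Qed.

Lemma mcont_mul F G z : mcont F z -> mcont G z -> mcont (fun w => F w * G w)%C z.
Proof.
move=> hF hG eps heps.
set A := Cnorm (F z) + 1; set B := Cnorm (G z) + 1.
have hA : 1 <= A by have := Cnorm_ge0 (F z); rewrite /A; lra.
have hB : 1 <= B by have := Cnorm_ge0 (G z); rewrite /B; lra.
have [d1 [hd1 h1]] := hF (eps / (2 * B)) ltac:(apply: Rdiv_lt_0_compat; lra).
have [d2 [hd2 h2]] := hG (eps / (2 * A)) ltac:(apply: Rdiv_lt_0_compat; lra).
have [d3 [hd3 h3]] := hG 1 Rlt_0_1.
exists (Rmin d1 (Rmin d2 d3)); split; first by repeat apply: Rmin_glb_lt.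
move=> w hw.
have {}h1 := h1 w (fun j => Rlt_le_trans _ _ _ (hw j) (Rmin_l _ _)).
have {}h2 := h2 w (fun j => Rlt_le_trans _ _ _ (hw j) (Rle_trans _ _ _ (Rmin_r _ _) (Rmin_l _ _))).
have {}h3 := h3 w (fun j => Rlt_le_trans _ _ _ (hw j) (Rle_trans _ _ _ (Rmin_r _ _) (Rmin_r _ _))).
have -> : (F w * G w - F z * G z = (F w - F z) * G w + F z * (G w - G z))%C by ring.
apply: Rle_lt_trans (Cnorm_tri _ _) _; rewrite !Cnorm_mul.
have hGw : Cnorm (G w) <= B by have := Cnorm_tri_rev (G w) (G z); rewrite /B; lra.
have t1 : Cnorm (F w - F z)%C * Cnorm (G w) < eps / 2.
  apply: Rle_lt_trans (_ : Cnorm (F w - F z)%C * B < _).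
    by apply: Rmult_le_compat_l => //; exact: Cnorm_ge0.
  have -> : eps / 2 = eps / (2 * B) * B by field; lra.
  by apply: Rmult_lt_compat_r; lra.
have t2 : Cnorm (F z) * Cnorm (G w - G z)%C <= eps / 2.
  have -> : eps / 2 = A * (eps / (2 * A)) by field; lra.
  apply: Rmult_le_compat; try exact: Cnorm_ge0; last lra.
  by rewrite /A; lra.
lra.
Qed.

Lemma mcont_coord (phi : cplx -> cplx) j z : ccont phi (z j) -> mcont (fun w => phi (w j)) z.
Proof. by move=> h eps heps; have [d [hd hh]] := h eps heps; exists d; split => // w hw; apply: hh. Qed.

Lemma hol_const c : holomorphic_on_tube (fun _ : CVec n => c).
Proof. by apply/holP => z hz; split; [exact: mcont_const|move=> j; exact: cdiff_const]. Qed.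

Lemma hol_add F G : holomorphic_on_tube F -> holomorphic_on_tube G ->
  holomorphic_on_tube (fun z => F z + G z)%C.
Proof.
move=> /holP hF /holP hG; apply/holP => z hz; have [a1 a2] := hF z hz; have [b1 b2] := hG z hz.
by split; [exact: mcont_add|move=> j; apply: cdiff_add].
Qed.

Lemma hol_mul F G : holomorphic_on_tube F -> holomorphic_on_tube G ->
  holomorphic_on_tube (fun z => F z * G z)%C.
Proof.
move=> /holP hF /holP hG; apply/holP => z hz; have [a1 a2] := hF z hz; have [b1 b2] := hG z hz.
by split; [exact: mcont_mul|move=> j; apply: cdiff_mul].
Qed.

Lemma hol_ext F G : (forall z, F z = G z) -> holomorphic_on_tube F -> holomorphic_on_tube G.
Proof. by move=> e h; have -> : G = F by apply: functional_extensionality. Qed.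

Lemma hol_sub F G : holomorphic_on_tube F -> holomorphic_on_tube G ->
  holomorphic_on_tube (fun z => F z - G z)%C.
Proof.
move=> hF hG; apply: (@hol_ext (fun z => F z + (- C1) * G z)%C); first by move=> z; ring.
by apply: hol_add => //; apply: hol_mul => //; exact: hol_const.
Qed.

Lemma hol_coord (phi : cplx -> cplx) j : (forall u, 0 < Cim u -> cdiff phi u) ->
  holomorphic_on_tube (fun z : CVec n => phi (z j)).
Proof.
move=> h; apply/holP => z hz; split.
  by apply: mcont_coord; apply: cdiff_cont; apply: h; exact: hz.
move=> k; case: (eqVneq j k) => [<-|hjk].
  apply: (@cdiff_ext phi); last by apply: h; exact: hz.
  by move=> u; rewrite cupdate_same.
apply: (@cdiff_ext (fun _ => phi (z j))); last exact: cdiff_const.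
by move=> u; rewrite /cupdate (negbTE hjk).
Qed.

Lemma hol_prod (I : Type) (r : seq I) (F : I -> CVec n -> cplx) :
  (forall i, holomorphic_on_tube (F i)) ->
  holomorphic_on_tube (fun z => \big[Cmul/C1]_(i <- r) F i z).
Proof.
move=> h; elim: r => [|i r IH].
  by apply: (@hol_ext (fun _ => C1)); [move=> z; rewrite big_nil|exact: hol_const].
apply: (@hol_ext (fun z => F i z * \big[Cmul/C1]_(k <- r) F k z)%C).
  by move=> z; rewrite big_cons.
exact: hol_mul.
Qed.

Definition ishift (t : R) z : CVec n := fun j => (z j + (0, t))%C.

Lemma hol_shift F t : 0 <= t -> holomorphic_on_tube F -> holomorphic_on_tube (fun z => F (ishift t z)).
Proof.
move=> ht /holP hF; apply/holP => z hz.
have hz' : in_tube (ishift t z) by move=> j; have := hz j; rewrite /ishift; cunfold; lra.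
have [h1 h2] := hF _ hz'; split.
  move=> eps heps; have [d [hd hh]] := h1 eps heps; exists d; split => // w hw.
  apply: hh => j; rewrite /ishift.
  by have -> : (w j + (0, t) - (z j + (0, t)) = w j - z j)%C by [ring|]; exact: hw.
move=> j; have e u : F (ishift t (cupdate z j u)) = F (cupdate (ishift t z) j (u + (0, t))%C).
  by congr F; apply: functional_extensionality => k; rewrite /ishift /cupdate; case: eqP.
apply: (@cdiff_ext (fun u => F (cupdate (ishift t z) j (u + (0, t))%C))) => [u|]; first by rewrite e.
apply: (@cdiff_comp (fun u => u + (0, t))%C (fun v => F (cupdate (ishift t z) j v))).
  by apply: cdiff_add; [exact: cdiff_id|exact: cdiff_const].
exact: h2.
Qed.

(** The class in which the later estimates take place: boundedness on each region Im z_j >= delta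
    makes the restrictions to fixed heights uniformly continuous, and it passes at once to
    differences, products and upward shifts. *)
Definition Hbd F := holomorphic_on_tube F /\ forall delta, 0 < delta ->
  exists A, 0 < A /\ forall z, (forall j, delta <= Cim (z j)) -> Cnorm (F z) <= A.

Lemma Hp_Hbd p F : 0 < p -> in_Hp p F -> Hbd F.
Proof. by move=> hp h; split; [case: h|exact: Hp_bounded h]. Qed.

Lemma Hbd_sub F G : Hbd F -> Hbd G -> Hbd (fun z => F z - G z)%C.
Proof.
move=> [hF bF] [hG bG]; split; first exact: hol_sub.
move=> d hd; have [A [hA h1]] := bF d hd; have [B [hB h2]] := bG d hd.
exists (A + B); split; first lra.
move=> z hz; have := Cnorm_tri_sub (F z) (G z); have := h1 z hz; have := h2 z hz; lra.
Qed.

Lemma Hbd_mul F G : Hbd F -> Hbd G -> Hbd (fun z => F z * G z)%C.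
Proof.
move=> [hF bF] [hG bG]; split; first exact: hol_mul.
move=> d hd; have [A [hA h1]] := bF d hd; have [B [hB h2]] := bG d hd.
exists (A * B); split; first nra.
by move=> z hz; rewrite Cnorm_mul; apply: Rmult_le_compat; try exact: Cnorm_ge0; [exact: h1|exact: h2].
Qed.

Lemma Hbd_shift F t : 0 <= t -> Hbd F -> Hbd (fun z => F (ishift t z)).
Proof.
move=> ht [hF bF]; split; first exact: hol_shift.
move=> d hd; have [A [hA h1]] := bF d hd; exists A; split => // z hz; apply: h1 => j.
by have := hz j; rewrite /ishift; cunfold; lra.
Qed.

Lemma Hbd_lip F delta : Hbd F -> 0 < delta -> exists Lam, 0 < Lam /\
  forall z w d, (forall j, delta <= Cim (z j)) -> 0 <= d <= delta / 8 ->
    (forall j, Cnorm (w j - z j)%C <= d) -> Cnorm (F w - F z)%C <= Lam * d.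
Proof.
move=> [hF bF] hd; have [A [hA h]] := bF (delta / 2) ltac:(lra).
exists (INR n * (32 * A / (delta / 2)) + 1); split.
  have : 0 <= INR n * (32 * A / (delta / 2)).
    by apply: Rmult_le_pos; [exact: pos_INR|apply: Rdiv_le_0_compat; lra].
  lra.
move=> z w d hz hdd hw.
apply: Rle_trans (@Cnorm_lip_poly n F z (delta / 2) A ltac:(lra) hF _ w d ltac:(lra) hw) _.
  move=> v hv; have hIm j : delta / 2 <= Cim (v j).
    by have [_ /Rabs_le_between h1] := hv j; have := hz j; lra.
  by split; [move=> j; have := hIm j; lra|exact: h].
rewrite -Rmult_assoc; nra.
Qed.

Lemma vec_min (y : RVec n) : in_Gamma y -> exists m, 0 < m /\ forall j, m <= y j.
Proof.
move=> hy; set s := \big[Rplus/0]_(j < n) / y j.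
have hpos j : 0 < / y j by apply: Rinv_0_lt_compat; exact: hy.
have hs : 0 <= s by apply: rsum_ge0 => j _; exact: Rlt_le.
exists (/ (s + 1)); split; first by apply: Rinv_0_lt_compat; lra.
move=> j; rewrite -(Rinv_inv (y j)); apply: Rinv_le_contravar => //.
have := rsum_ge_term (F := fun j => / y j) j (fun i => Rlt_le _ _ (hpos i)); rewrite -/s; lra.
Qed.

Lemma rpow_le0 a p : a <= 0 -> rpow a p = 0.
Proof. by rewrite /rpow; case: Rle_dec => //=. Qed.

Lemma rpow_continuity p a : 0 < p -> continuity_pt (fun t => rpow t p) a.
Proof.
move=> hp; have [ha|[->|ha]] : a < 0 \/ a = 0 \/ 0 < a by lra.
- apply/continuity_pt_filterlim/filterlim_locally => eps.
  exists (mkposreal (- a) ltac:(lra)) => t /= ht.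
  have : t <= 0 by move/Rabs_lt_between: ht; rewrite /minus /plus /opp /=; lra.
  move=> h; rewrite !rpow_le0 //; last lra.
  by rewrite /ball /= /AbsRing_ball /abs /minus /plus /opp /= Rplus_opp_r Rabs_R0; exact: cond_pos.
- apply/continuity_pt_filterlim/filterlim_locally => eps.
  have [d [hd ed]] := @rpow_small p (eps / 2) hp ltac:(have := cond_pos eps; lra).
  exists (mkposreal d hd) => t /= ht.
  have {}ht : t < d by move/Rabs_lt_between: ht; rewrite /minus /plus /opp /=; lra.
  rewrite rpow0 /ball /= /AbsRing_ball /abs /minus /plus /opp /= Ropp_0 Rplus_0_r.
  rewrite Rabs_pos_eq; last exact: rpow_ge0.
  have : rpow t p <= rpow d p by apply: rpow_le; lra.
  by rewrite ed; have := cond_pos eps; lra.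
- apply: (continuity_pt_ext_loc (fun t => exp (p * ln t))).
    exists (mkposreal a ha) => t /= ht; rewrite rpow_pos //.
    by move/Rabs_lt_between: ht; rewrite /minus /plus /opp /=; lra.
  apply: ex_derive_continuity_pt; by auto_derive.
Qed.

Lemma rpow_ucont p A eps : 0 < p -> 0 < A -> 0 < eps -> exists d, 0 < d /\
  forall a b, 0 <= a <= A -> 0 <= b <= A -> Rabs (a - b) <= d -> Rabs (rpow a p - rpow b p) <= eps.
Proof.
move=> hp hA heps.
have [[d hd] h] := Heine_cor2 (fun x (_ : 0 <= x <= A) => rpow_continuity x hp) (mkposreal eps heps).
exists (d / 2); split; first lra.
by move=> a b ha hb hab; apply: Rlt_le; apply: h => //=; rewrite /= in hab *; lra.
Qed.

Definition Fp p F (y : RVec n) : RVec n -> R := fun x => rpow (Cnorm (F (cpoint x y))) p.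

Lemma Fp_ge0 p F y x : 0 <= Fp p F y x.
Proof. exact: rpow_ge0. Qed.

Lemma ucont_rpow_norm p (Phi : RVec n -> cplx) A : 0 < p -> 0 < A ->
  (forall x, Cnorm (Phi x) <= A) ->
  (forall eps, 0 < eps -> exists d, 0 < d /\ forall x x', (forall j, Rabs (x j - x' j) <= d) ->
     Cnorm (Phi x - Phi x')%C <= eps) ->
  ucont (fun x => rpow (Cnorm (Phi x)) p).
Proof.
move=> hp hA hb hu eps heps.
have [d [hd h]] := rpow_ucont hp hA heps.
have [d' [hd' h']] := hu d hd; exists d'; split => // x x' hx; apply: h.
- by split; [exact: Cnorm_ge0|exact: hb].
- by split; [exact: Cnorm_ge0|exact: hb].
- have := h' x x' hx; have := Cnorm_tri_rev (Phi x) (Phi x'); have := Cnorm_tri_rev (Phi x') (Phi x).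
  rewrite (Cnorm_sub_sym (Phi x')) => *; apply: Rabs_le; lra.
Qed.

Lemma Hbd_ucont F y : Hbd F -> in_Gamma y -> (exists A, 0 < A /\ forall x, Cnorm (F (cpoint x y)) <= A) /\
  forall eps, 0 < eps -> exists d, 0 < d /\ forall x x', (forall j, Rabs (x j - x' j) <= d) ->
     Cnorm (F (cpoint x y) - F (cpoint x' y))%C <= eps.
Proof.
move=> hF hy; have [m [hm hym]] := vec_min hy; split.
  by have [_ /(_ m hm) [A [hA h]]] := hF; exists A; split => // x; apply: h.
move=> eps heps; have [Lam [hL h]] := Hbd_lip hF hm.
exists (Rmin (m / 8) (eps / Lam)); split.
  by apply: Rmin_glb_lt; [lra|exact: Rdiv_lt_0_compat].
move=> x x' hx.
set d := Rmin (m / 8) (eps / Lam) in hx *.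
have hd1 : d <= m / 8 by exact: Rmin_l.
have hd2 : d <= eps / Lam by exact: Rmin_r.
have hd0 : 0 <= d by apply: Rlt_le; apply: Rmin_glb_lt; [lra|exact: Rdiv_lt_0_compat].
apply: Rle_trans (h (cpoint x' y) (cpoint x y) d _ _ _) _ => //.
  move=> j; have -> : (cpoint x y j - cpoint x' y j)%C = RtoC (x j - x' j).
    by rewrite /cpoint; cring.
  by rewrite Cnorm_RtoC.
have -> : eps = Lam * (eps / Lam) by field; lra.
by apply: Rmult_le_compat_l; lra.
Qed.

Lemma Fp_ucont p F y : 0 < p -> Hbd F -> in_Gamma y -> ucont (Fp p F y).
Proof.
move=> hp hF hy; have [[A [hA hb]] hu] := Hbd_ucont hF hy.
exact: (ucont_rpow_norm (Phi := fun x => F (cpoint x y)) hp hA hb hu).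
Qed.

Definition evec (j : 'I_n) (t : R) : RVec n := fun k => if k == j then t else 0.

Lemma cpoint_shift_x x y j t :
  cpoint (vadd x (evec j t)) y = cupdate (cpoint x y) j (cpoint x y j + (t, 0))%C.
Proof.
apply: functional_extensionality => k; rewrite /cpoint /cupdate /vadd /evec.
by case: eqP => [->|_]; cunfold; rewrite ?Rplus_0_r.
Qed.

Lemma cpoint_shift_y x y j t :
  cpoint x (vadd y (evec j t)) = cupdate (cpoint x y) j (cpoint x y j + (0, t))%C.
Proof.
apply: functional_extensionality => k; rewrite /cpoint /cupdate /vadd /evec.
by case: eqP => [->|_]; cunfold; rewrite ?Rplus_0_r.
Qed.

(** One coordinate as a function of its displacement from the base point. The half plane estimates,
    stated at (0, delta) above real nodes, then apply at every [x] with the same nodes. *)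
Definition slice F x y j (u : cplx) : cplx := F (cupdate (cpoint x y) j (cpoint x y j + u)%C).

Lemma slice_cdiff F x y j u : holomorphic_on_tube F -> in_Gamma y -> 0 <= Cim u ->
  cdiff (slice F x y j) u.
Proof.
move=> hF hy hu.
apply: (@cdiff_comp (fun u => cpoint x y j + u)%C (fun v => F (cupdate (cpoint x y) j v))).
  by apply: cdiff_add; [exact: cdiff_const|exact: cdiff_id].
apply: hol_slice => //; first by move=> k _; exact: hy.
by move: hu; have := hy j; rewrite /cpoint; cunfold; lra.
Qed.

Lemma slice_bound F x y j u m A : (forall k, m <= y k) -> 0 <= Cim u ->
  (forall z, (forall k, m <= Cim (z k)) -> Cnorm (F z) <= A) -> Cnorm (slice F x y j u) <= A.
Proof.
move=> hy hu h; apply: h => k; rewrite /cupdate; case: eqP => _; last exact: hy.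
by move: hu; have := hy j; rewrite /cpoint; cunfold; lra.
Qed.

Lemma slice_mod F x y j m Lam : (forall k, m <= y k) -> 0 < m ->
  (forall z w d, (forall j, m <= Cim (z j)) -> 0 <= d <= m / 8 ->
    (forall j, Cnorm (w j - z j)%C <= d) -> Cnorm (F w - F z)%C <= Lam * d) ->
  forall s t, Rabs (s - t) <= m / 8 ->
    Cnorm (slice F x y j (s, 0) - slice F x y j (t, 0))%C <= Lam * Rabs (s - t).
Proof.
move=> hy hm h s t hst; apply: h.
- move=> k; rewrite /cupdate; case: eqP => _; last exact: hy.
  by have := hy j; rewrite /cpoint; cunfold; lra.
- by split => //; exact: Rabs_pos.
- move=> k; rewrite /cupdate; case: eqP => _.
    have -> : (cpoint x y j + (s, 0) - (cpoint x y j + (t, 0)))%C = RtoC (s - t) by cring.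
    by rewrite Cnorm_RtoC; lra.
  by have -> : (cpoint x y k - cpoint x y k = C0)%C by [ring|]; rewrite Cnorm0; exact: Rabs_pos.
Qed.

Lemma Fp_slice_x p F x y j t : Fp p F y (vadd x (evec j t)) = rpow (Cnorm (slice F x y j (t, 0))) p.
Proof. by rewrite /Fp cpoint_shift_x. Qed.

Lemma Fp_slice_y p F x y j t : Fp p F (vadd y (evec j t)) x = rpow (Cnorm (slice F x y j (0, t))) p.
Proof. by rewrite /Fp cpoint_shift_y. Qed.

Lemma ucont_shift (g : RVec n -> R) v : ucont g -> ucont (fun x => g (vadd x v)).
Proof.
move=> h eps heps; have [d [hd hh]] := h eps heps; exists d; split => // x x' hx; apply: hh => j.
by rewrite /vadd; have -> : x j + v j - (x' j + v j) = x j - x' j by ring.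
Qed.

Lemma integral_le_ge0 (g : RVec n -> R) V : (forall x, 0 <= g x) -> integral_le g V -> 0 <= V.
Proof. by move=> hg h; apply: (h [::]) => x; exact: hg. Qed.

Lemma Fp_node_sum p F y j (L : nat) (w t : nat -> R) V : 0 < p -> Hbd F -> in_Gamma y ->
  (forall l, (l < L)%N -> 0 <= w l) -> \rsum_(l < L) w l <= 1 -> integral_le (Fp p F y) V ->
  integral_le (fun x => \rsum_(l < L) (w l * Fp p F y (vadd x (evec j (t l))))) V.
Proof.
move=> hp hF hy hw hW hV.
have hV0 := integral_le_ge0 (Fp_ge0 p F y) hV.
apply: (@integral_le_mono n _ (fun x => \rsum_(l < L) (w l * Fp p F y (vadd x (evec j (t l)))))
  (\rsum_(l < L) (w l * V))).
- by move=> x; exact: Rle_refl.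
- rewrite (eq_bigr (fun l : 'I_L => V * w l)) => [|l _]; last by ring.
  by rewrite rsum_scal -[X in _ <= X]Rmult_1_r; exact: Rmult_le_compat_l.
apply: (@integral_le_sum n L w (fun _ => V) (fun l x => Fp p F y (vadd x (evec j (t l))))) => //.
- by move=> l x; exact: Fp_ge0.
- by move=> l; apply: ucont_shift; exact: Fp_ucont.
- by move=> l hl; apply: integral_le_shift.
Qed.

(** The Lipschitz constant is uniform in [x], so [jensen_nodes] supplies the same nodes for all
    slices and its pointwise inequality can be integrated over [x]. The additive error is removed by
    [integral_le_local]. *)
Lemma Fp_mono_step p F y j d V : 0 < p -> Hbd F -> in_Gamma y -> 0 < d ->
  integral_le (Fp p F y) V -> integral_le (Fp p F (vadd y (evec j d))) V.
Proof.
move=> hp hF hy hd hV; have [m [hm hym]] := vec_min hy.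
have [_ /(_ m hm) [A [hA hAb]]] := hF.
have [Lam [hLam hlip]] := Hbd_lip hF hm.
have hV0 := integral_le_ge0 (Fp_ge0 p F y) hV.
apply: integral_le_local => r eps hr heps.
have [X [tau [hX _ htau hrest]]] := @jensen_nodes A p eps d 0 hA hp heps hd.
have hrho : 0 < Rmin (m / 8) (tau / Lam) by apply: Rmin_glb_lt; [lra|exact: Rdiv_lt_0_compat].
have [kappa [L [hk _ hL _ hJ]]] := hrest _ 1 hrho Rlt_0_1.
pose w l := pwt X kappa L 0 (kappa + d) l.
have hw l : 0 <= w l by apply: pwt_ge0 => //; lra.
exists (fun x => \rsum_(l < L) (w l * Fp p F y (vadd x (evec j (node X L l))))); split.
- by move=> x; apply: rsum_ge0 => l _; apply: Rmult_le_pos => //; exact: Fp_ge0.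
- apply: (@integral_le_mono n _ _ V); [by move=> x; exact: Rle_refl|lra|].
  apply: Fp_node_sum => //.
  by apply: (@Wtot_le1 X kappa L hX hk hL 0 (kappa + d)); lra.
move=> x _; rewrite Fp_slice_y.
have hdd : 0 < d <= d by lra.
apply: Rle_trans (hJ (slice F x y j) _ _ _ d hdd) _.
- by move=> u hu; apply: slice_cdiff => //; case: hF.
- by move=> u hu; apply: slice_bound hAb.
- move=> s t _ _ hst.
  have h1 := Rmin_l (m / 8) (tau / Lam); have h2 := Rmin_r (m / 8) (tau / Lam).
  apply: Rle_trans (@slice_mod F x y j m Lam hym hm hlip s t _) _; first lra.
  have -> : tau = Lam * (tau / Lam) by field; lra.
  by apply: Rmult_le_compat_l; lra.
apply: Rplus_le_compat_r; apply: Req_le; apply: eq_bigr => l _.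
by rewrite Fp_slice_x.
Qed.

Lemma Fp_mono p F y y' V : 0 < p -> Hbd F -> in_Gamma y -> (forall j, y j <= y' j) ->
  integral_le (Fp p F y) V -> integral_le (Fp p F y') V.
Proof.
move=> hp hF hy hyy hV.
pose yk k : RVec n := fun j => if (j < k)%N then y' j else y j.
suff key k : (k <= n)%N -> integral_le (Fp p F (yk k)) V.
  have := key n (leqnn n); have -> : yk n = y'; last by [].
  by apply: functional_extensionality => j; rewrite /yk ltn_ord.
elim: k => [|k IH] hk; first by have -> : yk 0%N = y by apply: functional_extensionality.
have {}IH := IH (ltnW hk).
pose j := Ordinal hk.
have e : yk k.+1 = vadd (yk k) (evec j (y' j - y j)).
  apply: functional_extensionality => i; rewrite /yk /vadd /evec ltnS (leq_eqVlt i k).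
  case: (eqVneq i j) => [->|hij]; first by rewrite /j /= ?eqxx ltnn /=; ring.
  have -> : (i == k :> nat) = false by apply/negbTE.
  by rewrite /= Rplus_0_r.
have [h|h] := Rle_lt_dec (y' j - y j) 0.
  have -> : yk k.+1 = yk k; last by [].
  rewrite e; apply: functional_extensionality => i; rewrite /vadd /evec; case: eqP => _; last by rewrite Rplus_0_r.
  by have := hyy j; have -> : y' j - y j = 0 by [have := hyy j; lra|]; rewrite Rplus_0_r.
rewrite e; apply: Fp_mono_step => //.
move=> i; rewrite /yk; case: ifP => _; last exact: hy.
by have := hy i; have := hyy i; lra.
Qed.

End Hol.

(** * Vertical translates converge in H^p *)

Section ShiftSmall.
Variable n : nat.
Implicit Types (F : CVec n -> cplx) (y : RVec n).

Lemma step_sum L (w : nat -> R) (s : nat -> step n) : exists t : step n,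
  (forall x, seval t x = \rsum_(l < L) (w l * seval (s l) x)) /\
  step_int t = \rsum_(l < L) (w l * step_int (s l)).
Proof.
elim: L => [|L [t [h1 h2]]].
  by exists [::]; split => [x|]; rewrite big_ord0.
exists (t ++ sscal (w L) (s L)); split => [x|].
- by rewrite (rsum_recr (fun l => w l * seval (s l) x)) seval_cat seval_scal h1.
- by rewrite (rsum_recr (fun l => w l * step_int (s l))) sint_cat sint_scal h2.
Qed.

Lemma ucont_rsum L (w : nat -> R) (f : nat -> RVec n -> R) : (forall l, ucont (f l)) ->
  ucont (fun x => \rsum_(l < L) (w l * f l x)).
Proof.
move=> h; elim: L => [|L IH].
  have -> : (fun x : RVec n => \rsum_(l < 0) (w l * f l x)) = (fun _ => 0).
    by apply: functional_extensionality => x; rewrite big_ord0.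
  exact: ucont_const.
have -> : (fun x => \rsum_(l < L.+1) (w l * f l x)) = (fun x => \rsum_(l < L) (w l * f l x) + w L * f L x).
  by apply: functional_extensionality => x; rewrite (rsum_recr (fun l => w l * f l x)).
by apply: ucont_add => //; exact: ucont_scal.
Qed.

(** The two comparisons in [shift_step] use Poisson means at heights kappa + d and kappa + 2 d. This
    domination lets both be summed with the weights of the lower height, so that a single node is
    good for both. *)
Lemma pwt_double X kappa L h1 h2 l : 0 < X -> 0 < kappa -> (0 < L)%N ->
  0 < h1 -> h1 <= h2 <= 2 * h1 -> pwt X kappa L 0 h1 l <= 2 * pwt X kappa L 0 h2 l.
Proof.
move=> hX hk hL hh1 hh.
have -> : 2 * pwt X kappa L 0 h2 l = mesh X L / dist_const X kappa L * (2 * pk h2 (0 - node X L l)).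
  by rewrite /pwt; ring.
apply: Rmult_le_compat_l.
  apply: Rlt_le; apply: Rdiv_lt_0_compat; first exact: mesh_gt0.
  by have := dist_const_ge1 hX hk hL; lra.
move: (0 - node X L l) => s; rewrite /pk; have hPI := PI_RGT_0.
have p1 : 0 < s * s + h1 * h1 by nra.
have p2 : 0 < s * s + h2 * h2 by nra.
rewrite /Rdiv !(Rinv_mult PI).
have key : h1 * / (s * s + h1 * h1) <= 2 * h2 * / (s * s + h2 * h2).
  apply: (Rmult_le_reg_r ((s * s + h1 * h1) * (s * s + h2 * h2))); first nra.
  have -> : h1 * / (s * s + h1 * h1) * ((s * s + h1 * h1) * (s * s + h2 * h2)) = h1 * (s * s + h2 * h2).
    by field; lra.
  have -> : 2 * h2 * / (s * s + h2 * h2) * ((s * s + h1 * h1) * (s * s + h2 * h2)) =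
     2 * h2 * (s * s + h1 * h1) by field; lra.
  have a1 : h1 * (s * s) <= 2 * h2 * (s * s) by apply: Rmult_le_compat_r; nra.
  have a2 : h1 * (h2 * h2) <= 2 * h2 * (h1 * h1).
    have -> : h1 * (h2 * h2) = (h1 * h2) * h2 by ring.
    have -> : 2 * h2 * (h1 * h1) = (h1 * h2) * (2 * h1) by ring.
    by apply: Rmult_le_compat_l; [nra|lra].
  lra.
have hi : 0 < / PI by exact: Rinv_0_lt_compat.
have := Rmult_le_compat_l _ _ _ (Rlt_le _ _ hi) key; lra.
Qed.

(* Both [F_y] and [F_{y+d}], translated by a common node, are compared with [F_{y+2d}];
   the deficit of norm [eta] makes the weighted mean of these distances small. *)
Lemma shift_step p F N0 eps2 : 0 < p -> Hbd F ->
  (forall y, in_Gamma y -> integral_le (Fp p F y) N0) -> 0 <= N0 -> 0 < eps2 ->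
  exists eta, 0 < eta /\ forall y j d, in_Gamma y -> 0 < d ->
    ~ integral_le (Fp p F (vadd y (evec j (2 * d)))) (N0 - eta) ->
    integral_le (fun x => rpow (Cnorm (F (cpoint x y) - F (cpoint x (vadd y (evec j d))))%C) p)
      (rpow 2 p * eps2).
Proof.
move=> hp hF hN hN0 heps2.
(* [ep], [eta] and later [e] are set so that 6 * ep * N0, 3 * C * eta and 3 * e * vol are each at
   most eps2 / 8, to be confronted with a lower bound eps2 / 2. *)
set ep := eps2 / (48 * (N0 + 1)).
have hep : 0 < ep by apply: Rdiv_lt_0_compat; lra.
have hepN : 6 * ep * N0 <= eps2 / 8.
  have -> : 6 * ep * N0 = eps2 / 8 * (N0 / (N0 + 1)) by rewrite /ep; field; lra.
  have : N0 / (N0 + 1) <= 1 by apply/Rle_div_l; lra.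
  nra.
have [C [hC hpl]] := pl_nodes hp hep.
set eta := eps2 / (24 * C).
have heta : 0 < eta by apply: Rdiv_lt_0_compat; lra.
exists eta; split => // y j d hy hd hno.
set yd := vadd y (evec j d); set y2 := vadd y (evec j (2 * d)) in hno.
have ey2 : y2 = vadd yd (evec j d).
  apply: functional_extensionality => k; rewrite /y2 /yd /vadd /evec; case: eqP => _; ring.
have [m [hm hym]] := vec_min hy.
have hymd k : m <= yd k.
  by rewrite /yd /vadd /evec; have := hym k; case: eqP => _; lra.
have hyd : in_Gamma yd by move=> k; have := hymd k; lra.
have hy2 : in_Gamma y2.
  by move=> k; rewrite ey2 /vadd /evec; have := hyd k; case: eqP => _; lra.
have [_ /(_ m hm) [A [hA hAb]]] := hF.
have hhol : holomorphic_on_tube F by case: hF.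
have [Lam [hLam hlip]] := Hbd_lip hF hm.
have [sa [hsa hsaN]] := not_integral_le hno.
have [ra [hra hsup]] := step_support sa.
apply: integral_le_local => r eps' hr heps'.
(* The weights [w1] have total mass at least 3 / 4, and at most 2 * (kappa + d) / T <= 1 / 4 of it
   beyond [T], so half the mass sits at nodes within [T]. *)
set T := 16 * d.
set rB := r + T + ra + 1.
have hrB : 0 < rB by rewrite /rB /T; lra.
set vol := (2 * rB) ^ n.
have hvol : 0 < vol by apply: pow_lt; lra.
set e := eps2 / (24 * vol).
have he : 0 < e by apply: Rdiv_lt_0_compat; lra.
have hevol : 3 * e * vol = eps2 / 8 by rewrite /e; field; lra.
have hD : 0 < 2 * d by lra.
have [X [tau [hX hX0 htau hrest]]] := hpl A e (2 * d) (16 * d) hA he hD.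
have hrho : 0 < Rmin (m / 8) (tau / Lam) by apply: Rmin_glb_lt; [lra|exact: Rdiv_lt_0_compat].
have hsig : 0 < Rmin d (1 / 32) by apply: Rmin_glb_lt; lra.
have [kappa [L [hk hks hL hmesh hJ]]] := hrest _ _ hrho hsig.
have hkd : kappa <= d by apply: Rle_trans hks (Rmin_l _ _).
have hmesh1 : mesh X L / kappa <= 1 / 32 by apply: Rle_trans hmesh (Rmin_r _ _).
pose t l := node X L l.
pose w1 l := pwt X kappa L 0 (kappa + d) l.
pose w2 l := pwt X kappa L 0 (kappa + 2 * d) l.
have hw1 l : 0 <= w1 l by apply: pwt_ge0 => //; lra.
have hw2 l : 0 <= w2 l by apply: pwt_ge0 => //; lra.
have hw12 l : w1 l <= 2 * w2 l by apply: pwt_double => //; lra.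
have hW1 : \rsum_(l < L) w1 l <= 1.
  by apply: (@Wtot_le1 X kappa L hX hk hL 0 (kappa + d)); lra.
have hW2 : \rsum_(l < L) w2 l <= 1.
  by apply: (@Wtot_le1 X kappa L hX hk hL 0 (kappa + 2 * d)); lra.
have hW1g : 3 / 4 <= \rsum_(l < L) w1 l.
  have h1 : (kappa + d) / (X + 1) <= 1 / 8 by apply/Rle_div_l; lra.
  have h2 := @Wtot_ge X kappa L hX hk hL 0 (kappa + d) (X + 1) ltac:(lra) ltac:(lra) ltac:(lra)
    ltac:(lra) ltac:(lra).
  apply: Rle_trans (_ : _ <= 1 - (kappa + d) / (X + 1) - 4 * (mesh X L / kappa)) h2; lra.
have htail : \rsum_(l < L) (if Rle_dec (Rabs (t l)) T then 0 else w1 l) <= 1 / 4.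
  have h := @pwt_tail X kappa L hX hk hL (kappa + d) T ltac:(lra) ltac:(rewrite /T; lra).
  apply: Rle_trans h _; apply/Rle_div_l; rewrite /T; lra.
have hWT : 1 / 2 <= \rsum_(l < L) (if Rle_dec (Rabs (t l)) T then w1 l else 0).
  have : \rsum_(l < L) w1 l = \rsum_(l < L) (if Rle_dec (Rabs (t l)) T then w1 l else 0)
    + \rsum_(l < L) (if Rle_dec (Rabs (t l)) T then 0 else w1 l).
    rewrite -rsum_add; apply: eq_bigr => l _; case: Rle_dec => _ /=; ring.
  lra.
pose a x := F (cpoint x y2).
pose E1 l x := rpow (Cnorm (slice F x y j (t l, 0) - a x)%C) p.
pose E2 l x := rpow (Cnorm (slice F x yd j (t l, 0) - a x)%C) p.
pose S1 x := \rsum_(l < L) (w1 l * Fp p F yd (vadd x (evec j (t l)))).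
pose S2 x := \rsum_(l < L) (w2 l * Fp p F y (vadd x (evec j (t l)))).
pose ap x := Fp p F y2 x.
have hmodule (yy : RVec n) x : (forall k, m <= yy k) -> forall s u, Rabs s <= X + 1 -> Rabs u <= X + 1 ->
    Rabs (s - u) <= Rmin (m / 8) (tau / Lam) ->
    Cnorm (slice F x yy j (s, 0) - slice F x yy j (u, 0))%C <= tau.
  move=> hyy s u _ _ hsu.
  have h1 := Rmin_l (m / 8) (tau / Lam); have h2 := Rmin_r (m / 8) (tau / Lam).
  apply: Rle_trans (@slice_mod n F x yy j m Lam hyy hm hlip s u _) _; first lra.
  have -> : tau = Lam * (tau / Lam) by field; lra.
  by apply: Rmult_le_compat_l; lra.
have hI2 x : \rsum_(l < L) (w2 l * E1 l x) <= ep * (ap x + S2 x) + C * (S2 x - ap x) + e.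
  have := hJ (slice F x y j) (fun u hu => slice_cdiff x j hhol hy hu)
    (fun u hu => slice_bound x j hym hu hAb) (hmodule y x hym) (2 * d) ltac:(lra).
  have ea : a x = slice F x y j (0, 2 * d) by rewrite /slice -cpoint_shift_y.
  have eS : S2 x = \rsum_(l < L) (w2 l * rpow (Cnorm (slice F x y j (t l, 0))) p).
    by apply: eq_bigr => l _; rewrite Fp_slice_x.
  by rewrite /E1 eS /ap /Fp -/(a x) ea.
have hI1 x : \rsum_(l < L) (w1 l * E2 l x) <= ep * (ap x + S1 x) + C * (S1 x - ap x) + e.
  have := hJ (slice F x yd j) (fun u hu => slice_cdiff x j hhol hyd hu)
    (fun u hu => slice_bound x j hymd hu hAb) (hmodule yd x hymd) d ltac:(lra).
  have ea : a x = slice F x yd j (0, d) by rewrite /slice -cpoint_shift_y -ey2.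
  have eS : S1 x = \rsum_(l < L) (w1 l * rpow (Cnorm (slice F x yd j (t l, 0))) p).
    by apply: eq_bigr => l _; rewrite Fp_slice_x.
  by rewrite /E2 eS /ap /Fp -/(a x) ea.
(* [ap] is moved to the left side, where the step function [sa] of large integral bounds it from
   below; the right side then needs only upper bounds on p-means. *)
have hI x : \rsum_(l < L) (w1 l * (E1 l x + E2 l x)) + 3 * C * ap x <=
    3 * ep * ap x + ((2 * ep + 2 * C) * S2 x + (ep + C) * S1 x) + 3 * e.
  have h1 : \rsum_(l < L) (w1 l * (E1 l x + E2 l x)) <=
    2 * \rsum_(l < L) (w2 l * E1 l x) + \rsum_(l < L) (w1 l * E2 l x).
    rewrite -rsum_scal -rsum_add; apply: rsum_le => l _.
    have := hw12 l; have : 0 <= E1 l x by exact: rpow_ge0.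
    by nra.
  have := hI1 x; have := hI2 x; lra.
(* Restricted to a cube, because the constant error 3 * e is integrable only over a bounded set. *)
pose gE l x := ind (cube n rB) x * (E1 l x + E2 l x).
have hE0 l x : 0 <= E1 l x + E2 l x.
  have h1 : 0 <= E1 l x by exact: rpow_ge0.
  have h2 : 0 <= E2 l x by exact: rpow_ge0.
  lra.
have hind x : ind (cube n rB) x = 0 \/ ind (cube n rB) x = 1.
  by rewrite /ind; case: excluded_middle_informative => h /=; [right|left].
have hgE0 l x : 0 <= gE l x.
  by rewrite /gE; have := hE0 l x; case: (hind x) => ->; lra.
(* Pigeonhole over the nodes: if each node within [T] had an integral above [eps2], the step
   functions witnessing this would have a weighted sum of integral at least eps2 / 2. *)
have [l0 [hl0 hl0E]] : exists l, Rabs (t l) <= T /\ integral_le (gE l) eps2.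
  case: (excluded_middle_informative (exists l, Rabs (t l) <= T /\ integral_le (gE l) eps2)) => // hcon.
  exfalso.
  have hex l : {s : step n | step_le s (gE l) /\ (if Rle_dec (Rabs (t l)) T then eps2 else 0) <= step_int s}.
    apply: constructive_indefinite_description.
    case: Rle_dec => hT /=; last by exists [::]; split; [move=> x; exact: hgE0|exact: Rle_refl].
    have hnl : ~ integral_le (gE l) eps2 by move=> h; apply: hcon; exists l.
    have [s [h1 h2]] := not_integral_le hnl.
    by exists s; split => //; lra.
  pose s l := sval (hex l).
  have hs1 l x : seval (s l) x <= gE l x by exact: (svalP (hex l)).1.
  have hs2 l : (if Rle_dec (Rabs (t l)) T then eps2 else 0) <= step_int (s l).
    exact: (svalP (hex l)).2.
  have [ts [ht1 ht2]] := step_sum L w1 s.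
  have hint : eps2 / 2 <= step_int ts.
    rewrite ht2.
    apply: Rle_trans (_ : eps2 * \rsum_(l < L) (if Rle_dec (Rabs (t l)) T then w1 l else 0) <= _).
      by have := Rmult_le_compat_l _ _ _ (Rlt_le _ _ heps2) hWT; lra.
    rewrite -rsum_scal; apply: rsum_le => l _; have := hs2 l; have := hw1 l.
    case: Rle_dec => _ /=; nra.
  pose g x := 3 * ep * ap x + ((2 * ep + 2 * C) * S2 x + (ep + C) * S1 x).
  have uap : ucont ap by apply: Fp_ucont.
  have uS1 : ucont S1.
    apply: (@ucont_rsum L w1 (fun l x => Fp p F yd (vadd x (evec j (t l))))) => l.
    by apply: (@ucont_shift n (Fp p F yd)); apply: Fp_ucont.
  have uS2 : ucont S2.
    apply: (@ucont_rsum L w2 (fun l x => Fp p F y (vadd x (evec j (t l))))) => l.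
    by apply: (@ucont_shift n (Fp p F y)); apply: Fp_ucont.
  have ap0 x : 0 <= ap x by exact: Fp_ge0.
  have S10 x : 0 <= S1 x by apply: rsum_ge0 => l _; apply: Rmult_le_pos => //; exact: Fp_ge0.
  have S20 x : 0 <= S2 x by apply: rsum_ge0 => l _; apply: Rmult_le_pos => //; exact: Fp_ge0.
  have hg0 x : 0 <= g x.
    rewrite /g; have := ap0 x; have := S10 x; have := S20 x => q1 q2 q3.
    have : 0 <= 3 * ep * ap x by apply: Rmult_le_pos; lra.
    have : 0 <= (2 * ep + 2 * C) * S2 x by apply: Rmult_le_pos; lra.
    have : 0 <= (ep + C) * S1 x by apply: Rmult_le_pos; lra.
    lra.
  have hgint : integral_le g (3 * ep * N0 + ((2 * ep + 2 * C) * N0 + (ep + C) * N0)).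
    apply: integral_le_add.
    - by move=> x; apply: Rmult_le_pos; [lra|].
    - move=> x; have := S10 x; have := S20 x => q1 q2.
      have : 0 <= (2 * ep + 2 * C) * S2 x by apply: Rmult_le_pos; lra.
      have : 0 <= (ep + C) * S1 x by apply: Rmult_le_pos; lra.
      lra.
    - exact: ucont_scal.
    - by apply: ucont_add; exact: ucont_scal.
    - by apply: integral_le_scal; [lra|exact: hN].
    apply: integral_le_add.
    - by move=> x; apply: Rmult_le_pos; [lra|].
    - by move=> x; apply: Rmult_le_pos; [lra|].
    - exact: ucont_scal.
    - exact: ucont_scal.
    - by apply: integral_le_scal; [lra|apply: Fp_node_sum => //; exact: hN].
    - by apply: integral_le_scal; [lra|apply: Fp_node_sum => //; exact: hN].
  have := hgint ((- (3 * e), cube n rB) :: (ts ++ sscal (3 * C) sa)).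
  rewrite sint_cons sint_cat sint_scal cube_vol; last lra.
  rewrite -/vol => hfin.
  have {}hfin : - (3 * e) * vol + (step_int ts + 3 * C * step_int sa) <=
    3 * ep * N0 + ((2 * ep + 2 * C) * N0 + (ep + C) * N0).
    apply: hfin => x; rewrite -/(seval _ x) seval_cons seval_cat seval_scal ht1.
    have hts : \rsum_(l < L) (w1 l * seval (s l) x) <= ind (cube n rB) x * \rsum_(l < L) (w1 l * (E1 l x + E2 l x)).
      rewrite -rsum_scal; apply: rsum_le => l _; have := hs1 l x; rewrite /gE => h1.
      have := Rmult_le_compat_l _ _ _ (hw1 l) h1; lra.
    have hsax : seval sa x <= ap x by exact: hsa.
    have := hind x; rewrite /ind; case: excluded_middle_informative => hx /= _.
      have e1 : ind (cube n rB) x = 1 by rewrite /ind; case: excluded_middle_informative.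
      rewrite e1 Rmult_1_l in hts.
      have := hI x; rewrite -/(g x) => h1.
      have h2 : 3 * C * seval sa x <= 3 * C * ap x by apply: Rmult_le_compat_l; lra.
      apply: Rle_trans (Rplus_le_compat_l _ _ _ (Rplus_le_compat _ _ _ _ hts h2)) _.
      move: h1; move: (\big[_/_]_(l < L) (w1 l * (E1 l x + E2 l x))) => Q1 h1.
      have {}h1 : Q1 + 3 * C * ap x <= g x + 3 * e by exact: h1.
      move: h1; move: (g x) (3 * C * ap x) => v1 v2 h1; lra.
    have e0 : ind (cube n rB) x = 0 by rewrite /ind; case: excluded_middle_informative.
    rewrite e0 Rmult_0_l in hts.
    rewrite (hsup x); last first.
      by move=> h; apply: hx => k; have := h k; rewrite /= /rB /T; lra.
    move: hts; move: (\big[_/_]_(l < L) (w1 l * seval (s l) x)) => Q1 hts.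
    have := hg0 x; lra.
  have h3 : 3 * C * (N0 - eta) < 3 * C * step_int sa by apply: Rmult_lt_compat_l; lra.
  have h4 : 3 * C * eta = eps2 / 8 by rewrite /eta; field; lra.
  lra.
exists (fun x => rpow 2 p * gE l0 (vadd x (evec j (- t l0)))); split.
- by move=> x; apply: Rmult_le_pos => //; exact: rpow_ge0.
- apply: (@integral_le_mono n _ _ (rpow 2 p * eps2)); [by move=> x; exact: Rle_refl|lra|].
  apply: integral_le_scal; first exact: rpow_ge0.
  exact: (@integral_le_shift n (evec j (- t l0)) (gE l0)).
move=> x hx; set x' := vadd x (evec j (- t l0)).
have ex : x = vadd x' (evec j (t l0)).
  by apply: functional_extensionality => k; rewrite /x' /vadd /evec; case: eqP => _; ring.
have hx' : ind (cube n rB) x' = 1.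
  rewrite /ind; case: excluded_middle_informative => // h; case: h => k /=.
  have /Rabs_le_between := hx k; rewrite /x' /vadd /evec /rB.
  have /Rabs_le_between := hl0; have : 0 < T by rewrite /T; lra.
  by case: eqP => _; lra.
have es yy : F (cpoint x yy) = slice F x' yy j (t l0, 0) by rewrite ex cpoint_shift_x.
rewrite /gE hx' Rmult_1_l /E1 /E2 !es.
have := rpow_Cnorm_add (slice F x' y j (t l0, 0) - a x')%C (a x' - slice F x' yd j (t l0, 0))%C hp.
rewrite (Cnorm_sub_sym (a x')).
have -> : (slice F x' y j (t l0, 0) - a x' + (a x' - slice F x' yd j (t l0, 0)) =
  slice F x' y j (t l0, 0) - slice F x' yd j (t l0, 0))%C by ring.
lra.
Qed.

Lemma rpow_csum p L (f : nat -> cplx) : 0 < p -> (0 < L)%N ->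
  rpow (Cnorm (\csum_(l < L) f l)) p <= rpow (INR L) p * \rsum_(l < L) rpow (Cnorm (f l)) p.
Proof.
move=> hp hL.
have hLR : 0 < INR L by apply: lt_0_INR; apply/ltP.
set S := \rsum_(l < L) rpow (Cnorm (f l)) p.
have hS : 0 <= S by apply: rsum_ge0 => l _; exact: rpow_ge0.
have hb (l : 'I_L) : Cnorm (f l) <= rpow S (/ p).
  have h1 : rpow (Cnorm (f l)) p <= S.
    by apply: (rsum_ge_term (F := fun l : 'I_L => rpow (Cnorm (f l)) p)) => i; exact: rpow_ge0.
  have hip : 0 <= / p by apply: Rlt_le; exact: Rinv_0_lt_compat.
  have := rpow_le hip h1.
  by rewrite rpow_rpow Rinv_r ?rpow1 //; [exact: Cnorm_ge0|lra].
have h2 : Cnorm (\csum_(l < L) f l) <= INR L * rpow S (/ p).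
  apply: Rle_trans (Cnorm_csum _ _ _) _.
  apply: Rle_trans; first by apply: rsum_le => l _; exact: hb.
  by rewrite rsum_ord_const; exact: Rle_refl.
apply: Rle_trans (rpow_le (Rlt_le _ _ hp) h2) _.
rewrite rpow_mul ?rpow_root //; try lra.
exact: rpow_ge0.
Qed.

Lemma ishift_cpoint (x y : RVec n) d : ishift d (cpoint x y) = cpoint x (fun j => y j + d).
Proof. by apply: functional_extensionality => j; rewrite /ishift /cpoint; cunfold; rewrite Rplus_0_r. Qed.

(** [N0] is the supremum of the p-means over all heights. By monotonicity, at every height below a
    suitable [ys] the p-mean is not bounded by N0 - eta, which is the premise of [shift_step]. The
    shift by [d] in all coordinates is a chain of [n] shifts in single coordinates. *)
Theorem Hp_shift_small p F eps : (0 < n)%N -> 0 < p -> in_Hp p F -> 0 < eps ->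
  exists d, 0 < d /\ forall y, in_Gamma y ->
    integral_le (Fp p (fun z => F z - F (ishift d z))%C y) eps.
Proof.
move=> hn hp hF heps; have hbd := Hp_Hbd hp hF.
have [hhol [M [hM hMN]]] := hF.
pose E v := exists y s, [/\ in_Gamma y, step_le s (Fp p F y) & v = step_int s].
have hEb : bound E by exists (rpow M p) => v [y [s [hy hs ->]]]; exact: hMN hy _ hs.
have hE0 : E 0.
  by exists (fun _ => 1), [::]; split => //; [move=> j; lra|move=> x; exact: Fp_ge0].
have [N0 [hN1 hN2]] := completeness E hEb (ex_intro _ _ hE0).
have hN y : in_Gamma y -> integral_le (Fp p F y) N0 by move=> hy s hs; apply: hN1; exists y, s.
have hN0 : 0 <= N0 by exact: hN1.
have hnR : 0 < INR n by apply: lt_0_INR; apply/ltP.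
have h2p : 0 < rpow 2 p by apply: rpow_gt0; lra.
have hnp : 0 < rpow (INR n) p by exact: rpow_gt0.
set eps2 := eps / (rpow (INR n) p * (INR n * rpow 2 p)).
have hden : 0 < rpow (INR n) p * (INR n * rpow 2 p) by repeat apply: Rmult_lt_0_compat.
have heps2 : 0 < eps2 by exact: Rdiv_lt_0_compat.
have [eta [heta hstep]] := shift_step hp hbd hN hN0 heps2.
have [ys [hys hysN]] : exists y, in_Gamma y /\ ~ integral_le (Fp p F y) (N0 - eta).
  case: (excluded_middle_informative (exists y, in_Gamma y /\ ~ integral_le (Fp p F y) (N0 - eta))) => // hcon.
  have : N0 <= N0 - eta; last lra.
  apply: hN2 => v [y [s [hy hs ->]]].
  case: (excluded_middle_informative (integral_le (Fp p F y) (N0 - eta))) => h; first exact: h.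
  by case: hcon; exists y.
have [m [hm hysm]] := vec_min hys.
(* Leaves room below [m] for a coordinate y0 <= d, a possible earlier shift by [d], and the
   reference height 2 * d above. *)
set d := m / 4; have hd : 0 < d by rewrite /d; lra.
have hlow y : in_Gamma y -> (forall j, y j <= m) -> ~ integral_le (Fp p F y) (N0 - eta).
  by move=> hy hym h; apply: hysN; apply: Fp_mono h => // j; have := hym j; have := hysm j; lra.
exists d; split => // y hy.
(* Larger heights reduce to [y0], since the p-means of F - F_d decrease with the height as well. *)
pose y0 : RVec n := fun j => Rmin (y j) d.
have hy0 : in_Gamma y0 by move=> j; apply: Rmin_glb_lt; [exact: hy|].
have hy0d j : y0 j <= d by exact: Rmin_r.
have hbdD : Hbd (fun z => F z - F (ishift d z))%C.
  by apply: Hbd_sub => //; apply: Hbd_shift => //; lra.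
apply: (Fp_mono (y := y0)) => //; first by move=> j; exact: Rmin_l.
pose yk k : RVec n := fun j => if (j < k)%N then y0 j + d else y0 j.
have hyk k : in_Gamma (yk k) by move=> j; rewrite /yk; have := hy0 j; case: ifP => _; lra.
pose Dk k x := (F (cpoint x (yk k)) - F (cpoint x (yk k.+1)))%C.
have eyk (k : 'I_n) : yk k.+1 = vadd (yk k) (evec k d).
  apply: functional_extensionality => i; rewrite /yk /vadd /evec ltnS (leq_eqVlt i k).
  case: (eqVneq i k) => [->|hik]; first by rewrite eqxx ltnn.
  have -> : (i == k :> nat) = false by apply/negbTE.
  by rewrite /= Rplus_0_r.
have hDk k : (k < n)%N -> integral_le (fun x => rpow (Cnorm (Dk k x)) p) (rpow 2 p * eps2).
  move=> hk; have ek := eyk (Ordinal hk); rewrite /= in ek.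
  rewrite /Dk ek; apply: (hstep (yk k) (Ordinal hk) d) => //.
  apply: hlow.
    by move=> j; rewrite /vadd /evec; have := hyk k j; case: eqP => _; lra.
  move=> j; rewrite /vadd /evec /yk; have := hy0d j.
  by case: ifP => _; case: eqP => _; rewrite /d; lra.
have hDu k : ucont (fun x => rpow (Cnorm (Dk k x)) p).
  have [[A1 [hA1 hb1]] hu1] := Hbd_ucont hbd (hyk k).
  have [[A2 [hA2 hb2]] hu2] := Hbd_ucont hbd (hyk k.+1).
  apply: (@ucont_rpow_norm n p (Dk k) (A1 + A2)) => //; first lra.
    by move=> x; have := Cnorm_tri_sub (F (cpoint x (yk k))) (F (cpoint x (yk k.+1)));
       have := hb1 x; have := hb2 x; rewrite /Dk; lra.
  move=> e he; have [d1 [hd1 h1]] := hu1 (e / 2) ltac:(lra); have [d2 [hd2 h2]] := hu2 (e / 2) ltac:(lra).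
  exists (Rmin d1 d2); split; first exact: Rmin_glb_lt.
  move=> x x' hx.
  have := h1 x x' (fun j => Rle_trans _ _ _ (hx j) (Rmin_l _ _)).
  have := h2 x x' (fun j => Rle_trans _ _ _ (hx j) (Rmin_r _ _)).
  have -> : (Dk k x - Dk k x' = (F (cpoint x (yk k)) - F (cpoint x' (yk k)))
     - (F (cpoint x (yk k.+1)) - F (cpoint x' (yk k.+1))))%C by rewrite /Dk; ring.
  by have := Cnorm_tri_sub (F (cpoint x (yk k)) - F (cpoint x' (yk k)))%C
     (F (cpoint x (yk k.+1)) - F (cpoint x' (yk k.+1)))%C; lra.
have htel x : (F (cpoint x y0) - F (ishift d (cpoint x y0)) = \csum_(k < n) (Dk k x))%C.
  have e0 : yk 0%N = y0 by [].
  have en : yk n = (fun j => y0 j + d).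
    by apply: functional_extensionality => j; rewrite /yk ltn_ord.
  rewrite ishift_cpoint -en -{1}e0.
  suff key k : (F (cpoint x (yk 0%N)) - F (cpoint x (yk k)) = \csum_(i < k) (Dk i x))%C by exact: key.
  elim: k => [|k IH]; first by rewrite big_ord0; ring.
  by rewrite big_ord_recr /= -IH /Dk; ring.
apply: (@integral_le_mono n _ (fun x => \rsum_(k < n) (rpow (INR n) p * rpow (Cnorm (Dk k x)) p))
   (\rsum_(k < n) (rpow (INR n) p * (rpow 2 p * eps2)))).
- move=> x; rewrite /Fp htel rsum_scal; exact: (@rpow_csum p n (fun k => Dk k x)).
- rewrite rsum_ord_const /eps2; apply: Req_le; field; repeat split; lra.
apply: (@integral_le_sum n n (fun _ => rpow (INR n) p) (fun _ => rpow 2 p * eps2)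
   (fun k x => rpow (Cnorm (Dk k x)) p)) => //.
- by move=> *; lra.
- by move=> *; exact: rpow_ge0.
Qed.

End ShiftSmall.

(** * Multiplication by a decaying rational factor *)

Lemma Cnorm_pow_sub1 a k : Cnorm a <= 1 -> Cnorm (a ^ k - C1)%C <= INR k * Cnorm (a - C1)%C.
Proof.
move=> ha; elim: k => [|k IH].
  by rewrite /= (_ : C1 - C1 = C0)%C; [rewrite Cnorm0; lra|ring].
have -> : (a ^ k.+1 - C1 = a * (a ^ k - C1) + (a - C1))%C by rewrite /=; ring.
apply: Rle_trans (Cnorm_tri _ _) _; rewrite Cnorm_mul S_INR.
have h0 := Cnorm_ge0 (a ^ k - C1)%C; have := Cnorm_ge0 a; nra.
Qed.

Lemma Cnorm_prod_sub1 n (a : 'I_n -> cplx) (r : seq 'I_n) d : (forall j, Cnorm (a j) <= 1) ->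
  (forall j, Cnorm (a j - C1)%C <= d) ->
  Cnorm (\big[Cmul/C1]_(j <- r) a j) <= 1 /\
  Cnorm (\big[Cmul/C1]_(j <- r) a j - C1)%C <= INR (size r) * d.
Proof.
move=> ha hd; elim: r => [|j r [IH1 IH2]].
  rewrite !big_nil Cnorm1 (_ : C1 - C1 = C0)%C; last ring.
  by rewrite Cnorm0 /=; split; lra.
rewrite !big_cons; set P := \big[Cmul/C1]_(i <- r) a i in IH1 IH2 *.
have h1 := Cnorm_ge0 P; have h2 := Cnorm_ge0 (a j); have h3 := ha j; split.
  by rewrite Cnorm_mul; nra.
have -> : (a j * P - C1 = a j * (P - C1) + (a j - C1))%C by ring.
apply: Rle_trans (Cnorm_tri _ _) _; rewrite Cnorm_mul.
have -> : INR (size (j :: r)) = INR (size r) + 1 by rewrite [size _]/= S_INR.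
have h0 := Cnorm_ge0 (P - C1)%C; have := hd j; nra.
Qed.

Definition vden (e : R) (u : cplx) : cplx := (C1 - Ci * RtoC e * u)%C.

Lemma vden_ge1 e u : 0 <= e -> 0 <= Cim u -> 1 <= Cnorm (vden e u).
Proof.
move=> he hu; apply: Rle_trans (Cre_le _); apply: Rle_trans (Rle_abs _).
by rewrite /vden; move: hu; cunfold; nra.
Qed.

Lemma vden_neq0 e u : 0 <= e -> 0 <= Cim u -> vden e u <> C0.
Proof. by move=> he hu h; have := vden_ge1 he hu; rewrite h Cnorm0; lra. Qed.

Lemma vden_decay e u : 0 < e <= 1 -> 0 <= Cim u -> e * Cnorm (u + Ci)%C <= Cnorm (vden e u).
Proof.
move=> he hu.
have -> : e * Cnorm (u + Ci)%C = Cnorm (RtoC e * (u + Ci))%C.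
  by rewrite Cnorm_mul Cnorm_RtoC Rabs_pos_eq; lra.
apply: Cnorm_le_sqr; first exact: Cnorm_ge0.
rewrite Cnorm_sqr /Cnorm2 /vden; case: u hu => x y; cunfold => hy.
have h1 : 0 <= e * (y + 1) <= 1 + e * y by nra.
have h2 : (e * (y + 1)) * (e * (y + 1)) <= (1 + e * y) * (1 + e * y) by apply: Rmult_le_compat; lra.
lra.
Qed.

Lemma vinv_sub1 e u : 0 <= e -> 0 <= Cim u -> Cnorm (/ vden e u - C1)%C <= e * Cnorm u.
Proof.
move=> he hu; have hn := vden_neq0 he hu; have h1 := vden_ge1 he hu.
have -> : (/ vden e u - C1 = Ci * RtoC e * u / vden e u)%C.
  have -> : (Ci * RtoC e * u = C1 - vden e u)%C by rewrite /vden; ring.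
  by field.
rewrite !Cnorm_mul Cnorm_inv // Cnorm_Ci Cnorm_RtoC Rabs_pos_eq // Rmult_1_l.
have h2 : / Cnorm (vden e u) <= 1 by rewrite -Rinv_1; apply: Rinv_le_contravar; lra.
have h3 : 0 <= / Cnorm (vden e u) by apply: Rlt_le; apply: Rinv_0_lt_compat; lra.
have := Cnorm_ge0 u => h4; have : 0 <= e * Cnorm u by exact: Rmult_le_pos.
nra.
Qed.

Lemma vinv_le1 e u : 0 <= e -> 0 <= Cim u -> Cnorm (/ vden e u)%C <= 1.
Proof.
move=> he hu; rewrite Cnorm_inv; last exact: vden_neq0.
by rewrite -Rinv_1; apply: Rinv_le_contravar; [lra|exact: vden_ge1].
Qed.

Lemma cdiff_vinv e u : 0 <= e -> 0 <= Cim u -> cdiff (fun u => / vden e u)%C u.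
Proof.
move=> he hu; apply: (@cdiff_comp (vden e) Cinv); last by apply: cdiff_inv; exact: vden_neq0.
apply: cdiff_sub; first exact: cdiff_const.
by apply: cdiff_mul; [exact: cdiff_const|exact: cdiff_id].
Qed.

Section Cutoff.
Variable n : nat.
Implicit Types (F : CVec n -> cplx) (z : CVec n).

Definition cutoff e m z : cplx := \big[Cmul/C1]_(j < n) ((/ vden e (z j)) ^ m)%C.

Lemma pow_le1 a k : 0 <= a <= 1 -> a ^ k <= 1.
Proof. by move=> h; elim: k => [|k IH] /=; [lra|have : 0 <= a ^ k by [apply: pow_le; lra|]; nra]. Qed.

Lemma cutoff_bounds e m z d : 0 <= e -> (forall j, 0 <= Cim (z j)) -> (forall j, Cnorm (z j) <= d) ->
  Cnorm (cutoff e m z - C1)%C <= INR n * (INR m * (e * d)).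
Proof.
move=> he hz hd.
have ha j : Cnorm ((/ vden e (z j)) ^ m)%C <= 1.
  by rewrite Cnorm_pow; apply: pow_le1; split; [exact: Cnorm_ge0|exact: vinv_le1].
have hb j : Cnorm ((/ vden e (z j)) ^ m - C1)%C <= INR m * (e * d).
  apply: Rle_trans (Cnorm_pow_sub1 _ (vinv_le1 he (hz j))) _.
  apply: Rmult_le_compat_l; first exact: pos_INR.
  apply: Rle_trans (vinv_sub1 he (hz j)) _.
  exact: Rmult_le_compat_l.
have [_] := Cnorm_prod_sub1 (enum 'I_n) ha hb.
by rewrite size_enum_ord /cutoff -(big_enum _ _ predT).
Qed.

Lemma cutoff_le1 e m z : 0 <= e -> (forall j, 0 <= Cim (z j)) -> Cnorm (cutoff e m z) <= 1.
Proof.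
move=> he hz; rewrite /cutoff Cnorm_cprod.
apply: (Rle_trans _ (\big[Rmult/1]_(j < n) 1)); last by rewrite big1_eq; exact: Rle_refl.
apply: rprod_le => j _; rewrite Cnorm_pow; split; first by apply: pow_le; exact: Cnorm_ge0.
by apply: pow_le1; split; [exact: Cnorm_ge0|exact: vinv_le1].
Qed.

Lemma cutoff_decay e m z : 0 < e <= 1 -> (forall j, 0 <= Cim (z j)) ->
  Cnorm (cutoff e m z) <= \big[Rmult/1]_(j < n) ((/ e) ^ m * (/ Cnorm (z j + Ci)%C) ^ m).
Proof.
move=> he hz; rewrite /cutoff Cnorm_cprod; apply: rprod_le => j _.
rewrite Cnorm_pow; split; first by apply: pow_le; exact: Cnorm_ge0.
rewrite -Rpow_mult_distr; apply: pow_incr; split; first exact: Cnorm_ge0.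
rewrite Cnorm_inv; last by apply: vden_neq0 => //; lra.
have h1 : 0 < Cnorm (z j + Ci)%C.
  by apply: Cnorm_gt0; apply: C0_neq_im; have := hz j; cunfold; lra.
rewrite -Rinv_mult; apply: Rinv_le_contravar; first by apply: Rmult_lt_0_compat; lra.
exact: vden_decay.
Qed.

Lemma cutoff_hol e m : 0 <= e -> holomorphic_on_tube (cutoff e m).
Proof.
move=> he; apply: hol_prod => j.
apply: (@hol_coord n (fun u => (/ vden e u) ^ m)%C) => u hu.
by apply: cdiff_pow; apply: cdiff_vinv => //; lra.
Qed.

Lemma cutoff_small p F A t M eta m : 0 < p -> 0 < A -> 0 < t -> 0 < eta -> Hbd F ->
  (forall z, in_tube z -> Cnorm (F z) <= A) -> integral_le (Fp p F (fun _ => t)) M ->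
  exists e, 0 < e <= 1 /\ forall y, in_Gamma y ->
    integral_le (Fp p (fun z => F z - F z * cutoff e m z)%C (fun j => y j + t)) eta.
Proof.
move=> hp hA ht heta hF hAb hM.
(* 2^p comes from |F - F * cutoff| <= 2 * |F|, used on the tail. On the cube, [k] below measures how
   small [e] must be for the cutoff to be close to 1. *)
set C := rpow 2 p; have hC : 0 < C by apply: rpow_gt0; lra.
have heta' : 0 < eta / (2 * C) by apply: Rdiv_lt_0_compat; lra.
have [r [hr htail]] := integral_le_tail (Fp_ge0 p F (fun _ => t)) hM heta'.
set vol := (2 * r) ^ n; have hvol : 0 < vol by apply: pow_lt; lra.
set tau := eta / (2 * vol); have htau : 0 < tau by apply: Rdiv_lt_0_compat; lra.
have [d [hd ed]] := rpow_small hp htau.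
set k := A * (INR n * (INR m * (r + t))) + 1.
have hk : 1 <= k.
  rewrite /k; have : 0 <= A * (INR n * (INR m * (r + t))); last lra.
  by repeat apply: Rmult_le_pos; try exact: pos_INR; lra.
exists (Rmin 1 (d / k)).
set e := Rmin 1 (d / k).
have he : 0 < e <= 1.
  by split; [apply: Rmin_glb_lt; [lra|apply: Rdiv_lt_0_compat; lra]|exact: Rmin_l].
split => // y hy.
have hcb : Hbd (cutoff e m).
  split; first by apply: cutoff_hol; lra.
  move=> dl hdl; exists 1; split; first lra.
  by move=> z hz; apply: cutoff_le1 => [|j]; [lra|have := hz j; lra].
have hH : Hbd (fun z => F z - F z * cutoff e m z)%C by apply: Hbd_sub => //; exact: Hbd_mul.
apply: (Fp_mono (y := fun _ => t)) => //; first by move=> j; have := hy j; lra.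
have -> : eta = C * (eta / (2 * C)) + tau * vol by rewrite /tau; field; lra.
have him x (j : 'I_n) : 0 <= Cim (cpoint x (fun _ => t) j) by rewrite /cpoint; cunfold; lra.
apply: htail => //; first lra.
- move=> x; rewrite /Fp -rpow_mul; [|lra|exact: Cnorm_ge0].
  apply: rpow_le; first lra.
  have h := cutoff_le1 m (Rlt_le _ _ he.1) (him x).
  apply: Rle_trans (Cnorm_tri_sub _ _) _; rewrite Cnorm_mul.
  have := Cnorm_ge0 (F (cpoint x (fun _ => t))); nra.
move=> x hx; rewrite /Fp -ed; apply: rpow_le; first lra.
set z := cpoint x (fun _ => t).
have hz j : Cnorm (z j) <= r + t.
  apply: Rle_trans (Cnorm_le_sum _) _; rewrite /z /cpoint; cunfold.
  by have := hx j; rewrite (Rabs_pos_eq t); lra.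
have h1 := cutoff_bounds m (Rlt_le _ _ he.1) (him x) hz.
have -> : (F z - F z * cutoff e m z = - (F z * (cutoff e m z - C1)))%C by ring.
rewrite Cnorm_opp Cnorm_mul.
apply: Rle_trans (_ : A * (INR n * (INR m * (e * (r + t)))) <= _).
  apply: Rmult_le_compat => //; try exact: Cnorm_ge0.
  by apply: hAb => j; rewrite /z /cpoint; cunfold.
have -> : A * (INR n * (INR m * (e * (r + t)))) = e * (k - 1) by rewrite /k; ring.
have h2 : e <= d / k by exact: Rmin_r.
have h3 : d / k * k = d by field; lra.
nra.
Qed.

End Cutoff.

(** * Approximation by rational functions with pole at -i *)

Lemma CInt_const c a b : CInt (fun _ => c) a b = (RtoC (b - a) * c)%C.
Proof.
have -> : (fun _ : R => c) = (fun t => c + RtoC t * C0)%C.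
  by apply: functional_extensionality => t; ring.
by rewrite CInt_affine; ring.
Qed.

Lemma CInt_riemann_sum (g : R -> cplx) a h K Lam : 0 < h -> lcont_on g a (a + INR K * h) ->
  (forall i t, (i < K)%N -> a + INR i * h <= t <= a + INR i * h + h ->
     Cnorm (g t - g (a + INR i * h)%R)%C <= Lam) ->
  Cnorm (CInt g a (a + INR K * h)%R - \csum_(i < K) (RtoC h * g (a + INR i * h)%R))%C <= INR K * (2 * Lam * h).
Proof.
move=> hh; elim: K => [|K IH] hc hv.
  rewrite big_ord0; have -> : a + INR 0 * h = a by rewrite /=; ring.
  have -> : CInt g a a = C0 by rewrite /CInt !RInt_point.
  by rewrite (_ : C0 - C0 = C0)%C; [rewrite Cnorm0 /=; lra|ring].
have hK := pos_INR K.
have e : a + INR K.+1 * h = a + INR K * h + h by rewrite S_INR; ring.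
have hc1 : lcont_on g (a + INR K * h) (a + INR K * h + h).
  by move=> t ht; apply: hc; rewrite e; nra.
rewrite (@CInt_Chasles g a (a + INR K * h)) //; try (rewrite ?e; nra).
rewrite big_ord_recr /= e.
have h1 := IH (fun t ht => hc t ltac:(rewrite e; lra)) (fun i t hi => hv i t (ltnW hi)).
set b := a + INR K * h in h1 hc1 *.
have h2 : Cnorm (CInt g b (b + h)%R - RtoC h * g b)%C <= 2 * Lam * h.
  have ec : (RtoC h * g b = CInt (fun _ => g b) b (b + h)%R)%C.
    by rewrite CInt_const; congr (RtoC _ * _)%C; ring.
  have hcst : lcont_on (fun _ => g b) b (b + h) by move=> t _; split; exact: continuous_const.
  rewrite ec -CInt_sub //; last lra.
  have -> : 2 * Lam * h = 2 * Lam * (b + h - b) by ring.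
  apply: CInt_bound; first lra.
    move=> t ht; have [c1 c2] := hc1 t ht; split.
      exact: (@continuous_minus _ _ _ (fun t => Cre (g t)) (fun _ => Cre (g b)) t c1 (continuous_const _ _)).
    exact: (@continuous_minus _ _ _ (fun t => Cim (g t)) (fun _ => Cim (g b)) t c2 (continuous_const _ _)).
  by move=> t ht; apply: hv.
have := S_INR K => eK.
move: h1; set S := \big[Cadd/C0]_(i < K) _ => h1.
have -> : (CInt g a b + CInt g b (b + h)%R - (S + RtoC h * g b) =
  (CInt g a b - S) + (CInt g b (b + h)%R - RtoC h * g b))%C by ring.
apply: Rle_trans (Cnorm_tri _ _) _.
by rewrite -/(INR K.+1) eK; lra.
Qed.

(** Up to the factor dist_const * pi <= 3 * 4, this sum is the total Poisson mass [Wtot] over the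
    origin at height 1. *)
Lemma node_sum X L : 0 < X -> (0 < L)%N -> mesh X L <= 1 ->
  \rsum_(l < L) (mesh X L * / (node X L l * node X L l + 1)) <= 12.
Proof.
move=> hX hL hm; have hPI := PI_RGT_0; have hPI4 := PI_4; have hm0 := mesh_gt0 hX hL.
have h1 := @Wtot_le1 X 1 L hX Rlt_0_1 hL 0 1 (Rle_refl _).
have hd : dist_const X 1 L <= 3 by rewrite /dist_const Rdiv_1_r; nra.
have hd1 := dist_const_ge1 hX Rlt_0_1 hL.
apply: Rle_trans (_ : dist_const X 1 L * PI * Wtot X 1 L 0 1 <= _); last first.
  apply: Rle_trans (_ : 3 * 4 * 1 <= _); last lra.
  apply: Rmult_le_compat => //; try nra.
  by apply: rsum_ge0 => l _; apply: pwt_ge0 => //; lra.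
rewrite /Wtot -rsum_scal; apply: rsum_le => l _; apply: Req_le.
rewrite /pwt /pk; move: (node X L l) => t; field; repeat split; try lra; nra.
Qed.

Lemma Cnorm_add_Ci_ge z : - (1 / 4) <= Cim z -> Cnorm z <= Cnorm (z + Ci)%C /\ 3 / 4 <= Cnorm (z + Ci)%C.
Proof.
case: z => x y; cunfold => hy; split.
  apply: Cnorm_le_sqr; first exact: Cnorm_ge0.
  by rewrite Cnorm_sqr /Cnorm2; cunfold; nra.
apply: Rle_trans (Cim_le _); apply: Rle_trans (Rle_abs _); cunfold; lra.
Qed.

Lemma pow_inv4_le c k : 3 / 4 <= c -> (/ c) ^ k.+1 <= 4 / 3 * (/ c) ^ k.
Proof.
move=> hc; rewrite /=; apply: Rmult_le_compat_r.
  by apply: pow_le; apply: Rlt_le; apply: Rinv_0_lt_compat; lra.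
have -> : 4 / 3 = / (3 / 4) by field.
by apply: Rinv_le_contravar; lra.
Qed.

(** * Cauchy's formula on a horizontal line as a Riemann sum *)

Section LineCauchy.
Variables (s : R) (g : cplx -> cplx) (A : R).
Hypotheses (hs : 0 < s <= 1 / 8) (hA : 0 <= A).
Hypothesis hg : forall z, - (2 * s) < Cim z -> cdiff g z /\ Cnorm (g z) <= A * (/ Cnorm (z + Ci)%C) ^ 4.

Lemma line_bound z : - (2 * s) < Cim z -> Cnorm (g z) <= 4 * A.
Proof.
move=> hz; have [_ h] := hg hz; have [_ hc] := @Cnorm_add_Ci_ge z ltac:(lra).
have h1 := pow_inv4_le 0 hc; have h2 := pow_inv4_le 1 hc; have h3 := pow_inv4_le 2 hc.
have h4 := pow_inv4_le 3 hc.
have e0 : (/ Cnorm (z + Ci)%C) ^ 0 = 1 by [].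
have h5 : (/ Cnorm (z + Ci)%C) ^ 4 <= 4 by lra.
have := Rmult_le_compat_l _ _ _ hA h5; lra.
Qed.

Lemma line_dist t z : 0 <= Cim z -> s <= Cnorm ((t, - s)%R - z)%C.
Proof.
move=> hz; apply: Rle_trans (Cim_le _); rewrite -Rabs_Ropp; apply: Rle_trans (Rle_abs _).
by move: hz; cunfold; lra.
Qed.

Lemma line_neq t z : 0 <= Cim z -> ((t, - s)%R - z)%C <> C0.
Proof. by move=> hz h; have := line_dist t hz; rewrite h Cnorm0; lra. Qed.

Lemma line_lip t t' z : 0 <= Cim z -> Rabs (t' - t) <= s / 4 ->
  Cnorm (g (t', - s)%R / ((t', - s)%R - z) - g (t, - s)%R / ((t, - s)%R - z))%C
    <= 132 * A / (s * s) * Rabs (t' - t).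
Proof.
move=> hz ht.
have h1 : Cnorm (g (t', - s)%R - g (t, - s)%R)%C <= 16 * (4 * A) / (s / 2) * Rabs (t' - t).
  have ew : Cnorm ((t', - s)%R - (t, - s)%R)%C = Rabs (t' - t).
    by rewrite -Cnorm_RtoC; congr Cnorm; cring.
  rewrite -ew; apply: Cauchy_lipschitz; [lra| |by rewrite ew; lra].
  move=> w [_]; rewrite /= => hw; have hw' : - (2 * s) < Cim w by lra.
  by split; [have [] := hg hw'|exact: line_bound].
have d1 := line_dist t hz; have d2 := line_dist t' hz.
have n1 := (@line_neq t z hz); have n2 := (@line_neq t' z hz).
have i1 : / Cnorm ((t, - s)%R - z)%C <= / s by apply: Rinv_le_contravar; lra.
have i2 : / Cnorm ((t', - s)%R - z)%C <= / s by apply: Rinv_le_contravar; lra.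
have hg1 := @line_bound (t, - s)%R ltac:(rewrite /=; lra).
set D := Rabs (t' - t) in ht h1 *; have hD : 0 <= D by exact: Rabs_pos.
have -> : (g (t', - s)%R / ((t', - s)%R - z) - g (t, - s)%R / ((t, - s)%R - z) =
   (g (t', - s)%R - g (t, - s)%R) / ((t', - s)%R - z) +
   g (t, - s)%R * RtoC (t - t')%R * (/ ((t', - s)%R - z) * / ((t, - s)%R - z)))%C.
  have -> : RtoC (t - t')%R = (((t, - s)%R - z) - ((t', - s)%R - z))%C by cring.
  by field.
apply: Rle_trans (Cnorm_tri _ _) _.
rewrite !Cnorm_mul !Cnorm_inv // Cnorm_RtoC (Rabs_minus_sym t) -/D.
have is0 : 0 < / s by apply: Rinv_0_lt_compat; lra.
have q1 : 0 <= / Cnorm ((t, - s)%R - z)%C by apply: Rlt_le; apply: Rinv_0_lt_compat; lra.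
have q2 : 0 <= / Cnorm ((t', - s)%R - z)%C by apply: Rlt_le; apply: Rinv_0_lt_compat; lra.
have e1 : Cnorm (g (t', - s)%R - g (t, - s)%R)%C * / Cnorm ((t', - s)%R - z)%C <= 16 * (4 * A) / (s / 2) * D * / s.
  by apply: Rmult_le_compat => //; exact: Cnorm_ge0.
have e2 : Cnorm (g (t, - s)%R) * D * (/ Cnorm ((t', - s)%R - z)%C * / Cnorm ((t, - s)%R - z)%C) <=
   4 * A * D * (/ s * / s).
  apply: Rmult_le_compat; [apply: Rmult_le_pos => //; exact: Cnorm_ge0|exact: Rmult_le_pos| |].
    exact: Rmult_le_compat_r.
  exact: Rmult_le_compat.
have -> : 132 * A / (s * s) * D = 16 * (4 * A) / (s / 2) * D * / s + 4 * A * D * (/ s * / s).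
  by field; lra.
lra.
Qed.

(** Cauchy's formula on [-Y, Y] x [-s, Y] with Y = X + 1. The point [z] is at distance at least Y /
    2 from the three outer sides, where the decay of [g] makes the integrals O(1 / Y); the bottom
    side becomes the Riemann sum. *)
Lemma line_near X L z : 0 < X -> (0 < L)%N -> mesh X L <= s / 4 -> 0 <= Cim z ->
  Cnorm z <= (X + 1) / 2 ->
  Cnorm (RtoC (2 * PI) * Ci * g z - \csum_(l < L) (RtoC (mesh X L) *
     (g (node X L l, - s)%R / ((node X L l, - s)%R - z))))%C <=
  A * (20 / (X + 1) + 528 * (X + 1) * mesh X L / (s * s)).
Proof.
move=> hX hL hm hz hzX; have hm0 := mesh_gt0 hX hL.
set Y := X + 1; have hY : 1 < Y by rewrite /Y; lra.
rewrite -/Y in hzX.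
have hre : Rabs (Cre z) <= Y / 2 by apply: Rle_trans hzX; exact: Cre_le.
have him : Rabs (Cim z) <= Y / 2 by apply: Rle_trans hzX; exact: Cim_le.
move/Rabs_le_between: hre => hre; move/Rabs_le_between: him => him.
have hcd w : inrect (- Y) Y (- s) Y w -> cdiff g w.
  by move=> [_ hw]; have [] := @hg w ltac:(lra).
have hCau := @Cauchy_formula g z (- Y) Y (- s) Y ltac:(lra) ltac:(lra) hcd.
pose phi w := (g w / (w - z))%C.
have hbc : bcont phi (- Y) Y (- s) Y.
  move=> w hw; apply: cdiff_cont; apply: cdiff_mul; first by apply: hcd; case: hw.
  by apply: cdiff_inv_sub; apply: onbdry_neq hw; lra.
have hYs : - Y <= Y by lra.
have hsY : - s <= Y by lra.
set M := 2 * A / Y.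
have hM w : - s <= Cim w -> Y <= Cnorm w -> Cnorm (phi w) <= M / Y.
  move=> hw1 hw2; have [_ hgw] := @hg w ltac:(lra).
  have [hc1 hc2] := @Cnorm_add_Ci_ge w ltac:(lra).
  have hd : Y / 2 <= Cnorm (w - z)%C by have := Cnorm_tri_rev w z; lra.
  have hwz : (w - z)%C <> C0 by move=> e; rewrite e Cnorm0 in hd; lra.
  rewrite /phi Cnorm_mul Cnorm_inv //.
  have -> : M / Y = (A * / Y) * / (Y / 2) by rewrite /M; field; lra.
  have hiY : 0 < / Y by apply: Rinv_0_lt_compat; lra.
  have hiY1 : / Y <= 1 by rewrite -Rinv_1; apply: Rinv_le_contravar; lra.
  apply: Rmult_le_compat; first exact: Cnorm_ge0.
  - by apply: Rlt_le; apply: Rinv_0_lt_compat; lra.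
  - apply: Rle_trans hgw _; apply: Rmult_le_compat_l => //.
    apply: Rle_trans (_ : (/ Y) ^ 4 <= _).
      apply: pow_incr; split; first by apply: Rlt_le; apply: Rinv_0_lt_compat; lra.
      by apply: Rinv_le_contravar; lra.
    have h3 : (/ Y) ^ 3 <= 1 by apply: pow_le1; lra.
    have -> : (/ Y) ^ 4 = / Y * (/ Y) ^ 3 by [].
    nra.
  by apply: Rinv_le_contravar; lra.
have norm_re w : Rabs (Cre w) = Y -> Y <= Cnorm w by move=> e; have := Cre_le w; lra.
have norm_im w : Cim w = Y -> Y <= Cnorm w by move=> e; have := Cim_le w; rewrite e Rabs_pos_eq; lra.
have b1 : Cnorm (CInt (fun t => phi (Y, t)) (- s) Y) <= 2 * (M / Y) * (Y - - s).
  apply: CInt_bound => //; first by apply: bcont_right hbc; lra.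
  by move=> t ht; apply: hM; [rewrite /=; lra|apply: norm_re; rewrite /= Rabs_pos_eq; lra].
have b2 : Cnorm (CInt (fun t => phi (- Y, t)) (- s) Y) <= 2 * (M / Y) * (Y - - s).
  apply: CInt_bound => //; first by apply: bcont_left hbc; lra.
  by move=> t ht; apply: hM; [rewrite /=; lra|apply: norm_re; rewrite /= Rabs_Ropp Rabs_pos_eq; lra].
have b3 : Cnorm (CInt (fun t => phi (t, Y)) (- Y) Y) <= 2 * (M / Y) * (Y - - Y).
  apply: CInt_bound => //; first by apply: bcont_top hbc; lra.
  by move=> t ht; apply: hM; [rewrite /=; lra|exact: norm_im].
have hbot := bcont_bottom hsY hbc.
have eend : Y = - Y + INR L * mesh X L by have := node_last X hL; rewrite /node -/Y.
have b4 : Cnorm (CInt (fun t => phi (t, - s)%R) (- Y) Y - \csum_(l < L) (RtoC (mesh X L) *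
     phi (node X L l, - s)%R))%C <= INR L * (2 * (132 * A / (s * s) * mesh X L) * mesh X L).
  rewrite [X in CInt _ _ X]eend.
  apply: (@CInt_riemann_sum (fun t => phi (t, - s)%R) (- Y) (mesh X L) L) => //.
    by rewrite -eend.
  move=> i t hi ht; set v := - Y + INR i * mesh X L in ht *.
  have hv : Rabs (t - v) <= mesh X L by rewrite Rabs_pos_eq; lra.
  apply: Rle_trans (line_lip hz _) _; first lra.
  apply: Rmult_le_compat_l => //.
  by apply: Rmult_le_pos; [lra|apply: Rlt_le; apply: Rinv_0_lt_compat; nra].
have eb : INR L * (2 * (132 * A / (s * s) * mesh X L) * mesh X L) = A * (528 * Y * mesh X L / (s * s)).
  have -> : INR L * (2 * (132 * A / (s * s) * mesh X L) * mesh X L) =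
    INR L * mesh X L * (264 * A / (s * s) * mesh X L) by field; lra.
  have -> : INR L * mesh X L = 2 * Y by lra.
  by field; lra.
rewrite eb in b4.
rewrite -hCau /bdry -/(phi _).
set S := \big[Cadd/C0]_(l < L) _ in b4 *.
set I1 := CInt (fun t => phi (t, - s)%R) (- Y) Y in b4 *.
set I2 := CInt (fun t => phi (Y, t)) (- s) Y in b1 *.
set I3 := CInt (fun t => phi (t, Y)) (- Y) Y in b3 *.
set I4 := CInt (fun t => phi (- Y, t)) (- s) Y in b2 *.
have -> : (I1 + Ci * I2 - I3 - Ci * I4 - S = (I1 - S) + (Ci * I2 - (I3 + Ci * I4)))%C by ring.
apply: Rle_trans (Cnorm_tri _ _) _.
have t1 := Cnorm_tri_sub (Ci * I2)%C (I3 + Ci * I4)%C; have t2 := Cnorm_tri I3 (Ci * I4)%C.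
rewrite !Cnorm_mul Cnorm_Ci !Rmult_1_l in t1 t2.
have hMY : 2 * (M / Y) * (Y - - s) + 2 * (M / Y) * (Y - - s) + 2 * (M / Y) * (Y - - Y) <= A * (20 / Y).
  have -> : 2 * (M / Y) * (Y - - s) + 2 * (M / Y) * (Y - - s) + 2 * (M / Y) * (Y - - Y) =
     A * / Y * (16 + 8 * (s * / Y)) by rewrite /M; field; lra.
  have hiY : 0 < / Y by apply: Rinv_0_lt_compat; lra.
  have hiY1 : / Y <= 1 by rewrite -Rinv_1; apply: Rinv_le_contravar; lra.
  have -> : A * (20 / Y) = A * / Y * 20 by field; lra.
  apply: Rmult_le_compat_l; [apply: Rmult_le_pos; lra|nra].
lra.
Qed.

(** For large [z] no cancellation is used: both terms are small separately. In each summand two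
    powers of the decay make the sum over the nodes converge, and a further one together with the
    kernel yields a multiple of 1 / (s * W), because c + D >= W. *)
Lemma line_far X L z : 0 < X -> (0 < L)%N -> mesh X L <= 1 -> 0 <= Cim z ->
  (X + 1) / 2 <= Cnorm z ->
  Cnorm (RtoC (2 * PI) * Ci * g z - \csum_(l < L) (RtoC (mesh X L) *
     (g (node X L l, - s)%R / ((node X L l, - s)%R - z))))%C <= A * (200 / (s * (X + 1))).
Proof.
move=> hX hL hm hz hzX; have hm0 := mesh_gt0 hX hL.
set Y := X + 1; have hY : 1 < Y by rewrite /Y; lra.
rewrite -/Y in hzX.
have [hW1 hW2] := @Cnorm_add_Ci_ge z ltac:(lra).
set W := Cnorm (z + Ci)%C in hW1 hW2; have hW : Y / 2 <= W by lra.
have hiW : / W <= 2 / Y.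
  have -> : 2 / Y = / (Y / 2) by field; lra.
  by apply: Rinv_le_contravar; lra.
have hiW0 : 0 < / W by apply: Rinv_0_lt_compat; lra.
have his : 0 < / s by apply: Rinv_0_lt_compat; lra.
have hsi : s * / s = 1 by field; lra.
have his8 : 8 <= / s by nra.
have hiY0 : 0 < / Y by apply: Rinv_0_lt_compat; lra.
have c1 : Cnorm (RtoC (2 * PI) * Ci * g z)%C <= A * (80 / Y).
  rewrite Cnorm_2PI_Ci; have [_ hgz] := @hg z ltac:(lra).
  have k1 := pow_inv4_le 1 hW2; have k2 := pow_inv4_le 2 hW2; have k3 := pow_inv4_le 3 hW2.
  have e1 : (/ W) ^ 1 = / W by rewrite pow_1.
  have k4 : (/ W) ^ 4 <= 5 * / Y by rewrite -/W in k1 k2 k3; lra.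
  have k5 := Rmult_le_compat_l _ _ _ hA k4; rewrite -/W in hgz.
  have hPI := PI_4; have hPI0 := PI_RGT_0; have := Cnorm_ge0 (g z).
  have -> : A * (80 / Y) = 2 * 4 * (A * (5 * / Y)) + A * (40 / Y) by field; lra.
  have : 0 <= A * (40 / Y) by apply: Rmult_le_pos => //; apply: Rmult_le_pos; lra.
  nra.
have c2 : Cnorm (\csum_(l < L) (RtoC (mesh X L) *
     (g (node X L l, - s)%R / ((node X L l, - s)%R - z))))%C <= A * (96 / (s * Y)).
  apply: Rle_trans (Cnorm_csum _ _ _) _.
  apply: (Rle_trans _ (\rsum_(l < L) (4 * A * / (s * W) * (mesh X L * / (node X L l * node X L l + 1))))).
    apply: rsum_le => l _; set t := node X L l.
    rewrite Cnorm_mul Cnorm_RtoC Rabs_pos_eq; last lra.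
    have -> : 4 * A * / (s * W) * (mesh X L * / (t * t + 1)) =
      mesh X L * (4 * A * / (s * W) * / (t * t + 1)) by ring.
    apply: Rmult_le_compat_l; first lra.
    have [_ hgt] := @hg (t, - s)%R ltac:(rewrite /=; lra).
    have [_ hc] := @Cnorm_add_Ci_ge (t, - s)%R ltac:(rewrite /=; lra).
    have hD := line_dist t hz; have hn := (@line_neq t z hz).
    have hc2 : Cnorm ((t, - s)%R + Ci)%C * Cnorm ((t, - s)%R + Ci)%C = t * t + (1 - s) * (1 - s).
      by rewrite Cnorm_sqr /Cnorm2; cunfold; ring.
    have htri : W <= Cnorm ((t, - s)%R + Ci)%C + Cnorm ((t, - s)%R - z)%C.
      rewrite /W; have -> : (z + Ci = ((t, - s)%R + Ci) - ((t, - s)%R - z))%C by ring.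
      exact: Cnorm_tri_sub.
    rewrite Cnorm_mul Cnorm_inv //.
    set c := Cnorm ((t, - s)%R + Ci)%C in hgt hc hc2 htri *.
    set D := Cnorm ((t, - s)%R - z)%C in hD htri *.
    have hic : / c <= 4 / 3.
      have -> : 4 / 3 = / (3 / 4) by field.
      by apply: Rinv_le_contravar; lra.
    have hic0 : 0 < / c by apply: Rinv_0_lt_compat; lra.
    have hiD : / D <= / s by apply: Rinv_le_contravar; lra.
    have hiD0 : 0 < / D by apply: Rinv_0_lt_compat; lra.
    have m1 : / c * / D <= 7 / 6 * / s * / W.
      apply: (Rmult_le_reg_r W); first lra.
      have -> : 7 / 6 * / s * / W * W = 7 / 6 * / s by field; lra.
      apply: (Rle_trans _ (/ c * / D * (c + D))); first by apply: Rmult_le_compat_l => //; nra.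
      have -> : / c * / D * (c + D) = / D + / c by field; lra.
      lra.
    have m2 : / c * / c <= 4 / 3 * / (t * t + 1).
      rewrite -Rinv_mult hc2.
      have -> : 4 / 3 * / (t * t + 1) = / (3 / 4 * (t * t + 1)) by field; nra.
      by apply: Rinv_le_contravar; nra.
    apply: (Rle_trans _ (A * ((/ c * / c) * / c * (/ c * / D)))).
      have -> : A * (/ c * / c * / c * (/ c * / D)) = A * (/ c) ^ 4 * / D by ring.
      by apply: Rmult_le_compat_r; lra.
    have -> : 4 * A * / (s * W) * / (t * t + 1) = A * (/ (t * t + 1) * (4 * (/ s * / W))) by rewrite Rinv_mult; ring.
    apply: Rmult_le_compat_l => //.
    have ht0 : 0 < / (t * t + 1) by apply: Rinv_0_lt_compat; nra.
    have hsW : 0 < / s * / W by exact: Rmult_lt_0_compat.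
    apply: (Rle_trans _ (4 / 3 * / (t * t + 1) * (4 / 3) * (7 / 6 * / s * / W))); last by nra.
    have p1 : 0 <= / c * / c by apply: Rmult_le_pos; lra.
    have p2 : 0 <= / c * / D by apply: Rmult_le_pos; lra.
    apply: Rmult_le_compat => //; first by apply: Rmult_le_pos; lra.
    by apply: Rmult_le_compat => //; lra.
  rewrite rsum_scal; have hns := node_sum hX hL hm.
  apply: (Rle_trans _ (4 * A * / (s * W) * 12)).
    apply: Rmult_le_compat_l => //.
    by apply: Rmult_le_pos; [lra|apply: Rlt_le; apply: Rinv_0_lt_compat; nra].
  rewrite Rinv_mult.
  have -> : A * (96 / (s * Y)) = 48 * A * / s * (2 / Y) by field; lra.
  have -> : 4 * A * (/ s * / W) * 12 = 48 * A * / s * / W by ring.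
  by apply: Rmult_le_compat_l => //; apply: Rmult_le_pos; lra.
apply: Rle_trans (Cnorm_tri_sub _ _) _.
have : A * (80 / Y) <= A * (10 / (s * Y)).
  apply: Rmult_le_compat_l => //.
  have -> : 10 / (s * Y) = 10 * / s * / Y by field; lra.
  have -> : 80 / Y = 80 * / Y by [].
  by apply: Rmult_le_compat_r; lra.
have : A * (10 / (s * Y)) + A * (96 / (s * Y)) <= A * (200 / (s * Y)).
  have -> : A * (10 / (s * Y)) + A * (96 / (s * Y)) = A * (106 * / (s * Y)) by field; lra.
  apply: Rmult_le_compat_l => //; apply: Rmult_le_compat_r; last lra.
  by apply: Rlt_le; apply: Rinv_0_lt_compat; nra.
lra.
Qed.

End LineCauchy.

(** [X] and [L] depend on [s] and [eps] only, and the error is linear in [A], so the same nodes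
    serve in one variable whatever values the other variables take. The near and far regimes meet at
    |z| = (X + 1) / 2. *)
Lemma line_approx s eps : 0 < s <= 1 / 8 -> 0 < eps -> exists X L, [/\ 0 < X, (0 < L)%N &
  forall g A, 0 <= A ->
  (forall z, - (2 * s) < Cim z -> cdiff g z /\ Cnorm (g z) <= A * (/ Cnorm (z + Ci)%C) ^ 4) ->
  forall z, 0 <= Cim z ->
  Cnorm (RtoC (2 * PI) * Ci * g z - \csum_(l < L) (RtoC (mesh X L) *
     (g (node X L l, - s)%R / ((node X L l, - s)%R - z))))%C <= A * eps].
Proof.
move=> hs heps.
have his : 0 < / s by apply: Rinv_0_lt_compat; lra.
set X := 200 / (s * eps).
have hX : 0 < X by apply: Rdiv_lt_0_compat; nra.
have hXe : 200 / (s * (X + 1)) <= eps.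
  apply/Rle_div_l; first nra.
  have : X * (s * eps) = 200 by rewrite /X; field; lra.
  nra.
have hYe : 20 / (X + 1) <= eps / 2.
  apply: Rle_trans (_ : 200 / (s * (X + 1)) / 10 <= _); last lra.
  have -> : 200 / (s * (X + 1)) / 10 = 20 * / s * / (X + 1) by field; lra.
  apply: Rmult_le_compat_r; first by apply: Rlt_le; apply: Rinv_0_lt_compat; lra.
  have : s * / s = 1 by [field; lra|]; nra.
set h0 := Rmin (s / 4) (eps * (s * s) / (1056 * (X + 1))).
have hh0 : 0 < h0.
  apply: Rmin_glb_lt; first lra.
  by apply: Rdiv_lt_0_compat; [apply: Rmult_lt_0_compat; nra|lra].
have [L hL] := INR_unbounded (2 * (X + 1) / h0).
have hLp : 0 < INR L.
  by apply: Rlt_trans hL; apply: Rdiv_lt_0_compat; lra.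
have hL0 : (0 < L)%N by apply/ltP; apply: INR_lt.
have hm : mesh X L <= h0.
  rewrite /mesh; apply/Rle_div_l => //; move/Rlt_div_l: hL => /(_ hh0); lra.
have hm1 : mesh X L <= s / 4 by apply: Rle_trans hm (Rmin_l _ _).
have hm2 : 528 * (X + 1) * mesh X L / (s * s) <= eps / 2.
  apply/Rle_div_l; first nra.
  apply: Rle_trans (_ : 528 * (X + 1) * (eps * (s * s) / (1056 * (X + 1))) <= _).
    by apply: Rmult_le_compat_l; [lra|apply: Rle_trans hm (Rmin_r _ _)].
  by apply: Req_le; field; lra.
exists X, L; split => // g A hA hg z hz.
case: (Rle_lt_dec (Cnorm z) ((X + 1) / 2)) => hzX.
  apply: Rle_trans (line_near hs hA hg hX hL0 hm1 hz hzX) _.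
  by apply: Rmult_le_compat_l => //; lra.
apply: Rle_trans (line_far hs hA hg hX hL0 _ hz (Rlt_le _ _ hzX)) _; first lra.
exact: Rmult_le_compat_l.
Qed.

(** Polynomial functions as a closure under operations: easier to produce than lists of monomials,
    into which [polyP_cpoly] converts them. *)
Inductive polyP n : (CVec n -> cplx) -> Prop :=
| polyP_const c : polyP (fun _ => c)
| polyP_coord j : polyP (fun w => w j)
| polyP_add F G : polyP F -> polyP G -> polyP (fun w => F w + G w)%C
| polyP_mul F G : polyP F -> polyP G -> polyP (fun w => F w * G w)%C.

Lemma polyP_csum n L (F : nat -> CVec n -> cplx) : (forall l, polyP (F l)) ->
  polyP (fun w => \csum_(l < L) F l w).
Proof.
move=> h; elim: L => [|L IH].
  have -> : (fun w : CVec n => \csum_(l < 0) F l w) = (fun _ => C0).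
    by apply: functional_extensionality => w; rewrite big_ord0.
  exact: polyP_const.
have -> : (fun w : CVec n => \csum_(l < L.+1) F l w) = (fun w => \csum_(l < L) F l w + F L w)%C.
  by apply: functional_extensionality => w; rewrite big_ord_recr.
exact: polyP_add.
Qed.

Lemma polyP_subst n (F : CVec n -> cplx) j c : polyP F -> polyP (fun w => F (cupdate w j c)).
Proof.
elim=> [d|i|G H _ hG _ hH|G H _ hG _ hH].
- exact: polyP_const.
- rewrite /cupdate; case: eqP => _; [exact: polyP_const|exact: polyP_coord].
- exact: polyP_add hG hH.
- exact: polyP_mul hG hH.
Qed.

Lemma cpoly_eval_cat n (P Q : cpoly n) w : cpoly_eval (P ++ Q) w = (cpoly_eval P w + cpoly_eval Q w)%C.
Proof. by elim: P => [|m P IH] /=; [ring|rewrite IH; ring]. Qed.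

Lemma Cpow_add z a b : (z ^ (a + b) = z ^ a * z ^ b)%C.
Proof. by elim: a => [|a IH]; [rewrite add0n /=; ring|rewrite addSn /= IH; ring]. Qed.

Lemma polyP_cpoly n (F : CVec n -> cplx) : polyP F -> exists P : cpoly n, forall w, cpoly_eval P w = F w.
Proof.
elim=> [c|j|G H _ [P hP] _ [Q hQ]|G H _ [P hP] _ [Q hQ]].
- exists [:: (c, fun _ => 0%N)] => w; rewrite /= /monomial_eval big1 //; ring.
- exists [:: (C1, fun i => nat_of_bool (i == j))] => w; rewrite /= /monomial_eval (bigD1 j) //= eqxx big1 /=.
    by ring.
  by move=> i /negbTE ->.
- by exists (P ++ Q) => w; rewrite cpoly_eval_cat hP hQ.
pose mm (m m' : cplx * ('I_n -> nat)) := ((m.1 * m'.1)%C, fun j => (m.2 j + m'.2 j)%N).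
have hmm m w : cpoly_eval (map (mm m) Q) w = (m.1 * monomial_eval m.2 w * H w)%C.
  rewrite -hQ; elim: {hQ} Q => [|m' Q IH]; first by rewrite /=; ring.
  rewrite /= IH.
  have -> : monomial_eval (fun j => (m.2 j + m'.2 j)%N) w = (monomial_eval m.2 w * monomial_eval m'.2 w)%C.
    rewrite /monomial_eval -big_split /=; apply: eq_bigr => j _; exact: Cpow_add.
  by ring.
exists (flatten [seq map (mm m) Q | m <- P]) => w; rewrite -hP.
elim: {hP} P => [|m P IH]; first by rewrite /=; ring.
by rewrite /= cpoly_eval_cat IH hmm; ring.
Qed.

(** A one-variable polynomial, expressed through its use in an arbitrary coordinate of an arbitrary
    dimension. *)
Definition pol1 (l : cplx -> cplx) := forall n (k : 'I_n), polyP (fun w => l (w k)).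

Lemma pol1_const c : pol1 (fun _ => c). Proof. move=> n k; exact: polyP_const. Qed.
Lemma pol1_id : pol1 (fun u => u). Proof. move=> n k; exact: polyP_coord. Qed.
Lemma pol1_add f g : pol1 f -> pol1 g -> pol1 (fun u => f u + g u)%C.
Proof. move=> hf hg n k; exact: polyP_add (hf n k) (hg n k). Qed.
Lemma pol1_mul f g : pol1 f -> pol1 g -> pol1 (fun u => f u * g u)%C.
Proof. move=> hf hg n k; exact: polyP_mul (hf n k) (hg n k). Qed.
Lemma pol1_pow f m : pol1 f -> pol1 (fun u => f u ^ m)%C.
Proof. by move=> hf; elim: m => [|m IH] /=; [exact: pol1_const|exact: pol1_mul]. Qed.
Lemma pol1_csum L (f : nat -> cplx -> cplx) : (forall l, pol1 (f l)) -> pol1 (fun u => \csum_(l < L) f l u).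
Proof. by move=> h n k; apply: (@polyP_csum n L (fun l w => f l (w k))) => l; exact: h. Qed.

Lemma csum_sub L (a b : 'I_L -> cplx) : (\csum_(i < L) (a i) - \csum_(i < L) (b i) = \csum_(i < L) (a i - b i))%C.
Proof.
suff -> : \csum_(i < L) (a i) = (\csum_(i < L) (a i - b i) + \csum_(i < L) (b i))%C.
  by move: (\big[Cadd/C0]_(i < L) _) (\big[Cadd/C0]_(i < L) b i) => x y; ring.
by rewrite -big_split; apply: eq_bigr => i _ /=; ring.
Qed.

Lemma geometric_csum q J : ((C1 - q) * \csum_(k < J) (q ^ k) = C1 - q ^ J)%C.
Proof.
elim: J => [|J IH]; first by rewrite big_ord0 /=; ring.
rewrite big_ord_recr /=; move: IH; set S := \big[Cadd/C0]_(k < J) _ => IH.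
by transitivity ((C1 - q) * S + (C1 - q) * q ^ J)%C; [ring|rewrite IH; ring].
Qed.

Lemma Cim_pos_neq z : 0 <= Cim z -> (z + Ci)%C <> C0.
Proof. by move=> h; apply: C0_neq_im; move: h; cunfold; lra. Qed.

Lemma Cnorm_u_le1 z : 0 <= Cim z -> Cnorm (/ (z + Ci))%C <= 1.
Proof.
move=> h; rewrite Cnorm_inv; last exact: Cim_pos_neq.
rewrite -Rinv_1; apply: Rinv_le_contravar; first lra.
by apply: Rle_trans (Cim_le _); apply: Rle_trans (Rle_abs _); move: h; cunfold; lra.
Qed.

(* With [w = 1 - 2 i u = (z - i) / (z + i)] in the closed unit disc, the Cauchy kernel at a point [zeta] of
   the lower half plane is [2 i u / ((zeta - i) (1 - b w))] where [b = (zeta + i) / (zeta - i)], [|b| < 1]. *)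
Lemma kernel_poly zeta eta : Cim zeta < 0 -> 0 < eta -> exists l, pol1 l /\
  forall z, 0 <= Cim z -> Cnorm (/ (zeta - z) - l (/ (z + Ci)))%C <= eta.
Proof.
move=> hze heta.
have hzi : (zeta - Ci)%C <> C0 by apply: C0_neq_im; move: hze; cunfold; lra.
have hzi1 : 1 <= Cnorm (zeta - Ci)%C.
  apply: Rle_trans (Cim_le _); rewrite -Rabs_Ropp; apply: Rle_trans (Rle_abs _).
  by move: hze; cunfold; lra.
set b := ((zeta + Ci) / (zeta - Ci))%C.
have hb : Cnorm b < 1.
  rewrite /b Cnorm_mul Cnorm_inv //; apply/Rlt_div_l; first lra.
  rewrite Rmult_1_l; apply: sqrt_lt_1_alt; split; first exact: Cnorm2_ge0.
  by move: hze; rewrite /Cnorm2; case: (zeta) => x y; cunfold; nra.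
have hb0 := Cnorm_ge0 b.
have hy : 0 < eta * (1 - Cnorm b) / 2 by apply: Rmult_lt_0_compat; [apply: Rmult_lt_0_compat; lra|lra].
have [J hJ] := @pow_lt_1_zero (Cnorm b) ltac:(rewrite Rabs_pos_eq; lra) _ hy.
have {}hJ : Cnorm b ^ J <= eta * (1 - Cnorm b) / 2.
  by have := hJ J (le_n J); rewrite Rabs_pos_eq; [lra|exact: pow_le].
exists (fun u => RtoC 2 * Ci / (zeta - Ci) * u * \csum_(k < J) ((b * (C1 - RtoC 2 * Ci * u)) ^ k))%C; split.
  apply: pol1_mul; first by apply: pol1_mul; [exact: pol1_const|exact: pol1_id].
  apply: (@pol1_csum J (fun k u => (b * (C1 - RtoC 2 * Ci * u)) ^ k)%C) => k; apply: pol1_pow.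
  apply: pol1_mul; first exact: pol1_const.
  have -> : (fun u => C1 - RtoC 2 * Ci * u)%C = (fun u => C1 + - (RtoC 2 * Ci) * u)%C.
    by apply: functional_extensionality => u; ring.
  apply: pol1_add; first exact: pol1_const.
  by apply: pol1_mul; [exact: pol1_const|exact: pol1_id].
move=> z hz; have hzn := Cim_pos_neq hz; set u := (/ (z + Ci))%C.
set q := (b * (C1 - RtoC 2 * Ci * u))%C.
have hq : Cnorm q <= Cnorm b.
  rewrite /q Cnorm_mul; have : Cnorm (C1 - RtoC 2 * Ci * u)%C <= 1; last by nra.
  have -> : (C1 - RtoC 2 * Ci * u = (z - Ci) / (z + Ci))%C.
    rewrite /u; have -> : RtoC 2 = (C1 + C1)%C by cring.
    by field.
  rewrite Cnorm_mul Cnorm_inv //; apply/Rle_div_l; first exact: Cnorm_gt0.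
  rewrite Rmult_1_l; apply: sqrt_le_1_alt.
  by move: hz; rewrite /Cnorm2; case: (z) => x y; cunfold; nra.
have hq1 : 1 - Cnorm b <= Cnorm (C1 - q)%C.
  by have := Cnorm_tri_rev C1 q; rewrite Cnorm1; lra.
have hqn : (C1 - q)%C <> C0 by move=> e; rewrite e Cnorm0 in hq1; lra.
have hzz : (zeta - z)%C <> C0 by apply: C0_neq_im; move: hze hz; cunfold; lra.
have ek : (/ (zeta - z) = RtoC 2 * Ci / (zeta - Ci) * u / (C1 - q))%C.
  have e1 : ((C1 - q) * (zeta - Ci) * (z + Ci) = RtoC 2 * Ci * (zeta - z))%C.
    rewrite /q /b /u; have -> : RtoC 2 = (C1 + C1)%C by cring.
    have -> : ((C1 - (zeta + Ci) / (zeta - Ci) * (C1 - (C1 + C1) * Ci * / (z + Ci))) * (zeta - Ci) * (z + Ci)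
       = (zeta - Ci) * (z + Ci) - (zeta + Ci) * (z - Ci))%C by field.
    by ring.
  have e2 : (RtoC 2 * Ci * (/ (C1 - q) * / (zeta - Ci) * / (z + Ci)) = / (zeta - z))%C.
    have -> : (/ (zeta - z) = RtoC 2 * Ci * (zeta - z) * (/ (C1 - q) * / (zeta - Ci) * / (z + Ci)) * / (zeta - z))%C.
      by rewrite -e1; field.
    by field.
  by rewrite -e2 /u; ring.
have hg := geometric_csum q J.
set S := \big[Cadd/C0]_(k < J) _ in hg *.
have -> : (/ (zeta - z) - RtoC 2 * Ci / (zeta - Ci) * u * S =
   RtoC 2 * Ci / (zeta - Ci) * u * (q ^ J / (C1 - q)))%C.
  have -> : (S = (C1 - q ^ J) / (C1 - q))%C by rewrite -hg; field.
  by rewrite ek; field.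
rewrite !Cnorm_mul !Cnorm_inv // Cnorm_Ci Cnorm_RtoC Rabs_pos_eq; last lra.
rewrite Cnorm_pow.
have hu := Cnorm_u_le1 hz; rewrite -/u in hu.
have i1 : 0 <= / Cnorm (zeta - Ci)%C <= 1.
  split; first by apply: Rlt_le; apply: Rinv_0_lt_compat; lra.
  by rewrite -Rinv_1; apply: Rinv_le_contravar; lra.
have hqJ : Cnorm q ^ J <= eta * (1 - Cnorm b) / 2.
  by apply: Rle_trans hJ; apply: pow_incr; split; [exact: Cnorm_ge0|].
have hqJ0 : 0 <= Cnorm q ^ J by apply: pow_le; exact: Cnorm_ge0.
have i2 : Cnorm q ^ J * / Cnorm (C1 - q)%C <= eta / 2.
  apply/Rle_div_l; first lra.
  apply: Rle_trans hqJ _; nra.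
have i3 : 0 <= Cnorm q ^ J * / Cnorm (C1 - q)%C.
  by apply: Rmult_le_pos => //; apply: Rlt_le; apply: Rinv_0_lt_compat; lra.
have hu0 := Cnorm_ge0 u.
have i4 : / Cnorm (zeta - Ci)%C * Cnorm u <= 1 by nra.
have i5 : 0 <= / Cnorm (zeta - Ci)%C * Cnorm u by nra.
move: i2 i3; move: (Cnorm q ^ J * _) => v1 i2 i3.
apply: (Rle_trans _ (2 * (/ Cnorm (zeta - Ci)%C * Cnorm u) * v1)); first by rewrite (Cnorm_inv hzn); apply: Req_le; ring.
move: i4 i5; move: (/ Cnorm (zeta - Ci)%C * Cnorm u) => v2 i4 i5.
nra.
Qed.

(** [line_approx] is applied to f(z) * (z + i)^K, which still decays with the power 4, and the
    result is multiplied by u^K, so that the error carries the weight |u|^K. The approximant is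
    linear in the values f (zeta i), with points and polynomials chosen before [f]. *)
Lemma runge1 s eps K : 0 < s <= 1 / 8 -> 0 < eps ->
  exists L (zeta : nat -> cplx) (l : nat -> cplx -> cplx),
  [/\ forall i, pol1 (l i), forall i, Cim (zeta i) = - s &
  forall f A, 0 <= A ->
  (forall z, - (2 * s) < Cim z -> cdiff f z /\ Cnorm (f z) <= A * (/ Cnorm (z + Ci)%C) ^ (4 + K)) ->
  forall z, 0 <= Cim z ->
  Cnorm (f z - (/ (z + Ci)) ^ K * \csum_(i < L) (l i (/ (z + Ci)) * f (zeta i)))%C
    <= A * eps * Cnorm (/ (z + Ci))%C ^ K].
Proof.
move=> hs heps; have [X [L [hX hL happ]]] := line_approx hs heps.
have hm := mesh_gt0 hX hL; set h := mesh X L in hm happ.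
have hLp : 0 < INR L by apply: lt_0_INR; apply/ltP.
pose zeta i : cplx := (node X L i, - s).
(* The [L] kernel errors, each weighted by [h] and by |g| <= 4 * A, add up to A * eps. With the
   error of [line_approx] the total is 2 * A * eps, to be divided by 2 pi. *)
set eta := eps / (4 * h * INR L).
have heta : 0 < eta by apply: Rdiv_lt_0_compat => //; apply: Rmult_lt_0_compat => //; lra.
have hex i : {l | pol1 l /\ forall z, 0 <= Cim z -> Cnorm (/ (zeta i - z) - l (/ (z + Ci)))%C <= eta}.
  apply: constructive_indefinite_description; apply: kernel_poly => //; rewrite /zeta /=; lra.
pose l0 i := sval (hex i).
have hl0 i z : 0 <= Cim z -> Cnorm (/ (zeta i - z) - l0 i (/ (z + Ci)))%C <= eta := (svalP (hex i)).2 z.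
have hPI : 2 < PI by have := PI2_1; lra.
pose w := (RtoC (2 * PI) * Ci)%C.
have hwn : Cnorm w = 2 * PI by have := Cnorm_2PI_Ci C1; rewrite Cnorm1 Rmult_1_r -/w => <-; congr Cnorm; ring.
have hw0 : w <> C0 by move=> e; rewrite e Cnorm0 in hwn; lra.
exists L, zeta, (fun i u => / w * RtoC h * (zeta i + Ci) ^ K * l0 i u)%C; split => //.
  move=> i; apply: pol1_mul; first exact: pol1_const.
  exact: (svalP (hex i)).1.
move=> f A hA hf z hz; have hzn := Cim_pos_neq hz.
pose g v := (f v * (v + Ci) ^ K)%C.
have hg v : - (2 * s) < Cim v -> cdiff g v /\ Cnorm (g v) <= A * (/ Cnorm (v + Ci)%C) ^ 4.
  move=> hv; have [h1 h2] := hf v hv; split.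
    apply: cdiff_mul => //; apply: cdiff_pow.
    by apply: cdiff_add; [exact: cdiff_id|exact: cdiff_const].
  have [_ hc] := @Cnorm_add_Ci_ge v ltac:(lra).
  rewrite /g Cnorm_mul Cnorm_pow.
  apply: (Rle_trans _ (A * (/ Cnorm (v + Ci)%C) ^ (4 + K) * Cnorm (v + Ci)%C ^ K)).
    by apply: Rmult_le_compat_r => //; apply: pow_le; exact: Cnorm_ge0.
  apply: Req_le; rewrite -plusE pow_add -!Rmult_assoc Rmult_assoc -Rpow_mult_distr Rinv_l; last lra.
  by rewrite pow1; ring.
have hmain := happ g A hA hg z hz.
rewrite -/zeta in hmain.
set u := (/ (z + Ci))%C.
have huz : (u * (z + Ci) = C1)%C by rewrite /u; field.
have hgu : (u ^ K * g z = f z)%C.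
  have e : (u ^ K * (z + Ci) ^ K = C1)%C.
    have mulpow a b k : (a ^ k * b ^ k = (a * b) ^ k)%C by elim: k => [|k IH] /=; [ring|rewrite -IH; ring].
    by rewrite mulpow huz; elim: (K) => [//|k IH] /=; rewrite IH; ring.
  by rewrite /g; transitivity (f z * (u ^ K * (z + Ci) ^ K))%C; [ring|rewrite e; ring].
pose S1 := (\csum_(i < L) (RtoC h * (g (zeta i) / (zeta i - z))))%C.
pose S2 := (\csum_(i < L) (RtoC h * (g (zeta i) * l0 i u)))%C.
have hS12 : Cnorm (S1 - S2)%C <= A * eps.
  have -> : (S1 - S2 = \csum_(i < L) (RtoC h * (g (zeta i) * (/ (zeta i - z) - l0 i u))))%C.
    by rewrite csum_sub; apply: eq_bigr => i _; ring.
  apply: Rle_trans (Cnorm_csum _ _ _) _.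
  apply: (Rle_trans _ (\rsum_(i < L) (h * (4 * A * eta)))).
    apply: rsum_le => i _; rewrite (Cnorm_mul (RtoC h)) (Cnorm_mul (g (zeta i))) Cnorm_RtoC Rabs_pos_eq; last lra.
    apply: Rmult_le_compat_l; first lra.
    apply: Rmult_le_compat; try exact: Cnorm_ge0.
      by apply: (line_bound hs hA hg); rewrite /zeta /=; lra.
    exact: hl0.
  rewrite rsum_ord_const; apply: Req_le; rewrite /eta; field; lra.
have e0 : (f z - u ^ K * \csum_(i < L) (/ w * RtoC h * (zeta i + Ci) ^ K * l0 i u * f (zeta i)) =
   u ^ K * (/ w) * ((w * g z - S1) + (S1 - S2)))%C.
  have -> : (\csum_(i < L) (/ w * RtoC h * (zeta i + Ci) ^ K * l0 i u * f (zeta i)) = / w * S2)%C.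
    rewrite /S2 big_distrr /=; apply: eq_bigr => i _; rewrite /g; ring.
  by rewrite -hgu; field.
rewrite e0 !Cnorm_mul Cnorm_pow Cnorm_inv // hwn.
have hmain2 : Cnorm ((w * g z - S1) + (S1 - S2))%C <= 2 * (A * eps).
  apply: Rle_trans (Cnorm_tri _ _) _; have : Cnorm (w * g z - S1)%C <= A * eps by exact: hmain.
  lra.
have hv0 : 0 <= Cnorm u ^ K by apply: pow_le; exact: Cnorm_ge0.
have hAe : 0 <= A * eps by apply: Rmult_le_pos; lra.
have -> : A * eps * Cnorm u ^ K = Cnorm u ^ K * (A * eps) by ring.
rewrite Rmult_assoc; apply: Rmult_le_compat_l => //.
apply: (Rle_trans _ (/ (2 * PI) * (2 * (A * eps)))).
  by apply: Rmult_le_compat_l => //; apply: Rlt_le; apply: Rinv_0_lt_compat; lra.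
have -> : / (2 * PI) * (2 * (A * eps)) = A * eps * / PI by field; lra.
have : / PI <= 1 by rewrite -Rinv_1; apply: Rinv_le_contravar; lra.
nra.
Qed.

(** * Approximation in one variable after another *)

Section RungeMulti.
Variables (n K L : nat) (s eps : R) (zeta : nat -> cplx) (l : nat -> cplx -> cplx).
Implicit Types (G : CVec n -> cplx) (z : CVec n) (r : seq 'I_n).
Hypotheses (hs : 0 < s <= 1 / 8) (heps : 0 <= eps <= 1).
Hypothesis hl : forall i, pol1 (l i).
Hypothesis hzeta : forall i, Cim (zeta i) = - s.
Hypothesis hrunge : forall f A, 0 <= A ->
  (forall z : cplx, - (2 * s) < Cim z -> cdiff f z /\ Cnorm (f z) <= A * (/ Cnorm (z + Ci)%C) ^ (4 + K)) ->
  forall z : cplx, 0 <= Cim z ->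
  Cnorm (f z - (/ (z + Ci)) ^ K * \csum_(i < L) (l i (/ (z + Ci)) * f (zeta i)))%C
    <= A * eps * Cnorm (/ (z + Ci))%C ^ K.

Definition runge_op j G z : cplx :=
  ((/ (z j + Ci)) ^ K * \csum_(i < L) (l i (/ (z j + Ci)) * G (cupdate z j (zeta i))))%C.

Fixpoint runge_ops r G : CVec n -> cplx := if r is j :: r' then runge_ops r' (runge_op j G) else G.

Lemma runge_op_sub j G H z : runge_op j (fun z => G z - H z)%C z = (runge_op j G z - runge_op j H z)%C.
Proof.
rewrite /runge_op.
have -> : (\csum_(i < L) (l i (/ (z j + Ci)) * (G (cupdate z j (zeta i)) - H (cupdate z j (zeta i)))) =
  \csum_(i < L) (l i (/ (z j + Ci)) * G (cupdate z j (zeta i)))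
   - \csum_(i < L) (l i (/ (z j + Ci)) * H (cupdate z j (zeta i))))%C.
  by rewrite csum_sub; apply: eq_bigr => i _; ring.
by move: (\big[Cadd/C0]_(i < L) _) (\big[Cadd/C0]_(i < L) (_ * H _)%C) => x y; ring.
Qed.

Lemma runge_ops_sub r G H z : runge_ops r (fun z => G z - H z)%C z = (runge_ops r G z - runge_ops r H z)%C.
Proof.
elim: r G H => [//|j r IH] G H /=; rewrite -IH; congr (runge_ops r _ z).
by apply: functional_extensionality => w; exact: runge_op_sub.
Qed.

(** The variables outside [r] are frozen at [z], those in [r] range over the enlarged half plane Im
    > - 2 s. Differentiability is asked one coordinate at a time, which is the form consumed by the
    one-variable approximation. *)
Definition decay r z G A := forall z', (forall j, j \notin r -> z' j = z j) ->
  (forall j, j \in r -> - (2 * s) < Cim (z' j)) ->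
  Cnorm (G z') <= A * \big[Rmult/1]_(j <- r) (/ Cnorm (z' j + Ci)%C) ^ (4 + K) /\
  forall j, j \in r -> cdiff (fun v => G (cupdate z' j v)) (z' j).

Lemma cupdate_comm z i j u v : i != j -> cupdate (cupdate z i u) j v = cupdate (cupdate z j v) i u.
Proof.
move=> hij; apply: functional_extensionality => k; rewrite /cupdate.
by case: (eqVneq k j) => [->|//]; rewrite eq_sym (negbTE hij).
Qed.

Lemma cupdate_neq z i j u : i != j -> cupdate z j u i = z i.
Proof. by move=> h; rewrite /cupdate (negbTE h). Qed.

Lemma inv_pow_le c : 1 <= c -> (/ c) ^ (4 + K) <= (/ c) ^ K.
Proof.
move=> hc; rewrite -plusE pow_add.
have hi : 0 <= / c by apply: Rlt_le; apply: Rinv_0_lt_compat; lra.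
have hi1 : / c <= 1 by rewrite -Rinv_1; apply: Rinv_le_contravar; lra.
have := @pow_le1 (/ c) 4 ltac:(lra); have := pow_le _ K hi; nra.
Qed.

Lemma Cnorm_add_Ci_ge1 u : 0 <= Cim u -> 1 <= Cnorm (u + Ci)%C.
Proof.
by move=> h; apply: Rle_trans (Cim_le _); apply: Rle_trans (Rle_abs _); move: h; cunfold; lra.
Qed.

(** The error of the approximation in variable [j] is again separately holomorphic and decaying in
    the remaining variables, with its constant multiplied by eps * |u_j|^K; so the induction can
    treat it like [G] itself. *)
Lemma decay_error j r z G A : j \notin r -> 0 <= A -> 0 <= Cim (z j) -> decay (j :: r) z G A ->
  decay r z (fun w => G w - runge_op j G w)%C (A * eps * Cnorm (/ (z j + Ci))%C ^ K).
Proof.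
move=> hj hA hzj hd z' hz' hIm.
have ezj : z' j = z j by exact: hz'.
set Pr := \big[Rmult/1]_(i <- r) (/ Cnorm (z' i + Ci)%C) ^ (4 + K).
have hPr : 0 <= Pr.
  apply: rprod_ge0 => i _; apply: pow_le; have := Cnorm_ge0 (z' i + Ci)%C => -[h|<-].
    by apply: Rlt_le; exact: Rinv_0_lt_compat.
  by rewrite Rinv_0; lra.
have hoff v : forall i, i \notin j :: r -> cupdate z' j v i = z i.
  by move=> i; rewrite inE negb_or => /andP [h1 h2]; rewrite cupdate_neq //; exact: hz'.
have hon v : - (2 * s) < Cim v -> forall i, i \in j :: r -> - (2 * s) < Cim (cupdate z' j v i).
  move=> hv i; rewrite inE; case: (eqVneq i j) => [-> _|hij /= hi]; first by rewrite cupdate_same.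
  by rewrite cupdate_neq //; exact: hIm.
have hprod v : \big[Rmult/1]_(i <- j :: r) (/ Cnorm (cupdate z' j v i + Ci)%C) ^ (4 + K) =
   (/ Cnorm (v + Ci)%C) ^ (4 + K) * Pr.
  rewrite big_cons cupdate_same; congr (_ * _); rewrite /Pr !big_seq; apply: eq_bigr => i hi.
  by rewrite cupdate_neq //; apply: contraNneq hj => <-.
split.
  have h1 : forall v, - (2 * s) < Cim v -> cdiff (fun v => G (cupdate z' j v)) v /\
     Cnorm (G (cupdate z' j v)) <= A * Pr * (/ Cnorm (v + Ci)%C) ^ (4 + K).
    move=> v hv; have [b c] := hd _ (hoff v) (hon v hv); split; last by rewrite hprod in b; lra.
    have := c j (mem_head _ _); rewrite cupdate_same; apply: cdiff_ext => w.
    by rewrite cupdate_twice.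
  have hAP : 0 <= A * Pr by exact: Rmult_le_pos.
  have := hrunge hAP h1 hzj; rewrite -ezj cupdate_id -/(runge_op j G z').
  by rewrite /runge_op; lra.
move=> i hi; have hij : i != j by apply: contraNneq hj => <-.
have hzjs : - (2 * s) < Cim (z' j) by rewrite ezj; lra.
apply: cdiff_sub.
  have := (hd _ (hoff (z' j)) (hon _ hzjs)).2 i; rewrite cupdate_id inE hi orbT; exact.
apply: (@cdiff_ext (fun v => (/ (z' j + Ci)) ^ K * \csum_(k < L) (l k (/ (z' j + Ci)) *
    G (cupdate (cupdate z' j (zeta k)) i v)))%C).
  move=> v; rewrite /runge_op (@cupdate_neq z' j i) 1?eq_sym //; congr (_ * _)%C.
  by apply: eq_bigr => k _; rewrite cupdate_comm // eq_sym.
apply: cdiff_mul; first exact: cdiff_const.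
apply: cdiff_csum => k; apply: cdiff_mul; first exact: cdiff_const.
have hk : - (2 * s) < Cim (zeta k) by rewrite hzeta; lra.
have := (hd _ (hoff (zeta k)) (hon _ hk)).2 i; rewrite inE hi orbT (@cupdate_neq z' i j) //; exact.
Qed.

Lemma decay_tail j r z G A : j \notin r -> 0 <= A -> 0 <= Cim (z j) -> decay (j :: r) z G A ->
  decay r z G (A * (/ Cnorm (z j + Ci)%C) ^ (4 + K)).
Proof.
move=> hj hA hzj hd z' hz' hIm.
have h1 : forall i, i \notin j :: r -> z' i = z i.
  by move=> i; rewrite inE negb_or => /andP [_]; exact: hz'.
have h2 : forall i, i \in j :: r -> - (2 * s) < Cim (z' i).
  by move=> i; rewrite inE => /orP [/eqP ->|]; [rewrite hz' //; lra|exact: hIm].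
have [b c] := hd z' h1 h2; split.
  by move: b; rewrite big_cons (hz' j hj) Rmult_assoc.
by move=> i hi; apply: c; rewrite inE hi orbT.
Qed.

(** With E = G - R_j G and R' the remaining operators, G - R' R_j G = (G - R' G) + E - (E - R' E).
    The constants satisfy c' = 2 * c + 1, whence 2^size - 1; the bound eps <= 1 keeps the last term
    linear in [eps]. *)
Lemma runge_ops_error r z G A : uniq r -> 0 <= A -> (forall j, 0 <= Cim (z j)) -> decay r z G A ->
  Cnorm (G z - runge_ops r G z)%C <= (2 ^ size r - 1) * eps * A * \big[Rmult/1]_(j <- r) Cnorm (/ (z j + Ci))%C ^ K.
Proof.
move=> hu hA hz; elim: r hu G A hA => [|j r IH] hu G A hA hd.
  by rewrite /= (_ : G z - G z = C0)%C; [rewrite Cnorm0; lra|ring].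
move: hu => /= /andP [hj hu].
set c := 2 ^ size r - 1.
have hc : 0 <= c by have := pow_R1_Rle 2 (size r); rewrite /c; lra.
set Q := \big[Rmult/1]_(i <- r) Cnorm (/ (z i + Ci))%C ^ K.
have hQ : 0 <= Q by apply: rprod_ge0 => i _; apply: pow_le; exact: Cnorm_ge0.
rewrite big_cons -/Q; set uj := Cnorm (/ (z j + Ci))%C ^ K.
have huj : 0 <= uj by apply: pow_le; exact: Cnorm_ge0.
have einv i : Cnorm (/ (z i + Ci))%C = / Cnorm (z i + Ci)%C by apply: Cnorm_inv; exact: Cim_pos_neq.
have hpow i : (/ Cnorm (z i + Ci)%C) ^ (4 + K) <= Cnorm (/ (z i + Ci))%C ^ K.
  by rewrite einv; apply: inv_pow_le; exact: Cnorm_add_Ci_ge1.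
have hpow0 i : 0 <= (/ Cnorm (z i + Ci)%C) ^ (4 + K).
  by rewrite -einv; apply: pow_le; exact: Cnorm_ge0.
have hAE : 0 <= A * eps * uj by repeat apply: Rmult_le_pos => //; lra.
have e1 := IH hu G _ (Rmult_le_pos _ _ hA (hpow0 j)) (decay_tail hj hA (hz j) hd).
have hdE := decay_error hj hA (hz j) hd.
have e2 := IH hu _ _ hAE hdE.
have e3 : Cnorm (G z - runge_op j G z)%C <= A * eps * uj * Q.
  have [b _] := hdE z (fun _ _ => erefl) (fun i _ => ltac:(have := hz i; lra)).
  apply: Rle_trans b _; apply: Rmult_le_compat_l => //.
  by apply: rprod_le => i _.
rewrite -/c -/Q in e1 e2.
have -> : (G z - runge_ops r (runge_op j G) z = (G z - runge_ops r G z) + ((G z - runge_op j G z)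
   - ((G z - runge_op j G z) - runge_ops r (fun w => G w - runge_op j G w) z)))%C by rewrite runge_ops_sub; ring.
apply: Rle_trans (Cnorm_tri _ _) _.
have t2 := Cnorm_tri_sub (G z - runge_op j G z)%C ((G z - runge_op j G z) - runge_ops r (fun w => G w - runge_op j G w) z)%C.
have e1' : Cnorm (G z - runge_ops r G z)%C <= c * (A * eps * uj * Q).
  apply: Rle_trans e1 _.
  have := Rmult_le_compat_l _ _ _ (Rmult_le_pos _ _ (Rmult_le_pos _ _ hc heps.1) (Rmult_le_pos _ _ hA hQ)) (hpow j).
  rewrite -/uj; lra.
have hX : 0 <= A * eps * uj * Q by exact: Rmult_le_pos.
have e2' : c * eps * (A * eps * uj) * Q <= c * (A * eps * uj * Q).
  have -> : c * eps * (A * eps * uj) * Q = eps * (c * (A * eps * uj * Q)) by ring.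
  have : 0 <= c * (A * eps * uj * Q) by exact: Rmult_le_pos.
  nra.
have -> : (2 * 2 ^ size r - 1) * eps * A * (uj * Q) = (2 * c + 1) * (A * eps * uj * Q) by rewrite /c; ring.
lra.
Qed.

(* [G] becomes [prod_(j notin r) u_j^K] times a polynomial in the [u_j] once the variables in [r] are frozen. *)
Definition polyoff r G := forall z0, exists Phi, polyP Phi /\ forall z, (forall j, j \in r -> z j = z0 j) ->
  G z = (\big[Cmul/C1]_(j | j \notin r) (/ (z j + Ci)) ^ K * Phi (fun j => / (z j + Ci)))%C.

Lemma runge_op_poly j r G : j \notin r -> polyoff (j :: r) G -> polyoff r (runge_op j G).
Proof.
move=> hj h z0.
have hex i : {Phi | polyP Phi /\ forall z, (forall k, k \in j :: r -> z k = cupdate z0 j (zeta i) k) ->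
  G z = (\big[Cmul/C1]_(k | k \notin j :: r) (/ (z k + Ci)) ^ K * Phi (fun k => / (z k + Ci)))%C}.
  by apply: constructive_indefinite_description; exact: h.
pose Phi i := sval (hex i).
have hPhi i := (svalP (hex i)).2.
exists (fun w => \csum_(i < L) (l i (w j) * Phi i (cupdate w j (/ (zeta i + Ci)))))%C; split.
  apply: (@polyP_csum n L (fun i w => l i (w j) * Phi i (cupdate w j (/ (zeta i + Ci))))%C) => i.
  by apply: polyP_mul; [exact: hl|apply: polyP_subst; exact: (svalP (hex i)).1].
move=> z hz; rewrite (bigD1 j) //=.
set R0 := \big[Cmul/C1]_(k | _) _.
rewrite /runge_op -CmulA; congr (_ * _)%C.
rewrite big_distrr /=; apply: eq_bigr => i _.
have -> : G (cupdate z j (zeta i)) = (R0 * Phi i (cupdate (fun k => / (z k + Ci)) j (/ (zeta i + Ci))))%C.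
  rewrite (hPhi i); last first.
    move=> k; rewrite inE; case: (eqVneq k j) => [-> _|hkj /= hk]; first by rewrite !cupdate_same.
    by rewrite !cupdate_neq //; exact: hz.
  congr (_ * _)%C.
    apply: eq_big => [k|k]; first by rewrite inE negb_or andbC.
    by rewrite inE negb_or => /andP [hk _]; rewrite cupdate_neq.
  congr (sval (hex i) _); apply: functional_extensionality => k.
  by rewrite /cupdate; case: eqP.
by ring.
Qed.

Lemma runge_ops_poly r G : uniq r -> polyoff r G -> polyoff [::] (runge_ops r G).
Proof.
elim: r G => [//|j r IH] G /= /andP [hj hu] h; apply: IH => //.
exact: runge_op_poly.
Qed.

Lemma runge_ops_full G : exists Phi, polyP Phi /\ forall z, runge_ops (enum 'I_n) G z =
  (\big[Cmul/C1]_(j < n) (/ (z j + Ci)) ^ K * Phi (fun j => / (z j + Ci)))%C.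
Proof.
have h : polyoff (enum 'I_n) G.
  move=> z0; exists (fun _ => G z0); split; first exact: polyP_const.
  move=> z hz; rewrite big1; last by move=> j; rewrite mem_enum.
  have -> : z = z0 by apply: functional_extensionality => j; apply: hz; rewrite mem_enum.
  by ring.
have [Phi [h1 h2]] := runge_ops_poly (enum_uniq _) h (fun _ => C0).
exists Phi; split => // z; rewrite h2 //; congr (_ * _)%C.
Qed.

End RungeMulti.

Theorem runge_multi n N s G A eta : 0 < s <= 1 / 8 -> 0 <= A -> 0 < eta ->
  (forall z : CVec n, (forall j, - (2 * s) < Cim (z j)) ->
     Cnorm (G z) <= A * \big[Rmult/1]_(j < n) (/ Cnorm (z j + Ci)%C) ^ (4 + N.+1) /\
     forall j, cdiff (fun v => G (cupdate z j v)) (z j)) ->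
  exists P : cpoly n, forall z, (forall j, 0 <= Cim (z j)) ->
    Cnorm (G z - RN_fun N (@alpha_i n) P z)%C <= eta * \big[Rmult/1]_(j < n) Cnorm (/ (z j + Ci))%C ^ N.+1.
Proof.
move=> hs hA heta hG.
have h2n : 0 < 2 ^ n by apply: pow_lt; lra.
set eps := Rmin 1 (eta / (2 ^ n * (A + 1))).
have hden : 0 < 2 ^ n * (A + 1) by apply: Rmult_lt_0_compat; lra.
have heps : 0 < eps by apply: Rmin_glb_lt; [lra|exact: Rdiv_lt_0_compat].
have heps1 : 0 <= eps <= 1 by split; [lra|exact: Rmin_l].
have [L [zeta [l [hl hzeta hr]]]] := @runge1 s eps N.+1 hs heps.
have [Phi [hP1 hP2]] := @runge_ops_full n N.+1 L zeta l hl G.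
have [P hP] := polyP_cpoly hP1.
exists P => z hz.
have hd : decay N.+1 s (enum 'I_n) z G A.
  move=> z' _ hz'; have [h1 h2] := hG z' (fun j => hz' j ltac:(by rewrite mem_enum)); split => [|j _]; last exact: h2.
  by apply: Rle_trans h1 _; rewrite -(big_enum _ _ predT); exact: Rle_refl.
have := runge_ops_error hs heps1 hzeta hr (enum_uniq _) hA hz hd.
rewrite hP2 size_enum_ord (big_enum _ _ predT) -hP => h.
apply: Rle_trans h _; apply: Rmult_le_compat_r.
  by apply: rprod_ge0 => j _; apply: pow_le; exact: Cnorm_ge0.
apply: (Rle_trans _ (eps * (2 ^ n * (A + 1)))).
  have -> : (2 ^ n - 1) * eps * A = eps * ((2 ^ n - 1) * A) by ring.
  apply: Rmult_le_compat_l; first lra.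
  by have := pow_R1_Rle 2 n ltac:(lra); nra.
by apply/Rle_div_r => //; exact: Rmin_r.
Qed.

(** * Integrability of the rational functions, and density *)

(** Compares r * (x + 1)^(-r - 1) with the decrement of x^(-r) through 1 + y <= exp y; telescoping
    bounds the series of (d + 1)^(-r - 1) by 1 + 1 / r. *)
Lemma rpow_inv_telescope r x : 0 < r -> 1 <= x ->
  r * rpow (/ (x + 1)) (r + 1) <= rpow (/ x) r - rpow (/ (x + 1)) r.
Proof.
move=> hr hx.
have i1 : 0 < / (x + 1) by apply: Rinv_0_lt_compat; lra.
have i0 : 0 < / x by apply: Rinv_0_lt_compat; lra.
have hv : 0 < x * / (x + 1) by apply: Rmult_lt_0_compat; lra.
have hln : ln (/ (x + 1)) + / (x + 1) <= ln (/ x).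
  have h1 := exp_ineq1_le (ln (x * / (x + 1))); rewrite exp_ln // in h1.
  have e1 : x * / (x + 1) = 1 - / (x + 1) by field; lra.
  rewrite {2}e1 in h1; rewrite ln_mult // in h1; last lra.
  by rewrite (ln_Rinv x); lra.
rewrite rpow_plus (@rpow1 (/ (x + 1))); last lra.
have h2 : rpow (/ (x + 1)) r * (1 + r * / (x + 1)) <= rpow (/ x) r.
  rewrite !rpow_pos //.
  apply: (Rle_trans _ (exp (r * ln (/ (x + 1))) * exp (r * / (x + 1)))).
    by apply: Rmult_le_compat_l; [apply: Rlt_le; exact: exp_pos|exact: exp_ineq1_le].
  rewrite -exp_plus; apply: exp_le_mono; rewrite -Rmult_plus_distr_l.
  by apply: Rmult_le_compat_l; lra.
lra.
Qed.

Lemma rsum_inv_rpow r M : 0 < r -> \rsum_(d < M) rpow (/ INR d.+1) (r + 1) <= 1 + / r.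
Proof.
move=> hr; have hir : 0 < / r by exact: Rinv_0_lt_compat.
case: M => [|M]; first by rewrite big_ord0; lra.
have key : \rsum_(d < M.+1) rpow (/ INR d.+1) (r + 1) <= 1 + / r * (1 - rpow (/ INR M.+1) r).
  elim: M => [|M IH].
    by rewrite big_ord_recr big_ord0 /= Rinv_1 !rpow_one; lra.
  rewrite (rsum_recr (fun d => rpow (/ INR d.+1) (r + 1))).
  have h1 : 1 <= INR M.+1 by rewrite S_INR; have := pos_INR M; lra.
  have h2 := rpow_inv_telescope hr h1.
  rewrite [INR M.+2]S_INR.
  have h3 : rpow (/ (INR M.+1 + 1)) (r + 1) <= / r * (rpow (/ INR M.+1) r - rpow (/ (INR M.+1 + 1)) r).
    apply: (Rmult_le_reg_l r) => //.
    by rewrite -Rmult_assoc Rinv_r ?Rmult_1_l; lra.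
  apply: Rle_trans (Rplus_le_compat _ _ _ _ IH h3) _; lra.
have := rpow_ge0 (/ INR M.+1) r; nra.
Qed.

(** The distance from the origin to the unit cell [i - R0, i + 1 - R0). *)
Definition ndist (R0 i : nat) : nat := if (i < R0)%N then (R0 - i.+1)%N else (i - R0)%N.

Lemma rpow_prod n (a : 'I_n -> R) p : (forall j, 0 <= a j) ->
  rpow (\big[Rmult/1]_(j < n) a j) p = \big[Rmult/1]_(j < n) rpow (a j) p.
Proof.
move=> ha; suff [] : 0 <= \big[Rmult/1]_(j < n) a j /\
  rpow (\big[Rmult/1]_(j < n) a j) p = \big[Rmult/1]_(j < n) rpow (a j) p by [].
elim/big_rec2: _ => [|j x y _ [h0 h1]]; first by rewrite rpow_one; split; [lra|].
by rewrite rpow_mul // h1; split => //; apply: Rmult_le_pos.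
Qed.

Lemma Cnorm_one_ge t : (1 + Rabs t) / 2 <= Cnorm (t, 1).
Proof.
have h1 := Cre_le (t, 1); have h2 := Cim_le (t, 1).
by rewrite /= in h1 h2; rewrite (Rabs_pos_eq 1) in h2; lra.
Qed.

(** On a unit cell at distance d from the origin the one-variable factor is at most (2 / (d + 1))^q,
    and the two half lines contribute one convergent series each. *)
Lemma weight_integral n q : 1 < q -> exists C, 0 < C /\
  integral_le (fun x : RVec n => \big[Rmult/1]_(j < n) rpow (/ Cnorm (x j, 1)) q) C.
Proof.
move=> hq; set r := q - 1; have hr : 0 < r by rewrite /r; lra.
have eq : q = r + 1 by rewrite /r; ring.
have h2q : 0 < rpow 2 q by apply: rpow_gt0; lra.
have hir : 0 < / r by exact: Rinv_0_lt_compat.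
set C := 2 * (rpow 2 q * (1 + / r)).
have hC : 0 < C by apply: Rmult_lt_0_compat; [lra|apply: Rmult_lt_0_compat; lra].
exists (C ^ n); split; first exact: pow_lt.
apply: (@integral_le_prod n (fun t => rpow (/ Cnorm (t, 1)) q)
  (fun R0 i => rpow 2 q * rpow (/ INR (ndist R0 i).+1) q)).
- by move=> t; exact: rpow_ge0.
- lra.
- move=> R0 i t h1 h2.
  have hN : 0 < INR (ndist R0 i).+1 by exact: INRS_gt0.
  rewrite -rpow_mul; [|lra|by apply: Rlt_le; exact: Rinv_0_lt_compat].
  apply: rpow_le; first lra.
  have -> : 2 * / INR (ndist R0 i).+1 = / (INR (ndist R0 i).+1 / 2) by field; lra.
  apply: Rinv_le_contravar; first lra.
  apply: Rle_trans (Cnorm_one_ge t); apply: Rmult_le_compat_r; first lra.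
  rewrite S_INR /ndist; case: ltnP => hi.
    rewrite -minusE minus_INR; last by apply/leP.
    rewrite S_INR; have := Rle_abs (- t); rewrite Rabs_Ropp; lra.
  rewrite -minusE minus_INR; last by apply/leP.
  by have := Rle_abs t; lra.
move=> R0 hR0.
rewrite rsum_scal.
have -> : C = rpow 2 q * ((1 + / r) + (1 + / r)) by rewrite /C; ring.
apply: Rmult_le_compat_l; first lra.
have hb := rsum_inv_rpow R0 hr.
rewrite mul2n -addnn big_split_ord /=; apply: Rplus_le_compat; last first.
  rewrite (eq_bigr (fun i : 'I_R0 => rpow (/ INR i.+1) (r + 1))) // => i _.
  by rewrite /ndist ltnNge leq_addr /= addKn -eq.
rewrite (reindex_inj rev_ord_inj) /=.
rewrite (eq_bigr (fun i : 'I_R0 => rpow (/ INR i.+1) (r + 1))) // => i _.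
rewrite /ndist.
have -> : (R0 - i.+1 < R0)%N by have := ltn_ord i; lia.
have -> : (R0 - (R0 - i.+1).+1)%N = i by have := ltn_ord i; lia.
by rewrite -eq.
Qed.

Lemma weight_le p K n : (0 < K)%N -> 0 < p -> 1 < INR K * p -> exists C, 0 < C /\
  forall c (H : RVec n -> cplx), 0 <= c ->
  (forall x, Cnorm (H x) <= c * \big[Rmult/1]_(j < n) (/ Cnorm (x j, 1)) ^ K) ->
  integral_le (fun x => rpow (Cnorm (H x)) p) (rpow c p * C).
Proof.
move=> hK hp hKp; have [C [hC h]] := @weight_integral n _ hKp.
exists C; split => // c H hc hH.
have ha (x : RVec n) j : 0 <= / Cnorm (x j, 1).
  by apply: Rlt_le; apply: Rinv_0_lt_compat; have := Cnorm_one_ge (x j); have := Rabs_pos (x j); lra.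
apply: (@integral_le_mono n _ (fun x => rpow c p * \big[Rmult/1]_(j < n) rpow (/ Cnorm (x j, 1)) (INR K * p))
  (rpow c p * C)); [|lra|by apply: integral_le_scal => //; exact: rpow_ge0].
move=> x; apply: Rle_trans (rpow_le (Rlt_le _ _ hp) (hH x)) _.
have hap j : 0 <= (/ Cnorm (x j, 1)) ^ K by exact: pow_le.
rewrite rpow_mul //; last by apply: rprod_ge0.
rewrite rpow_prod //; apply: Req_le; congr (_ * _); apply: eq_bigr => j _.
by rewrite rpow_natpow // rpow_pow.
Qed.

Lemma Cnorm_u_le (x y : R) : 0 <= y -> Cnorm (/ ((x, y) + Ci))%C <= / Cnorm (x, 1).
Proof.
move=> hy; rewrite Cnorm_inv; last by apply: Cim_pos_neq.
apply: Rinv_le_contravar.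
  by have := Cnorm_one_ge x; have := Rabs_pos x; lra.
apply: sqrt_le_1_alt; rewrite /Cnorm2; cunfold; nra.
Qed.

(** * The approximating rational functions belong to H^p *)

Section RN.
Variables (n N : nat).
Implicit Types (P : cpoly n) (z : CVec n).

Lemma cpoly_bound P : exists c, 0 <= c /\ forall w : CVec n, (forall j, Cnorm (w j) <= 1) ->
  Cnorm (cpoly_eval P w) <= c.
Proof.
elim: P => [|[a e] P [c [hc h]]]; first by exists 0; split; [lra|move=> w _; rewrite /= Cnorm0; lra].
have ha := Cnorm_ge0 a.
exists (Cnorm a + c); split; first lra.
move=> w hw; rewrite /=; apply: Rle_trans (Cnorm_tri _ _) _.
apply: Rplus_le_compat; last exact: h.
have hm : Cnorm (monomial_eval e w) <= 1.
  rewrite /monomial_eval Cnorm_cprod.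
  apply: (Rle_trans _ (\big[Rmult/1]_(j < n) 1)); last by rewrite big1_eq; exact: Rle_refl.
  apply: rprod_le => j _; rewrite Cnorm_pow; have := hw j; have := Cnorm_ge0 (w j) => h0 h1.
  by split; [exact: pow_le|apply: pow_le1].
by rewrite Cnorm_mul; have := Cnorm_ge0 (monomial_eval e w); nra.
Qed.

Lemma RN_bound P : exists c, 0 <= c /\ forall z, (forall j, 0 <= Cim (z j)) ->
  Cnorm (RN_fun N (@alpha_i n) P z) <= c * \big[Rmult/1]_(j < n) Cnorm (/ (z j + Ci))%C ^ N.+1.
Proof.
have [c [hc h]] := cpoly_bound P; exists c; split => // z hz.
rewrite /RN_fun Cnorm_mul Cnorm_cprod Rmult_comm.
rewrite (eq_bigr (fun j => Cnorm (/ (z j + Ci))%C ^ N.+1)); last by move=> j _; rewrite Cnorm_pow.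
apply: Rmult_le_compat_r; first by apply: rprod_ge0 => j _; apply: pow_le; exact: Cnorm_ge0.
by apply: h => j; exact: Cnorm_u_le1.
Qed.

Lemma RN_hol P : holomorphic_on_tube (RN_fun N (@alpha_i n) P).
Proof.
have hu u : 0 < Cim u -> cdiff (fun u => / (u + Ci))%C u.
  move=> hu; apply: (@cdiff_comp (fun u => u + Ci)%C Cinv).
    by apply: cdiff_add; [exact: cdiff_id|exact: cdiff_const].
  by apply: cdiff_inv; apply: Cim_pos_neq; lra.
apply: hol_mul.
  apply: hol_prod => j; apply: (@hol_coord n (fun u => (/ (u + Ci)) ^ N.+1)%C) => u h.
  by apply: cdiff_pow; exact: hu.
elim: P => [|[a e] P IH]; first exact: hol_const.
apply: (@hol_add n (fun z => a * monomial_eval e (fun j => / (z j + Ci)))%C) => //.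
apply: hol_mul; first exact: hol_const.
apply: hol_prod => j; apply: (@hol_coord n (fun u => (/ (u + Ci)) ^ e j)%C) => u h.
by apply: cdiff_pow; exact: hu.
Qed.

Lemma prod_u_le (x y : RVec n) : in_Gamma y ->
  \big[Rmult/1]_(j < n) Cnorm (/ (cpoint x y j + Ci))%C ^ N.+1 <=
  \big[Rmult/1]_(j < n) (/ Cnorm (x j, 1)) ^ N.+1.
Proof.
move=> hy; apply: rprod_le => j _; split; first by apply: pow_le; exact: Cnorm_ge0.
apply: pow_incr; split; first exact: Cnorm_ge0.
by apply: Cnorm_u_le; have := hy j; lra.
Qed.

Lemma RN_in_Hp P p : 0 < p -> 1 < INR N.+1 * p -> in_Hp p (RN_fun N (@alpha_i n) P).
Proof.
move=> hp hNp; split; first exact: RN_hol.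
have [c [hc hb]] := RN_bound P; have [C [hC hw]] := @weight_le p N.+1 n isT hp hNp.
have h0 : 0 <= rpow c p * C by apply: Rmult_le_pos; [exact: rpow_ge0|lra].
exists (rpow (rpow c p * C) (/ p)); split; first exact: rpow_ge0.
move=> y hy; rewrite rpow_root //; last lra.
apply: hw => // x.
apply: Rle_trans (hb _ _) _; first by move=> j; have := hy j; rewrite /cpoint; cunfold; lra.
by apply: Rmult_le_compat_l => //; exact: prod_u_le.
Qed.

End RN.

Section CutoffRunge.
Variables (n N : nat).
Implicit Types (F G : CVec n -> cplx) (z : CVec n).

Lemma ishift_add t t' z : ishift t (ishift t' z) = ishift (t' + t) z.
Proof. by apply: functional_extensionality => j; rewrite /ishift; cunfold; congr pair; ring. Qed.

Lemma Cnorm_ishift_ge t u : 0 <= t -> - (1 / 4) <= Cim u -> Cnorm (u + Ci)%C <= Cnorm (u + (0, t)%R + Ci)%C.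
Proof.
move=> ht; case: u => x y; cunfold => hy; apply: sqrt_le_1_alt; rewrite /Cnorm2; cunfold; nra.
Qed.

Lemma cutoff_runge F A t e eta : 0 <= A -> 0 < t -> 0 < e <= 1 -> 0 < eta -> holomorphic_on_tube F ->
  (forall z, in_tube z -> Cnorm (F z) <= A) ->
  exists P : cpoly n, forall z, (forall j, 0 <= Cim (z j)) ->
    Cnorm (F (ishift t z) * cutoff e (4 + N.+1) (ishift t z) - RN_fun N (@alpha_i n) P z)%C
      <= eta * \big[Rmult/1]_(j < n) Cnorm (/ (z j + Ci))%C ^ N.+1.
Proof.
move=> hA ht he heta hF hAb.
(* The shift by [t] exceeds 2 * s, so the shifted product is holomorphic on Im z_j > - 2 s, where
   [F] is still evaluated inside the tube. *)
pose s := Rmin (1 / 8) (t / 4).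
have hs : 0 < s <= 1 / 8 by split; [apply: Rmin_glb_lt; lra|exact: Rmin_l].
have hst : s <= t / 4 by exact: Rmin_r.
pose G z := (F z * cutoff e (4 + N.+1) z)%C.
have hG : holomorphic_on_tube G by apply: hol_mul => //; apply: cutoff_hol; lra.
have hE : 0 <= \big[Rmult/1]_(j < n) (/ e) ^ (4 + N.+1).
  by apply: rprod_ge0 => j _; apply: pow_le; apply: Rlt_le; apply: Rinv_0_lt_compat; lra.
apply: (@runge_multi n N s (fun z => G (ishift t z))
  (A * \big[Rmult/1]_(j < n) (/ e) ^ (4 + N.+1)) eta) => //; first exact: Rmult_le_pos.
move=> z hz.
have hzt : in_tube (ishift t z) by move=> j; have := hz j; rewrite /ishift; cunfold; lra.
split.
  rewrite /G Cnorm_mul Rmult_assoc; apply: Rmult_le_compat; try exact: Cnorm_ge0.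
    exact: hAb.
  apply: Rle_trans (cutoff_decay _ he (fun j => Rlt_le _ _ (hzt j))) _.
  rewrite -big_split; apply: rprod_le => j _.
  have hzj : - (1 / 4) <= Cim (z j) by have := hz j; lra.
  have [_ h1] := Cnorm_add_Ci_ge hzj; have h2 := Cnorm_ishift_ge (Rlt_le _ _ ht) hzj.
  have h3 : 0 < / Cnorm (ishift t z j + Ci)%C by apply: Rinv_0_lt_compat; rewrite /ishift; lra.
  have he0 : 0 <= / e by apply: Rlt_le; apply: Rinv_0_lt_compat; lra.
  split; first by apply: Rmult_le_pos; apply: pow_le; lra.
  apply: Rmult_le_compat_l; first exact: pow_le.
  apply: pow_incr; split; first lra.
  by apply: Rinv_le_contravar; rewrite /ishift; lra.
move=> j; have [_ hd] := (holP G).1 hG _ hzt.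
apply: (@cdiff_ext (fun v => G (cupdate (ishift t z) j (v + (0, t))))%C).
  move=> v; congr (G _); apply: functional_extensionality => k.
  by rewrite /ishift /cupdate; case: eqP.
apply: (@cdiff_comp (fun v => v + (0, t))%C (fun u => G (cupdate (ishift t z) j u))).
  by apply: cdiff_add; [exact: cdiff_id|exact: cdiff_const].
exact: hd.
Qed.

End CutoffRunge.

Lemma Fp_add n p (F G : CVec n -> cplx) y A B : 0 < p -> Hbd F -> Hbd G -> in_Gamma y ->
  integral_le (Fp p F y) A -> integral_le (Fp p G y) B ->
  integral_le (Fp p (fun z => F z + G z)%C y) (rpow 2 p * (A + B)).
Proof.
move=> hp hF hG hy hA hB.
apply: (@integral_le_mono n _ (fun x => rpow 2 p * (Fp p F y x + Fp p G y x)) (rpow 2 p * (A + B))); [|lra|].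
  by move=> x; exact: rpow_Cnorm_add.
apply: integral_le_scal; first exact: rpow_ge0.
by apply: integral_le_add => //; try exact: Fp_ge0; exact: Fp_ucont.
Qed.

Theorem theorem4p2 (n : nat) (hn : (0 < n)%N) (N : nat) (hN : (0 < N)%N)
  (p : R) (hp : 0 < p) (hNp : 1 < INR N * p) :
  (forall P : cpoly n, in_Hp p (RN_fun N (@alpha_i n) P)) /\
  (forall F : CVec n -> cplx, in_Hp p F ->
     forall eps : R, 0 < eps ->
       exists P : cpoly n,
         Hp_norm_le p (fun z => Csub (F z) (RN_fun N (@alpha_i n) P z)) eps).
Proof.
have hNp1 : 1 < INR N.+1 * p by rewrite S_INR; nra.
split=> [P|F hF eps heps]; first exact: RN_in_Hp.
set E := rpow eps p; have hE : 0 < E by exact: rpow_gt0.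
set k := rpow 2 p; have hk : 0 < k by apply: rpow_gt0; lra.
have hden : 0 < k * (1 + 2 * k) by apply: Rmult_lt_0_compat; lra.
(* Three errors of size [eta] are combined by two quasi-triangle inequalities: k * (eta + k * (eta +
   eta)) = E. *)
set eta := E / (k * (1 + 2 * k)); have heta : 0 < eta by exact: Rdiv_lt_0_compat.
have hbF := Hp_Hbd hp hF.
have [d [hd hshift]] := Hp_shift_small hn hp hF heta.
(* The shift by [d] is split in two halves: the first makes [F1] bounded on the whole tube, the
   second lets the product with the cutoff extend below the real axis. *)
set t := d / 2; have ht : 0 < t by rewrite /t; lra.
pose F1 z := F (ishift t z).
have hbF1 : Hbd F1 by apply: Hbd_shift => //; lra.
have [A [hA hAb]] : exists A, 0 < A /\ forall z, in_tube z -> Cnorm (F1 z) <= A.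
  have [_ /(_ t ht) [A [hA h]]] := hbF; exists A; split => // z hz; apply: h => j.
  by have := hz j; rewrite /ishift; cunfold; lra.
have [_ [M [hM hMN]]] := hF.
have hint : integral_le (Fp p F1 (fun _ => t)) (rpow M p).
  have := hMN (fun _ => t + t) (fun _ => ltac:(lra)).
  by apply: integral_le_mono; [move=> x; rewrite /Fp /F1 ishift_cpoint; exact: Rle_refl|exact: Rle_refl].
have [e [he hcut]] := cutoff_small (4 + N.+1) hp hA ht heta hbF1 hAb hint.
have [C [hC hw]] := @weight_le p N.+1 n isT hp hNp1.
have hetaC : 0 < eta / C by exact: Rdiv_lt_0_compat.
have [et [het eet]] := rpow_small hp hetaC.
have [P hP] := @cutoff_runge n N F1 A t e et (Rlt_le _ _ hA) ht he het hbF1.1 hAb.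
exists P => y hy.
pose H z := (F1 z - F1 z * cutoff e (4 + N.+1) z)%C.
pose D1 z := (F z - F (ishift d z))%C.
pose D2 z := H (ishift t z).
pose D3 z := (F1 (ishift t z) * cutoff e (4 + N.+1) (ishift t z) - RN_fun N (@alpha_i n) P z)%C.
have hbcut : Hbd (@cutoff n e (4 + N.+1)).
  split; first by apply: cutoff_hol; lra.
  move=> dl hdl; exists 1; split; first lra.
  by move=> z hz; apply: cutoff_le1 => [|j]; [lra|have := hz j; lra].
have hbG : Hbd (fun z => F1 z * cutoff e (4 + N.+1) z)%C by exact: Hbd_mul.
have hb1 : Hbd D1 by apply: Hbd_sub => //; apply: Hbd_shift => //; lra.
have hb2 : Hbd D2 by apply: (@Hbd_shift n H) => //; [lra|exact: Hbd_sub].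
have hb3 : Hbd D3.
  apply: Hbd_sub; first by apply: (@Hbd_shift n (fun z => F1 z * cutoff e (4 + N.+1) z)%C) => //; lra.
  by apply: (Hp_Hbd hp); exact: RN_in_Hp.
have hb23 : Hbd (fun z => D2 z + D3 z)%C.
  split; first by apply: hol_add; [exact: hb2.1|exact: hb3.1].
  move=> dl hdl; have [A2 [hA2 h2]] := hb2.2 dl hdl; have [A3 [hA3 h3]] := hb3.2 dl hdl.
  exists (A2 + A3); split; first lra.
  by move=> z hz; apply: Rle_trans (Cnorm_tri _ _) _; have := h2 z hz; have := h3 z hz; lra.
have i1 := hshift y hy.
have i2 : integral_le (Fp p D2 y) eta.
  by apply: integral_le_mono (hcut y hy); [move=> x; rewrite /Fp /D2 ishift_cpoint; exact: Rle_refl|exact: Rle_refl].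
have i3 : integral_le (Fp p D3 y) eta.
  have -> : eta = rpow et p * C by rewrite eet; field; lra.
  apply: (hw et (fun x => D3 (cpoint x y))); first lra.
  move=> x; apply: Rle_trans (hP _ _) _; first by move=> j; have := hy j; rewrite /cpoint; cunfold; lra.
  by apply: Rmult_le_compat_l; [lra|exact: prod_u_le].
have i23 := Fp_add hp hb2 hb3 hy i2 i3.
have := Fp_add hp hb1 hb23 hy i1 i23; apply: integral_le_mono.
  move=> x; rewrite /Fp; apply: Req_le; congr (rpow (Cnorm _) p).
  rewrite /D1 /D2 /D3 /H /F1 ishift_add (_ : t + t = d); last by rewrite /t; field.
  by ring.
apply: Req_le; rewrite -/k -/E /eta; field; lra.
Qed.
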